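(* Let $E_0,E_1$ be Banach spaces over $\mathbb{K}\in\{\mathbb{R},\mathbb{C}\}$ with continuous and dense embedding $E_1\hookrightarrow E_0$. For each $\theta\in(0,1)$ let $(\cdot,\cdot)_\theta$ be an admissible interpolation functor of exponent $\theta$, and put $E_\theta:=(E_0,E_1)_\theta$ with norm $\|\cdot\|_\theta$. Let $A\in\mathcal{H}(E_1,E_0)$ and let $$0\le\gamma<\alpha<\xi\le1,\qquad q:=\frac{1+\gamma-\alpha}{\xi-\alpha}>1 .$$ If $\xi<1$, assume there is an interpolation functor $\{\cdot,\cdot\}_{\alpha/\xi}$ of exponent $\alpha/\xi$ with $E_\alpha\doteq\{E_0,E_\xi\}_{\alpha/\xi}$. If $\gamma>0$, assume for each $\eta\in\{\alpha,\xi\}\setminus\{1\}$ that there is an interpolation functor $\{\cdot,\cdot\}_{\gamma/\eta}$ of exponent $\gamma/\eta$ with $E_\gamma\doteq\{E_0,E_\eta\}_{\gamma/\eta}$. Let $O_\alpha\subset E_\alpha$ be open and $O_\xi:=O_\alpha\cap E_\xi$. Assume that $f:O_\xi\to E_\gamma$ is such that for each $R>0$ there is a constant $N(R)>0$ with $$\|f(w)-f(v)\|_\gamma\le N(R)\big[1+\|w\|_\xi^{q-1}+\|v\|_\xi^{q-1}\big]\big[(1+\|w\|_\xi+\|v\|_\xi)\|w-v\|_\alpha+\|w-v\|_\xi\big]$$ for all $w,v\in O_\xi\cap\bar{\mathbb{B}}_{E_\alpha}(0,R)$. Consider the semilinear Cauchy problem $$u'=Au+f(u),\quad t>0,\qquad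 u(0)=u_0. \qquad(\mathrm{S})$$ Then the following hold. (i) (Existence and uniqueness) Given any $u_0\in O_\alpha$, there is $t^+=t^+(u_0)\in(0,\infty]$ such that (S) possesses a unique maximal strong solution $$u(\cdot;u_0)\in C^1\big((0,t^+),E_0\big)\cap C\big((0,t^+),E_1\big)\cap C\big([0,t^+),O_\alpha\big)$$ with $\lim_{t\to0}t^{\xi-\alpha}\|u(t;u_0)\|_\xi=0$. (ii) (Continuous dependence) The map $(t,u_0)\mapsto u(t;u_0)$ is a semiflow on $O_\alpha$. (iii) (Global existence) If $u([0,t^+(u_0));u_0)$ is relatively compact in $O_\alpha$, then $t^+(u_0)=\infty$. (iv) (Blow-up criteria) Let $u_0\in O_\alpha$ be such that $t^+(u_0)<\infty$. (a) If $u(\cdot;u_0):[0,t^+(u_0))\to E_\alpha$ is uniformly continuous, then $\lim_{t\nearrow t^+(u_0)}\mathrm{dist}_{E_\alpha}(u(t;u_0),\partial O_\alpha)=0$. (b) If $\limsup_{t\nearrow t^+(u_0)}\|f(u(t;u_0))\|_0<\infty$, then $\lim_{t\nearrow t^+(u_0)}\mathrm{dist}_{E_\alpha}(u(t;u_0),\partial O_\alpha)=0$.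
   Context: Notation. $\doteq$ means equality of spaces with equivalent norms. $\|\cdot\|_0,\|\cdot\|_1$ are the norms of $E_0,E_1$. $\bar{\mathbb{B}}_{E}(x,R)$ is the closed ball in $E$ with center $x$ and radius $R$. $\mathcal{H}(E_1,E_0)$ is the subset of the bounded linear operators $\mathcal{L}(E_1,E_0)$ consisting of those $A$ which, viewed as unbounded operators in $E_0$ with domain $E_1$, generate a strongly continuous analytic semigroup $(e^{tA})_{t\ge0}$ on $E_0$. An interpolation functor $(\cdot,\cdot)_\theta$ is of exponent $\theta$ if there is a constant $c$ such that every linear map $T$ that is bounded $E_0\to F_0$ and $E_1\to F_1$ maps $(E_0,E_1)_\theta$ boundedly to $(F_0,F_1)_\theta$ with norm at most $c\|T\|_{\mathcal{L}(E_0,F_0)}^{1-\theta}\|T\|_{\mathcal{L}(E_1,F_1)}^{\theta}$. It is admissible if $E_1$ is dense in $(E_0,E_1)_\theta$ whenever $E_1$ is densely embedded in $E_0$. The functors may be different for different $\theta$. Topological notions for $O_\alpha$ (including its boundary $\partial O_\alpha$) are taken in $E_\alpha$. A strong solution on an interval satisfies the differential equation in $E_0$ for all $t>0$ in the interval together with the initial condition; maximal means that it cannot be extended to a larger interval as such a solution; $t^+(u_0)$ is the maximal existence time. $\mathrm{dist}_E$ is the distance with respect to the norm of $E$. A semiflow on $O_\alpha$ is a map $(t,u_0)\mapsto u(t;u_0)$, defined on $\bigcup_{u_0\in O_\alpha}[0,t^+(u_0))\times\{u_0\}$, which is open in $[0,\infty)\times O_\alpha$, that is continuous into $O_\alpha$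 and satisfies $u(0;u_0)=u_0$ and $u(t+s;u_0)=u(t;u(s;u_0))$. *)

(* Defs.v *)
From Stdlib Require Import Reals Lra List ClassicalEpsilon.
From Coquelicot Require Import Coquelicot.

Set Implicit Arguments.
Unset Strict Implicit.

Open Scope R_scope.

Inductive scalar_field := real_scalars | complex_scalars.

Definition Kring (k : scalar_field) : AbsRing :=
  match k with real_scalars => R_AbsRing | complex_scalars => C_AbsRing end.

Definition RtoK (k : scalar_field) : R -> Kring k :=
  match k return R -> Kring k with
  | real_scalars => fun r => r
  | complex_scalars => RtoC
  end.

(* [Rpower 0 a] is 1 in the standard library; here [0 ^ a = 0]. Only used for
   a nonnegative base and a positive exponent. *)
Definition rpow (x a : R) : R := if Rlt_dec 0 x then Rpower x a else 0.

(* Meaningful for bounded maps: the supremum of an unbounded set is sent to 0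
   by the projection [real]. *)
Definition opnorm {K : AbsRing} {U V : NormedModule K} (l : U -> V) : R :=
  real (Lub_Rbar (fun r => exists x : U, norm x <= 1 /\ r = norm (l x))).

Definition closure {T : UniformSpace} (S : T -> Prop) (x : T) : Prop :=
  forall P : T -> Prop, locally x P -> exists y, S y /\ P y.

Definition boundary {T : UniformSpace} (S : T -> Prop) (x : T) : Prop :=
  closure S x /\ closure (fun y => ~ S y) x.

Definition compact_set {T : UniformSpace} (S : T -> Prop) : Prop :=
  forall (I : Type) (U : I -> T -> Prop),
    (forall i, open (U i)) -> (forall x, S x -> exists i, U i x) ->
    exists l : list I, forall x, S x -> exists i, In i l /\ U i x.

Definition relatively_compact_in {T : UniformSpace} (O S : T -> Prop) : Prop :=
  compact_set (fun x => O x /\ closure S x).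

(* The infimum over the empty set is [p_infty]. *)
Definition dist_to {K : AbsRing} {E : NormedModule K}
    (x : E) (S : E -> Prop) : Rbar :=
  Glb_Rbar (fun r => exists y, S y /\ r = norm (minus x y)).

(* Upper limit from the left, as the infimum of the eventual upper bounds. *)
Definition limsup_left (g : R -> R) (T : R) : Rbar :=
  Glb_Rbar (fun M => at_left T (fun t => g t <= M)).

Section Embedded.

Context {K : AbsRing}.

Record banach_in (V : NormedModule K) := {
  bspace :> CompleteNormedModule K;
  emb : bspace -> V;
  emb_linear : is_linear emb;
  emb_inj : forall x y : bspace, emb x = emb y -> x = y
}.

Lemma whole_inj (E : CompleteNormedModule K) (x y : E) : x = y -> x = y.
Proof. exact (fun h => h). Qed.

Definition whole (E : CompleteNormedModule K) : banach_in E :=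
  @Build_banach_in E E (fun x => x) (is_linear_id (V := E)) (@whole_inj E).

Context {V : NormedModule K}.

Definition mem (X : banach_in V) (v : V) : Prop := exists x : X, emb x = v.

(* The element [v] of [V] viewed in [X]; arbitrary unless [mem X v]. *)
Definition elt (X : banach_in V) (v : V) : X :=
  epsilon (inhabits zero) (fun x => emb x = v).

Definition coe {X : banach_in V} (Y : banach_in V) (x : X) : Y := elt Y (emb x).

Definition embedded (X Y : banach_in V) : Prop :=
  exists C : R, forall x : X, exists y : Y,
    emb y = emb x /\ norm y <= C * norm x.

Definition densely_embedded (X Y : banach_in V) : Prop :=
  embedded X Y /\ forall y : Y, closure (fun y' => exists x : X, emb x = emb y') y.

Definition same_space (X Y : banach_in V) : Prop :=
  embedded X Y /\ embedded Y X.

End Embedded.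

(* An interpolation couple is given by a pair of Banach spaces which are
   continuously embedded in a common space [V]. Taking [V] normed rather than
   a Hausdorff topological vector space is no restriction: it may be replaced
   by the sum of the two Banach spaces. *)
Definition couple_map (K : AbsRing) :=
  forall V : NormedModule K, banach_in V -> banach_in V -> banach_in V.

Section Interpolation.

Context {K : AbsRing}.

(* Continuous embeddings of [X0 :&: X1] in [Z] and of [Z] in [X0 + X1]. *)
Definition intermediate {V : NormedModule K} (X0 X1 Z : banach_in V) : Prop :=
  (exists C : R, forall (x0 : X0) (x1 : X1), emb x0 = emb x1 ->
     exists z : Z, emb z = emb x0 /\ norm z <= C * Rmax (norm x0) (norm x1)) /\
  (exists C : R, forall z : Z, exists (x0 : X0) (x1 : X1),
     emb z = plus (emb x0) (emb x1) /\ norm x0 + norm x1 <= C * norm z).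

Definition restr {V W : NormedModule K} (T : V -> W)
    (X : banach_in V) (Y : banach_in W) (x : X) : Y := elt Y (T (emb x)).
Arguments restr {V W} T X Y x.

Definition bounded_between {V W : NormedModule K} (T : V -> W)
    (X : banach_in V) (Y : banach_in W) : Prop :=
  (forall x : X, mem Y (T (emb x))) /\ is_linear (restr T X Y).

(* [T] only matters on [X0 + X1], where it is linear. *)
Definition couple_morphism {V W : NormedModule K} (T : V -> W)
    (X0 X1 : banach_in V) (Y0 Y1 : banach_in W) : Prop :=
  (forall (x0 : X0) (x1 : X1),
     T (plus (emb x0) (emb x1)) = plus (T (emb x0)) (T (emb x1))) /\
  bounded_between T X0 Y0 /\ bounded_between T X1 Y1.

Definition interpolation_functor (F : couple_map K) : Prop :=
  (forall (V : NormedModule K) (X0 X1 : banach_in V),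
     intermediate X0 X1 (F V X0 X1)) /\
  (forall (V W : NormedModule K) (X0 X1 : banach_in V) (Y0 Y1 : banach_in W)
          (T : V -> W),
     couple_morphism T X0 X1 Y0 Y1 ->
     bounded_between T (F V X0 X1) (F W Y0 Y1)).

Definition functor_of_exponent (F : couple_map K) (theta : R) : Prop :=
  interpolation_functor F /\
  exists c : R,
    forall (V W : NormedModule K) (X0 X1 : banach_in V) (Y0 Y1 : banach_in W)
           (T : V -> W),
      couple_morphism T X0 X1 Y0 Y1 ->
      opnorm (restr T (F V X0 X1) (F W Y0 Y1))
        <= c * rpow (opnorm (restr T X0 Y0)) (1 - theta)
             * rpow (opnorm (restr T X1 Y1)) theta.

Definition admissible (F : couple_map K) : Prop :=
  forall (V : NormedModule K) (X0 X1 : banach_in V),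
    densely_embedded X1 X0 -> densely_embedded X1 (F V X0 X1).

Definition interp_scale {E0 : CompleteNormedModule K} (F : R -> couple_map K)
    (E1 : banach_in E0) (theta : R) : banach_in E0 :=
  if Req_EM_T theta 0 then whole E0
  else if Req_EM_T theta 1 then E1
  else F theta E0 (whole E0) E1.

End Interpolation.

Section Complexification.

Context (E : NormedModule R_AbsRing).

(* (a + ib) (x + iy) = (ax - by) + i (bx + ay) *)
Definition cplx_scal (z : C) (v : E * E) : E * E :=
  (minus (scal (fst z) (fst v)) (scal (snd z) (snd v)),
   plus (scal (snd z) (fst v)) (scal (fst z) (snd v))).

(* The norm of x + iy is the supremum over phi of the norm of
   cos phi x + sin phi y, written as a supremum over the unit disc. *)
Definition cplx_vals (v : E * E) (r : R) : Prop :=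
  exists a b : R, a ^ 2 + b ^ 2 <= 1 /\
    r = norm (plus (scal a (fst v)) (scal b (snd v))).

Definition cplx_norm (v : E * E) : R := real (Lub_Rbar (cplx_vals v)).

Lemma scal_R0 (x : E) : scal (0 : R) x = zero.
Proof. exact (scal_zero_l x). Qed.

Lemma scal_RD (a : R) (x y : E) :
  scal a (plus x y) = plus (scal a x) (scal a y).
Proof. exact (scal_distr_l a x y). Qed.

Lemma scal_RB (a : R) (x y : E) :
  scal a (minus x y) = plus (scal a x) (scal (- a) y).
Proof.
transitivity (minus (scal a x) (scal a y)); [exact (scal_minus_distr_l a x y)|].
unfold minus. apply f_equal. symmetry. exact (scal_opp_l a y).
Qed.

Lemma scal_RDl (a b : R) (x : E) :
  scal (a + b) x = plus (scal a x) (scal b x).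
Proof. exact (scal_distr_r (a : R_AbsRing) b x). Qed.

Lemma scal_RA (a b : R) (x : E) : scal a (scal b x) = scal (a * b) x.
Proof. exact (scal_assoc a b x). Qed.

Lemma scal_R1 (x : E) : scal (1 : R) x = x.
Proof. exact (scal_one x). Qed.

Lemma disc_abs_le (a b : R) : a ^ 2 + b ^ 2 <= 1 -> Rabs a <= 1.
Proof. intros H. apply Rabs_le. nra. Qed.

Lemma cplx_vals_bound v r : cplx_vals v r -> r <= norm (fst v) + norm (snd v).
Proof.
intros [a [b [H ->]]].
assert (Ha := disc_abs_le H).
assert (Hb : Rabs b <= 1) by (apply disc_abs_le with (b := a); lra).
eapply Rle_trans; [exact (norm_triangle (scal a (fst v)) (scal b (snd v)))|].
assert (H1 := norm_scal a (fst v)). assert (H2 := norm_scal b (snd v)).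
change (abs a) with (Rabs a) in H1. change (abs b) with (Rabs b) in H2.
assert (P1 := norm_ge_0 (fst v)). assert (P2 := norm_ge_0 (snd v)).
assert (Q1 := Rmult_le_compat_r _ _ _ P1 Ha).
assert (Q2 := Rmult_le_compat_r _ _ _ P2 Hb).
apply Rplus_le_compat.
- eapply Rle_trans; [exact H1|]. rewrite Rmult_1_l in Q1. exact Q1.
- eapply Rle_trans; [exact H2|]. rewrite Rmult_1_l in Q2. exact Q2.
Qed.

Lemma cplx_vals_0 v : cplx_vals v 0.
Proof.
exists 0, 0. split; [lra|].
rewrite !scal_R0, plus_zero_l. symmetry. exact norm_zero.
Qed.

Lemma cplx_norm_lub v : is_lub_Rbar (cplx_vals v) (cplx_norm v).
Proof.
unfold cplx_norm. assert (H := Lub_Rbar_correct (cplx_vals v)).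
destruct (Lub_Rbar (cplx_vals v)) as [l| |]; [exact H| |]; exfalso.
- assert (B : Rbar_le p_infty (norm (fst v) + norm (snd v))).
  { apply (proj2 H). intros r Hr. exact (cplx_vals_bound Hr). }
  exact B.
- exact (proj1 H 0 (cplx_vals_0 v)).
Qed.

Lemma cplx_norm_ub v a b : a ^ 2 + b ^ 2 <= 1 ->
  norm (plus (scal a (fst v)) (scal b (snd v))) <= cplx_norm v.
Proof.
intros H. apply (proj1 (cplx_norm_lub v)). now exists a, b.
Qed.

Lemma cplx_norm_le v M :
  (forall a b, a ^ 2 + b ^ 2 <= 1 ->
     norm (plus (scal a (fst v)) (scal b (snd v))) <= M) -> cplx_norm v <= M.
Proof.
intros H. apply (proj2 (cplx_norm_lub v) (Finite M)).
intros r [a [b [Hab ->]]]. now apply H.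
Qed.

Lemma cplx_norm_ge0 v : 0 <= cplx_norm v.
Proof. exact (proj1 (cplx_norm_lub v) 0 (cplx_vals_0 v)). Qed.

Lemma cplx_norm_fst v : norm (fst v) <= cplx_norm v.
Proof.
assert (H := @cplx_norm_ub v 1 0 ltac:(lra)).
now rewrite scal_R0, scal_R1, plus_zero_r in H.
Qed.

Lemma cplx_norm_snd v : norm (snd v) <= cplx_norm v.
Proof.
assert (H := @cplx_norm_ub v 0 1 ltac:(lra)).
now rewrite scal_R0, scal_R1, plus_zero_l in H.
Qed.

Lemma cplx_norm_sum v : cplx_norm v <= norm (fst v) + norm (snd v).
Proof.
apply cplx_norm_le. intros a b H. apply cplx_vals_bound. now exists a, b.
Qed.

Lemma plus4 (p q r s : E) :
  plus (plus p q) (plus r s) = plus (plus p r) (plus q s).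
Proof.
rewrite <- !plus_assoc. f_equal. rewrite !plus_assoc. f_equal. apply plus_comm.
Qed.

Lemma minus4 (p q r s : E) :
  minus (plus p q) (plus r s) = plus (minus p r) (minus q s).
Proof.
unfold minus. transitivity (plus (plus p q) (plus (opp r) (opp s))).
- apply f_equal. exact (opp_plus r s).
- apply plus4.
Qed.

Lemma scal_R_lin (a b c d : R) (x y : E) :
  plus (scal a (minus (scal c x) (scal d y)))
       (scal b (plus (scal d x) (scal c y))) =
  plus (scal (a * c + b * d) x) (scal (b * c - a * d) y).
Proof.
rewrite scal_RB, scal_RD, !scal_RA.
replace (b * c - a * d) with (b * c + - a * d) by ring.
rewrite !scal_RDl, plus4. apply f_equal, plus_comm.
Qed.

Lemma cplx_scal_assoc (x y : C) (u : E * E) :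
  cplx_scal x (cplx_scal y u) = cplx_scal (Cmult x y) u.
Proof.
destruct x as [a b], y as [c d], u as [u w]. unfold cplx_scal.
apply injective_projections; cbn [fst snd Cmult].
- assert (H := scal_R_lin a (- b) c d u w).
  transitivity (plus (scal a (minus (scal c u) (scal d w)))
                     (scal (- b) (plus (scal d u) (scal c w)))).
  + unfold minus at 1. apply f_equal. symmetry. exact (scal_opp_l b _).
  + rewrite H. unfold minus.
    replace (a * c + - b * d) with (a * c - b * d) by ring.
    apply f_equal.
    transitivity (scal (- (a * d + b * c)) w); [f_equal; ring|].
    exact (scal_opp_l (a * d + b * c) w).
- rewrite scal_R_lin.
  f_equal; f_equal; ring.
Qed.

Lemma cplx_scal_one (u : E * E) : cplx_scal (RtoC 1) u = u.
Proof.
destruct u as [u w]. unfold cplx_scal, RtoC; simpl.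
rewrite !scal_R1, !scal_R0, plus_zero_l. f_equal. exact (minus_zero_r u).
Qed.

Lemma cplx_scal_distr_l (x : C) (u v : E * E) :
  cplx_scal x (plus u v) = plus (cplx_scal x u) (cplx_scal x v).
Proof.
destruct x as [a b], u as [u1 u2], v as [v1 v2].
apply injective_projections; simpl.
- rewrite !scal_RD. apply minus4.
- rewrite !scal_RD. apply plus4.
Qed.

Lemma cplx_scal_distr_r (x y : C) (u : E * E) :
  cplx_scal (Cplus x y) u = plus (cplx_scal x u) (cplx_scal y u).
Proof.
destruct x as [a b], y as [c d], u as [u1 u2].
apply injective_projections; simpl; rewrite !scal_RDl.
- apply minus4.
- apply plus4.
Qed.

Lemma cplx_norm_triangle (u v : E * E) :
  cplx_norm (plus u v) <= cplx_norm u + cplx_norm v.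
Proof.
apply cplx_norm_le. intros a b H. simpl. rewrite !scal_RD, plus4.
eapply Rle_trans.
- exact (norm_triangle (plus (scal a (fst u)) (scal b (snd u)))
           (plus (scal a (fst v)) (scal b (snd v)))).
- apply Rplus_le_compat; now apply cplx_norm_ub.
Qed.

Lemma cplx_norm_scal (z : C) (v : E * E) :
  cplx_norm (cplx_scal z v) <= Cmod z * cplx_norm v.
Proof.
apply cplx_norm_le. intros a b H. destruct z as [c d], v as [x y].
unfold cplx_scal; cbn [fst snd]. rewrite scal_R_lin.
set (m := Cmod (c, d)).
assert (Hm : m * m = c ^ 2 + d ^ 2) by (apply sqrt_sqrt; simpl; nra).
assert (m0 : 0 <= m) by apply Cmod_ge_0.
destruct (Req_dec m 0) as [mz|mz].
- assert (c = 0) by nra. assert (d = 0) by nra. subst c d.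
  replace (a * 0 + b * 0) with 0 by ring. replace (b * 0 - a * 0) with 0 by ring.
  rewrite !scal_R0, plus_zero_l. eapply Rle_trans; [right; exact norm_zero|].
  apply Rmult_le_pos; [exact m0|apply cplx_norm_ge0].
- pose (a' := (a * c + b * d) / m). pose (b' := (b * c - a * d) / m).
  assert (E1 : a * c + b * d = m * a') by (unfold a'; field; exact mz).
  assert (E2 : b * c - a * d = m * b') by (unfold b'; field; exact mz).
  assert (H' : a' ^ 2 + b' ^ 2 <= 1).
  { assert (Q : (m * m) * (a' ^ 2 + b' ^ 2) = (a ^ 2 + b ^ 2) * (m * m)).
    { replace ((m * m) * (a' ^ 2 + b' ^ 2))
        with ((m * a') ^ 2 + (m * b') ^ 2) by ring.
      rewrite <- E1, <- E2, Hm. ring. }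
    assert (mp : 0 < m * m) by nra.
    apply (Rmult_le_reg_l (m * m)); [exact mp|].
    rewrite Q, Rmult_1_r. rewrite <- (Rmult_1_l (m * m)) at 2.
    apply Rmult_le_compat_r; [lra|exact H]. }
  rewrite E1, E2.
  replace (plus (scal (m * a') x) (scal (m * b') y))
    with (scal m (plus (scal a' x) (scal b' y)))
    by (rewrite scal_RD, !scal_RA; reflexivity).
  eapply Rle_trans;
    [exact (norm_scal m (plus (scal a' x) (scal b' y) : E))|].
  change (abs m) with (Rabs m). rewrite (Rabs_pos_eq m m0).
  apply Rmult_le_compat_l; [exact m0|].
  exact (@cplx_norm_ub (x, y) a' b' H').
Qed.

Lemma cplx_norm_ball (x y : E * E) (eps : R) :
  cplx_norm (minus y x) < eps -> ball x eps y.
Proof.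
intros H. split; apply norm_compat1; eapply Rle_lt_trans; try exact H.
- exact (cplx_norm_fst (minus y x)).
- exact (cplx_norm_snd (minus y x)).
Qed.

Lemma cplx_ball_norm (x y : E * E) (eps : posreal) :
  ball x eps y ->
  cplx_norm (minus y x) < (2 * norm_factor (V := E)) * eps.
Proof.
intros [H1 H2]. eapply Rle_lt_trans; [apply cplx_norm_sum|].
replace (2 * norm_factor (V := E) * eps)
  with (norm_factor (V := E) * eps + norm_factor (V := E) * eps) by ring.
apply Rplus_lt_compat.
- exact (norm_compat2 (fst x) (fst y) eps H1).
- exact (norm_compat2 (snd x) (snd y) eps H2).
Qed.

Lemma cplx_norm_eq_zero (x : E * E) : cplx_norm x = 0 -> x = zero.
Proof.
intros H. assert (H1 := cplx_norm_fst x). assert (H2 := cplx_norm_snd x).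
assert (P1 := norm_ge_0 (fst x)). assert (P2 := norm_ge_0 (snd x)).
apply injective_projections; apply norm_eq_zero; lra.
Qed.

Definition cplx_ModuleSpace_mixin : ModuleSpace.mixin_of C_Ring _ :=
  ModuleSpace.Mixin C_Ring (prod_AbelianGroup E E) cplx_scal
    cplx_scal_assoc cplx_scal_one cplx_scal_distr_l cplx_scal_distr_r.

Definition cplx_NormedModuleAux : NormedModuleAux C_AbsRing :=
  NormedModuleAux.Pack C_AbsRing (E * E)
    (NormedModuleAux.Class C_AbsRing (E * E)
      (ModuleSpace.Class C_Ring (E * E)
         (AbelianGroup.class (prod_AbelianGroup E E)) cplx_ModuleSpace_mixin)
      (UniformSpace.class (prod_UniformSpace E E))) (E * E).

Definition cplx_NormedModule_mixin :
    NormedModule.mixin_of C_AbsRing cplx_NormedModuleAux :=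
  NormedModule.Mixin C_AbsRing cplx_NormedModuleAux cplx_norm
    (2 * norm_factor (V := E)) cplx_norm_triangle cplx_norm_scal
    cplx_norm_ball cplx_ball_norm cplx_norm_eq_zero.

Definition complexification : NormedModule C_AbsRing :=
  NormedModule.Pack C_AbsRing (E * E)
    (NormedModule.Class C_AbsRing (E * E)
      (NormedModuleAux.class C_AbsRing cplx_NormedModuleAux)
      cplx_NormedModule_mixin) (E * E).

End Complexification.

Definition sector (delta : R) (z : C) : Prop :=
  exists r phi : R, 0 < r /\ Rabs phi < delta /\ z = (r * cos phi, r * sin phi).

Definition holomorphic_at {X : NormedModule C_AbsRing}
    (S : C -> X -> X) (z : C) : Prop :=
  exists D : X -> X, is_linear D /\
    filterlim
      (fun h : C => opnorm (fun x =>
         minus (scal (Cinv h : C_AbsRing) (minus (S (Cplus z h) x) (S z x))) (D x)))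
      (locally' (RtoC 0)) (locally 0).

Definition analytic_complex {X : NormedModule C_AbsRing}
    (T : R -> X -> X) : Prop :=
  exists (delta : R) (S : C -> X -> X),
    0 < delta <= PI / 2 /\
    (forall t x, 0 <= t -> S (RtoC t) x = T t x) /\
    (forall z, sector delta z -> is_linear (S z)) /\
    (forall z w x, sector delta z -> sector delta w ->
       S (Cplus z w) x = S z (S w x)) /\
    (forall z, sector delta z -> holomorphic_at S z) /\
    (forall delta' x, 0 < delta' < delta ->
       filterlim (fun z => S z x)
         (within (sector delta') (locally (RtoC 0))) (locally x)).

(* Over the reals, analyticity refers to the complexified semigroup. *)
Definition analytic (k : scalar_field) :
    forall E : NormedModule (Kring k), (R -> E -> E) -> Prop :=
  match k return forall E : NormedModule (Kring k), (R -> E -> E) -> Prop with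
  | real_scalars => fun E T =>
      @analytic_complex (complexification E)
        (fun t v => (T t (fst v), T t (snd v)))
  | complex_scalars => fun E T => @analytic_complex E T
  end.

Section Semigroups.

Context {k : scalar_field} {E0 : CompleteNormedModule (Kring k)}.

Definition C0_semigroup (T : R -> E0 -> E0) : Prop :=
  (forall t, 0 <= t -> is_linear (T t)) /\
  (forall x, T 0 x = x) /\
  (forall s t x, 0 <= s -> 0 <= t -> T (s + t) x = T s (T t x)) /\
  (forall x, filterlim (fun t => T t x) (at_right 0) (locally x)).

Definition generates {E1 : banach_in E0} (A : E1 -> E0)
    (T : R -> E0 -> E0) : Prop :=
  forall x y : E0,
    filterlim (fun h => scal (RtoK k (/ h)) (minus (T h x) x))
      (at_right 0) (locally y)
    <-> exists z : E1, emb z = x /\ A z = y.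

(* [A] belongs to the class H(E1, E0). *)
Definition analytic_generator (E1 : banach_in E0) (A : E1 -> E0) : Prop :=
  is_linear A /\
  exists T : R -> E0 -> E0,
    C0_semigroup T /\ analytic (k := k) T /\ generates A T.

End Semigroups.

(* These are the intervals [0, T) and [0, T] with T > 0, T possibly infinite in
   the first case. *)
Definition time_interval (J : R -> Prop) : Prop :=
  (forall t, J t -> 0 <= t) /\
  (forall s t, J t -> 0 <= s <= t -> J s) /\
  (exists t, 0 < t /\ J t).

Definition half_open (T : Rbar) (t : R) : Prop := 0 <= t /\ Rbar_lt t T.

Section CauchyProblem.

Context {k : scalar_field} {E0 : CompleteNormedModule (Kring k)}.
Context {E1 Ea Ex Eg : banach_in E0}.
Context (A : E1 -> E0) (O : Ea -> Prop) (f : Ex -> Eg).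
(* [d] is the exponent of the time weight. *)
Context (d : R).

(* Derivative relative to [J]; one-sided at an end point in [J]. *)
Definition is_derive_on (J : R -> Prop) (u : R -> E0) (t : R) (l : E0) : Prop :=
  filterlim (fun s => scal (RtoK k (/ (s - t))) (minus (u s) (u t)))
    (within J (locally' t)) (locally l).

Definition continuous_on_at {X : UniformSpace} (J : R -> Prop) (u : R -> X)
    (t : R) : Prop :=
  filterlim u (within J (locally t)) (locally (u t)).

Record solution (u0 : Ea) (J : R -> Prop) (u : R -> Ea) : Prop := {
  sol_interval : time_interval J;
  sol_init : u 0 = u0;
  sol_range : forall t, J t -> O (u t);
  sol_cont : forall t, J t -> continuous_on_at J u t;
  sol_mem : forall t, J t -> 0 < t -> mem E1 (emb (u t));
  sol_cont1 : forall t, J t -> 0 < t ->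
    continuous_on_at J (fun s => coe E1 (u s)) t;
  sol_ode : exists u' : R -> E0, forall t, J t -> 0 < t ->
    is_derive_on J (fun s => emb (u s)) t (u' t) /\
    continuous_on_at J u' t /\
    u' t = plus (A (coe E1 (u t))) (emb (f (coe Ex (u t))));
  sol_weight :
    filterlim (fun t => Rpower t d * norm (coe Ex (u t)))
      (at_right 0) (locally 0)
}.

Definition maximal_solution (u0 : Ea) (J : R -> Prop) (u : R -> Ea) : Prop :=
  solution u0 J u /\
  forall (J' : R -> Prop) (v : R -> Ea), solution u0 J' v ->
    (forall t, J t -> J' t /\ v t = u t) -> forall t, J' t -> J t.

End CauchyProblem.

Definition is_semiflow {K : AbsRing} {E : NormedModule K} (O : E -> Prop)
    (tplus : E -> Rbar) (phi : R -> E -> E) : Prop :=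
  let D (p : R * E) := O (snd p) /\ half_open (tplus (snd p)) (fst p) in
  (exists W : R * E -> Prop, open W /\
     forall t x, 0 <= t -> O x -> (D (t, x) <-> W (t, x))) /\
  (forall t x, D (t, x) -> O (phi t x)) /\
  (forall p, D p ->
     filterlim (fun p' => phi (fst p') (snd p'))
       (within D (locally p)) (locally (phi (fst p) (snd p)))) /\
  (forall x, O x -> phi 0 x = x) /\
  (forall s t x, D (s, x) -> 0 <= t ->
     (D (t, phi s x) <-> D (t + s, x)) /\
     (D (t + s, x) -> phi (t + s) x = phi t (phi s x))).

(* Main.v *)
Require Import Defs.
From Stdlib Require Import Reals Lra Lia List ClassicalEpsilon Classical.
From Coquelicot Require Import Coquelicot.

(** The problem is solved through the variation of constants formula

    [u t = T t u0 + the integral of T (t - s) (f (u s)) over 0 < s < t],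

    where [T] is the semigroup generated by [A]. A fixed point is sought among the
    functions that stay close to [u0] in [E alpha] and satisfy
    [norm (u t) <= eps * t ^ (alpha - xi)] in [E xi]; for such functions the
    growth condition bounds [f (u s)] in [E gamma] by a multiple of
    [eps ^ q * s ^ (- q * (xi - alpha))] ([nl_scaled], [local_bounds_exist]). The
    problem is critical: the exponent is [q * (xi - alpha) = 1 + gamma - alpha],
    which is less than one, and the integral of
    [(t - s) ^ (gamma - xi) * s ^ (alpha - gamma - 1)] is a constant times
    [t ^ (alpha - xi)]. So the integral operator preserves the class of functions
    with no gain of a power of [t]. What makes it a contraction is the power of
    [eps] ([image_contract]); and [eps] may be chosen small, because
    [t ^ (xi - alpha) * norm (T t u0)] tends to zero in [E xi] for every [u0] in
    [E alpha], by the density of [E1] ([decay_scale]). The required limit of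
    [t ^ (xi - alpha) * norm (u t)] puts every solution into this class on a
    short interval, whence uniqueness ([strong_small], [strong_unique]). The
    constants can be chosen uniformly for data near a given point, which yields a
    uniform time of existence and Lipschitz dependence on the data
    ([strong_exists], [strong_stable]).

    The kernel estimates are those of an analytic semigroup on an interpolation
    scale. Cauchy's estimate for the holomorphic extension gives the smoothing
    from [E0] to [E1] ([cauchy_estimate], [generator_smoothing]), and
    interpolation gives it from [E0] to [E theta] ([smoothing_from_E0]). To start
    from [E theta] with positive [theta], one interpolates again, using the
    presentation of [E theta] as an interpolation space between [E0] and [E eta]
    ([smoothing_scale]).

    A fixed point is Hoelder continuous in [E xi] away from [t = 0]
    ([image_holder]), hence so is [f (u t)] in [E0], and then the fixed point is a
    strong solution ([mild_mem], [mild_cont_E1], [mild_rder], [strong_of_image]).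

    Local solutions are glued to a maximal one. Lipschitz dependence propagates
    along orbits and gives the semiflow ([stable], [orbit_near]). Since times of
    existence are bounded below near each point of [O], an orbit with finite life
    time cannot visit a small ball around a point of [O] at late times
    ([no_late_visit]). By compactness a relatively compact orbit is therefore
    global. An orbit with finite life time that is uniformly continuous in
    [E alpha] converges there, and its limit is not in [O], so it is a boundary
    point ([cauchy_late_limit], [cauchy_to_boundary]). If [f] is bounded in [E0]
    along the orbit, uniform continuity follows from the variation of constants
    formula, whose kernel from [E0] to [E alpha] has the integrable order [alpha]
    ([bounded_cauchy_late]). *)

Set Implicit Arguments.
Unset Strict Implicit.
Open Scope R_scope.

(** * Real linear combinations *)

Lemma RtoK_plus k a b : RtoK k (a + b) = plus (RtoK k a) (RtoK k b).
Proof. destruct k; [reflexivity|exact (RtoC_plus a b)]. Qed.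

Lemma RtoK_mult k a b : RtoK k (a * b) = mult (RtoK k a) (RtoK k b).
Proof. destruct k; [reflexivity|exact (RtoC_mult a b)]. Qed.

Lemma RtoK_one k : RtoK k 1 = one.
Proof. destruct k; reflexivity. Qed.

Lemma RtoK_zero k : RtoK k 0 = zero.
Proof. destruct k; reflexivity. Qed.

Lemma abs_RtoK k a : abs (RtoK k a) = Rabs a.
Proof. destruct k; [reflexivity|exact (Cmod_R a)]. Qed.

Section Vec.

Context {k : scalar_field} {V : NormedModule (Kring k)}.

Definition vadd (x y : V) : V := plus x y.
Definition vopp (x : V) : V := opp x.
Definition vzero : V := zero.
Definition vscal (r : R) (x : V) : V := scal (RtoK k r) x.

End Vec.

Notation "x +v y" := (vadd x y) (at level 50, left associativity).
Notation "x -v y" := (vadd x (vopp y)) (at level 50, left associativity).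
Notation "r *v x" := (vscal r x) (at level 40, left associativity).

Section VecFacts.

Context {k : scalar_field} {V : NormedModule (Kring k)}.
Implicit Types x y z : V.

Lemma vaddC x y : x +v y = y +v x.
Proof. exact (plus_comm x y). Qed.

Lemma vaddA x y z : x +v (y +v z) = (x +v y) +v z.
Proof. exact (plus_assoc x y z). Qed.

Lemma vadd0 x : x +v vzero = x.
Proof. exact (plus_zero_r x). Qed.

Lemma vscalA a b x : a *v (b *v x) = (a * b) *v x.
Proof. unfold vscal. rewrite RtoK_mult. exact (scal_assoc _ _ x). Qed.

Lemma vscal1 x : 1 *v x = x.
Proof. unfold vscal. rewrite RtoK_one. exact (scal_one x). Qed.

Lemma vscal0 x : 0 *v x = vzero.
Proof. unfold vscal. rewrite RtoK_zero. exact (scal_zero_l x). Qed.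

Lemma vscal_vzero a : a *v (vzero : V) = vzero.
Proof. exact (scal_zero_r _). Qed.

Lemma vscalDr a x y : a *v (x +v y) = a *v x +v a *v y.
Proof. exact (scal_distr_l (RtoK k a) x y). Qed.

Lemma vscalDl a b x : (a + b) *v x = a *v x +v b *v x.
Proof. unfold vscal. rewrite RtoK_plus. exact (scal_distr_r _ _ x). Qed.

Lemma vopp_scal x : vopp x = (-1) *v x.
Proof.
assert (H : x +v (-1) *v x = vzero).
{ rewrite <- (vscal1 x) at 1. rewrite <- vscalDl.
  replace (1 + -1) with 0 by ring. apply vscal0. }
assert (H' : vopp x +v x = vzero) by exact (plus_opp_l x).
rewrite <- (vadd0 (vopp x)), <- H, vaddA, H', vaddC. apply vadd0.
Qed.

Inductive vexp :=
  VA (n : nat) | VZ | VP (a b : vexp) | VO (a : vexp) | VS (r : R) (a : vexp).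

Fixpoint veval (env : list V) (e : vexp) : V :=
  match e with
  | VA n => nth n env vzero
  | VZ => vzero
  | VP a b => veval env a +v veval env b
  | VO a => vopp (veval env a)
  | VS r a => r *v veval env a
  end.

Fixpoint vcoef (e : vexp) (n : nat) : R :=
  match e with
  | VA m => if Nat.eqb m n then 1 else 0
  | VZ => 0
  | VP a b => vcoef a n + vcoef b n
  | VO a => - vcoef a n
  | VS r a => r * vcoef a n
  end.

Fixpoint lincomb (env : list V) (c : nat -> R) : V :=
  match env with
  | nil => vzero
  | x :: l => c 0%nat *v x +v lincomb l (fun n => c (S n))
  end.

Fixpoint same_coef (env : list V) (c c' : nat -> R) : Prop :=
  match env with
  | nil => True
  | _ :: l => c 0%nat = c' 0%nat /\ same_coef l (fun n => c (S n)) (fun n => c' (S n))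
  end.

Lemma lincomb_ext env : forall c c', same_coef env c c' -> lincomb env c = lincomb env c'.
Proof.
induction env as [|x l IH]; intros c c'; simpl; [reflexivity|].
intros [H1 H2]. now rewrite H1, (IH _ _ H2).
Qed.

Lemma lincomb_zero env : forall c, (forall n, c n = 0) -> lincomb env c = vzero.
Proof.
induction env as [|x l IH]; intros c H; simpl; [reflexivity|].
rewrite H, IH, vscal0; [apply vadd0|intros n; apply H].
Qed.

Lemma lincomb_plus env : forall c c',
  lincomb env (fun n => c n + c' n) = lincomb env c +v lincomb env c'.
Proof.
induction env as [|x l IH]; intros c c'; simpl; [now rewrite vadd0|].
rewrite (IH (fun n => c (S n)) (fun n => c' (S n))), vscalDl, <- !vaddA. f_equal.
rewrite !vaddA. f_equal. apply vaddC.
Qed.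

Lemma lincomb_scal env r : forall c,
  lincomb env (fun n => r * c n) = r *v lincomb env c.
Proof.
induction env as [|x l IH]; intros c; simpl; [now rewrite vscal_vzero|].
now rewrite (IH (fun n => c (S n))), vscalDr, vscalA.
Qed.

Lemma lincomb_nth env : forall n,
  lincomb env (fun m => if Nat.eqb n m then 1 else 0) = nth n env vzero.
Proof.
induction env as [|x l IH]; intros [|n]; simpl; try reflexivity.
- rewrite lincomb_zero; [now rewrite vscal1, vadd0|reflexivity].
- now rewrite IH, vscal0, vaddC, vadd0.
Qed.

Lemma veval_lincomb env e : veval env e = lincomb env (vcoef e).
Proof.
induction e as [n| |a IHa b IHb|a IHa|r a IHa]; simpl.
- symmetry. apply lincomb_nth.
- symmetry. now apply lincomb_zero.
- now rewrite IHa, IHb, <- lincomb_plus.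
- rewrite IHa, vopp_scal, <- lincomb_scal.
  assert (H : forall c c', (forall n, c n = c' n) -> lincomb env c = lincomb env c').
  { clear. induction env as [|x l IH]; intros c c' H; simpl; [reflexivity|].
    rewrite H. f_equal. apply IH. intros n. apply H. }
  apply H. intros n. ring.
- now rewrite IHa, <- lincomb_scal.
Qed.

(** Equality of real linear combinations is decided coefficientwise; the tactic
    [vec] below leaves it to [field] and [lra]. *)
Lemma veval_eq env e1 e2 :
  same_coef env (vcoef e1) (vcoef e2) -> veval env e1 = veval env e2.
Proof. intros H. rewrite !veval_lincomb. now apply lincomb_ext. Qed.

End VecFacts.

Ltac vec_mem x l :=
  match l with
  | nil => constr:(false)
  | cons x _ => constr:(true)
  | cons _ ?t => vec_mem x t
  end.
Ltac vec_index x l :=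
  match l with
  | cons x _ => constr:(O)
  | cons _ ?t => let n := vec_index x t in constr:(S n)
  end.
Ltac vec_atoms l e :=
  match e with
  | vadd ?a ?b => let l := vec_atoms l a in vec_atoms l b
  | vopp ?a => vec_atoms l a
  | vscal _ ?a => vec_atoms l a
  | vzero => l
  | _ => match vec_mem e l with true => l | false => constr:(cons e l) end
  end.
Ltac vec_reify l e :=
  match e with
  | vadd ?a ?b => let a := vec_reify l a in let b := vec_reify l b in constr:(VP a b)
  | vopp ?a => let a := vec_reify l a in constr:(VO a)
  | vscal ?r ?a => let a := vec_reify l a in constr:(VS r a)
  | vzero => constr:(VZ)
  | _ => let n := vec_index e l in constr:(VA n)
  end.
Ltac vec_goal :=
  match goal with
  | |- @eq ?T ?a ?b =>
    let l := vec_atoms (@nil T) a in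
    let l := vec_atoms l b in
    let ea := vec_reify l a in let eb := vec_reify l b in
    apply (@veval_eq _ _ l ea eb)
  end;
  cbn [same_coef vcoef Nat.eqb].
Ltac vec := vec_goal; repeat split; first [ring | lra | field; lra | field].

(** * Gauges: the norm of an embedded Banach space, seen from the ambient space *)

(** [B x r] is to be read: [x] lies in the space described by [B], and its norm
    there is at most [r]. Working with this relation on the ambient space avoids
    carrying elements along the embeddings. *)
Record gauge {k : scalar_field} (V : NormedModule (Kring k)) := {
  gbd :> V -> R -> Prop;
  gbd_le : forall x r s, gbd x r -> r <= s -> gbd x s;
  gbd_pos : forall x r, gbd x r -> 0 <= r;
  gbd_zero : gbd vzero 0;
  gbd_add : forall x y r s, gbd x r -> gbd y s -> gbd (x +v y) (r + s);
  gbd_scal : forall c x r, gbd x r -> gbd (c *v x) (Rabs c * r);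
  gbd_eps : forall x r, (forall e, 0 < e -> gbd x (r + e)) -> gbd x r;
  gbd_eq0 : forall x, gbd x 0 -> x = vzero
}.

Arguments gbd : simpl never.

Section Gauge.

Context {k : scalar_field} {V : NormedModule (Kring k)}.
Implicit Types (B : gauge V) (x y : V).

Lemma gbd_opp B x r : B x r -> B (vopp x) r.
Proof.
intros H. rewrite vopp_scal. eapply gbd_le; [exact (gbd_scal (-1) H)|].
rewrite Rabs_left; lra.
Qed.

Lemma gbd_sub B x y r s : B x r -> B y s -> B (x -v y) (r + s).
Proof. intros H1 H2. exact (gbd_add H1 (gbd_opp H2)). Qed.

Lemma gbd_eq B x y r : B y r -> x = y -> B x r.
Proof. intros H ->. exact H. Qed.

Lemma gbd_swap B x y r : B (x -v y) r -> B (y -v x) r.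
Proof. intros H. apply (gbd_eq (gbd_opp H)). vec. Qed.

Lemma gbd_tri B x y z r s : B (x -v y) r -> B (y -v z) s -> B (x -v z) (r + s).
Proof. intros H1 H2. apply (gbd_eq (gbd_add H1 H2)). vec. Qed.

Lemma gbd_sub_eq B x y : B (x -v y) 0 -> x = y.
Proof.
intros H. apply gbd_eq0 in H.
transitivity ((x -v y) +v y); [vec|]. rewrite H. vec.
Qed.

Lemma gbd_eq_eps B x y : (forall e, 0 < e -> B (x -v y) e) -> x = y.
Proof.
intros H. apply (@gbd_sub_eq B). apply gbd_eps. intros e He.
rewrite Rplus_0_l. now apply H.
Qed.

Lemma gbd_scal_pos B c x r : 0 <= c -> B x r -> B (c *v x) (c * r).
Proof. intros Hc H. rewrite <- (Rabs_pos_eq c Hc) at 2. now apply gbd_scal. Qed.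

Lemma gbd_unscal B c x r : 0 < c -> B (c *v x) (c * r) -> B x r.
Proof.
intros Hc H. apply (gbd_scal_pos (c := / c)) in H; [|left; now apply Rinv_0_lt_compat].
rewrite vscalA in H. rewrite <- Rmult_assoc, Rinv_l in H by lra.
rewrite vscal1 in H. now rewrite Rmult_1_l in H.
Qed.

Definition norm_gauge (W : NormedModule (Kring k)) : gauge W.
Proof.
refine {| gbd := fun (x : W) r => norm x <= r |}.
- intros x r s H1 H2. lra.
- intros x r H. assert (P := norm_ge_0 x). lra.
- right. exact norm_zero.
- intros x y r s H1 H2. eapply Rle_trans; [exact (norm_triangle x y)|lra].
- intros c x r H. eapply Rle_trans; [exact (norm_scal _ x)|]. rewrite abs_RtoK.
  apply Rmult_le_compat_l; [apply Rabs_pos|exact H].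
- intros x r H. apply Rnot_lt_le. intros h.
  assert (Q := H ((norm x - r) / 2) ltac:(lra)). lra.
- intros x H. apply norm_eq_zero. assert (P := norm_ge_0 x). lra.
Defined.

Definition gcomplete B : Prop :=
  forall u : nat -> V,
    (forall e, 0 < e -> exists N, forall n m, (N <= n)%nat -> (N <= m)%nat ->
       B (u n -v u m) e) ->
    exists l, forall e, 0 < e -> exists N, forall n, (N <= n)%nat -> B (u n -v l) e.

End Gauge.

(** * Continuity, right derivatives and the mean value inequality *)

Definition Rcont (H : R -> R) (D : R -> Prop) (t : R) : Prop :=
  forall e, 0 < e -> exists d, 0 < d /\
    forall s, D s -> Rabs (s - t) < d -> Rabs (H s - H t) < e.

Section Calculus.

Context {k : scalar_field} {V : NormedModule (Kring k)}.
Implicit Types (B : gauge V).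

Definition cont B (p : R -> V) (D : R -> Prop) (t : R) : Prop :=
  forall e, 0 < e -> exists d, 0 < d /\
    forall s, D s -> Rabs (s - t) < d -> B (p s -v p t) e.

(** Right derivative; only this one-sided notion is stable under the
    manipulations of semigroups below. *)
Definition rder B (p : R -> V) (t : R) (l : V) : Prop :=
  forall e, 0 < e -> exists d, 0 < d /\
    forall h, 0 < h < d -> B (p (t + h) -v p t -v h *v l) (e * h).

Definition icc (a b s : R) : Prop := a <= s <= b.

(** A supremum argument: with the slack [e], the inequality extends a little to
    the right of every point up to which it holds, so the largest interval on
    which it holds is the whole interval. *)
Lemma incr_le B (p : R -> V) (H : R -> R) a b : a <= b ->
  (forall t, a <= t <= b -> cont B p (icc a b) t) ->
  (forall t, a <= t <= b -> Rcont H (icc a b) t) ->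
  (forall t, a < t < b -> forall e, 0 < e -> exists d, 0 < d /\
     forall h, 0 < h < d -> B (p (t + h) -v p t) (H (t + h) - H t + e * h)) ->
  B (p b -v p a) (H b - H a).
Proof.
intros Hab Cp CH D.
destruct Hab as [Hab| <-];
  [|replace (p a -v p a) with (vzero : V) by vec; rewrite Rminus_diag; apply gbd_zero].
(* The endpoints are reached by continuity, so start at [s] in the interior. *)
assert (Main : forall s e, a < s < b -> 0 < e ->
  B (p b -v p s) (H b - H s + e * (b - s) + e)).
{ intros s e Hs He.
  pose (P t := s <= t <= b /\ forall r, s <= r <= t -> B (p r -v p s) (H r - H s + e * (r - s))).
  assert (Ps : P s).
  { split; [lra|]. intros r Hr. replace r with s by lra.
    replace (p s -v p s) with (vzero : V) by vec.
    replace (H s - H s + e * (s - s)) with 0 by ring. apply gbd_zero. }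
  destruct (completeness P) as [c [Hub Hlub]].
  { exists b. intros t [Ht _]. lra. }
  { now exists s. }
  assert (Hsc : s <= c) by (apply Hub; exact Ps).
  assert (Hcb : c <= b) by (apply Hlub; intros t [Ht _]; lra).
  assert (Below : forall r, s <= r < c -> B (p r -v p s) (H r - H s + e * (r - s))).
  { intros r Hr. destruct (classic (exists t, P t /\ r < t)) as [[t [[_ Pt] Hrt]]|No].
    - apply Pt. lra.
    - exfalso. assert (c <= r); [|lra]. apply Hlub. intros t Pt.
      apply Rnot_lt_le. intros h. apply No. now exists t. }
  assert (AtC : forall e', 0 < e' -> B (p c -v p s) (H c - H s + e * (c - s) + e')).
  { intros e' He'. destruct Hsc as [Hsc| <-];
      [|eapply gbd_le; [apply Ps; lra|lra]].
    destruct (Cp c ltac:(lra) (e' / 2) ltac:(lra)) as [d1 [Hd1 C1]].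
    destruct (CH c ltac:(lra) (e' / 2) ltac:(lra)) as [d2 [Hd2 C2]].
    pose (r := Rmax s (c - Rmin d1 d2 / 2)).
    assert (Hm : 0 < Rmin d1 d2) by (apply Rmin_glb_lt; assumption).
    assert (M1 := Rmin_l d1 d2). assert (M2 := Rmin_r d1 d2).
    assert (Hr : s <= r < c).
    { split; [apply Rmax_l|]. apply Rmax_lub_lt; lra. }
    assert (Hr2 : c - Rmin d1 d2 / 2 <= r) by apply Rmax_r.
    assert (Q1 := C1 r ltac:(unfold icc; lra) ltac:(rewrite Rabs_left1; lra)).
    assert (Q2 := C2 r ltac:(unfold icc; lra) ltac:(rewrite Rabs_left1; lra)).
    apply Rabs_def2 in Q2.
    eapply gbd_le; [exact (gbd_tri (gbd_swap Q1) (Below r Hr))|].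
    assert (e * (r - s) <= e * (c - s)) by (apply Rmult_le_compat_l; lra). lra. }
  destruct Hcb as [Hcb| ->]; [|apply AtC; exact He].
  exfalso.
  destruct (D c ltac:(lra) e He) as [d [Hd Dd]].
  pose (t := c + Rmin (d / 2) (b - c)).
  assert (Hm : 0 < Rmin (d / 2) (b - c)) by (apply Rmin_glb_lt; lra).
  assert (M1 := Rmin_l (d / 2) (b - c)). assert (M2 := Rmin_r (d / 2) (b - c)).
  assert (Pt : P t).
  { split; [unfold t; lra|]. intros r Hr.
    destruct (Rlt_le_dec r c) as [h|h]; [apply Below; lra|].
    apply gbd_eps. intros e' He'.
    destruct h as [h| <-]; [|apply AtC, He'].
    assert (Q := Dd (r - c) ltac:(unfold t in Hr; lra)).
    replace (c + (r - c)) with r in Q by ring.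
    eapply gbd_le; [exact (gbd_tri Q (AtC e' He'))|]. lra. }
  assert (t <= c) by (apply Hub; exact Pt). unfold t in *. lra. }
apply gbd_eps. intros e He.
pose (e1 := Rmin (e / 4) (e / (4 * (b - a)))).
assert (He1 : 0 < e1).
{ apply Rmin_glb_lt; [lra|]. apply Rdiv_lt_0_compat; lra. }
assert (He1' : e1 * (b - a) <= e / 4).
{ apply Rle_trans with (e / (4 * (b - a)) * (b - a)).
  - apply Rmult_le_compat_r; [lra|apply Rmin_r].
  - right. field. lra. }
destruct (Cp a ltac:(lra) (e / 4) ltac:(lra)) as [d1 [Hd1 C1]].
destruct (CH a ltac:(lra) (e / 4) ltac:(lra)) as [d2 [Hd2 C2]].
pose (s := a + Rmin (Rmin d1 d2) (b - a) / 2).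
assert (Hm : 0 < Rmin (Rmin d1 d2) (b - a)).
{ apply Rmin_glb_lt; [apply Rmin_glb_lt; assumption|lra]. }
assert (M1 := Rmin_l d1 d2). assert (M2 := Rmin_r d1 d2).
assert (M3 := Rmin_l (Rmin d1 d2) (b - a)). assert (M4 := Rmin_r (Rmin d1 d2) (b - a)).
assert (Hs : a < s < b) by (unfold s; lra).
assert (Q1 := C1 s ltac:(unfold icc; lra) ltac:(unfold s; rewrite Rabs_pos_eq; lra)).
assert (Q2 := C2 s ltac:(unfold icc; lra) ltac:(unfold s; rewrite Rabs_pos_eq; lra)).
apply Rabs_def2 in Q2.
eapply gbd_le; [exact (gbd_tri (Main s e1 Hs He1) Q1)|].
assert (e1 * (b - s) <= e1 * (b - a)) by (apply Rmult_le_compat_l; lra).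
assert (e1 <= e / 4) by apply Rmin_l. lra.
Qed.

End Calculus.

Lemma is_derive_eps (H : R -> R) t m : is_derive H t m ->
  forall e, 0 < e -> exists d, 0 < d /\
    forall h, Rabs h < d -> Rabs (H (t + h) - H t - m * h) <= e * Rabs h.
Proof.
intros HD e He. apply is_derive_Reals in HD.
destruct (HD e He) as [d Hd]. exists d. split; [apply cond_pos|].
intros h Hh. destruct (Req_dec h 0) as [->|Hh0].
- rewrite Rplus_0_r, Rabs_R0. replace (H t - H t - m * 0) with 0 by ring.
  rewrite Rabs_R0. lra.
- assert (Q := Hd h Hh0 Hh).
  replace (H (t + h) - H t - m * h) with (((H (t + h) - H t) / h - m) * h) by (field; auto).
  rewrite Rabs_mult. apply Rmult_le_compat_r; [apply Rabs_pos|lra].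
Qed.

Lemma Rcont_continuous (H : R -> R) D t : continuous H t -> Rcont H D t.
Proof.
intros C e He.
destruct (proj1 (filterlim_locally H (H t)) C (mkposreal e He)) as [d Hd].
exists d. split; [apply cond_pos|]. intros s _ Hs. exact (Hd s Hs).
Qed.

Section Calculus2.

Context {k : scalar_field} {V : NormedModule (Kring k)}.
Implicit Types (B : gauge V) (T : V -> V).

Lemma mean_value B (p : R -> V) (H h : R -> R) a b : a <= b ->
  (forall t, a <= t <= b -> cont B p (icc a b) t) ->
  (forall t, a <= t <= b -> Rcont H (icc a b) t) ->
  (forall t, a < t < b -> is_derive H t (h t)) ->
  (forall t, a < t < b -> exists l, rder B p t l /\ B l (h t)) ->
  B (p b -v p a) (H b - H a).
Proof.
intros Hab Cp CH DH Dp. apply incr_le; try assumption.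
intros t Ht e He. destruct (Dp t Ht) as [l [D1 Hl]].
destruct (D1 (e / 2) ltac:(lra)) as [d1 [Hd1 Q1]].
destruct (is_derive_eps (DH t Ht) (e := e / 2) ltac:(lra)) as [d2 [Hd2 Q2]].
exists (Rmin d1 d2). split; [now apply Rmin_glb_lt|]. intros r Hr.
assert (M1 := Rmin_l d1 d2). assert (M2 := Rmin_r d1 d2).
assert (Q1' := Q1 r ltac:(lra)).
assert (Q2' := Q2 r ltac:(rewrite Rabs_pos_eq; lra)).
rewrite (Rabs_pos_eq r) in Q2' by lra. apply Rabs_le_between in Q2'.
eapply gbd_le.
- apply (gbd_eq (gbd_add Q1' (gbd_scal_pos (c := r) ltac:(lra) Hl))). vec.
- lra.
Qed.

Lemma mean_value_const B (p : R -> V) (M : R) a b : a <= b ->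
  (forall t, a <= t <= b -> cont B p (icc a b) t) ->
  (forall t, a < t < b -> exists l, rder B p t l /\ B l M) ->
  B (p b -v p a) (M * (b - a)).
Proof.
intros Hab Cp Dp.
replace (M * (b - a)) with (M * b - M * a) by ring.
apply (@mean_value B p (fun t => M * t) (fun _ => M)); try assumption.
- intros t _. apply Rcont_continuous.
  apply (continuous_mult (fun _ => M) (fun t => t)); [apply continuous_const|apply continuous_id].
- intros t _. auto_derive; [exact I|ring].
Qed.

Lemma rder0_const B (p : R -> V) a b : a <= b ->
  (forall t, a <= t <= b -> cont B p (icc a b) t) ->
  (forall t, a < t < b -> rder B p t vzero) -> p b = p a.
Proof.
intros Hab Cp Dp. apply (@gbd_sub_eq _ _ B).
rewrite <- (Rmult_0_l (b - a)). apply mean_value_const; try assumption.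
intros t Ht. exists vzero. split; [now apply Dp|apply gbd_zero].
Qed.

Definition maps B B' T (C : R) : Prop := forall x r, B x r -> B' (T x) (C * r).

Definition real_linear T : Prop :=
  (forall x y, T (x +v y) = T x +v T y) /\ (forall c x, T (c *v x) = c *v T x).

Lemma real_linear_opp T x : real_linear T -> T (vopp x) = vopp (T x).
Proof. intros [_ H]. rewrite !vopp_scal. apply H. Qed.

Lemma real_linear_sub T x y : real_linear T -> T (x -v y) = T x -v T y.
Proof. intros H. rewrite (proj1 H). now rewrite real_linear_opp. Qed.

Lemma real_linear_0 T : real_linear T -> T vzero = vzero.
Proof. intros [_ H]. rewrite <- (vscal0 vzero) at 1. rewrite H. vec. Qed.

Lemma cont_sub B p (D D' : R -> Prop) t :
  (forall s, D' s -> D s) -> cont B p D t -> cont B p D' t.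
Proof.
intros Hs C e He. destruct (C e He) as [d [Hd Q]]. exists d. split; [exact Hd|].
intros s Ds. apply Q, Hs, Ds.
Qed.

Lemma cont_local B p (D D' : R -> Prop) t r : 0 < r ->
  (forall s, D' s -> Rabs (s - t) < r -> D s) -> cont B p D t -> cont B p D' t.
Proof.
intros Hr Hs C e He. destruct (C e He) as [d [Hd Q]].
exists (Rmin d r). split; [now apply Rmin_glb_lt|].
intros s Ds Hst. assert (M1 := Rmin_l d r). assert (M2 := Rmin_r d r).
apply Q; [apply Hs; [exact Ds|]|]; lra.
Qed.

Lemma cont_ext B p p' (D : R -> Prop) t :
  p t = p' t -> (forall s, D s -> p s = p' s) -> cont B p D t -> cont B p' D t.
Proof.
intros Et Es C e He. destruct (C e He) as [d [Hd Q]]. exists d. split; [exact Hd|].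
intros s Ds Hst. rewrite <- Et, <- Es by exact Ds. now apply Q.
Qed.

Lemma cont_const B x D t : cont B (fun _ => x) D t.
Proof.
intros e He. exists 1. split; [lra|]. intros s _ _.
eapply gbd_le; [apply (gbd_eq (gbd_zero B)); vec|lra].
Qed.

Lemma cont_add B p p' D t :
  cont B p D t -> cont B p' D t -> cont B (fun s => p s +v p' s) D t.
Proof.
intros C C' e He.
destruct (C (e / 2) ltac:(lra)) as [d [Hd Q]].
destruct (C' (e / 2) ltac:(lra)) as [d' [Hd' Q']].
exists (Rmin d d'). split; [now apply Rmin_glb_lt|]. intros s Ds Hs.
assert (M1 := Rmin_l d d'). assert (M2 := Rmin_r d d').
eapply gbd_le.
- apply (gbd_eq (gbd_add (Q s Ds ltac:(lra)) (Q' s Ds ltac:(lra)))). vec.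
- lra.
Qed.

Lemma cont_lin B B' T C p D t : real_linear T -> maps B B' T C ->
  cont B p D t -> cont B' (fun s => T (p s)) D t.
Proof.
intros L M Cp e He.
assert (HC : 0 < Rabs C + 1) by (assert (P := Rabs_pos C); lra).
destruct (Cp (e / (Rabs C + 1))) as [d [Hd Q]].
{ now apply Rdiv_lt_0_compat. }
exists d. split; [exact Hd|]. intros s Ds Hs.
eapply gbd_le.
- apply (gbd_eq (M _ _ (Q s Ds Hs))). now rewrite real_linear_sub.
- assert (C <= Rabs C) by apply Rle_abs.
  apply Rle_trans with ((Rabs C + 1) * (e / (Rabs C + 1))); [|right; field; lra].
  apply Rmult_le_compat_r; [|lra]. left. now apply Rdiv_lt_0_compat.
Qed.

Lemma real_linear_id : real_linear (fun x : V => x).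
Proof. split; reflexivity. Qed.

Lemma real_linear_scal c : real_linear (fun x : V => c *v x).
Proof. split; intros; vec. Qed.

Lemma maps_scal B c : maps B B (fun x => c *v x) (Rabs c).
Proof. intros x r H. now apply gbd_scal. Qed.

Lemma cont_scal B c p D t : cont B p D t -> cont B (fun s => c *v p s) D t.
Proof. apply cont_lin with (C := Rabs c); [apply real_linear_scal|apply maps_scal]. Qed.

Lemma cont_minus B p p' D t :
  cont B p D t -> cont B p' D t -> cont B (fun s => p s -v p' s) D t.
Proof.
intros C C'. apply (cont_add C).
apply (cont_scal (-1)) in C'. revert C'. apply cont_ext; intros; vec.
Qed.

Lemma cont_shift B p (D : R -> Prop) c t :
  cont B p D (t + c) -> cont B (fun s => p (s + c)) (fun s => D (s + c)) t.
Proof.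
intros C e He. destruct (C e He) as [d [Hd Q]]. exists d. split; [exact Hd|].
intros s Ds Hs. apply Q; [exact Ds|]. now replace (s + c - (t + c)) with (s - t) by ring.
Qed.

Lemma rder_add B p p' t l l' :
  rder B p t l -> rder B p' t l' -> rder B (fun s => p s +v p' s) t (l +v l').
Proof.
intros C C' e He.
destruct (C (e / 2) ltac:(lra)) as [d [Hd Q]].
destruct (C' (e / 2) ltac:(lra)) as [d' [Hd' Q']].
exists (Rmin d d'). split; [now apply Rmin_glb_lt|]. intros h Hh.
assert (M1 := Rmin_l d d'). assert (M2 := Rmin_r d d').
eapply gbd_le.
- apply (gbd_eq (gbd_add (Q h ltac:(lra)) (Q' h ltac:(lra)))). vec.
- lra.
Qed.

Lemma rder_lin B B' T C p t l : real_linear T -> maps B B' T C ->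
  rder B p t l -> rder B' (fun s => T (p s)) t (T l).
Proof.
intros L M Cp e He.
assert (HC : 0 < Rabs C + 1) by (assert (P := Rabs_pos C); lra).
assert (He' : 0 < e / (Rabs C + 1)) by now apply Rdiv_lt_0_compat.
destruct (Cp (e / (Rabs C + 1)) He') as [d [Hd Q]].
exists d. split; [exact Hd|]. intros h Hh.
eapply gbd_le.
- apply (gbd_eq (M _ _ (Q h Hh))). now rewrite !real_linear_sub, (proj2 L).
- assert (C <= Rabs C) by apply Rle_abs.
  apply Rle_trans with ((Rabs C + 1) * (e / (Rabs C + 1) * h)); [|right; field; lra].
  apply Rmult_le_compat_r; [|lra]. apply Rmult_le_pos; lra.
Qed.

Lemma rder_scal B c p t l : rder B p t l -> rder B (fun s => c *v p s) t (c *v l).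
Proof. apply (rder_lin (real_linear_scal c) (@maps_scal B c)). Qed.

Lemma rder_eq B p t l l' : rder B p t l -> l = l' -> rder B p t l'.
Proof. now intros H <-. Qed.

Lemma rder_local B p p' t l r : 0 < r ->
  (forall s, t <= s < t + r -> p s = p' s) -> rder B p t l -> rder B p' t l.
Proof.
intros Hr Es C e He. destruct (C e He) as [d [Hd Q]].
exists (Rmin d r). split; [now apply Rmin_glb_lt|]. intros h Hh.
assert (M1 := Rmin_l d r). assert (M2 := Rmin_r d r).
rewrite <- !Es by lra. apply Q. lra.
Qed.

Lemma rder_minus B p p' t l l' :
  rder B p t l -> rder B p' t l' -> rder B (fun s => p s -v p' s) t (l -v l').
Proof.
intros C C'.
apply (rder_scal (-1)) in C'.
apply rder_eq with (l +v (-1) *v l'); [|vec].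
apply (rder_local (p := fun s => p s +v (-1) *v p' s) Rlt_0_1); [intros; vec|].
now apply rder_add.
Qed.

Lemma rder_const B x t : rder B (fun _ => x) t vzero.
Proof.
intros e He. exists 1. split; [lra|]. intros h Hh.
eapply gbd_le; [apply (gbd_eq (gbd_zero B)); vec|]. apply Rmult_le_pos; lra.
Qed.

Lemma rder_id B x t : rder B (fun s => s *v x) t x.
Proof.
intros e He. exists 1. split; [lra|]. intros h Hh.
eapply gbd_le; [apply (gbd_eq (gbd_zero B)); vec|]. apply Rmult_le_pos; lra.
Qed.

Lemma cont_id B x r D t : B x r -> cont B (fun s => s *v x) D t.
Proof.
intros Hx e He. assert (Hr := gbd_pos Hx).
exists (e / (r + 1)). split; [apply Rdiv_lt_0_compat; lra|]. intros s _ Hs.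
eapply gbd_le.
- apply (gbd_eq (gbd_scal (s - t) Hx)). vec.
- apply Rle_trans with (e / (r + 1) * (r + 1)); [|right; field; lra].
  apply Rmult_le_compat; try lra. apply Rabs_pos.
Qed.

Lemma rder_shift B p c t l : rder B p (t + c) l -> rder B (fun s => p (s + c)) t l.
Proof.
intros C e He. destruct (C e He) as [d [Hd Q]]. exists d. split; [exact Hd|].
intros h Hh. replace (t + h + c) with (t + c + h) by ring. now apply Q.
Qed.

(** * Improper integrals through antiderivatives *)

(** The integral of [g] over [a, b] is the increment of an antiderivative that
    is continuous up to the endpoints. The integrand may therefore be singular
    at the endpoints, and the mean value inequality gives uniqueness and bounds. *)
Definition is_int B (g : R -> V) (a b : R) (y : V) : Prop :=
  a <= b /\ exists G : R -> V,
    (forall t, a <= t <= b -> cont B G (icc a b) t) /\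
    (forall t, a < t < b -> rder B G t (g t)) /\ y = G b -v G a.

Lemma int_ext B g g' a b y :
  (forall t, a < t < b -> g t = g' t) -> is_int B g a b y -> is_int B g' a b y.
Proof.
intros E [Hab [G [C [D ->]]]]. split; [exact Hab|]. exists G.
repeat split; auto. intros t Ht. rewrite <- E by exact Ht. now apply D.
Qed.

Lemma int_eq B g a b y y' : is_int B g a b y -> y = y' -> is_int B g a b y'.
Proof. now intros H <-. Qed.

Lemma int_point B g a : is_int B g a a vzero.
Proof.
split; [lra|]. exists (fun _ => vzero). repeat split.
- intros t _. apply cont_const.
- intros t Ht. lra.
- vec.
Qed.

Lemma int_lin B B' T C g a b y : real_linear T -> maps B B' T C ->
  is_int B g a b y -> is_int B' (fun s => T (g s)) a b (T y).
Proof.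
intros L M [Hab [G [Cg [D ->]]]]. split; [exact Hab|]. exists (fun s => T (G s)).
repeat split.
- intros t Ht. apply (cont_lin L M). now apply Cg.
- intros t Ht. apply (rder_lin L M). now apply D.
- now apply real_linear_sub.
Qed.

Lemma int_embed B B' C g a b y : (forall x r, B x r -> B' x (C * r)) ->
  is_int B g a b y -> is_int B' g a b y.
Proof. intros M. exact (int_lin real_linear_id M). Qed.

Lemma int_scal B c g a b y :
  is_int B g a b y -> is_int B (fun s => c *v g s) a b (c *v y).
Proof. exact (int_lin (real_linear_scal c) (@maps_scal B c)). Qed.

Lemma int_minus B g g' a b y y' : is_int B g a b y -> is_int B g' a b y' ->
  is_int B (fun s => g s -v g' s) a b (y -v y').
Proof.
intros [Hab [G [C [D ->]]]] [_ [G' [C' [D' ->]]]].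
split; [exact Hab|]. exists (fun s => G s -v G' s). repeat split.
- intros t Ht. apply cont_minus; auto.
- intros t Ht. apply rder_minus; auto.
- vec.
Qed.

Lemma int_add B g g' a b y y' : is_int B g a b y -> is_int B g' a b y' ->
  is_int B (fun s => g s +v g' s) a b (y +v y').
Proof.
intros [Hab [G [C [D ->]]]] [_ [G' [C' [D' ->]]]].
split; [exact Hab|]. exists (fun s => G s +v G' s). repeat split.
- intros t Ht. apply cont_add; auto.
- intros t Ht. apply rder_add; auto.
- vec.
Qed.

Lemma int_bound B g a b y (H h : R -> R) : is_int B g a b y ->
  (forall t, a <= t <= b -> Rcont H (icc a b) t) ->
  (forall t, a < t < b -> is_derive H t (h t)) ->
  (forall t, a < t < b -> B (g t) (h t)) -> B y (H b - H a).
Proof.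
intros [Hab [G [C [D ->]]]] CH DH Hg.
apply (mean_value (h := h)); try assumption.
intros t Ht. exists (g t). split; auto.
Qed.

Lemma int_bound_const B g a b y M : is_int B g a b y ->
  (forall t, a < t < b -> B (g t) M) -> B y (M * (b - a)).
Proof.
intros [Hab [G [C [D ->]]]] Hg. apply mean_value_const; try assumption.
intros t Ht. exists (g t). split; auto.
Qed.

Lemma int_unique B g a b y y' : is_int B g a b y -> is_int B g a b y' -> y = y'.
Proof.
intros I I'. apply (@gbd_sub_eq _ _ B). rewrite <- (Rmult_0_l (b - a)).
apply (int_bound_const (int_minus I I')). intros t _.
apply (gbd_eq (gbd_zero B)). vec.
Qed.

Lemma int_split B g a b y c : is_int B g a b y -> a <= c <= b ->
  exists y1 y2, is_int B g a c y1 /\ is_int B g c b y2 /\ y = y1 +v y2.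
Proof.
intros [Hab [G [C [D ->]]]] Hc. exists (G c -v G a), (G b -v G c). repeat split.
- lra.
- exists G. repeat split; auto.
  + intros t Ht. apply cont_sub with (icc a b); [unfold icc; intros; lra|]. apply C. lra.
  + intros t Ht. apply D. lra.
- lra.
- exists G. repeat split; auto.
  + intros t Ht. apply cont_sub with (icc a b); [unfold icc; intros; lra|]. apply C. lra.
  + intros t Ht. apply D. lra.
- vec.
Qed.

Lemma int_const B x r a b : B x r -> a <= b -> is_int B (fun _ => x) a b ((b - a) *v x).
Proof.
intros Hx Hab. split; [exact Hab|]. exists (fun s => s *v x). repeat split.
- intros t _. now apply cont_id with r.
- intros t _. apply rder_id.
- vec.
Qed.

End Calculus2.

(** * Zabreiko's lemma *)

Lemma half_pow_pos n : 0 < (/ 2) ^ n.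
Proof. apply pow_lt. lra. Qed.

Lemma half_pow_small e : 0 < e -> exists N, forall n, (N <= n)%nat -> (/ 2) ^ n < e.
Proof.
intros He. assert (P := pow_lt_1_zero (/ 2) ltac:(rewrite Rabs_pos_eq; lra) e He).
destruct P as [N HN]. exists N. intros n Hn. specialize (HN n Hn).
now rewrite Rabs_pos_eq in HN by (left; apply half_pow_pos).
Qed.

Section Zabreiko.

Context {k : scalar_field} {V : NormedModule (Kring k)}.
Implicit Types (B : gauge V).

Fixpoint vsum (x : nat -> V) (n : nat) : V :=
  match n with O => vzero | S m => vsum x m +v x m end.

Lemma geometric_tail B (u : nat -> V) c :
  (forall n, B (u (S n) -v u n) (c * (/ 2) ^ n)) ->
  forall n m, (n <= m)%nat -> B (u m -v u n) (2 * c * (/ 2) ^ n).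
Proof.
intros Hu n m Hnm.
assert (Hc : 0 <= c).
{ assert (P := gbd_pos (Hu 0%nat)). simpl in P. lra. }
assert (Q : B (u m -v u n) (2 * c * ((/ 2) ^ n - (/ 2) ^ m))).
{ induction Hnm as [|m Hnm IH].
  - apply (gbd_eq (gbd_le (gbd_zero B) (s := 2 * c * ((/ 2) ^ n - (/ 2) ^ n)) ltac:(lra))).
    vec.
  - eapply gbd_le; [exact (gbd_tri (Hu m) IH)|]. simpl. lra. }
eapply gbd_le; [exact Q|]. apply Rmult_le_compat_l; [lra|].
assert (P := half_pow_pos m). lra.
Qed.

Lemma geometric_limit B (u : nat -> V) c : gcomplete B ->
  (forall n, B (u (S n) -v u n) (c * (/ 2) ^ n)) ->
  exists l, forall n, B (l -v u n) (2 * c * (/ 2) ^ n).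
Proof.
intros Cm Hu. assert (T := geometric_tail Hu).
assert (Hc : 0 <= c).
{ assert (P := gbd_pos (Hu 0%nat)). simpl in P. lra. }
destruct (Cm u) as [l Hl].
{ intros e He. destruct (half_pow_small (e := e / (2 * c + 1))) as [N HN].
  { apply Rdiv_lt_0_compat; lra. }
  assert (Q : forall n m, (N <= n)%nat -> (n <= m)%nat -> B (u m -v u n) e).
  { intros n m Hn Hm. eapply gbd_le; [exact (T n m Hm)|].
    apply Rle_trans with ((2 * c + 1) * (e / (2 * c + 1))); [|right; field; lra].
    apply Rmult_le_compat; try lra. left. apply half_pow_pos.
    left. now apply HN. }
  exists N. intros n m Hn Hm. destruct (Nat.le_ge_cases n m) as [h|h].
  - now apply gbd_swap, Q.
  - now apply Q. }
exists l. intros n. apply gbd_eps. intros e He.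
destruct (Hl e He) as [N HN].
apply gbd_le with (e + 2 * c * (/ 2) ^ n); [|lra].
apply (gbd_tri (y := u (Nat.max N n))).
- apply gbd_swap, HN. lia.
- apply T. lia.
Qed.

(** A countably subadditive gauge-like relation on a complete space is
    continuous. This contains both the uniform boundedness principle and the
    closed graph theorem. The proof is Baire's theorem for the level sets,
    followed by successive approximation. *)
Lemma zabreiko (L : V -> R -> Prop) : gcomplete (norm_gauge V) ->
  (forall x, exists r, L x r) ->
  (forall x r s, L x r -> r <= s -> L x s) ->
  (forall x y r s, L x r -> L y s -> L (x +v y) (r + s)) ->
  (forall c x r, L x r -> L (c *v x) (Rabs c * r)) ->
  (forall (x : nat -> V) s N, (forall n, L (x n) (N * (/ 2) ^ n)) ->
     (forall e, 0 < e -> exists M, forall n, (M <= n)%nat ->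
        norm_gauge V (vsum x n -v s) e) -> L s (2 * N)) ->
  exists C, 0 < C /\ forall x r, 0 < r -> norm x <= r -> L x (C * r).
Proof.
intros Cm Lex Lle Ladd Lscal Lsum. set (B := norm_gauge V) in *.
(* Otherwise nested balls that avoid one level set after another have a common
   point, which lies in no level set. *)
assert (Baire : exists (N : nat) x0 r, 0 < r /\ forall y, B (y -v x0) r ->
  forall e, 0 < e -> exists a, L a (INR N) /\ B (y -v a) e).
{ apply NNPP. intros No.
  assert (Step : forall (N : nat) (p : V * R), 0 < snd p -> exists p' : V * R,
    0 < snd p' <= snd p / 2 /\ B (fst p' -v fst p) (snd p / 2) /\
    forall y, B (y -v fst p') (snd p') -> ~ L y (INR N)).
  { intros N [x0 r] Hr. simpl in *. apply NNPP. intros No'. apply No.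
    exists N, x0, (r / 2). split; [lra|]. intros y Hy e He. apply NNPP. intros No2.
    apply No'. exists (y, Rmin (r / 2) e). simpl.
    split; [split; [apply Rmin_glb_lt; lra|apply Rmin_l]|]. split; [exact Hy|].
    intros z Hz Lz. apply No2. exists z. split; [exact Lz|].
    apply gbd_swap. apply (gbd_le Hz). apply Rmin_r. }
  pose (next N p := epsilon (inhabits (vzero, 1)) (fun p' : V * R =>
    0 < snd p' <= snd p / 2 /\ B (fst p' -v fst p) (snd p / 2) /\
    forall y, B (y -v fst p') (snd p') -> ~ L y (INR N))).
  assert (Hnext : forall N p, 0 < snd p -> 0 < snd (next N p) <= snd p / 2 /\
    B (fst (next N p) -v fst p) (snd p / 2) /\
    forall y, B (y -v fst (next N p)) (snd (next N p)) -> ~ L y (INR N)).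
  { intros N p Hp. unfold next. apply epsilon_spec. now apply Step. }
  pose (P := fix P n := match n with O => (vzero : V, 1) | S m => next m (P m) end).
  assert (Ppos : forall n, 0 < snd (P n)).
  { induction n as [|n IH]; [simpl; lra|]. apply (Hnext n (P n) IH). }
  assert (Pn : forall n m, (n <= m)%nat ->
    snd (P m) <= snd (P n) /\ B (fst (P m) -v fst (P n)) (snd (P n) - snd (P m))).
  { intros n m Hnm. induction Hnm as [|m Hnm [IH1 IH2]].
    - split; [lra|]. rewrite Rminus_diag. apply (gbd_eq (gbd_zero B)). vec.
    - destruct (Hnext m (P m) (Ppos m)) as [H1 [H2 _]].
      change (next m (P m)) with (P (S m)) in *. assert (Q := Ppos m).
      split; [lra|]. eapply gbd_le; [exact (gbd_tri H2 IH2)|]. lra. }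
  assert (Phalf : forall n, snd (P n) <= (/ 2) ^ n).
  { induction n as [|n IH]; [simpl; lra|].
    destruct (Hnext n (P n) (Ppos n)) as [H1 _].
    change (next n (P n)) with (P (S n)) in *. simpl pow. lra. }
  destruct (Cm (fun n => fst (P n))) as [l Hl].
  { intros e He. destruct (half_pow_small He) as [N HN]. exists N.
    assert (Q : forall n m, (N <= n)%nat -> (n <= m)%nat -> B (fst (P m) -v fst (P n)) e).
    { intros n m Hn Hm. eapply gbd_le; [exact (proj2 (Pn n m Hm))|].
      assert (H1 := Ppos m). assert (H2 := Phalf n). assert (H3 := HN n Hn). lra. }
    intros n m Hn Hm. destruct (Nat.le_ge_cases n m) as [h|h].
    - now apply gbd_swap, Q.
    - now apply Q. }
  destruct (Lex l) as [r Lr].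
  destruct (INR_unbounded r) as [N HN].
  assert (L1 : L l (INR N)) by (apply (Lle _ _ _ Lr); lra).
  refine (proj2 (proj2 (Hnext N (P N) (Ppos N))) l _ L1).
  change (next N (P N)) with (P (S N)).
  apply gbd_eps. intros e He. destruct (Hl e He) as [M HM].
  assert (HM' := HM (Nat.max M (S N)) ltac:(lia)).
  eapply gbd_le; [exact (gbd_tri (gbd_swap HM') (proj2 (Pn (S N) (Nat.max M (S N)) ltac:(lia))))|].
  assert (H1 := Ppos (Nat.max M (S N))). lra. }
destruct Baire as [N [x0 [r [Hr Dense]]]].
assert (Dense0 : forall y, B y r -> forall e, 0 < e ->
  exists a, L a (INR N) /\ B (y -v a) e).
{ intros y Hy e He.
  destruct (Dense (x0 +v y) ltac:(apply (gbd_eq Hy); vec) e He) as [a [La Ha]].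
  destruct (Dense (x0 -v y) ltac:(apply (gbd_eq (gbd_opp Hy)); vec) e He) as [a' [La' Ha']].
  exists ((1/2) *v (a +v (-1) *v a')). split.
  - eapply Lle; [exact (Lscal _ _ _ (Ladd _ _ _ _ La (Lscal (-1) _ _ La')))|].
    rewrite (Rabs_left (-1)), (Rabs_pos_eq (1/2)) by lra. lra.
  - apply gbd_le with (1/2 * (e + e)); [|lra].
    apply (gbd_eq (gbd_scal_pos (c := 1/2) ltac:(lra) (gbd_sub Ha Ha'))). vec. }
assert (Dense1 : forall n y, B y (r * (/ 2) ^ n) ->
  exists a, L a (INR N * (/ 2) ^ n) /\ B (y -v a) (r * (/ 2) ^ S n)).
{ intros n y Hy. assert (P := half_pow_pos n).
  destruct (Dense0 ((/ (/ 2) ^ n) *v y)) with (e := r / 2) as [a [La Ha]].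
  - eapply gbd_le; [apply (gbd_scal_pos (c := / (/ 2) ^ n)); [|exact Hy]|].
    + left. now apply Rinv_0_lt_compat.
    + right. field. lra.
  - lra.
  - exists ((/ 2) ^ n *v a). split.
    + eapply Lle; [exact (Lscal _ _ _ La)|]. rewrite Rabs_pos_eq; lra.
    + apply gbd_le with ((/ 2) ^ n * (r / 2)); [|simpl; lra].
      apply (gbd_eq (gbd_scal_pos (c := (/ 2) ^ n) ltac:(lra) Ha)).
      vec_goal; repeat split; field; lra. }
assert (Ball : forall y, B y r -> L y (2 * INR N)).
{ intros y Hy.
  pose (a := fun n z => epsilon (inhabits (vzero : V))
    (fun a => L a (INR N * (/ 2) ^ n) /\ B (z -v a) (r * (/ 2) ^ S n))).
  pose (Z := fix Z n := match n with O => y | S m => Z m -v a m (Z m) end).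
  assert (HZ : forall n, B (Z n) (r * (/ 2) ^ n)).
  { induction n as [|n IH]; [simpl; now rewrite Rmult_1_r|].
    simpl Z. apply (epsilon_spec (inhabits (vzero : V)) (fun a => _ /\ _) (Dense1 n (Z n) IH)). }
  assert (Ha : forall n, L (a n (Z n)) (INR N * (/ 2) ^ n)).
  { intros n. apply (epsilon_spec (inhabits (vzero : V)) (fun a => _ /\ _)
      (Dense1 n (Z n) (HZ n))). }
  apply (Lsum (fun n => a n (Z n))); [exact Ha|].
  assert (HS : forall n, vsum (fun n => a n (Z n)) n = y -v Z n).
  { induction n as [|n IH]; [simpl; vec|]. simpl. rewrite IH. vec. }
  intros e He. destruct (half_pow_small (e := e / r)) as [M HM].
  { now apply Rdiv_lt_0_compat. }
  exists M. intros n Hn. rewrite HS.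
  apply gbd_le with (r * (/ 2) ^ n).
  - apply (gbd_eq (gbd_opp (HZ n))). vec.
  - apply Rle_trans with (r * (e / r)); [|right; field; lra].
    apply Rmult_le_compat_l; [lra|]. left. now apply HM. }
assert (PN := pos_INR N).
exists ((2 * INR N + 1) / r). split; [apply Rdiv_lt_0_compat; lra|].
intros x s Hs Hx.
assert (Q : L ((r / s) *v x) (2 * INR N)).
{ apply Ball. apply gbd_le with ((r / s) * s); [|right; field; lra].
  apply gbd_scal_pos; [|exact Hx]. left. now apply Rdiv_lt_0_compat. }
apply (Lscal (s / r)) in Q.
replace (s / r *v (r / s *v x)) with x in Q by vec.
eapply Lle; [exact Q|].
rewrite Rabs_pos_eq by (left; now apply Rdiv_lt_0_compat).
apply Rle_trans with (s / r * (2 * INR N + 1)); [|right; field; lra].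
apply Rmult_le_compat_l; [|lra]. left. now apply Rdiv_lt_0_compat.
Qed.

Lemma vsum_lin (T : V -> V) x n : real_linear T ->
  T (vsum x n) = vsum (fun n => T (x n)) n.
Proof.
intros L. induction n as [|n IH]; simpl; [now apply real_linear_0|].
now rewrite (proj1 L), IH.
Qed.

Lemma vsum_bound B (x : nat -> V) c n :
  (forall n, B (x n) (c * (/ 2) ^ n)) -> B (vsum x n) (2 * c).
Proof.
intros H. assert (Hc : 0 <= c).
{ assert (P := gbd_pos (H 0%nat)). simpl in P. lra. }
apply gbd_le with (2 * c * (/ 2) ^ 0); [|simpl; lra].
assert (Q : forall n, B (vsum x (S n) -v vsum x n) (c * (/ 2) ^ n)).
{ intros m. apply (gbd_eq (H m)). simpl. vec. }
apply (gbd_eq (geometric_tail Q (n := 0) (m := n) ltac:(lia))). simpl. vec.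
Qed.

Definition nmaps := @maps k V (norm_gauge V) (norm_gauge V).

Lemma uniform_boundedness (T : nat -> V -> V) : gcomplete (norm_gauge V) ->
  (forall n, real_linear (T n)) -> (forall n, exists C, nmaps (T n) C) ->
  (forall x, exists r, forall n, norm (T n x) <= r) ->
  exists C, 0 < C /\ forall n, nmaps (T n) C.
Proof.
intros Cm L M P.
destruct (@zabreiko (fun x r => forall n, norm_gauge V (T n x) r) Cm) as [C [HC Q]].
- exact P.
- intros x r s H Hrs n. exact (gbd_le (H n) Hrs).
- intros x y r s H H' n. rewrite (proj1 (L n)). now apply gbd_add.
- intros c x r H n. rewrite (proj2 (L n)). now apply gbd_scal.
- intros x s N H Hs n. apply gbd_eps. intros e He.
  destruct (M n) as [C HC].
  assert (PC : 0 < Rabs C + 1) by (assert (W := Rabs_pos C); lra).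
  destruct (Hs (e / (Rabs C + 1))) as [m Hm]; [now apply Rdiv_lt_0_compat|].
  assert (E1 : norm_gauge V (T n (vsum x m)) (2 * N)).
  { rewrite (vsum_lin _ _ (L n)). apply vsum_bound. intros j. apply H. }
  assert (E2 := HC _ _ (gbd_swap (Hm m (le_n m)))).
  apply gbd_le with (2 * N + C * (e / (Rabs C + 1))).
  + apply (gbd_eq (gbd_add E1 E2)). rewrite (real_linear_sub _ _ (L n)). vec.
  + assert (C <= Rabs C) by apply Rle_abs.
    assert (C * (e / (Rabs C + 1)) <= e); [|lra].
    apply Rle_trans with ((Rabs C + 1) * (e / (Rabs C + 1))); [|right; field; lra].
    apply Rmult_le_compat_r; [|lra]. left. now apply Rdiv_lt_0_compat.
- exists C. split; [exact HC|]. intros n x r Hx. apply gbd_eps. intros e He.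
  assert (He' : 0 < e / C) by now apply Rdiv_lt_0_compat.
  assert (Pr := gbd_pos Hx).
  apply (gbd_le (Q x (r + e / C) ltac:(lra) ltac:(change (norm x <= r) in Hx; lra) n)).
  right. field. lra.
Qed.

(** The closed graph theorem, where closedness of the graph comes from the
    boundedness of [T] on the ambient space. The relation [B (T x) r] is countably
    subadditive, because [B] is complete. *)
Lemma closed_graph B (T : V -> V) M C0 : gcomplete (norm_gauge V) -> gcomplete B ->
  (forall x r, B x r -> norm x <= C0 * r) ->
  real_linear T -> nmaps T M -> (forall x, exists r, B (T x) r) ->
  exists C, 0 < C /\ maps (norm_gauge V) B T C.
Proof.
intros Cm CB E L M0 P.
destruct (@zabreiko (fun x r => B (T x) r) Cm P) as [C [HC Q]].
- intros x r s H Hrs. exact (gbd_le H Hrs).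
- intros x y r s H H'. rewrite (proj1 L). now apply gbd_add.
- intros c x r H. rewrite (proj2 L). now apply gbd_scal.
- intros x s N H Hs.
  destruct (@geometric_limit B (vsum (fun n => T (x n))) N CB) as [l Hl].
  { intros n. apply (gbd_eq (H n)). simpl. vec. }
  assert (El : T s = l).
  { apply (@gbd_eq_eps _ _ (norm_gauge V)). intros e He.
    assert (PM : 0 < Rabs M + 1) by (assert (W := Rabs_pos M); lra).
    destruct (Hs (e / 2 / (Rabs M + 1))) as [m Hm]; [apply Rdiv_lt_0_compat; lra|].
    assert (PN : 0 <= N). { assert (W := gbd_pos (H 0%nat)). simpl in W. lra. }
    assert (PC : 0 < Rabs C0 + 1) by (assert (W := Rabs_pos C0); lra).
    assert (PCN : 0 < (Rabs C0 + 1) * (2 * N + 1)) by (apply Rmult_lt_0_compat; lra).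
    destruct (half_pow_small (e := e / 2 / ((Rabs C0 + 1) * (2 * N + 1)))) as [m' Hm'].
    { apply Rdiv_lt_0_compat; lra. }
    pose (n := Nat.max m m').
    assert (E1 := M0 _ _ (gbd_swap (Hm n ltac:(unfold n; lia)))).
    rewrite (real_linear_sub _ _ L), (vsum_lin _ _ L) in E1.
    assert (E2 : norm_gauge V (l -v vsum (fun n => T (x n)) n) (C0 * (2 * N * (/ 2) ^ n)))
      by (apply E, Hl).
    apply (gbd_le (gbd_tri E1 (gbd_swap E2))).
    assert (Hn := Hm' n ltac:(unfold n; lia)).
    assert (A1 : M * (e / 2 / (Rabs M + 1)) <= e / 2).
    { apply Rle_trans with ((Rabs M + 1) * (e / 2 / (Rabs M + 1))); [|right; field; lra].
      apply Rmult_le_compat_r; [left; apply Rdiv_lt_0_compat; lra|].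
      assert (W := Rle_abs M). lra. }
    assert (A2 : C0 * (2 * N * (/ 2) ^ n) <= e / 2).
    { assert (W := half_pow_pos n). assert (W' := Rle_abs C0).
      apply Rle_trans with ((Rabs C0 + 1) * ((2 * N + 1) * (/ 2) ^ n)).
      - apply Rle_trans with (Rabs C0 * (2 * N * (/ 2) ^ n)).
        + apply Rmult_le_compat_r; [|exact W']. apply Rmult_le_pos; lra.
        + apply Rmult_le_compat; [apply Rabs_pos|apply Rmult_le_pos; lra|lra|].
          apply Rmult_le_compat_r; lra.
      - rewrite <- Rmult_assoc.
        apply Rle_trans with ((Rabs C0 + 1) * (2 * N + 1) *
           (e / 2 / ((Rabs C0 + 1) * (2 * N + 1)))); [|right; field; lra].
        apply Rmult_le_compat_l; lra. }
    lra. }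
  rewrite El. assert (Q := Hl 0%nat). simpl in Q. rewrite Rmult_1_r in Q.
  apply (gbd_eq Q). vec.
- exists C. split; [exact HC|]. intros x r Hx. apply gbd_eps. intros e He.
  assert (He' : 0 < e / C) by now apply Rdiv_lt_0_compat.
  assert (Pr := gbd_pos Hx).
  apply (gbd_le (Q x (r + e / C) ltac:(lra) ltac:(change (norm x <= r) in Hx; lra))).
  right. field. lra.
Qed.

End Zabreiko.

(** * Embedded Banach spaces as complete gauges *)

Section BanachGauge.

Context {k : scalar_field} {V : NormedModule (Kring k)}.
Implicit Types X Y : banach_in V.

Lemma emb_plus X (x y : X) : emb (plus x y) = emb x +v emb y.
Proof. exact (linear_plus _ (emb_linear X) x y). Qed.

Lemma emb_scal X (c : R) (x : X) : emb (scal (RtoK k c) x) = c *v emb x.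
Proof. exact (linear_scal _ (emb_linear X) _ x). Qed.

Lemma emb_zero X : emb (zero : X) = vzero.
Proof.
rewrite <- (vscal0 (vzero : V)).
transitivity (emb (scal (RtoK k 0) (zero : X))).
- f_equal. symmetry. exact (scal_zero_r _).
- rewrite emb_scal. rewrite !vscal0. reflexivity.
Qed.

Lemma emb_minus X (x y : X) : emb (minus x y) = emb x -v emb y.
Proof.
transitivity (emb (plus x (scal (RtoK k (-1)) y))).
- f_equal. unfold minus. f_equal. symmetry.
  transitivity (scal (opp one : Kring k) y); [|exact (scal_opp_one y)].
  f_equal. destruct k; [reflexivity|exact (RtoC_opp 1)].
- rewrite emb_plus, emb_scal. vec.
Qed.

Lemma elt_emb X (x : X) : elt X (emb x) = x.
Proof.
apply emb_inj. unfold elt.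
apply (epsilon_spec (inhabits zero) (fun z : X => emb z = emb x)). now exists x.
Qed.

Lemma emb_elt X v : mem X v -> emb (elt X v) = v.
Proof. intros H. unfold elt. exact (epsilon_spec (inhabits zero) (fun z : X => emb z = v) H). Qed.

Definition bd X : gauge V.
Proof.
refine {| gbd := fun x r => exists z : X, emb z = x /\ norm z <= r |}.
- intros x r s [z [E H]] Hrs. exists z. split; [exact E|lra].
- intros x r [z [E H]]. assert (P := norm_ge_0 z). lra.
- exists zero. split; [apply emb_zero|right; exact norm_zero].
- intros x y r s [z [E H]] [w [E' H']]. exists (plus z w). split.
  + rewrite emb_plus. now f_equal.
  + eapply Rle_trans; [exact (norm_triangle z w)|lra].
- intros c x r [z [E H]]. exists (scal (RtoK k c) z). split.
  + rewrite emb_scal. now f_equal.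
  + eapply Rle_trans; [exact (norm_scal _ z)|]. rewrite abs_RtoK.
    apply Rmult_le_compat_l; [apply Rabs_pos|exact H].
- intros x r H. destruct (H 1 Rlt_0_1) as [z [E _]]. exists z. split; [exact E|].
  apply Rnot_lt_le. intros h.
  destruct (H ((norm z - r) / 2) ltac:(lra)) as [w [E' Hw]].
  replace w with z in Hw by (apply emb_inj; congruence). lra.
- intros x [z [E H]]. rewrite <- E, <- emb_zero with X. f_equal.
  assert (P := norm_ge_0 z). exact (norm_eq_zero (V := X) z ltac:(lra)).
Defined.

Lemma bd_emb X (x : X) r : bd X (emb x) r <-> norm x <= r.
Proof.
split; [intros [z [E H]]|intros H].
- now apply emb_inj in E as ->.
- now exists x.
Qed.

Lemma bd_mem X v r : bd X v r -> mem X v.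
Proof. intros [z [E _]]. now exists z. Qed.

Lemma bd_norm X v : mem X v -> bd X v (norm (elt X v)).
Proof. intros H. exists (elt X v). split; [now apply emb_elt|lra]. Qed.

Lemma norm_elt_le X v r : bd X v r -> norm (elt X v) <= r.
Proof. intros [z [<- H]]. now rewrite elt_emb. Qed.

Lemma complete_norm (K : AbsRing) (E : CompleteNormedModule K) (u : nat -> E) :
  (forall e, 0 < e -> exists N, forall n m, (N <= n)%nat -> (N <= m)%nat ->
     norm (minus (u n) (u m)) < e) ->
  exists l, forall e, 0 < e -> exists N, forall n, (N <= n)%nat -> norm (minus (u n) l) < e.
Proof.
intros Hu.
destruct (proj1 (@filterlim_locally_cauchy nat E eventually _ u)) as [l Hl].
- intros [e He]. destruct (Hu e He) as [N HN].
  exists (fun n => (N <= n)%nat). split; [now exists N|].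
  intros n m Hn Hm. refine (@norm_compat1 K E (u n) (u m) e _). now apply HN.
- exists l. intros e He.
  exact (proj1 (@filterlim_locally_ball_norm K nat E eventually _ u l) Hl (mkposreal e He)).
Qed.

Lemma bd_complete X : gcomplete (bd X).
Proof.
intros u Hu. destruct (Hu 1 Rlt_0_1) as [N0 HN0].
assert (M : forall n, (N0 <= n)%nat -> mem X (u n -v u N0)).
{ intros n Hn. apply (@bd_mem _ _ 1). apply HN0; lia. }
destruct (@complete_norm _ X (fun n => elt X (u (N0 + n)%nat -v u N0))) as [l Hl].
{ intros e He. destruct (Hu (e / 2) ltac:(lra)) as [N HN]. exists N. intros n m Hn Hm.
  apply Rle_lt_trans with (e / 2); [|lra].
  apply bd_emb. rewrite emb_minus, !emb_elt by (apply M; lia).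
  apply (gbd_eq (HN (N0 + n)%nat (N0 + m)%nat ltac:(lia) ltac:(lia))). vec. }
exists (u N0 +v emb l). intros e He. destruct (Hl e He) as [N HN].
exists (N0 + N)%nat. intros n Hn.
assert (Q := HN (n - N0)%nat ltac:(lia)).
replace (N0 + (n - N0))%nat with n in Q by lia.
apply Rlt_le, bd_emb in Q. rewrite emb_minus, emb_elt in Q by (apply M; lia).
apply (gbd_eq Q). vec.
Qed.

Lemma embedded_bd X Y : embedded X Y -> exists C, 0 < C /\ forall x r, bd X x r -> bd Y x (C * r).
Proof.
intros [C H]. exists (Rabs C + 1).
assert (P := Rabs_pos C). assert (Q := Rle_abs C). split; [lra|].
intros x r [z [<- Hz]]. destruct (H z) as [y [E Hy]]. exists y. split; [exact E|].
assert (Pz := norm_ge_0 z).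
apply Rle_trans with (C * norm z); [exact Hy|].
apply Rle_trans with (Rabs C * norm z); [now apply Rmult_le_compat_r|].
apply Rmult_le_compat; lra.
Qed.

Lemma bd_ambient X : exists C, 0 < C /\ forall x r, bd X x r -> norm_gauge V x (C * r).
Proof.
destruct (linear_norm _ (emb_linear X)) as [C [HC H]]. exists C. split; [exact HC|].
intros x r [z [<- Hz]]. eapply Rle_trans; [apply H|].
apply Rmult_le_compat_l; lra.
Qed.

End BanachGauge.

Lemma bd_whole k (E : CompleteNormedModule (Kring k)) (x : E) r :
  bd (whole E) x r <-> norm x <= r.
Proof.
split.
- intros [z [<- H]]. exact H.
- intros H. now exists x.
Qed.

(** * Existence of improper integrals *)

Section RealScalars.

Context {k : scalar_field} (E : CompleteNormedModule (Kring k)).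

Definition real_scal (r : R) (x : E) : E := scal (RtoK k r) x.

Lemma real_scal_assoc (a b : R) (x : E) : real_scal a (real_scal b x) = real_scal (a * b) x.
Proof. exact (vscalA (V := E) a b x). Qed.

Lemma real_scal_one (x : E) : real_scal 1 x = x.
Proof. exact (vscal1 (V := E) x). Qed.

Lemma real_scal_distr_l (a : R) (x y : E) :
  real_scal a (plus x y) = plus (real_scal a x) (real_scal a y).
Proof. exact (vscalDr (V := E) a x y). Qed.

Lemma real_scal_distr_r (a b : R) (x : E) :
  real_scal (a + b) x = plus (real_scal a x) (real_scal b x).
Proof. exact (vscalDl (V := E) a b x). Qed.

Definition real_ModuleSpace_mixin : ModuleSpace.mixin_of R_Ring E :=
  ModuleSpace.Mixin R_Ring E real_scal
    real_scal_assoc real_scal_one real_scal_distr_l real_scal_distr_r.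

Definition real_NormedModuleAux : NormedModuleAux R_AbsRing :=
  NormedModuleAux.Pack R_AbsRing E
    (NormedModuleAux.Class R_AbsRing E
      (ModuleSpace.Class R_Ring E (AbelianGroup.class E) real_ModuleSpace_mixin)
      (UniformSpace.class E)) E.

Lemma real_norm_scal (a : R) (x : E) : norm (real_scal a x) <= abs a * norm x.
Proof.
eapply Rle_trans; [exact (norm_scal (RtoK k a) x)|]. rewrite abs_RtoK.
right. reflexivity.
Qed.

Definition real_NormedModule_mixin : NormedModule.mixin_of R_AbsRing real_NormedModuleAux :=
  NormedModule.Mixin R_AbsRing real_NormedModuleAux (fun x : E => norm x)
    (norm_factor (V := E)) (@norm_triangle _ E) real_norm_scal
    (@norm_compat1 _ E) (@norm_compat2 _ E) (@norm_eq_zero _ E).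

(** Restriction of scalars, which makes Riemann integration of functions of a
    real variable available over either field. *)
Definition real_module : CompleteNormedModule R_AbsRing :=
  CompleteNormedModule.Pack R_AbsRing E
    (CompleteNormedModule.Class R_AbsRing E
      (NormedModule.Class R_AbsRing E
        (NormedModuleAux.class R_AbsRing real_NormedModuleAux) real_NormedModule_mixin)
      (CompleteNormedModule.mixin _ E (CompleteNormedModule.class _ E))) E.

End RealScalars.

Section Integration.

Context {k : scalar_field} {V : NormedModule (Kring k)}.
Implicit Types X : banach_in V.

Definition ioo (a b s : R) : Prop := a < s < b.

Lemma antiderivative X (g : R -> V) a b : a < b ->
  (forall t, a < t < b -> mem X (g t)) ->
  (forall t, a < t < b -> cont (bd X) g (ioo a b) t) ->
  exists G : R -> V, forall t, a < t < b -> forall e, 0 < e -> exists d, 0 < d /\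
    forall h, Rabs h < d -> bd X (G (t + h) -v G t -v h *v g t) (e * Rabs h).
Proof.
intros Hab Mg Cg.
pose (W := real_module X). pose (gX := fun s => elt X (g s) : W).
assert (CX : forall t, a < t < b -> continuous gX t).
{ intros t Ht.
  apply (proj2 (@filterlim_locally_ball_norm _ R W (locally t) _ gX (gX t))). intros e.
  destruct (Cg t Ht (e / 2)) as [d [Hd Q]].
  { assert (P := cond_pos e). lra. }
  pose (d' := Rmin d (Rmin (t - a) (b - t))).
  assert (Hd' : 0 < d') by (apply Rmin_glb_lt; [exact Hd|apply Rmin_glb_lt; lra]).
  exists (mkposreal d' Hd'). intros s Hs. change (Rabs (s - t) < d') in Hs.
  assert (M1 : d' <= d) by apply Rmin_l.
  assert (M2 : d' <= Rmin (t - a) (b - t)) by apply Rmin_r.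
  assert (M3 := Rmin_l (t - a) (b - t)). assert (M4 := Rmin_r (t - a) (b - t)).
  assert (Hs' := Rabs_def2 _ _ Hs).
  assert (Q' := Q s ltac:(unfold ioo; lra) ltac:(lra)).
  apply Rle_lt_trans with (e / 2); [|assert (P := cond_pos e); lra].
  apply (proj1 (@bd_emb _ _ X (minus (elt X (g s)) (elt X (g t))) _)).
  rewrite emb_minus, !emb_elt by (apply Mg; lra). exact Q'. }
pose (c := (a + b) / 2).
pose (GX := fun t => RInt gX c t : W).
exists (fun t => emb (GX t : X)). intros t Ht e He.
assert (D : is_derive GX t (gX t)).
{ apply (is_derive_RInt gX GX c t); [|now apply CX].
  assert (Hd : 0 < Rmin (t - a) (b - t)) by (apply Rmin_glb_lt; lra).
  exists (mkposreal _ Hd). intros s Hs. change (Rabs (s - t) < Rmin (t - a) (b - t)) in Hs.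
  assert (M3 := Rmin_l (t - a) (b - t)). assert (M4 := Rmin_r (t - a) (b - t)).
  apply Rabs_def2 in Hs.
  apply (RInt_correct (V := W)), ex_RInt_continuous. intros z Hz. apply CX.
  assert (a < Rmin c s) by (apply Rmin_glb_lt; unfold c; lra).
  assert (Rmax c s < b) by (apply Rmax_lub_lt; unfold c; lra). lra. }
destruct D as [_ D].
destruct (D t (fun P HP => HP) (mkposreal e He)) as [d Hd].
exists d. split; [apply cond_pos|]. intros h Hh.
assert (Q := Hd (t + h)).
assert (Hb : ball t d (t + h)).
{ change (Rabs (t + h - t) < d). now replace (t + h - t) with h by ring. }
specialize (Q Hb).
change (norm (minus (minus (GX (t + h) : X) (GX t : X)) (scal (RtoK k (t + h - t)) (gX t : X)))
  <= e * Rabs (t + h - t)) in Q.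
replace (t + h - t) with h in Q by ring.
apply bd_emb in Q. rewrite !emb_minus, emb_scal in Q.
apply (gbd_eq Q). unfold gX. rewrite emb_elt by now apply Mg. vec.
Qed.

(** A continuous integrand dominated by an integrable function is integrable:
    the increments of its antiderivative are dominated by those of [H], so it has
    limits at the endpoints. *)
Lemma int_exists X (g : R -> V) (H h : R -> R) a b : a < b ->
  (forall t, a < t < b -> cont (bd X) g (ioo a b) t) ->
  (forall t, a <= t <= b -> Rcont H (icc a b) t) ->
  (forall t, a < t < b -> is_derive H t (h t)) ->
  (forall t, a < t < b -> bd X (g t) (h t)) -> exists y, is_int (bd X) g a b y.
Proof.
intros Hab Cg CH DH Hg.
destruct (@antiderivative X g a b Hab) as [G0 D0]; [|exact Cg|].
{ intros t Ht. exact (bd_mem (Hg t Ht)). }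
assert (Incr : forall s t, a < s -> s <= t -> t < b -> bd X (G0 t -v G0 s) (H t - H s)).
{ intros s t Hs Hst Ht. apply (mean_value (h := h)); [exact Hst| | | |].
  - intros r Hr e He.
    assert (P := gbd_pos (Hg r ltac:(lra))).
    destruct (D0 r ltac:(lra) 1 Rlt_0_1) as [d [Hd Q]].
    exists (Rmin d (e / (1 + h r))). split.
    { apply Rmin_glb_lt; [exact Hd|]. apply Rdiv_lt_0_compat; lra. }
    intros r' _ Hr'.
    assert (M1 := Rmin_l d (e / (1 + h r))). assert (M2 := Rmin_r d (e / (1 + h r))).
    assert (Q' := gbd_add (Q (r' - r) ltac:(lra)) (gbd_scal (r' - r) (Hg r ltac:(lra)))).
    replace (r + (r' - r)) with r' in Q' by ring.
    apply gbd_le with ((1 + h r) * (e / (1 + h r))); [|right; field; lra].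
    apply gbd_le with ((1 + h r) * Rabs (r' - r)).
    + eapply gbd_eq; [eapply gbd_le; [exact Q'|right; ring]|vec].
    + apply Rmult_le_compat_l; lra.
  - intros r Hr e He. destruct (CH r ltac:(lra) e He) as [d [Hd Q]].
    exists d. split; [exact Hd|]. intros r' Hr' Hr''. apply Q; [unfold icc in *; lra|exact Hr''].
  - intros r Hr. apply DH. lra.
  - intros r Hr. exists (g r). split; [|apply Hg; lra].
    intros e He. destruct (D0 r ltac:(lra) e He) as [d [Hd Q]].
    exists d. split; [exact Hd|]. intros h' Hh'.
    assert (Q' := Q h' ltac:(rewrite Rabs_pos_eq; lra)). now rewrite Rabs_pos_eq in Q' by lra. }
assert (Lim : forall c, c = a \/ c = b -> exists l, forall e, 0 < e -> exists d, 0 < d /\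
   forall s, a < s < b -> Rabs (s - c) < d -> bd X (G0 s -v l) e).
{ intros c Hc.
  assert (Cc : Rcont H (icc a b) c) by (apply CH; destruct Hc; lra).
  assert (Cau : forall e, 0 < e -> exists d, 0 < d /\ forall s t, a < s < b -> a < t < b ->
    Rabs (s - c) < d -> Rabs (t - c) < d -> bd X (G0 s -v G0 t) e).
  { intros e He. destruct (Cc (e / 2) ltac:(lra)) as [d [Hd Q]].
    exists d. split; [exact Hd|]. intros s t Hs Ht Hsc Htc.
    assert (Q1 := Rabs_def2 _ _ (Q s ltac:(unfold icc; lra) Hsc)).
    assert (Q2 := Rabs_def2 _ _ (Q t ltac:(unfold icc; lra) Htc)).
    destruct (Rle_lt_dec s t) as [h'|h'].
    - apply gbd_swap. eapply gbd_le; [apply Incr; lra|]. lra.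
    - eapply gbd_le; [apply Incr; lra|]. lra. }
  pose (sn := fun n : nat => c + (a + b - 2 * c) * ((/ 2) * (/ 2) ^ n)).
  assert (Hsn : forall n, a < sn n < b /\ Rabs (sn n - c) <= (b - a) * (/ 2) ^ n).
  { intros n. assert (P1 := half_pow_pos n).
    assert (P2 : (/ 2) ^ n <= 1).
    { rewrite <- (pow1 n). apply pow_incr. lra. }
    unfold sn. destruct Hc as [-> | ->].
    - split; [nra|]. rewrite Rabs_pos_eq; nra.
    - split; [nra|]. rewrite Rabs_left1; nra. }
  assert (Small : forall d, 0 < d -> exists N, forall n, (N <= n)%nat -> Rabs (sn n - c) < d).
  { intros d Hd. destruct (half_pow_small (e := d / (b - a))) as [N HN].
    { apply Rdiv_lt_0_compat; lra. }
    exists N. intros n Hn. eapply Rle_lt_trans; [apply Hsn|].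
    apply Rlt_le_trans with ((b - a) * (d / (b - a))); [|right; field; lra].
    apply Rmult_lt_compat_l; [lra|]. now apply HN. }
  destruct (@bd_complete _ _ X (fun n => G0 (sn n))) as [l Hl].
  { intros e He. destruct (Cau e He) as [d [Hd Q]]. destruct (Small d Hd) as [N HN].
    exists N. intros n m Hn Hm. apply Q; try apply Hsn; now apply HN. }
  exists l. intros e He. destruct (Cau (e / 2) ltac:(lra)) as [d [Hd Q]].
  exists d. split; [exact Hd|]. intros s Hs Hsc.
  destruct (Small d Hd) as [N HN]. destruct (Hl (e / 2) ltac:(lra)) as [N' HN'].
  apply gbd_le with (e / 2 + e / 2); [|lra].
  apply (gbd_tri (y := G0 (sn (Nat.max N N')))).
  - apply Q; [exact Hs|apply Hsn|exact Hsc|apply HN; lia].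
  - apply HN'. lia. }
destruct (Lim a (or_introl eq_refl)) as [la Hla].
destruct (Lim b (or_intror eq_refl)) as [lb Hlb].
pose (G := fun t => if Rle_lt_dec t a then la else if Rle_lt_dec b t then lb else G0 t).
assert (Ga : G a = la) by (unfold G; destruct (Rle_lt_dec a a); [reflexivity|lra]).
assert (Gb : G b = lb).
{ unfold G. destruct (Rle_lt_dec b a); [lra|]. destruct (Rle_lt_dec b b); [reflexivity|lra]. }
assert (Gi : forall t, a < t < b -> G t = G0 t).
{ intros t Ht. unfold G. destruct (Rle_lt_dec t a); [lra|].
  destruct (Rle_lt_dec b t); [lra|reflexivity]. }
exists (G b -v G a). split; [lra|]. exists G. split; [|split; [|reflexivity]].
- intros t Ht e He. destruct (Req_dec t a) as [->|Na]; [|destruct (Req_dec t b) as [->|Nb]].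
  + destruct (Hla e He) as [d [Hd Q]]. exists (Rmin d (b - a)).
    split; [apply Rmin_glb_lt; lra|]. intros s Hs Hsa.
    assert (M1 := Rmin_l d (b - a)). assert (M2 := Rmin_r d (b - a)). unfold icc in Hs.
    rewrite Ga. destruct (Req_dec s a) as [->|Nsa].
    * rewrite Ga. eapply gbd_le; [apply (gbd_eq (gbd_zero (bd X))); vec|lra].
    * rewrite Rabs_pos_eq in Hsa by lra. rewrite Gi by lra. apply Q; [lra|].
      rewrite Rabs_pos_eq; lra.
  + destruct (Hlb e He) as [d [Hd Q]]. exists (Rmin d (b - a)).
    split; [apply Rmin_glb_lt; lra|]. intros s Hs Hsa.
    assert (M1 := Rmin_l d (b - a)). assert (M2 := Rmin_r d (b - a)). unfold icc in Hs.
    rewrite Gb. destruct (Req_dec s b) as [->|Nsb].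
    * rewrite Gb. eapply gbd_le; [apply (gbd_eq (gbd_zero (bd X))); vec|lra].
    * rewrite Rabs_left1 in Hsa by lra. rewrite Gi by lra. apply Q; [lra|].
      rewrite Rabs_left1; lra.
  + destruct (CH t Ht e He) as [d [Hd Q]].
    pose (d' := Rmin d (Rmin (t - a) (b - t) / 2)).
    assert (Hm : 0 < Rmin (t - a) (b - t)) by (apply Rmin_glb_lt; lra).
    exists d'. split; [apply Rmin_glb_lt; lra|]. intros s Hs Hst.
    assert (M1 : d' <= d) by apply Rmin_l.
    assert (M2 : d' <= Rmin (t - a) (b - t) / 2) by apply Rmin_r.
    assert (M3 := Rmin_l (t - a) (b - t)). assert (M4 := Rmin_r (t - a) (b - t)).
    assert (Q' := Rabs_def2 _ _ (Q s Hs ltac:(lra))).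
    apply Rabs_def2 in Hst. rewrite !Gi by lra.
    destruct (Rle_lt_dec s t) as [h'|h'].
    * apply gbd_swap. eapply gbd_le; [apply Incr; lra|]. lra.
    * eapply gbd_le; [apply Incr; lra|]. lra.
- intros t Ht e He. destruct (D0 t Ht e He) as [d [Hd Q]].
  exists (Rmin d (b - t)). split; [apply Rmin_glb_lt; lra|]. intros h' Hh'.
  assert (M1 := Rmin_l d (b - t)). assert (M2 := Rmin_r d (b - t)).
  rewrite !Gi by lra.
  assert (Q' := Q h' ltac:(rewrite Rabs_pos_eq; lra)). now rewrite Rabs_pos_eq in Q' by lra.
Qed.

End Integration.

(** * Power weights *)

Lemma Rpower_pos x a : 0 < Rpower x a.
Proof. apply exp_pos. Qed.

Lemma rpow_Rpower x a : 0 < x -> rpow x a = Rpower x a.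
Proof. intros H. unfold rpow. destruct (Rlt_dec 0 x); [reflexivity|contradiction]. Qed.

Lemma rpow_0 a : rpow 0 a = 0.
Proof. unfold rpow. destruct (Rlt_dec 0 0); [lra|reflexivity]. Qed.

Lemma rpow_ge0 x a : 0 <= rpow x a.
Proof. unfold rpow. destruct (Rlt_dec 0 x); [left; apply Rpower_pos|lra]. Qed.

Lemma rpow_le x y a : 0 < a -> x <= y -> rpow x a <= rpow y a.
Proof.
intros Ha H. unfold rpow at 1. destruct (Rlt_dec 0 x) as [h|h]; [|apply rpow_ge0].
rewrite rpow_Rpower by lra. apply Rle_Rpower_l; lra.
Qed.

Lemma Rpower_antitone x y a : 0 <= a -> 0 < x <= y -> Rpower y (- a) <= Rpower x (- a).
Proof.
intros Ha H. rewrite !Rpower_Ropp. apply Rinv_le_contravar; [apply Rpower_pos|].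
apply Rle_Rpower_l; lra.
Qed.

Lemma Rpower_lt_inv x e a : 0 < a -> 0 < e -> 0 < x -> x < Rpower e (/ a) -> Rpower x a < e.
Proof.
intros Ha He Hx H.
apply Rlt_le_trans with (Rpower (Rpower e (/ a)) a).
- apply Rlt_Rpower_l; lra.
- rewrite Rpower_mult, Rinv_l, Rpower_1 by lra. lra.
Qed.

Lemma rpow_small e a : 0 < a -> 0 < e -> exists d, 0 < d /\ forall x, x < d -> rpow x a < e.
Proof.
intros Ha He. exists (Rpower e (/ a)). split; [apply Rpower_pos|].
intros x Hx. unfold rpow. destruct (Rlt_dec 0 x); [|exact He].
now apply Rpower_lt_inv.
Qed.

Lemma is_derive_rpow x a : 0 < x -> is_derive (fun y => rpow y a) x (a * Rpower x (a - 1)).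
Proof.
intros Hx. apply is_derive_ext_loc with (fun y => Rpower y a).
- exists (mkposreal x Hx). intros y Hy. change (Rabs (y - x) < x) in Hy.
  apply Rabs_def2 in Hy. symmetry. apply rpow_Rpower. lra.
- apply is_derive_Reals. now apply derivable_pt_lim_power.
Qed.

(** The antiderivative of [x ^ (- p)] that vanishes at [0]; [rpow] makes it
    continuous there. *)
Definition weight (p x : R) : R := rpow x (1 - p) / (1 - p).

Lemma is_derive_weight p x : p < 1 -> 0 < x -> is_derive (weight p) x (Rpower x (- p)).
Proof.
intros Hp Hx.
replace (Rpower x (- p)) with (/ (1 - p) * ((1 - p) * Rpower x (1 - p - 1))).
- apply is_derive_ext with (fun y => / (1 - p) * rpow y (1 - p)).
  + intros y. unfold weight. apply Rmult_comm.
  + apply (is_derive_scal (fun y => rpow y (1 - p))). now apply is_derive_rpow.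
- replace (1 - p - 1) with (- p) by ring. field. lra.
Qed.

Lemma weight_0 p : weight p 0 = 0.
Proof. unfold weight. rewrite rpow_0. unfold Rdiv. ring. Qed.

Lemma weight_cont p x : p < 1 -> 0 <= x -> Rcont (weight p) (fun y => 0 <= y) x.
Proof.
intros Hp [Hx| <-].
- apply Rcont_continuous.
  apply (ex_derive_continuous (weight p)). eexists. now apply is_derive_weight.
- intros e He. destruct (@rpow_small (e * (1 - p)) (1 - p)) as [d [Hd Q]]; [lra|nra|].
  exists d. split; [exact Hd|]. intros s Hs H.
  rewrite weight_0. rewrite Rminus_0_r in *. rewrite Rabs_pos_eq in H by exact Hs.
  rewrite Rabs_pos_eq.
  + unfold weight. apply Rmult_lt_reg_r with (1 - p); [lra|].
    unfold Rdiv. rewrite Rmult_assoc, Rinv_l, Rmult_1_r by lra. now apply Q.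
  + apply Rmult_le_pos; [apply rpow_ge0|]. left. apply Rinv_0_lt_compat. lra.
Qed.

Definition beta_const (p q : R) : R := Rpower 2 p / (1 - q) + Rpower 2 q / (1 - p).

Lemma beta_const_pos p q : p < 1 -> q < 1 -> 0 < beta_const p q.
Proof.
intros Hp Hq. assert (P1 := Rpower_pos 2 p). assert (P2 := Rpower_pos 2 q).
apply Rplus_lt_0_compat; apply Rdiv_lt_0_compat; lra.
Qed.

(** In each half of the interval one of the two factors is at most its value at
    the midpoint; this turns the beta integrand into an explicit derivative. *)
Definition beta_major (p q a b s : R) : R :=
  Rpower ((b - a) / 2) (- p) * weight q (s - a)
  - Rpower ((b - a) / 2) (- q) * weight p (b - s).

Definition beta_deriv (p q a b s : R) : R :=
  Rpower ((b - a) / 2) (- p) * Rpower (s - a) (- q)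
  + Rpower ((b - a) / 2) (- q) * Rpower (b - s) (- p).

Lemma beta_pointwise p q a b s : 0 <= p -> 0 <= q -> a < s < b ->
  Rpower (b - s) (- p) * Rpower (s - a) (- q) <= beta_deriv p q a b s.
Proof.
intros Hp Hq Hs. unfold beta_deriv.
assert (P1 := Rpower_pos (b - s) (- p)). assert (P2 := Rpower_pos (s - a) (- q)).
assert (P3 := Rpower_pos ((b - a) / 2) (- p)). assert (P4 := Rpower_pos ((b - a) / 2) (- q)).
destruct (Rle_lt_dec s ((a + b) / 2)) as [h|h].
- assert (Q : Rpower (b - s) (- p) <= Rpower ((b - a) / 2) (- p)).
  { apply Rpower_antitone; lra. }
  nra.
- assert (Q : Rpower (s - a) (- q) <= Rpower ((b - a) / 2) (- q)).
  { apply Rpower_antitone; lra. }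
  nra.
Qed.

Lemma beta_major_derive p q a b s : p < 1 -> q < 1 -> a < s < b ->
  is_derive (beta_major p q a b) s (beta_deriv p q a b s).
Proof.
intros Hp Hq Hs. unfold beta_major, beta_deriv.
replace (Rpower ((b - a) / 2) (- p) * Rpower (s - a) (- q)
  + Rpower ((b - a) / 2) (- q) * Rpower (b - s) (- p))
  with (minus (Rpower ((b - a) / 2) (- p) * (1 * Rpower (s - a) (- q)))
    (Rpower ((b - a) / 2) (- q) * ((-1) * Rpower (b - s) (- p)))).
- apply (is_derive_minus (V := R_NormedModule)).
  + apply (is_derive_scal (fun s => weight q (s - a))).
    apply (is_derive_comp (weight q) (fun s => s - a)).
    * apply is_derive_weight; lra.
    * auto_derive; [exact I|ring].
  + apply (is_derive_scal (fun s => weight p (b - s))).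
    apply (is_derive_comp (weight p) (fun s => b - s)).
    * apply is_derive_weight; lra.
    * auto_derive; [exact I|ring].
- change minus with Rminus. unfold minus, plus, opp. simpl. ring.
Qed.

Lemma beta_major_cont p q a b s : p < 1 -> q < 1 -> a <= s <= b ->
  Rcont (beta_major p q a b) (icc a b) s.
Proof.
intros Hp Hq Hs e He.
assert (P3 := Rpower_pos ((b - a) / 2) (- p)). assert (P4 := Rpower_pos ((b - a) / 2) (- q)).
set (c := Rpower ((b - a) / 2) (- p)) in *. set (c' := Rpower ((b - a) / 2) (- q)) in *.
destruct (@weight_cont q (s - a) Hq ltac:(lra) (e / (2 * c))) as [d1 [Hd1 Q1]].
{ apply Rdiv_lt_0_compat; lra. }
destruct (@weight_cont p (b - s) Hp ltac:(lra) (e / (2 * c'))) as [d2 [Hd2 Q2]].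
{ apply Rdiv_lt_0_compat; lra. }
exists (Rmin d1 d2). split; [now apply Rmin_glb_lt|]. intros r Hr Hrs.
assert (M1 := Rmin_l d1 d2). assert (M2 := Rmin_r d1 d2). unfold icc in Hr.
assert (E1 := Q1 (r - a) ltac:(lra) ltac:(replace (r - a - (s - a)) with (r - s) by ring; lra)).
assert (E2 := Q2 (b - r) ltac:(lra)
  ltac:(replace (b - r - (b - s)) with (- (r - s)) by ring; rewrite Rabs_Ropp; lra)).
apply Rabs_def2 in E1. apply Rabs_def2 in E2. unfold beta_major.
fold c. fold c'.
assert (F1 : c * (e / (2 * c)) = e / 2) by (field; lra).
assert (F2 : c' * (e / (2 * c')) = e / 2) by (field; lra).
assert (G1 := Rmult_lt_compat_l _ _ _ P3 (proj1 E1)).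
assert (G2 := Rmult_lt_compat_l _ _ _ P3 (proj2 E1)).
assert (G3 := Rmult_lt_compat_l _ _ _ P4 (proj1 E2)).
assert (G4 := Rmult_lt_compat_l _ _ _ P4 (proj2 E2)).
apply Rabs_def1; nra.
Qed.

Lemma beta_major_total p q a b : a < b ->
  beta_major p q a b b - beta_major p q a b a = beta_const p q * Rpower (b - a) (1 - p - q).
Proof.
intros Hab. unfold beta_major, beta_const. rewrite !Rminus_diag, !weight_0.
unfold weight. rewrite !rpow_Rpower by lra.
assert (E : forall u v, Rpower ((b - a) / 2) (- u) * Rpower (b - a) (1 - v)
  = Rpower 2 u * Rpower (b - a) (1 - u - v)).
{ intros u v. replace (1 - u - v) with (- u + (1 - v)) by ring. rewrite Rpower_plus.
  rewrite <- Rmult_assoc. f_equal. unfold Rpower. rewrite <- exp_plus. f_equal.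
  unfold Rdiv. rewrite ln_mult by lra. rewrite ln_Rinv by lra. ring. }
assert (E1 := E p q). assert (E2 := E q p).
replace (1 - q - p) with (1 - p - q) in E2 by ring.
unfold Rdiv in *.
transitivity (Rpower ((b - a) * / 2) (- p) * Rpower (b - a) (1 - q) * / (1 - q)
  + Rpower ((b - a) * / 2) (- q) * Rpower (b - a) (1 - p) * / (1 - p)); [ring|].
rewrite E1, E2. ring.
Qed.

Section BetaIntegral.

Context {k : scalar_field} {V : NormedModule (Kring k)}.
Context (g : R -> V) (a b p q K : R).

Lemma Rcont_scal (c : R) (H : R -> R) D t : Rcont H D t -> Rcont (fun s => c * H s) D t.
Proof.
intros C e He. destruct (C (e / (Rabs c + 1))) as [d [Hd Q]].
{ assert (P := Rabs_pos c). apply Rdiv_lt_0_compat; lra. }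
exists d. split; [exact Hd|]. intros s Ds Hs. assert (Q' := Q s Ds Hs).
rewrite <- Rmult_minus_distr_l, Rabs_mult.
assert (P := Rabs_pos c). assert (P' := Rabs_pos (H s - H t)).
apply Rle_lt_trans with ((Rabs c) * (e / (Rabs c + 1))); [apply Rmult_le_compat_l; lra|].
apply Rlt_le_trans with ((Rabs c + 1) * (e / (Rabs c + 1))); [|right; field; lra].
apply Rmult_lt_compat_r; [|lra]. apply Rdiv_lt_0_compat; lra.
Qed.

Context (Hab : a < b) (Hp : 0 <= p < 1) (Hq : 0 <= q < 1) (HK : 0 <= K).

Lemma int_beta_bound (B : gauge V) y : is_int B g a b y ->
  (forall s, a < s < b -> B (g s) (K * (Rpower (b - s) (- p) * Rpower (s - a) (- q)))) ->
  B y (K * beta_const p q * Rpower (b - a) (1 - p - q)).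
Proof using Hab Hp Hq HK.
intros I Hg.
replace (K * beta_const p q * Rpower (b - a) (1 - p - q))
  with (K * beta_major p q a b b - K * beta_major p q a b a)
  by (rewrite <- Rmult_minus_distr_l, beta_major_total by exact Hab; ring).
apply (int_bound (h := fun s => K * beta_deriv p q a b s)
  (H := fun s => K * beta_major p q a b s) I).
- intros t Ht. apply Rcont_scal, beta_major_cont; lra.
- intros t Ht. apply (is_derive_scal (beta_major p q a b)). apply beta_major_derive; lra.
- intros t Ht. apply (gbd_le (Hg t Ht)).
  apply Rmult_le_compat_l; [exact HK|]. apply beta_pointwise; lra.
Qed.

Lemma int_beta_exists (X : banach_in V) :
  (forall s, a < s < b -> cont (bd X) g (ioo a b) s) ->
  (forall s, a < s < b -> bd X (g s) (K * (Rpower (b - s) (- p) * Rpower (s - a) (- q)))) ->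
  exists y, is_int (bd X) g a b y.
Proof using Hab Hp Hq HK.
intros Cg Hg.
apply (@int_exists _ _ X g (fun s => K * beta_major p q a b s)
  (fun s => K * beta_deriv p q a b s)); try assumption.
- intros t Ht. apply Rcont_scal, beta_major_cont; lra.
- intros t Ht. apply (is_derive_scal (beta_major p q a b)). apply beta_major_derive; lra.
- intros t Ht. apply (gbd_le (Hg t Ht)).
  apply Rmult_le_compat_l; [exact HK|]. apply beta_pointwise; lra.
Qed.

End BetaIntegral.

(** * Cauchy's estimate *)

Section Cauchy.

Context {X : NormedModule (Kring complex_scalars)}.
Implicit Types (f : C -> X) (x y : X) (z w : C).

Definition cmul (z : C) (x : X) : X := scal (z : Kring complex_scalars) x.
Let B := norm_gauge X.

Lemma cmul_real_linear z : real_linear (cmul z).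
Proof.
split.
- intros x y. exact (scal_distr_l (z : Kring complex_scalars) x y).
- intros c x. unfold cmul, vscal.
  transitivity (scal (mult (z : Kring complex_scalars) (RtoC c)) x).
  + exact (scal_assoc (z : Kring complex_scalars) (RtoC c) x).
  + transitivity (scal (mult (RtoC c) (z : Kring complex_scalars)) x).
    * f_equal. exact (Cmult_comm z (RtoC c)).
    * symmetry. exact (scal_assoc (RtoC c) (z : Kring complex_scalars) x).
Qed.

Lemma cmul_mul z w x : cmul z (cmul w x) = cmul (z * w)%C x.
Proof. exact (scal_assoc (z : Kring complex_scalars) w x). Qed.

Lemma cmul_add z w x : cmul (z + w)%C x = cmul z x +v cmul w x.
Proof. exact (scal_distr_r (z : Kring complex_scalars) w x). Qed.

Lemma cmul_R (r : R) x : cmul (RtoC r) x = r *v x.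
Proof. reflexivity. Qed.

Lemma cmul_sub z w x : cmul (z - w)%C x = cmul z x -v cmul w x.
Proof.
assert (E : cmul z x = cmul (z - w)%C x +v cmul w x).
{ rewrite <- cmul_add. f_equal. ring. }
rewrite E. vec.
Qed.

Lemma cmul_maps z : maps B B (cmul z) (Cmod z).
Proof.
intros x r H. change (norm x <= r) in H.
change (norm (scal (z : Kring complex_scalars) x) <= Cmod z * r).
eapply Rle_trans; [exact (norm_scal (z : Kring complex_scalars) x)|].
apply Rmult_le_compat_l; [apply Cmod_ge_0|exact H].
Qed.

Lemma cmul_cancel z x r : z <> RtoC 0 -> B (cmul z x) (Cmod z * r) -> B x r.
Proof.
intros Hz H. assert (P : 0 < Cmod z) by now apply Cmod_gt_0.
apply (cmul_maps (/ z)%C) in H. rewrite cmul_mul in H.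
replace (/ z * z)%C with (RtoC 1) in H by (field; exact Hz).
rewrite cmul_R, vscal1 in H. rewrite Cmod_inv in H by exact Hz.
apply (gbd_le H). right. field. lra.
Qed.

Definition complex_der f z x : Prop :=
  forall e, 0 < e -> exists d, 0 < d /\ forall h : C, Cmod h < d ->
    B (f (z + h)%C -v f z -v cmul h x) (e * Cmod h).

Lemma complex_der_path f u v (s : R) x : complex_der f (u + RtoC s * v)%C x ->
  rder B (fun s => f (u + RtoC s * v)%C) s (cmul v x).
Proof.
intros D e He. assert (Pv := Cmod_ge_0 v).
destruct (D (e / (Cmod v + 1))) as [d [Hd Q]]; [apply Rdiv_lt_0_compat; lra|].
exists (d / (Cmod v + 1)). split; [apply Rdiv_lt_0_compat; lra|]. intros h Hh.
assert (Em : Cmod (RtoC h * v) = h * Cmod v).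
{ rewrite Cmod_mult, Cmod_R, Rabs_pos_eq; lra. }
assert (Q' := Q (RtoC h * v)%C).
rewrite Em in Q'.
assert (P1 : h * Cmod v < d).
{ apply Rle_lt_trans with (h * (Cmod v + 1)); [apply Rmult_le_compat_l; lra|].
  apply Rlt_le_trans with (d / (Cmod v + 1) * (Cmod v + 1)); [|right; field; lra].
  apply Rmult_lt_compat_r; lra. }
specialize (Q' P1).
replace (u + RtoC (s + h) * v)%C with (u + RtoC s * v + RtoC h * v)%C
  by (rewrite RtoC_plus; ring).
replace (cmul (RtoC h * v)%C x) with (h *v cmul v x) in Q' by now rewrite <- cmul_R, cmul_mul.
apply (gbd_le Q').
apply Rle_trans with (e / (Cmod v + 1) * (h * (Cmod v + 1))); [|right; field; lra].
apply Rmult_le_compat_l; [left; apply Rdiv_lt_0_compat; lra|]. lra.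
Qed.

Lemma complex_der_cont f u v (s : R) x D : complex_der f (u + RtoC s * v)%C x ->
  cont B (fun s => f (u + RtoC s * v)%C) D s.
Proof.
intros Df e He. assert (Pv := Cmod_ge_0 v). assert (Px := norm_ge_0 x).
destruct (Df 1 Rlt_0_1) as [d [Hd Q]].
pose (c := (Cmod v + 1) * (1 + norm x)).
assert (Hc : 0 < c) by (apply Rmult_lt_0_compat; lra).
exists (Rmin (d / (Cmod v + 1)) (e / c)).
split; [apply Rmin_glb_lt; apply Rdiv_lt_0_compat; lra|]. intros r _ Hr.
assert (M1 := Rmin_l (d / (Cmod v + 1)) (e / c)).
assert (M2 := Rmin_r (d / (Cmod v + 1)) (e / c)).
assert (Pa := Rabs_pos (r - s)).
assert (Em : Cmod (RtoC (r - s) * v) = Rabs (r - s) * Cmod v) by now rewrite Cmod_mult, Cmod_R.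
assert (Q' := Q (RtoC (r - s) * v)%C). rewrite Em in Q'.
assert (P1 : Rabs (r - s) * Cmod v < d).
{ apply Rle_lt_trans with (Rabs (r - s) * (Cmod v + 1)); [apply Rmult_le_compat_l; lra|].
  apply Rlt_le_trans with (d / (Cmod v + 1) * (Cmod v + 1)); [|right; field; lra].
  apply Rmult_lt_compat_r; lra. }
specialize (Q' P1).
replace (u + RtoC s * v + RtoC (r - s) * v)%C with (u + RtoC r * v)%C in Q'
  by (rewrite RtoC_minus; ring).
assert (Bx : B x (norm x)) by apply Rle_refl.
assert (Q2 := gbd_add Q' (cmul_maps (RtoC (r - s) * v)%C Bx)).
rewrite Em in Q2.
apply gbd_le with (c * (e / c)); [|right; field; lra].
apply gbd_le with (c * Rabs (r - s)); [|apply Rmult_le_compat_l; lra].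
eapply gbd_eq; [eapply gbd_le; [exact Q2|]|vec].
replace (c * Rabs (r - s)) with (Rabs (r - s) * (Cmod v + 1) * (1 + norm x)) by (unfold c; ring).
replace (1 * (Rabs (r - s) * Cmod v) + Rabs (r - s) * Cmod v * norm x)
  with (Rabs (r - s) * Cmod v * (1 + norm x)) by ring.
apply Rmult_le_compat_r; [lra|]. apply Rmult_le_compat_l; lra.
Qed.

Lemma disc_convex u v (s : R) r : Cmod u <= r -> Cmod v <= r -> 0 <= s <= 1 ->
  Cmod (u + RtoC s * (v - u))%C <= r.
Proof.
intros Hu Hv Hs.
replace (u + RtoC s * (v - u))%C with (RtoC (1 - s) * u + RtoC s * v)%C
  by (rewrite RtoC_minus; ring).
eapply Rle_trans; [apply Cmod_triangle|].
rewrite !Cmod_mult, !Cmod_R, !Rabs_pos_eq by lra. nra.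
Qed.

Lemma complex_der_lipschitz f f' r K : (forall z, Cmod z <= r -> complex_der f z (f' z)) ->
  (forall z, Cmod z <= r -> B (f' z) K) -> forall u v, Cmod u <= r -> Cmod v <= r ->
  B (f v -v f u) (Cmod (v - u)%C * K).
Proof.
intros D Hf u v Hu Hv.
assert (Q : B (f (u + RtoC 1 * (v - u))%C -v f (u + RtoC 0 * (v - u))%C)
  (Cmod (v - u)%C * K * (1 - 0))).
{ apply (mean_value_const (p := fun s => f (u + RtoC s * (v - u))%C)); [lra| |].
  - intros t Ht. eapply complex_der_cont. apply D. now apply disc_convex.
  - intros t Ht. exists (cmul (v - u)%C (f' (u + RtoC t * (v - u))%C)). split.
    + apply complex_der_path, D. apply disc_convex; lra.
    + apply cmul_maps, Hf. apply disc_convex; lra. }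
replace (u + RtoC 1 * (v - u))%C with v in Q by ring.
replace (u + RtoC 0 * (v - u))%C with u in Q by ring.
apply (gbd_le Q). lra.
Qed.

Lemma complex_der_taylor f f' f'' r K : (forall z, Cmod z <= r -> complex_der f z (f' z)) ->
  (forall z, Cmod z <= r -> complex_der f' z (f'' z)) ->
  (forall z, Cmod z <= r -> B (f'' z) K) -> forall u v, Cmod u <= r -> Cmod v <= r ->
  B (f v -v f u -v cmul (v - u)%C (f' u)) (Cmod (v - u)%C * (Cmod (v - u)%C * K)).
Proof.
intros D D' Hf u v Hu Hv. set (w := (v - u)%C).
assert (L := complex_der_lipschitz D' Hf).
assert (HK : 0 <= K) by exact (gbd_pos (Hf u Hu)).
pose (p := fun s : R => f (u + RtoC s * w)%C -v s *v cmul w (f' u)).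
assert (Q : B (p 1 -v p 0) (Cmod w * (Cmod w * K) * (1 - 0))).
{ apply mean_value_const; [lra| |].
  - intros t Ht. apply cont_minus.
    + eapply complex_der_cont. apply D. now apply disc_convex.
    + apply cont_id with (norm (cmul w (f' u))). apply Rle_refl.
  - intros t Ht.
    exists (cmul w (f' (u + RtoC t * w)%C) -v cmul w (f' u)). split.
    + apply rder_minus.
      * apply complex_der_path, D. apply disc_convex; lra.
      * apply rder_id.
    + rewrite <- (real_linear_sub _ _ (cmul_real_linear w)). apply cmul_maps.
      eapply gbd_le; [apply L; [exact Hu|apply disc_convex; lra]|].
      replace (u + RtoC t * w - u)%C with (RtoC t * w)%C by ring.
      rewrite Cmod_mult, Cmod_R, Rabs_pos_eq by lra.
      apply Rmult_le_compat_r; [exact HK|]. assert (P := Cmod_ge_0 w). nra. }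
apply (gbd_le (s := Cmod w * (Cmod w * K))) in Q; [|lra].
apply (gbd_eq Q). unfold p.
replace (u + RtoC 1 * w)%C with v by (unfold w; ring).
replace (u + RtoC 0 * w)%C with u by ring. vec.
Qed.

Definition cis (a : R) : C := (cos a, sin a).

Lemma cis_add a b : cis (a + b) = (cis a * cis b)%C.
Proof.
unfold cis. apply injective_projections; simpl; [apply cos_plus|].
rewrite sin_plus. ring.
Qed.

Lemma Cmod_cis a : Cmod (cis a) = 1.
Proof.
unfold Cmod, cis. simpl. transitivity (sqrt 1); [f_equal|apply sqrt_1].
assert (H := sin2_cos2 a). unfold Rsqr in H. lra.
Qed.

Lemma cis_1_dist a : 0 < a < PI -> 0 < Cmod (cis a - RtoC 1)%C <= 2 * a.
Proof.
intros Ha.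
assert (Hs : 0 < sin (a / 2)) by (apply sin_gt_0; lra).
assert (Hs' := sin_lt_x (a / 2) ltac:(lra)).
assert (E : Cmod (cis a - RtoC 1)%C = 2 * sin (a / 2)).
{ unfold Cmod, cis. simpl. rewrite <- (sqrt_Rsqr (2 * sin (a / 2))) by lra. f_equal.
  assert (H1 : cos a = 1 - 2 * sin (a / 2) * sin (a / 2)).
  { rewrite <- cos_2a_sin. f_equal. lra. }
  assert (H := sin2_cos2 a). unfold Rsqr in *. nra. }
rewrite E. lra.
Qed.

Lemma vsum_telescope (a : nat -> X) n :
  vsum (fun j => a (S j) -v a j) n = a n -v a 0%nat.
Proof. induction n as [|n IH]; cbn [vsum]; [vec|]. rewrite IH. vec. Qed.

Lemma vsum_ext (a b : nat -> X) n : (forall j, a j = b j) -> vsum a n = vsum b n.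
Proof. intros E. induction n as [|n IH]; cbn [vsum]; [reflexivity|]. now rewrite IH, E. Qed.

Lemma vsum_sub (a b : nat -> X) n : vsum (fun j => a j -v b j) n = vsum a n -v vsum b n.
Proof. induction n as [|n IH]; cbn [vsum]; [vec|]. rewrite IH. vec. Qed.

Lemma vsum_const x n : vsum (fun _ => x) n = INR n *v x.
Proof.
induction n as [|n IH]; [cbn [vsum INR]; vec|].
cbn [vsum]. rewrite IH, S_INR. vec.
Qed.

Lemma vsum_unif (a : nat -> X) c n : (forall j, B (a j) c) -> B (vsum a n) (INR n * c).
Proof.
intros H. induction n as [|n IH]; [cbn [vsum INR]; rewrite Rmult_0_l; apply gbd_zero|].
cbn [vsum]. rewrite S_INR. apply (gbd_le (gbd_add IH (H n))). lra.
Qed.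

Lemma vsum_cont (a : nat -> R -> X) D t n : (forall j, cont B (a j) D t) ->
  cont B (fun s => vsum (fun j => a j s) n) D t.
Proof.
intros H. induction n as [|n IH]; cbn [vsum]; [apply cont_const|]. now apply cont_add.
Qed.

Lemma vsum_rder (a : nat -> R -> X) (l : nat -> X) t n : (forall j, rder B (a j) t (l j)) ->
  rder B (fun s => vsum (fun j => a j s) n) t (vsum l n).
Proof.
intros H. induction n as [|n IH]; cbn [vsum]; [apply rder_const|]. now apply rder_add.
Qed.

(** Cauchy's estimate for the derivative at the centre of a disc. The Cauchy
    integral is replaced by the average over the [N]-th roots of unity: by
    telescoping around the polygon that average differs from its limit by
    [O(1/N)] when three derivatives are bounded, and all that remains are mean
    value inequalities. *)
Lemma cauchy_estimate (f0 f1 f2 f3 : C -> X) r M K : 0 < r ->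
  (forall z, Cmod z <= r -> complex_der f0 z (f1 z)) ->
  (forall z, Cmod z <= r -> complex_der f1 z (f2 z)) ->
  (forall z, Cmod z <= r -> complex_der f2 z (f3 z)) ->
  (forall z, Cmod z <= r -> B (f3 z) K) ->
  (forall z, Cmod z <= r -> B (f0 z) M) ->
  B (f1 (RtoC 0)) (M / r).
Proof.
intros Hr D0 D1 D2 H3 H0.
assert (L2 := complex_der_lipschitz D2 H3). assert (T1 := complex_der_taylor D1 D2 H3).
assert (HK : 0 <= K) by (apply (gbd_pos (H3 (RtoC 0) ltac:(rewrite Cmod_0; lra)))).
apply gbd_unscal with r; [exact Hr|].
replace (r * (M / r)) with M by (field; lra).
apply gbd_eps. intros e He.
(* The number of nodes, large enough for the error of the polygon. *)
destruct (INR_unbounded (4 * PI * (K * (r * (r * r))) / e + 3)) as [N HN].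
assert (PI0 := PI_RGT_0).
assert (Hc : 0 <= K * (r * (r * r))).
{ apply Rmult_le_pos; [exact HK|]. apply Rmult_le_pos; [lra|apply Rmult_le_pos; lra]. }
assert (Hc4 : 0 <= 4 * PI * (K * (r * (r * r))) / e).
{ apply Rmult_le_pos; [apply Rmult_le_pos; lra|]. left. now apply Rinv_0_lt_compat. }
assert (N3 : 3 < INR N) by lra.
pose (th := 2 * PI / INR N).
assert (Hth : 0 < th < PI).
{ split; [apply Rdiv_lt_0_compat; lra|].
  apply Rmult_lt_reg_r with (INR N); [lra|]. unfold th.
  replace (2 * PI / INR N * INR N) with (2 * PI) by (field; lra). nra. }
destruct (cis_1_dist Hth) as [Q0 Q1]. set (q := Cmod (cis th - RtoC 1)%C) in *.
assert (Hq : K * (r * (r * r)) * q <= e).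
{ apply Rle_trans with (K * (r * (r * r)) * (2 * th)); [apply Rmult_le_compat_l; lra|].
  unfold th. apply Rmult_le_reg_r with (INR N / e); [apply Rdiv_lt_0_compat; lra|].
  replace (e * (INR N / e)) with (INR N) by (field; lra).
  replace (K * (r * (r * r)) * (2 * (2 * PI / INR N)) * (INR N / e))
    with (4 * PI * (K * (r * (r * r))) / e) by (field; lra). lra. }
pose (om := fun j : nat => cis (INR j * th)).
pose (om' := fun j : nat => cis (- (INR j * th))).
assert (om_S : forall j, om (S j) = (om j * cis th)%C).
{ intros j. unfold om. rewrite S_INR, <- cis_add. f_equal. ring. }
assert (om'_S : forall j, (om' (S j) * cis th = om' j)%C).
{ intros j. unfold om'. rewrite S_INR, <- cis_add. f_equal. ring. }
assert (om_om' : forall j, (om' j * om j = RtoC 1)%C).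
{ intros j. unfold om, om'. rewrite <- cis_add. replace (- (INR j * th) + INR j * th) with 0 by ring.
  unfold cis. now rewrite cos_0, sin_0. }
assert (om_0 : om 0%nat = RtoC 1).
{ unfold om, cis. simpl. now rewrite Rmult_0_l, cos_0, sin_0. }
assert (om_N : om N = RtoC 1).
{ unfold om, th. replace (INR N * (2 * PI / INR N)) with (2 * PI) by (field; lra).
  unfold cis. now rewrite cos_2PI, sin_2PI. }
assert (om'_per : om' N = om' 0%nat).
{ transitivity (om' N * om N)%C; [rewrite om_N; ring|]. rewrite om_om'.
  rewrite <- (om_om' 0%nat), om_0. ring. }
assert (Mom : forall j, Cmod (om j) = 1) by (intros; apply Cmod_cis).
assert (Mom' : forall j, Cmod (om' j) = 1) by (intros; apply Cmod_cis).
assert (Disc : forall s j, 0 <= s <= r -> Cmod (RtoC 0 + RtoC s * om j)%C <= r).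
{ intros s j Hs. rewrite Cplus_0_l, Cmod_mult, Cmod_R, Mom, Rabs_pos_eq; lra. }
assert (Hom : (cis th - RtoC 1)%C <> RtoC 0).
{ intros E. unfold q in Q0. rewrite E, Cmod_0 in Q0. lra. }
pose (H := fun s => vsum (fun j => f1 (RtoC 0 + RtoC s * om j)%C) N).
pose (H' := fun s => vsum (fun j => cmul (om j) (f2 (RtoC 0 + RtoC s * om j)%C)) N).
(* The average of [f1] over the polygon is almost independent of its radius. *)
assert (HH' : forall s, 0 < s < r -> B (H' s) (INR N * (K * r * q))).
{ intros s Hs.
  assert (Tel : vsum (fun j => f1 (RtoC 0 + RtoC s * om (S j))%C
     -v f1 (RtoC 0 + RtoC s * om j)%C) N = vzero).
  { rewrite (vsum_telescope (fun j => f1 (RtoC 0 + RtoC s * om j)%C)).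
    rewrite om_N, om_0. vec. }
  pose (c := (RtoC s * (cis th - RtoC 1))%C).
  assert (Mc : Cmod c = s * q).
  { unfold c. rewrite Cmod_mult, Cmod_R, Rabs_pos_eq by lra. reflexivity. }
  assert (Hc0 : c <> RtoC 0).
  { intros E. rewrite E, Cmod_0 in Mc. assert (0 < s * q) by (apply Rmult_lt_0_compat; lra). lra. }
  assert (Bd : B (vsum (fun j => f1 (RtoC 0 + RtoC s * om (S j))%C
     -v f1 (RtoC 0 + RtoC s * om j)%C -v cmul c (cmul (om j) (f2 (RtoC 0 + RtoC s * om j)%C))) N)
     (INR N * (s * q * (s * q * K)))).
  { apply vsum_unif. intros j.
    assert (Q := T1 (RtoC 0 + RtoC s * om j)%C (RtoC 0 + RtoC s * om (S j))%C
      (Disc s j ltac:(lra)) (Disc s (S j) ltac:(lra))).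
    replace (RtoC 0 + RtoC s * om (S j) - (RtoC 0 + RtoC s * om j))%C with (c * om j)%C in Q
      by (rewrite om_S; unfold c; ring).
    rewrite Cmod_mult, Mom, Mc, Rmult_1_r in Q. now rewrite cmul_mul. }
  rewrite (vsum_sub (fun j => f1 (RtoC 0 + RtoC s * om (S j))%C
     -v f1 (RtoC 0 + RtoC s * om j)%C)) in Bd.
  rewrite Tel in Bd.
  rewrite <- (vsum_lin (fun j => cmul (om j) (f2 (RtoC 0 + RtoC s * om j)%C)) N
    (cmul_real_linear c)) in Bd.
  fold (H' s) in Bd.
  apply (cmul_cancel Hc0). rewrite Mc.
  apply gbd_le with (INR N * (s * q * (s * q * K))).
  - apply (gbd_eq (gbd_opp Bd)). vec.
  - assert (0 < s * q) by (apply Rmult_lt_0_compat; lra).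
    replace (s * q * (INR N * (K * r * q))) with (INR N * (s * q * (r * q * K))) by ring.
    apply Rmult_le_compat_l; [lra|]. apply Rmult_le_compat_l; [lra|].
    apply Rmult_le_compat_r; [exact HK|]. apply Rmult_le_compat_r; lra. }
assert (HH : forall s, 0 <= s <= r -> B (H s -v INR N *v f1 (RtoC 0)) (INR N * (K * (r * r) * q))).
{ intros s Hs.
  replace (INR N *v f1 (RtoC 0)) with (H 0).
  2:{ unfold H. rewrite <- vsum_const. apply vsum_ext. intros j. f_equal. ring. }
  assert (Hp : 0 <= INR N * (K * r * q)).
  { apply Rmult_le_pos; [lra|]. apply Rmult_le_pos; [|lra]. apply Rmult_le_pos; lra. }
  apply gbd_le with (INR N * (K * r * q) * (s - 0)).
  - apply mean_value_const; [lra| |].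
    + intros t Ht. apply (vsum_cont (a := fun j s => f1 (RtoC 0 + RtoC s * om j)%C)).
      intros j. eapply complex_der_cont. apply D1, Disc. lra.
    + intros t Ht. exists (H' t). split; [|apply HH'; lra].
      apply (vsum_rder (a := fun j s => f1 (RtoC 0 + RtoC s * om j)%C)).
      intros j. apply complex_der_path, D1, Disc. lra.
  - replace (INR N * (K * (r * r) * q)) with (INR N * (K * r * q) * r) by ring.
    apply Rmult_le_compat_l; lra. }
pose (G := fun s => vsum (fun j => cmul (om' j) (f0 (RtoC 0 + RtoC s * om j)%C)) N
   -v s *v (INR N *v f1 (RtoC 0))).
assert (G0 : G 0 = vzero).
{ unfold G.
  assert (E : vsum (fun j => cmul (om' j) (f0 (RtoC 0 + RtoC 0 * om j)%C)) N = vzero).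
  { apply (@gbd_eq0 _ _ B). apply (cmul_cancel Hom). rewrite Rmult_0_r.
    rewrite (vsum_lin _ _ (cmul_real_linear _)).
    pose (a := fun j => vopp (cmul (cis th * om' j)%C (f0 (RtoC 0)))).
    rewrite (vsum_ext (b := fun j => a (S j) -v a j)).
    2:{ intros j. unfold a. rewrite cmul_mul.
        replace (RtoC 0 + RtoC 0 * om j)%C with (RtoC 0) by ring.
        replace ((cis th - RtoC 1) * om' j)%C with (cis th * om' j - om' j)%C by ring.
        replace (cis th * om' (S j))%C with (om' j) by (rewrite <- (om'_S j); ring).
        rewrite cmul_sub. vec. }
    rewrite vsum_telescope. unfold a. rewrite om'_per.
    apply (gbd_eq (gbd_zero B)). vec. }
  rewrite E. vec. }
assert (GB : B (G r) (INR N * (K * (r * r) * q) * r)).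
{ replace (G r) with (G r -v G 0) by (rewrite G0; vec).
  apply gbd_le with (INR N * (K * (r * r) * q) * (r - 0)); [|lra].
  apply mean_value_const; [lra| |].
  - intros t Ht. apply cont_minus.
    + apply (vsum_cont (a := fun j s => cmul (om' j) (f0 (RtoC 0 + RtoC s * om j)%C))).
      intros j. apply (cont_lin (cmul_real_linear _) (cmul_maps (om' j))
        (p := fun s => f0 (RtoC 0 + RtoC s * om j)%C)).
      eapply complex_der_cont. apply D0, Disc. lra.
    + apply cont_id with (norm (INR N *v f1 (RtoC 0))). apply Rle_refl.
  - intros t Ht. exists (H t -v INR N *v f1 (RtoC 0)). split; [|apply HH; lra].
    apply rder_minus; [|apply rder_id].
    apply rder_eq with (vsum (fun j => cmul (om' j) (cmul (om j) (f1 (RtoC 0 + RtoC t * om j)%C))) N).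
    + apply (vsum_rder (a := fun j s => cmul (om' j) (f0 (RtoC 0 + RtoC s * om j)%C))).
      intros j. apply (rder_lin (cmul_real_linear _) (cmul_maps (om' j))
        (p := fun s => f0 (RtoC 0 + RtoC s * om j)%C)).
      apply complex_der_path, D0, Disc. lra.
    + unfold H. apply vsum_ext. intros j. rewrite cmul_mul, om_om', cmul_R. apply vscal1. }
assert (S0 : B (vsum (fun j => cmul (om' j) (f0 (RtoC 0 + RtoC r * om j)%C)) N) (INR N * M)).
{ apply vsum_unif. intros j. rewrite <- (Rmult_1_l M), <- (Mom' j).
  apply cmul_maps, H0, Disc. lra. }
apply gbd_unscal with (INR N); [lra|].
eapply gbd_le.
- apply (gbd_eq (gbd_sub S0 GB)). unfold G. vec.
- replace (INR N * (K * (r * r) * q) * r) with (INR N * (K * (r * (r * r)) * q)) by ring.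
  rewrite <- Rmult_plus_distr_l. apply Rmult_le_compat_l; lra.
Qed.

End Cauchy.

(** * Operator norms *)

Section Opnorm.

Context {k : scalar_field} {U W : NormedModule (Kring k)}.

Lemma opnorm_lub (l : U -> W) M : 0 <= M -> (forall x, norm (l x) <= M * norm x) ->
  is_lub_Rbar (fun r => exists x : U, norm x <= 1 /\ r = norm (l x)) (opnorm l).
Proof.
intros HM H. unfold opnorm.
assert (Q := Lub_Rbar_correct (fun r => exists x : U, norm x <= 1 /\ r = norm (l x))).
destruct (Lub_Rbar _) as [r| |]; [exact Q| |]; exfalso.
- assert (B : Rbar_le p_infty M).
  { apply (proj2 Q). intros r [x [Hx ->]]. eapply Rle_trans; [apply H|].
    rewrite <- (Rmult_1_r M) at 2. now apply Rmult_le_compat_l. }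
  exact B.
- apply (proj1 Q (norm (l zero))). exists zero. split; [|reflexivity].
  rewrite norm_zero. lra.
Qed.

Lemma opnorm_le (l : U -> W) M : 0 <= M -> (forall x, norm (l x) <= M * norm x) ->
  opnorm l <= M.
Proof.
intros HM H. apply (proj2 (opnorm_lub HM H) (Finite M)).
intros r [x [Hx ->]]. eapply Rle_trans; [apply H|].
rewrite <- (Rmult_1_r M) at 2. now apply Rmult_le_compat_l.
Qed.

Lemma opnorm_ge0 (l : U -> W) : is_linear l -> 0 <= opnorm l.
Proof.
intros [_ _ [M [HM H]]]. apply Rle_trans with (norm (l zero)); [apply norm_ge_0|].
apply (proj1 (opnorm_lub (Rlt_le _ _ HM) H)). exists zero. split; [|reflexivity].
rewrite norm_zero. lra.
Qed.

Lemma opnorm_bound (l : U -> W) x : is_linear l -> norm (l x) <= opnorm l * norm x.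
Proof.
intros L. assert (P := opnorm_ge0 L). destruct L as [Lp Ls [M [HM H]]].
destruct (Req_dec (norm x) 0) as [Z|NZ].
- specialize (H x). rewrite Z in *. lra.
- assert (Px : 0 < norm x) by (assert (Q := norm_ge_0 x); lra).
  assert (Q : norm (l (scal (RtoK k (/ norm x)) x)) <= opnorm l).
  { apply (proj1 (opnorm_lub (Rlt_le _ _ HM) H)).
    exists (scal (RtoK k (/ norm x)) x). split; [|reflexivity].
    eapply Rle_trans; [exact (norm_scal _ x)|]. rewrite abs_RtoK, Rabs_inv, Rabs_pos_eq by lra.
    right. field. lra. }
  assert (E : norm (l x) <= norm x * norm (l (scal (RtoK k (/ norm x)) x))).
  { replace (l x) with (norm x *v l (scal (RtoK k (/ norm x)) x)).
    - eapply Rle_trans; [exact (norm_scal _ _)|]. rewrite abs_RtoK, Rabs_pos_eq; lra.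
    - rewrite Ls. change (norm x *v (/ norm x *v l x) = l x). rewrite vscalA.
      rewrite Rinv_r by lra. apply vscal1. }
  rewrite Rmult_comm. eapply Rle_trans; [exact E|]. apply Rmult_le_compat_l; lra.
Qed.

End Opnorm.

Lemma is_linear_real {k} {V : NormedModule (Kring k)} (T : V -> V) : is_linear T -> real_linear T.
Proof.
intros L. split.
- exact (linear_plus _ L).
- intros c x. exact (linear_scal _ L (RtoK k c) x).
Qed.

Lemma is_linear_nmaps {k} {V : NormedModule (Kring k)} (T : V -> V) :
  is_linear T -> exists C, nmaps T C.
Proof.
intros [_ _ [C [HC H]]]. exists C. intros x r Hx. change (norm x <= r) in Hx.
change (norm (T x) <= C * r). eapply Rle_trans; [apply H|]. apply Rmult_le_compat_l; lra.
Qed.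

(** * Analytic semigroups regularize *)

Lemma sequence_bound (a : nat -> R) N M : (forall n, (N <= n)%nat -> a n <= M) ->
  exists r, forall n, a n <= r.
Proof.
revert M. induction N as [|N IH]; intros M H.
- exists M. intros n. apply H. lia.
- apply (IH (Rmax M (a N))). intros n Hn.
  destruct (Nat.eq_dec n N) as [->|Hne]; [apply Rmax_r|].
  apply Rle_trans with M; [apply H; lia|apply Rmax_l].
Qed.

Section Sector.

Definition cone (c : R) (z : C) : Prop := 0 < fst z /\ Rabs (snd z) < c * fst z.

Lemma cone_sector d z : 0 < d < PI / 2 -> cone (tan d) z -> sector d z.
Proof.
intros Hd [Ha Hb]. destruct z as [a b]. simpl in *.
pose (x := b / a).
assert (Hx : Rabs x < tan d).
{ unfold x, Rdiv. rewrite Rabs_mult, Rabs_inv, (Rabs_pos_eq a) by lra.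
  apply Rmult_lt_reg_r with a; [exact Ha|]. rewrite Rmult_assoc, Rinv_l; lra. }
apply Rabs_def2 in Hx.
assert (P : 0 < sqrt (1 + Rsqr x)) by (apply sqrt_lt_R0; assert (Q := Rle_0_sqr x); lra).
exists (a * sqrt (1 + Rsqr x)), (atan x). split; [now apply Rmult_lt_0_compat|]. split.
- apply Rabs_def1.
  + rewrite <- (atan_tan d) by lra. now apply atan_increasing.
  + rewrite <- (atan_tan d) by lra. rewrite <- atan_opp. apply atan_increasing. lra.
- rewrite cos_atan, sin_atan. f_equal; [field; lra|]. unfold x at 2. field. lra.
Qed.

Lemma Cmod_fst_snd (z : C) : Rabs (fst z) <= Cmod z /\ Rabs (snd z) <= Cmod z.
Proof.
assert (H := Rmax_Cmod z). split.
- eapply Rle_trans; [apply Rmax_l|exact H].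
- eapply Rle_trans; [apply Rmax_r|exact H].
Qed.

Lemma cone_open c z : 0 < c -> cone c z -> exists d, 0 < d /\
  forall h : C, Cmod h < d -> cone c (z + h)%C.
Proof.
intros Hc [H1 H2]. pose (g := c * fst z - Rabs (snd z)).
exists (Rmin (fst z) (g / (1 + c))). split.
{ apply Rmin_glb_lt; [exact H1|]. apply Rdiv_lt_0_compat; unfold g; lra. }
intros h Hh. assert (M1 := Rmin_l (fst z) (g / (1 + c))).
assert (M2 := Rmin_r (fst z) (g / (1 + c))).
destruct (Cmod_fst_snd h) as [A1 A2].
assert (A3 : Rabs (fst h) < fst z) by lra. apply Rabs_def2 in A3.
split; simpl; [lra|]. eapply Rle_lt_trans; [apply Rabs_triang|].
assert (A4 : (1 + c) * Cmod h < g).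
{ apply Rlt_le_trans with ((1 + c) * (g / (1 + c))); [|right; field; lra].
  apply Rmult_lt_compat_l; lra. }
unfold g in A4. assert (A5 := Rle_abs (- fst h)). rewrite Rabs_Ropp in A5.
assert (c * - fst h <= c * Cmod h) by (apply Rmult_le_compat_l; lra). lra.
Qed.

Lemma locally_C_Cmod (P : C -> Prop) (z : C) : locally (T := C_UniformSpace) z P ->
  exists d, 0 < d /\ forall h : C, Cmod h < d -> P (z + h)%C.
Proof.
intros [d Hd]. exists d. split; [apply cond_pos|]. intros h Hh. apply Hd.
destruct (Cmod_fst_snd h) as [A1 A2].
split; simpl.
- change (Rabs (fst z + fst h - fst z) < d).
  replace (fst z + fst h - fst z) with (fst h) by ring. lra.
- change (Rabs (snd z + snd h - snd z) < d).
  replace (snd z + snd h - snd z) with (snd h) by ring. lra.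
Qed.

End Sector.

Section Smoothing.

Context {X : NormedModule (Kring complex_scalars)} (T : R -> X -> X).
Let B := norm_gauge X.
Context (CX : gcomplete B) (HT : @analytic_complex X T).

(** The semigroup law expresses every derivative of the semigroup on a disc
    around [t] through its first derivative at one point close to [0], composed
    with values that are bounded uniformly; so Cauchy's estimate applies and
    yields the bound [C / t]. *)
Lemma analytic_smoothing : exists C t0, 0 < C /\ 0 < t0 /\
  forall t x, 0 < t <= t0 -> exists y, rder B (fun s => T s x) t y /\
    norm y <= C / t * norm x.
Proof.
(* The hypothesis with [Kring complex_scalars], to which its field is only convertible. *)
assert (HT' : exists (delta : R) (S : C -> X -> X),
  0 < delta <= PI / 2 /\
  (forall t x, 0 <= t -> S (RtoC t) x = T t x) /\
  (forall z, sector delta z -> is_linear (S z)) /\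
  (forall z w x, sector delta z -> sector delta w -> S (z + w)%C x = S z (S w x)) /\
  (forall z, sector delta z -> exists D : X -> X, is_linear D /\ filterlim
     (fun h => opnorm (fun x => minus (cmul (/ h)%C (minus (S (z + h)%C x) (S z x))) (D x)))
     (locally' (T := C_UniformSpace) (RtoC 0)) (locally 0)) /\
  (forall delta' x, 0 < delta' < delta ->
     filterlim (fun z => S z x) (within (sector delta') (locally (RtoC 0))) (locally x)))
  by exact HT.
destruct HT' as [delta [S [Hd [ST [Slin [Sadd [Shol Slim]]]]]]].
assert (PI0 := PI_RGT_0).
pose (d := delta / 2). pose (c := tan d).
assert (Hc : 0 < c) by (apply tan_gt_0; unfold d; lra).
assert (Cs : forall z, cone c z -> sector d z).
{ intros z Hz. apply cone_sector; [unfold d; lra|exact Hz]. }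
assert (CS : forall z, cone c z -> sector delta z).
{ intros z Hz. destruct (Cs z Hz) as [r [phi [H1 [H2 H3]]]].
  exists r, phi. repeat split; try assumption. unfold d in H2. lra. }
(* Otherwise a sequence tending to [0] contradicts the principle of uniform
   boundedness. *)
assert (Bd : exists M rho, 0 < M /\ 0 < rho /\
  forall z, cone c z -> Cmod z < rho -> nmaps (S z) M).
{ apply NNPP. intros No.
  assert (Bad : forall n : nat, exists z, cone c z /\ Cmod z < / INR (n + 1) /\
    ~ nmaps (S z) (INR (n + 1))).
  { intros n. assert (Pn : 0 < INR (n + 1)) by (apply lt_0_INR; lia).
    apply NNPP. intros No'. apply No. exists (INR (n + 1)), (/ INR (n + 1)).
    split; [exact Pn|]. split; [now apply Rinv_0_lt_compat|]. intros z Hz Hz'.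
    apply NNPP. intros No''. apply No'. now exists z. }
  apply choice in Bad. destruct Bad as [z Hz].
  destruct (@uniform_boundedness _ X (fun n => S (z n)) CX) as [C [HC Q]].
  - intros n. apply is_linear_real. exact (Slin _ (CS _ (proj1 (Hz n)))).
  - intros n. apply is_linear_nmaps. exact (Slin _ (CS _ (proj1 (Hz n)))).
  - intros x.
    assert (L := Slim d x ltac:(unfold d; lra)).
    assert (L' := proj1 (@filterlim_locally_ball_norm _ C X _ _ _ _) L (mkposreal 1 Rlt_0_1)).
    unfold within in L'. apply locally_C_Cmod in L'. destruct L' as [e [He L']].
    destruct (archimed_cor1 e He) as [N [HN HN']].
    apply sequence_bound with N (1 + norm x). intros n Hn.
    assert (Pn : 0 < INR N) by now apply lt_0_INR.
    assert (Q := L' (z n)). rewrite Cplus_0_l in Q.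
    assert (Q' : norm (minus (S (z n) x) x) < 1).
    { apply Q; [|apply Cs, Hz]. apply Rlt_trans with (/ INR N); [|exact HN].
      apply Rlt_le_trans with (/ INR (n + 1)); [apply Hz|].
      apply Rinv_le_contravar; [exact Pn|]. apply le_INR. lia. }
    change (norm (S (z n) x -v x) < 1) in Q'.
    assert (Bx : B x (norm x)) by apply Rle_refl.
    assert (Q2 : B (S (z n) x) (1 + norm x)).
    { apply (gbd_eq (gbd_add (g := B) (x := S (z n) x -v x) (r := 1) (Rlt_le _ _ Q') Bx)). vec. }
    exact Q2.
  - destruct (INR_unbounded C) as [N HN]. apply (proj2 (proj2 (Hz N))).
    intros x r Hx. apply (gbd_le (Q N x r Hx)).
    apply Rmult_le_compat_r; [exact (gbd_pos Hx)|]. rewrite plus_INR. simpl. lra. }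
destruct Bd as [M [rho [HM [Hrho Bd]]]].
(* The points [t - j * (t / 6)] with [j <= 3] are at least [t / 2]; discs of radius
   [r0 * t] around them stay in the cone. *)
pose (r0 := Rmin c 1 / 8).
assert (Hr0 : 0 < r0) by (apply Rdiv_lt_0_compat; [apply Rmin_glb_lt; lra|lra]).
assert (r0c : 8 * r0 <= c) by (unfold r0; assert (Q := Rmin_l c 1); lra).
assert (r01 : 8 * r0 <= 1) by (unfold r0; assert (Q := Rmin_r c 1); lra).
exists (M / r0), (rho / 4). split; [now apply Rdiv_lt_0_compat|]. split; [lra|].
intros t x Ht. pose (p := RtoC (t / 6)).
assert (Hp : cone c p).
{ split; simpl; [lra|]. rewrite Rabs_R0. apply Rmult_lt_0_compat; lra. }
destruct (Shol p (CS p Hp)) as [D [Dlin Dlim]].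
assert (Deriv : forall e, 0 < e -> exists d, 0 < d /\ forall h, Cmod h < d -> forall y,
  norm (S (p + h)%C y -v S p y -v cmul h (D y)) <= e * Cmod h * norm y).
{ intros e He.
  assert (L := proj1 (filterlim_locally _ _) Dlim (mkposreal e He)).
  unfold locally', within in L. apply locally_C_Cmod in L. destruct L as [d1 [Hd1 L]].
  destruct (cone_open Hc Hp) as [d2 [Hd2 Op]].
  exists (Rmin d1 d2). split; [now apply Rmin_glb_lt|]. intros h Hh y.
  assert (M1 := Rmin_l d1 d2). assert (M2 := Rmin_r d1 d2).
  destruct (classic (h = RtoC 0)) as [->|Hh0].
  - rewrite Cplus_0_r, Cmod_0.
    replace (S p y -v S p y -v cmul (RtoC 0) (D y)) with (vzero : X)
      by (rewrite cmul_R; vec).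
    right. rewrite Rmult_0_r, Rmult_0_l. exact norm_zero.
  - assert (Ph : 0 < Cmod h) by now apply Cmod_gt_0.
    pose (l := fun x : X => minus (cmul (/ h)%C (minus (S (p + h)%C x) (S p x))) (D x)).
    assert (Q : opnorm l < e).
    { assert (Q := L h ltac:(lra)). rewrite Cplus_0_l in Q. specialize (Q Hh0).
      change (Rabs (opnorm l - 0) < e) in Q. rewrite Rminus_0_r in Q.
      apply Rabs_def2 in Q. lra. }
    assert (Ll : is_linear l).
    { assert (L1 := Slin _ (CS _ (Op h ltac:(lra)))). assert (L2 := Slin _ (CS _ Hp)).
      assert (Lm := cmul_real_linear (X := X) (/ h)%C).
      split.
      - intros a b. change (cmul (/ h) (S (p + h)%C (a +v b) -v S p (a +v b)) -v D (a +v b) =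
          (cmul (/ h) (S (p + h)%C a -v S p a) -v D a) +v (cmul (/ h) (S (p + h)%C b -v S p b) -v D b)).
        rewrite (proj1 (is_linear_real L1)), (proj1 (is_linear_real L2)),
          (proj1 (is_linear_real Dlin)).
        rewrite !(real_linear_sub _ _ Lm), !(proj1 Lm). vec.
      - intros z a. change (cmul (/ h) (S (p + h)%C (cmul z a) -v S p (cmul z a)) -v D (cmul z a) =
          cmul z (cmul (/ h) (S (p + h)%C a -v S p a) -v D a)).
        assert (Lz := cmul_real_linear (X := X) z).
        replace (S (p + h)%C (cmul z a)) with (cmul z (S (p + h)%C a))
          by (symmetry; exact (linear_scal _ L1 z a)).
        replace (S p (cmul z a)) with (cmul z (S p a))
          by (symmetry; exact (linear_scal _ L2 z a)).
        replace (D (cmul z a)) with (cmul z (D a))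
          by (symmetry; exact (linear_scal _ Dlin z a)).
        rewrite !(real_linear_sub _ _ Lz), !(real_linear_sub _ _ Lm), !(real_linear_sub _ _ Lz), !cmul_mul.
        rewrite (Cmult_comm z (/ h)). reflexivity.
      - destruct (is_linear_nmaps L1) as [C1 B1]. destruct (is_linear_nmaps L2) as [C2 B2].
        destruct (is_linear_nmaps Dlin) as [C3 B3].
        exists (Rabs (Cmod (/ h)%C * (C1 + C2) + C3) + 1).
        split; [assert (Q' := Rabs_pos (Cmod (/ h)%C * (C1 + C2) + C3)); lra|].
        intros a. assert (Ba : B a (norm a)) by apply Rle_refl.
        assert (Q' := gbd_sub (cmul_maps (/ h)%C (gbd_sub (B1 _ _ Ba) (B2 _ _ Ba))) (B3 _ _ Ba)).
        refine (Rle_trans _ _ _ Q' _).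
        assert (Q2 := Rle_abs (Cmod (/ h)%C * (C1 + C2) + C3)).
        apply Rle_trans with ((Cmod (/ h)%C * (C1 + C2) + C3) * norm a); [right; ring|].
        apply Rmult_le_compat_r; [apply norm_ge_0|lra]. }
    assert (Q2 : B (l y) (e * norm y)).
    { eapply Rle_trans; [exact (opnorm_bound y Ll)|].
      apply Rmult_le_compat_r; [apply norm_ge_0|lra]. }
    apply (cmul_maps h) in Q2.
    replace (e * Cmod h * norm y) with (Cmod h * (e * norm y)) by ring.
    apply (gbd_eq Q2).
    change (S (p + h)%C y -v S p y -v cmul h (D y) =
      cmul h (cmul (/ h)%C (S (p + h)%C y -v S p y) -v D y)).
    rewrite (real_linear_sub _ _ (cmul_real_linear h)), cmul_mul.
    replace (h * / h)%C with (RtoC 1) by (field; exact Hh0).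
    rewrite cmul_R. vec. }
(* Differentiate [S (p + w) = S w (S p)] through the derivative at [p]. *)
assert (Dw : forall w y, cone c w -> Cmod w < rho ->
  complex_der (fun z => S z y) (p + w)%C (S w (D y))).
{ intros w y Hw Hw' e He. assert (Py := norm_ge_0 y).
  destruct (Deriv (e / (M * (norm y + 1)))) as [d1 [Hd1 Q]].
  { apply Rdiv_lt_0_compat; [exact He|]. apply Rmult_lt_0_compat; lra. }
  destruct (cone_open Hc Hp) as [d2 [Hd2 Op]].
  exists (Rmin d1 d2). split; [now apply Rmin_glb_lt|]. intros h Hh.
  assert (M1 := Rmin_l d1 d2). assert (M2 := Rmin_r d1 d2).
  assert (Lw := Slin _ (CS _ Hw)).
  replace (p + w + h)%C with (w + (p + h))%C by ring.
  replace (p + w)%C with (w + p)%C by ring.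
  rewrite (Sadd w (p + h)%C), (Sadd w p) by (apply CS; try assumption; apply Op; lra).
  assert (Q' := Bd w Hw Hw' _ _ (Q h ltac:(lra) y)).
  apply gbd_le with (M * (e / (M * (norm y + 1)) * Cmod h * norm y)).
  - apply (gbd_eq Q').
    rewrite !(real_linear_sub _ _ (is_linear_real Lw)).
    do 2 f_equal. symmetry. exact (linear_scal _ Lw h (D y)).
  - replace (M * (e / (M * (norm y + 1)) * Cmod h * norm y))
      with (e * Cmod h * (norm y / (norm y + 1))) by (field; lra).
    rewrite <- (Rmult_1_r (e * Cmod h)) at 2. apply Rmult_le_compat_l.
    + apply Rmult_le_pos; [lra|apply Cmod_ge_0].
    + apply Rmult_le_reg_r with (norm y + 1); [lra|].
      unfold Rdiv. rewrite Rmult_assoc, Rinv_l; lra. }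
pose (f := fun (j : nat) (y : X) (zeta : C) => S (RtoC (t - INR j * (t / 6)) + zeta)%C y).
assert (Dom : forall (j : nat) zeta, INR j <= 3 -> Cmod zeta <= r0 * t ->
  cone c (RtoC (t - INR j * (t / 6)) + zeta)%C /\
  Cmod (RtoC (t - INR j * (t / 6)) + zeta)%C < rho).
{ intros j zeta Hj Hz. destruct (Cmod_fst_snd zeta) as [A1 A2].
  assert (Pj := pos_INR j).
  assert (B1 : 0 <= INR j * (t / 6) <= t / 2) by (split; nra).
  assert (B2 : 8 * (r0 * t) <= t) by nra.
  assert (B3 : 8 * (r0 * t) <= c * t) by nra.
  assert (A3 := Rle_abs (- fst zeta)). rewrite Rabs_Ropp in A3.
  split; [split|].
  - simpl. lra.
  - simpl. rewrite Rplus_0_l.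
    assert (c * (3 / 8 * t) <= c * (t - INR j * (t / 6) + fst zeta)).
    { apply Rmult_le_compat_l; lra. }
    assert (0 < c * t) by (apply Rmult_lt_0_compat; lra). lra.
  - eapply Rle_lt_trans; [apply Cmod_triangle|]. rewrite Cmod_R, Rabs_pos_eq by lra. lra. }
assert (Step : forall j y zeta, INR (1 + j) <= 3 -> Cmod zeta <= r0 * t ->
  complex_der (f j y) zeta (f (1 + j)%nat (D y) zeta)).
{ intros j y zeta Hj Hz. destruct (Dom (1 + j)%nat zeta Hj Hz) as [D1 D2].
  intros e He. destruct (Dw _ y D1 D2 e He) as [d1 [Hd1 Q]].
  exists d1. split; [exact Hd1|]. intros h Hh. specialize (Q h Hh). unfold f.
  replace (p + (RtoC (t - INR (1 + j) * (t / 6)) + zeta))%C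
    with (RtoC (t - INR j * (t / 6)) + zeta)%C in Q.
  2:{ unfold p. rewrite Cplus_assoc, <- RtoC_plus, plus_INR. simpl INR. do 2 f_equal. field. }
  replace (RtoC (t - INR j * (t / 6)) + (zeta + h))%C
    with (RtoC (t - INR j * (t / 6)) + zeta + h)%C by ring.
  exact Q. }
pose (y3 := D (D (D x))).
assert (Est : B (f 1%nat (D x) (RtoC 0)) (M * norm x / (r0 * t))).
{ apply (@cauchy_estimate X (f 0%nat x) (f 1%nat (D x)) (f 2%nat (D (D x))) (f 3%nat y3)
    (r0 * t) (M * norm x) (M * norm y3)).
  - apply Rmult_lt_0_compat; lra.
  - intros z Hz. apply (Step 0%nat); [simpl; lra|exact Hz].
  - intros z Hz. apply (Step 1%nat); [simpl; lra|exact Hz].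
  - intros z Hz. apply (Step 2%nat); [simpl; lra|exact Hz].
  - intros z Hz. destruct (Dom 3%nat z ltac:(simpl; lra) Hz) as [D1 D2].
    apply (Bd _ D1 D2). apply Rle_refl.
  - intros z Hz. destruct (Dom 0%nat z ltac:(simpl; lra) Hz) as [D1 D2].
    apply (Bd _ D1 D2). apply Rle_refl. }
exists (f 1%nat (D x) (RtoC 0)). split.
- assert (Q := Step 0%nat x (RtoC 0) ltac:(simpl; lra) ltac:(rewrite Cmod_0; nra)).
  assert (Q' : complex_der (f 0%nat x) (RtoC (- t) + RtoC t * RtoC 1)%C (f 1%nat (D x) (RtoC 0))).
  { replace (RtoC (- t) + RtoC t * RtoC 1)%C with (RtoC 0); [exact Q|].
    rewrite RtoC_opp. ring. }
  apply complex_der_path in Q'. rewrite cmul_R, vscal1 in Q'.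
  revert Q'. apply rder_local with 1; [lra|]. intros s Hs. unfold f.
  rewrite <- ST by lra. f_equal. simpl INR.
  replace (t - 0 * (t / 6)) with t by field. rewrite RtoC_opp. ring.
- apply (Rle_trans _ _ _ Est). right. field. lra.
Qed.

End Smoothing.

Section AnalyticReal.

Context (E : CompleteNormedModule R_AbsRing).

Lemma norm_complete k (F : CompleteNormedModule (Kring k)) : gcomplete (norm_gauge F).
Proof.
intros u Hu. destruct (@complete_norm _ F u) as [l Hl].
- intros e He. destruct (Hu (e / 2) ltac:(lra)) as [N HN]. exists N. intros n m Hn Hm.
  apply Rle_lt_trans with (e / 2); [|lra]. exact (HN n m Hn Hm).
- exists l. intros e He. destruct (Hl e He) as [N HN]. exists N. intros n Hn.
  left. exact (HN n Hn).
Qed.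

Lemma complexification_complete :
  @gcomplete complex_scalars (complexification E) (norm_gauge _).
Proof.
intros u Hu.
destruct (@norm_complete real_scalars E (fun n => fst (u n))) as [l1 H1].
{ intros e He. destruct (Hu e He) as [N HN]. exists N. intros n m Hn Hm.
  exact (Rle_trans _ _ _ (cplx_norm_fst (minus (u n) (u m))) (HN n m Hn Hm)). }
destruct (@norm_complete real_scalars E (fun n => snd (u n))) as [l2 H2].
{ intros e He. destruct (Hu e He) as [N HN]. exists N. intros n m Hn Hm.
  exact (Rle_trans _ _ _ (cplx_norm_snd (minus (u n) (u m))) (HN n m Hn Hm)). }
exists (l1, l2). intros e He.
destruct (H1 (e / 2) ltac:(lra)) as [N1 Q1]. destruct (H2 (e / 2) ltac:(lra)) as [N2 Q2].
exists (Nat.max N1 N2). intros n Hn.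
refine (Rle_trans _ _ _ (cplx_norm_sum (minus (u n) (l1, l2))) _).
assert (R1 := Q1 n ltac:(lia)). assert (R2 := Q2 n ltac:(lia)).
change (norm (minus (fst (u n)) l1) <= e / 2) in R1.
change (norm (minus (snd (u n)) l2) <= e / 2) in R2.
change (norm (minus (fst (u n)) l1) + norm (minus (snd (u n)) l2) <= e). lra.
Qed.

End AnalyticReal.

Lemma analytic_rder k (E : CompleteNormedModule (Kring k)) (T : R -> E -> E) :
  @analytic k E T ->
  exists C t0, 0 < C /\ 0 < t0 /\
  forall t x, 0 < t <= t0 -> exists y, rder (norm_gauge E) (fun s => T s x) t y /\
    norm y <= C / t * norm x.
Proof.
destruct k; intros HA.
- destruct (@analytic_smoothing (complexification E) _ (@complexification_complete E) HA)
    as [C [t0 [HC [Ht0 H]]]].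
  exists C, t0. split; [exact HC|]. split; [exact Ht0|]. intros t x Ht.
  destruct (H t (x, zero) Ht) as [y [D Hy]].
  exists (fst y). split.
  + intros e He. destruct (D e He) as [d [Hd Q]]. exists d. split; [exact Hd|].
    intros h Hh. refine (Rle_trans _ _ _ _ (Q h Hh)).
    eapply Rle_trans; [|apply cplx_norm_fst]. right.
    change (norm (T (t + h) x -v T t x -v h *v fst y) =
      norm (plus (plus (T (t + h) x) (opp (T t x)))
        (opp (minus (scal h (fst y)) (scal (0 : R) (snd y)))))).
    rewrite scal_R0. f_equal. unfold vadd, vopp, vscal. do 2 f_equal.
    symmetry. exact (minus_zero_r _).
  + eapply Rle_trans; [exact (cplx_norm_fst y)|]. eapply Rle_trans; [exact Hy|].
    apply Rmult_le_compat_l; [left; apply Rdiv_lt_0_compat; lra|].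
    refine (Rle_trans _ _ _ (cplx_norm_sum (x, zero)) _). simpl.
    rewrite norm_zero. lra.
- exact (@analytic_smoothing E T (@norm_complete complex_scalars E) HA).
Qed.

(** * Estimates for analytic semigroups on [E0] and [E1] *)

Lemma filterlim_at_right_eps {K : AbsRing} {E : NormedModule K} (f : R -> E) (l : E) (a : R) :
  filterlim f (at_right a) (locally l) <->
  forall e, 0 < e -> exists d, 0 < d /\ forall h, 0 < h < d -> norm (minus (f (a + h)) l) <= e.
Proof.
split; intros H.
- intros e He.
  destruct (proj1 (@filterlim_locally_ball_norm K R E (at_right a) _ f l) H (mkposreal e He)) as [d Hd].
  exists d. split; [apply cond_pos|]. intros h Hh. left.
  apply Hd; [|lra]. change (Rabs (a + h - a) < d). rewrite Rabs_pos_eq; lra.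
- apply (proj2 (@filterlim_locally_ball_norm K R E (at_right a) _ f l)). intros [e He].
  destruct (H (e / 2) ltac:(lra)) as [d [Hd Q]].
  exists (mkposreal d Hd). intros s Hs Hs0. change (Rabs (s - a) < d) in Hs.
  apply Rabs_def2 in Hs. apply Rle_lt_trans with (e / 2); [|simpl; lra].
  assert (Q' := Q (s - a) ltac:(lra)).
  assert (E' : forall u v : R, u + (v - u) = v) by (intros; ring). now rewrite E' in Q'.
Qed.

Lemma rder_embed k (V : NormedModule (Kring k)) (B B' : gauge V) C p t l :
  (forall x r, B x r -> B' x (C * r)) -> rder B p t l -> rder B' p t l.
Proof. intros M. exact (rder_lin (real_linear_id (V := V)) M). Qed.

Lemma cont_embed k (V : NormedModule (Kring k)) (B B' : gauge V) C p D t :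
  (forall x r, B x r -> B' x (C * r)) -> cont B p D t -> cont B' p D t.
Proof. intros M. exact (cont_lin (real_linear_id (V := V)) M). Qed.

Section Semigroup.

Context {k : scalar_field} {E0 : CompleteNormedModule (Kring k)} (E1 : banach_in E0).

Notation N0 := (bd (whole E0)).
Notation N1 := (bd E1).

(** What is used of an operator of class [H(E1, E0)] and of its semigroup. Here
    [A] is extended arbitrarily from [E1] to [E0]; all estimates hold for times
    up to [t0]. *)
Record smoothing_semigroup (A : E0 -> E0) (T : R -> E0 -> E0) (t0 M : R) : Prop := {
  sg_t0 : 0 < t0;
  sg_M : 1 <= M;
  sg_linear : forall t, 0 <= t -> is_linear (T t);
  sg_0 : forall x, T 0 x = x;
  sg_add : forall s t x, 0 <= s -> 0 <= t -> T (s + t) x = T s (T t x);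
  sg_bound : forall t, 0 <= t <= t0 -> maps N0 N0 (T t) M;
  sg_cont0 : forall x e, 0 < e -> exists d, 0 < d /\
    forall h, 0 <= h < d -> N0 (T h x -v x) e;
  sg_gen : forall x y, rder N0 (fun s => T s x) 0 y -> mem E1 x /\ A x = y;
  sg_der : forall x t, mem E1 x -> 0 <= t -> rder N0 (fun s => T s x) t (T t (A x));
  sg_smooth : forall t, 0 < t <= t0 -> maps N0 N1 (T t) (M / t);
  sg_bound1 : forall t, 0 <= t <= t0 -> maps N1 N1 (T t) M;
  sg_diff : forall t h, 0 < t -> 0 < h -> t + h <= t0 ->
    maps N0 N0 (fun x => T (t + h) x -v T t x) (M * Rmin 1 (h / t));
  sg_diff1 : forall t h, 0 < t -> 0 < h -> t + h <= t0 ->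
    maps N1 N1 (fun x => T (t + h) x -v T t x) (M * Rmin 1 (h / t));
  sg_A_sub : forall x y, mem E1 x -> mem E1 y -> A (x -v y) = A x -v A y;
  sg_A : maps N1 N0 A M;
  sg_graph : forall x r s, mem E1 x -> N0 x r -> N0 (A x) s -> N1 x (M * (r + s));
  sg_int : forall x y t, 0 <= t <= t0 -> is_int N0 (fun s => T s x) 0 t y ->
    mem E1 y /\ A y = T t x -v x
}.

Lemma whole_norm_gauge (x : E0) r : norm_gauge E0 x r -> N0 x (1 * r).
Proof. intros H. rewrite Rmult_1_l. now apply bd_whole. Qed.

Lemma N0_norm (x : E0) : N0 x (norm x).
Proof. apply bd_whole. lra. Qed.

Lemma maps_whole (S : E0 -> E0) C : nmaps S C -> maps N0 N0 S C.
Proof. intros H x r Hx. apply bd_whole. apply H. now apply bd_whole in Hx. Qed.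

Lemma mem_sub (x y : E0) : mem E1 x -> mem E1 y -> mem E1 (x -v y).
Proof. intros [z <-] [w <-]. exists (minus z w). apply emb_minus. Qed.

Lemma elt_sub (x y : E0) : mem E1 x -> mem E1 y -> elt E1 (x -v y) = minus (elt E1 x) (elt E1 y).
Proof.
intros [z <-] [w <-]. rewrite <- emb_minus. now rewrite !elt_emb.
Qed.

Lemma semigroup_cont (T : R -> E0 -> E0) M t0 x t : 1 <= M ->
  (forall t, 0 <= t -> is_linear (T t)) ->
  (forall s t x, 0 <= s -> 0 <= t -> T (s + t) x = T s (T t x)) ->
  (forall t, 0 <= t <= t0 -> maps N0 N0 (T t) M) ->
  (forall e, 0 < e -> exists d, 0 < d /\ forall h, 0 <= h < d -> N0 (T h x -v x) e) ->
  0 <= t <= t0 -> cont N0 (fun s => T s x) (icc 0 t0) t.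
Proof.
intros HM TL Tadd TM Tc Ht e He.
destruct (Tc (e / M)) as [d [Hd Q]]; [apply Rdiv_lt_0_compat; lra|].
exists d. split; [exact Hd|]. intros s Hs Hst. unfold icc in Hs.
destruct (Rle_lt_dec s t) as [h|h].
- rewrite Rabs_left1 in Hst by lra.
  replace t with (s + (t - s)) by ring. rewrite Tadd by lra.
  assert (Q' := TM _ Hs _ _ (Q (t - s) ltac:(lra))).
  rewrite (real_linear_sub _ _ (is_linear_real (TL _ (proj1 Hs)))) in Q'.
  apply gbd_swap. apply (gbd_le Q'). right. field. lra.
- rewrite Rabs_pos_eq in Hst by lra.
  replace s with (t + (s - t)) by ring. rewrite Tadd by lra.
  assert (Q' := TM _ Ht _ _ (Q (s - t) ltac:(lra))).
  rewrite (real_linear_sub _ _ (is_linear_real (TL _ (proj1 Ht)))) in Q'.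
  apply (gbd_le Q'). right. field. lra.
Qed.

Section Analysis.

Context (A1 : E1 -> E0) (T : R -> E0 -> E0).
Context (HA : is_linear A1) (HT : C0_semigroup T) (HTa : analytic (k := k) T)
  (HG : generates A1 T).

Let A (x : E0) : E0 := A1 (elt E1 x).

Lemma T_linear t : 0 <= t -> is_linear (T t).
Proof using HT. apply HT. Qed.

Lemma T_real_linear t : 0 <= t -> real_linear (T t).
Proof using HT. intros Ht. now apply is_linear_real, T_linear. Qed.

Lemma T_0 x : T 0 x = x.
Proof using HT. apply HT. Qed.

Lemma T_add s t x : 0 <= s -> 0 <= t -> T (s + t) x = T s (T t x).
Proof using HT. apply HT. Qed.

Lemma T_maps t : 0 <= t -> exists C, maps N0 N0 (T t) C.
Proof using HT.
intros Ht. destruct (is_linear_nmaps (T_linear Ht)) as [C H]. exists C. now apply maps_whole.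
Qed.

Lemma T_cont0 x e : 0 < e -> exists d, 0 < d /\ forall h, 0 <= h < d -> N0 (T h x -v x) e.
Proof using HT.
intros He. destruct HT as [_ [_ [_ H]]].
destruct (proj1 (filterlim_at_right_eps _ _ _) (H x) e He) as [d [Hd Q]].
exists d. split; [exact Hd|]. intros h Hh.
destruct (Req_dec h 0) as [->|Hne].
- rewrite T_0. apply gbd_le with 0; [|lra]. apply (gbd_eq (gbd_zero N0)). vec.
- apply bd_whole. assert (Q' := Q h ltac:(lra)). now rewrite Rplus_0_l in Q'.
Qed.

Lemma T_bounded : exists M t0, 1 <= M /\ 0 < t0 /\ forall t, 0 <= t <= t0 -> maps N0 N0 (T t) M.
Proof using HT.
apply NNPP. intros No.
assert (Bad : forall n : nat, exists t, 0 <= t <= / INR (n + 1) /\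
  ~ maps N0 N0 (T t) (INR (n + 1))).
{ intros n. assert (Pn : 1 <= INR (n + 1)).
  { rewrite <- INR_1. apply le_INR. lia. }
  apply NNPP. intros No'. apply No. exists (INR (n + 1)), (/ INR (n + 1)).
  split; [lra|]. split; [apply Rinv_0_lt_compat; lra|]. intros t Ht.
  apply NNPP. intros No''. apply No'. now exists t. }
apply choice in Bad. destruct Bad as [t Ht].
destruct (@uniform_boundedness _ E0 (fun n => T (t n)) (@norm_complete _ E0)) as [C [HC Q]].
- intros n. apply T_real_linear. apply Ht.
- intros n. apply is_linear_nmaps, T_linear, Ht.
- intros x. destruct (T_cont0 x Rlt_0_1) as [d [Hd Q]].
  destruct (archimed_cor1 d Hd) as [N [HN HN']].
  apply sequence_bound with N (1 + norm x). intros n Hn.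
  assert (Pn : 0 < INR N) by now apply lt_0_INR.
  assert (Hsm : t n < d).
  { apply Rle_lt_trans with (/ INR N); [|exact HN].
    apply Rle_trans with (/ INR (n + 1)); [apply Ht|].
    apply Rinv_le_contravar; [exact Pn|]. apply le_INR. lia. }
  apply bd_whole. apply (gbd_eq (gbd_add (Q (t n) (conj (proj1 (proj1 (Ht n))) Hsm)) (N0_norm x))). vec.
- destruct (INR_unbounded C) as [N HN]. apply (proj2 (Ht N)).
  intros x r Hx. apply gbd_le with (C * r).
  + exact (maps_whole (Q N) Hx).
  + apply Rmult_le_compat_r; [exact (gbd_pos Hx)|]. rewrite plus_INR. simpl. lra.
Qed.

Lemma gen_iff x y : rder N0 (fun s => T s x) 0 y <-> mem E1 x /\ A x = y.
Proof using HT HG.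
transitivity (exists z : E1, emb z = x /\ A1 z = y).
- transitivity (filterlim (fun h => scal (RtoK k (/ h)) (minus (T h x) x)) (at_right 0) (locally y));
    [|exact (HG x y)].
  etransitivity; [|symmetry; exact (@filterlim_at_right_eps _ E0 _ y 0)].
  split; intros H e He.
  + destruct (H e He) as [d [Hd Q]]. exists d. split; [exact Hd|]. intros h Hh.
    assert (Q' := Q h Hh). rewrite T_0 in Q'. rewrite Rplus_0_l in *.
    apply bd_whole.
    change (N0 ((/ h) *v (T h x -v x) -v y) e).
    apply (gbd_scal_pos (c := / h)) in Q'; [|left; apply Rinv_0_lt_compat; lra].
    replace (/ h * (e * h)) with e in Q' by (field; lra).
    apply (gbd_eq Q'). vec_goal; repeat split; field; lra.
  + destruct (H e He) as [d [Hd Q]]. exists d. split; [exact Hd|]. intros h Hh.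
    assert (Q' := proj2 (@bd_whole k E0 _ _) (Q h Hh)). rewrite T_0, Rplus_0_l in *.
    change (N0 ((/ h) *v (T h x -v x) -v y) e) in Q'.
    apply (gbd_scal_pos (c := h)) in Q'; [|lra].
    rewrite Rmult_comm. apply (gbd_eq Q'). vec_goal; repeat split; field; lra.
- split.
  + intros [z [<- <-]]. split; [now exists z|]. unfold A. now rewrite elt_emb.
  + intros [[z <-] <-]. exists z. split; [reflexivity|]. unfold A. now rewrite elt_emb.
Qed.

Lemma T_rder_shift x t y : 0 <= t ->
  rder N0 (fun s => T s (T t x)) 0 y <-> rder N0 (fun s => T s x) t y.
Proof using HT.
intros Ht. split; intros H e He; destruct (H e He) as [d [Hd Q]]; exists d; (split; [exact Hd|]);
  intros h Hh; assert (Q' := Q h Hh); rewrite ?Rplus_0_l, ?T_0 in *.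
- rewrite (Rplus_comm t h), T_add; [exact Q'|lra|exact Ht].
- rewrite (Rplus_comm t h), T_add in Q'; [exact Q'|lra|exact Ht].
Qed.

Lemma T_domain x t : mem E1 x -> 0 <= t -> mem E1 (T t x) /\ A (T t x) = T t (A x).
Proof using HT HG.
intros Hx Ht. apply gen_iff.
destruct (T_maps Ht) as [C HC].
assert (D := proj2 (gen_iff x (A x)) (conj Hx eq_refl)).
assert (D' := rder_lin (T_real_linear Ht) HC D).
revert D'. apply rder_local with 1; [lra|]. intros s Hs.
rewrite <- !T_add by lra. f_equal. ring.
Qed.

Lemma T_der x t : mem E1 x -> 0 <= t -> rder N0 (fun s => T s x) t (T t (A x)).
Proof using HT HG.
intros Hx Ht. apply T_rder_shift; [exact Ht|]. apply gen_iff. now apply T_domain.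
Qed.

Lemma A_sub x y : mem E1 x -> mem E1 y -> A (x -v y) = A x -v A y.
Proof using HA.
intros Hx Hy. unfold A. rewrite elt_sub by assumption.
set (a := elt E1 x). set (b := elt E1 y).
assert (E : a = plus (minus a b) b).
{ unfold minus. rewrite <- plus_assoc. symmetry.
  transitivity (plus a zero); [f_equal; exact (plus_opp_l b)|exact (plus_zero_r a)]. }
rewrite E at 2.
replace (A1 (plus (minus a b) b)) with (A1 (minus a b) +v A1 b)
  by (symmetry; exact (linear_plus _ HA _ _)).
vec.
Qed.

Section Bounded.

Context (M t0 : R) (HM : 1 <= M) (Ht0 : 0 < t0)
  (TM : forall t, 0 <= t <= t0 -> maps N0 N0 (T t) M).

Lemma T_cont x t : 0 <= t <= t0 -> cont N0 (fun s => T s x) (icc 0 t0) t.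
Proof using HT HM Ht0 TM. exact (semigroup_cont HM T_linear T_add TM (T_cont0 x)). Qed.

Lemma T_int_exists x t : 0 < t <= t0 -> exists y, is_int N0 (fun s => T s x) 0 t y.
Proof using HT HM Ht0 TM.
intros Ht.
apply (@int_exists _ _ (whole E0) _ (fun s => M * norm x * s) (fun _ => M * norm x)).
- lra.
- intros s Hs. apply cont_sub with (icc 0 t0); [unfold ioo, icc; intros; lra|].
  apply T_cont. lra.
- intros s _. apply Rcont_scal, Rcont_continuous, continuous_id.
- intros s _. auto_derive; [exact I|ring].
- intros s Hs. apply TM; [lra|apply N0_norm].
Qed.

Lemma T_int_domain x y t : 0 <= t -> is_int N0 (fun s => T s x) 0 t y ->
  rder N0 (fun s => T s y) 0 (T t x -v x).
Proof using HT HM Ht0 TM.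
intros [Ht| <-] Iy e He.
2:{ exists 1. split; [lra|]. intros h Hh.
  rewrite (int_unique Iy (int_point N0 (fun s => T s x) 0)).
  rewrite !T_0, (real_linear_0 (T_real_linear (t := 0 + h) ltac:(lra))).
  eapply gbd_le; [apply (gbd_eq (gbd_zero N0)); vec|]. apply Rmult_le_pos; lra. }
(* For small [h], [T h y - y] is the difference of the integrals of [T s x] over
   [t, t + h] and [0, h]. *)
destruct (T_maps (Rlt_le _ _ Ht)) as [Ct HCt].
assert (PC : 0 <= Rabs Ct) by apply Rabs_pos.
destruct (@T_cont0 x (e / (2 * (Rabs Ct + 1)))) as [d1 [Hd1 Q1]]; [apply Rdiv_lt_0_compat; lra|].
exists (Rmin d1 (Rmin t0 t)). split; [apply Rmin_glb_lt; [exact Hd1|now apply Rmin_glb_lt]|].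
intros h Hh.
assert (M1 := Rmin_l d1 (Rmin t0 t)). assert (M2 := Rmin_r d1 (Rmin t0 t)).
assert (M3 := Rmin_l t0 t). assert (M4 := Rmin_r t0 t).
rewrite T_0, Rplus_0_l.
destruct (@T_int_exists x h ltac:(lra)) as [z Iz].
assert (Hz : N0 (z -v h *v x) (e / (2 * (Rabs Ct + 1)) * (h - 0))).
{ apply (int_bound_const (B := N0) (g := fun s => T s x -v x) (a := 0) (b := h)).
  - assert (Ic := @int_const _ _ N0 x _ 0 h (N0_norm x) ltac:(lra)).
    rewrite Rminus_0_r in Ic. now apply int_minus.
  - intros s Hs. apply Q1. lra. }
(* [T t z] is the integral over [t, t + h]. *)
assert (E : T h y -v y = T t z -v z).
{ destruct Iy as [_ [G [CG [DG ->]]]]. destruct Iz as [_ [H [CH [DH ->]]]].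
  pose (p1 := fun s => T h (G s) -v G (s + h)).
  assert (C1 : p1 (t - h) = p1 0).
  { apply (@rder0_const _ _ N0); [lra| |].
    - intros s Hs. apply cont_minus.
      + apply (cont_lin (T_real_linear (t := h) ltac:(lra)) (TM (t := h) ltac:(lra))).
        apply cont_sub with (icc 0 t); [unfold icc; intros; lra|]. apply CG. lra.
      + apply cont_sub with (fun s => icc 0 t (s + h)); [unfold icc; intros; lra|].
        apply cont_shift, CG. lra.
    - intros s Hs. apply rder_eq with (T h (T s x) -v T (s + h) x).
      + apply rder_minus.
        * apply (rder_lin (T_real_linear (t := h) ltac:(lra)) (TM (t := h) ltac:(lra))).
          apply DG. lra.
        * apply rder_shift, DG. lra.
      + rewrite (Rplus_comm s h), T_add by lra. vec. }
  pose (p2 := fun s => T (t - h) (H s) -v G (s + (t - h))).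
  assert (C2 : p2 h = p2 0).
  { destruct (T_maps (t := t - h) ltac:(lra)) as [C' HC'].
    apply (@rder0_const _ _ N0); [lra| |].
    - intros s Hs. apply cont_minus.
      + apply (cont_lin (T_real_linear (t := t - h) ltac:(lra)) HC'). now apply CH.
      + apply cont_sub with (fun s => icc 0 t (s + (t - h))); [unfold icc; intros; lra|].
        apply cont_shift, CG. lra.
    - intros s Hs. apply rder_eq with (T (t - h) (T s x) -v T (s + (t - h)) x).
      + apply rder_minus.
        * apply (rder_lin (T_real_linear (t := t - h) ltac:(lra)) HC'). now apply DH.
        * apply rder_shift, DG. lra.
      + rewrite (Rplus_comm s (t - h)), T_add by lra. vec. }
  pose (p3 := fun s => G s -v H s).
  assert (C3 : p3 h = p3 0).
  { apply (@rder0_const _ _ N0); [lra| |].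
    - intros s Hs. apply cont_minus.
      + apply cont_sub with (icc 0 t); [unfold icc; intros; lra|]. apply CG. lra.
      + apply CH. lra.
    - intros s Hs. apply rder_eq with (T s x -v T s x); [|vec].
      apply rder_minus; [apply DG; lra|now apply DH]. }
  unfold p1 in C1. unfold p2 in C2. unfold p3 in C3.
  replace (t - h + h) with t in C1 by ring. rewrite Rplus_0_l in C1.
  replace (h + (t - h)) with t in C2 by ring. rewrite Rplus_0_l in C2.
  replace (T t (H h -v H 0)) with (T h (T (t - h) (H h) -v T (t - h) (H 0))).
  2:{ rewrite <- (real_linear_sub _ _ (T_real_linear (t := t - h) ltac:(lra))).
      rewrite <- T_add by lra. f_equal. ring. }
  assert (F1 : T (t - h) (H h) -v T (t - h) (H 0) = G t -v G (t - h)).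
  { transitivity ((T (t - h) (H h) -v G t) -v (T (t - h) (H 0) -v G (t - h))
      +v (G t -v G (t - h))); [vec|]. rewrite C2. vec. }
  rewrite F1.
  rewrite !(real_linear_sub _ _ (T_real_linear (t := h) ltac:(lra))).
  transitivity ((T h (G t) -v T h (G 0)) -v (G t -v G 0)); [vec|].
  transitivity ((T h (G t) -v T h (G (t - h)) +v (T h (G (t - h)) -v G t)
    -v (T h (G 0) -v G h)) -v ((G h -v H h) -v (G 0 -v H 0)) -v (H h -v H 0)); [vec|].
  rewrite C1, C3. vec. }
rewrite E.
assert (Hz' := HCt _ _ Hz).
rewrite (real_linear_sub _ _ (T_real_linear (Rlt_le _ _ Ht))), (proj2 (T_real_linear (Rlt_le _ _ Ht))) in Hz'.
apply gbd_le with (Ct * (e / (2 * (Rabs Ct + 1)) * (h - 0)) + e / (2 * (Rabs Ct + 1)) * (h - 0)).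
- apply (gbd_eq (gbd_sub Hz' Hz)). vec.
- assert (L := Rle_abs Ct). rewrite Rminus_0_r.
  assert (Pz : 0 <= e / (2 * (Rabs Ct + 1)) * h).
  { apply Rmult_le_pos; [|lra]. left. apply Rdiv_lt_0_compat; lra. }
  apply Rle_trans with ((Rabs Ct + 1) * (e / (2 * (Rabs Ct + 1)) * h)); [nra|].
  replace ((Rabs Ct + 1) * (e / (2 * (Rabs Ct + 1)) * h)) with (e * h / 2) by (field; lra).
  assert (0 < e * h) by (apply Rmult_lt_0_compat; lra). lra.
Qed.

End Bounded.

Lemma nmaps_whole (S : E0 -> E0) C : maps N0 N0 S C -> nmaps S C.
Proof. intros H x r Hx. apply bd_whole. apply H. now apply bd_whole. Qed.

Lemma N1_N0 : exists C, 0 < C /\ forall x r, N1 x r -> N0 x (C * r).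
Proof.
destruct (bd_ambient E1) as [C [HC H]]. exists C. split; [exact HC|].
intros x r Hx. apply bd_whole. now apply H.
Qed.

(** The graph norm of [A] controls the norm of [E1]: on [E1] the identity is
    [T t - J A], where [J] is the integral of the semigroup over [0, t], and both
    [T t] and [J] are bounded from [E0] to [E1] by the closed graph theorem. *)
Lemma generator_smoothing : exists t0 M, smoothing_semigroup A T t0 M.
Proof using HA HT HTa HG.
destruct T_bounded as [M0 [t1 [HM0 [Ht1 TM1]]]].
destruct (analytic_rder HTa) as [C [t2 [HC [Ht2 Sm]]]].
pose (t0 := Rmin t1 t2).
assert (Ht0 : 0 < t0) by now apply Rmin_glb_lt.
assert (t01 : t0 <= t1) by apply Rmin_l. assert (t02 : t0 <= t2) by apply Rmin_r.
assert (TM : forall t, 0 <= t <= t0 -> maps N0 N0 (T t) M0) by (intros; apply TM1; lra).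
clear TM1.
assert (Smooth : forall t x, 0 < t <= t0 -> mem E1 (T t x) /\ N0 (A (T t x)) (C / t * norm x) /\
  rder N0 (fun s => T s x) t (A (T t x))).
{ intros t x Ht. destruct (Sm t x ltac:(lra)) as [y [D Hy]].
  assert (D' := rder_embed whole_norm_gauge D).
  assert (D0 := proj2 (T_rder_shift x y (Rlt_le _ _ (proj1 Ht))) D').
  apply gen_iff in D0. destruct D0 as [D1 D2]. rewrite D2.
  split; [exact D1|]. split; [now apply bd_whole|exact D']. }
destruct N1_N0 as [Ce [HCe Emb]].
destruct (@closed_graph _ E0 N1 (T t0) M0 Ce) as [Ct [HCt Bt]].
{ apply norm_complete. } { apply bd_complete. }
{ intros x r Hx. apply bd_whole. now apply Emb. }
{ apply T_real_linear. lra. } { apply nmaps_whole, TM. lra. }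
{ intros x. exists (norm (elt E1 (T t0 x))). apply bd_norm. apply Smooth. lra. }
pose (J := fun x => epsilon (inhabits (vzero : E0)) (fun y => is_int N0 (fun s => T s x) 0 t0 y)).
assert (HJ : forall x, is_int N0 (fun s => T s x) 0 t0 (J x)).
{ intros x. unfold J. apply epsilon_spec. apply (T_int_exists HM0 Ht0 TM). lra. }
assert (JD : forall x y t, 0 <= t -> is_int N0 (fun s => T s x) 0 t y ->
  mem E1 y /\ A y = T t x -v x).
{ intros x y t Ht Iy. apply gen_iff. exact (T_int_domain HM0 Ht0 TM Ht Iy). }
assert (JL : real_linear J).
{ split.
  - intros x y. apply (int_unique (HJ (x +v y))).
    apply (int_ext (g := fun s => T s x +v T s y)).
    + intros s Hs. symmetry. apply (proj1 (T_real_linear (t := s) ltac:(lra))).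
    + now apply int_add.
  - intros c x. apply (int_unique (HJ (c *v x))).
    apply (int_ext (g := fun s => c *v T s x)).
    + intros s Hs. symmetry. apply (proj2 (T_real_linear (t := s) ltac:(lra))).
    + now apply int_scal. }
assert (JM : maps N0 N0 J (M0 * t0)).
{ intros x r Hx. apply gbd_le with (M0 * r * (t0 - 0)); [|lra].
  apply (int_bound_const (HJ x)). intros s Hs. apply TM; [lra|exact Hx]. }
destruct (@closed_graph _ E0 N1 J (M0 * t0) Ce) as [CJ [HCJ BJ]].
{ apply norm_complete. } { apply bd_complete. }
{ intros x r Hx. apply bd_whole. now apply Emb. }
{ exact JL. } { now apply nmaps_whole. }
{ intros x. exists (norm (elt E1 (J x))). apply bd_norm. apply (JD x (J x) t0 ltac:(lra)), HJ. }
destruct (linear_norm _ HA) as [CA [HCA BA]].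
assert (AM : maps N1 N0 A CA).
{ intros x r [z [<- Hz]]. unfold A. rewrite elt_emb. apply bd_whole.
  eapply Rle_trans; [apply BA|]. apply Rmult_le_compat_l; lra. }
pose (G := Ct + CJ).
assert (Graph : forall x r s, mem E1 x -> N0 x r -> N0 (A x) s -> N1 x (G * (r + s))).
{ intros x r s Hx Hr Hs.
  assert (EJ : J (A x) = T t0 x -v x).
  { apply (int_unique (HJ (A x))). split; [lra|]. exists (fun s => T s x).
    rewrite T_0. repeat split.
    - intros t Ht. now apply (T_cont HM0 Ht0 TM).
    - intros t Ht. apply T_der; [exact Hx|lra]. }
  assert (B1 := Bt _ _ (proj1 (@bd_whole k E0 _ _) Hr)).
  assert (B2 := BJ _ _ (proj1 (@bd_whole k E0 _ _) Hs)). rewrite EJ in B2.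
  apply gbd_le with (Ct * r + CJ * s).
  - apply (gbd_eq (gbd_sub B1 B2)). vec.
  - assert (P1 := gbd_pos Hr). assert (P2 := gbd_pos Hs). unfold G. nra. }
assert (HG0 : 0 < G) by (unfold G; lra).
assert (Diff : forall t h, 0 < t -> 0 < h -> t + h <= t0 ->
  maps N0 N0 (fun x => T (t + h) x -v T t x) ((C + 2 * M0) * Rmin 1 (h / t))).
{ intros t h Pt Ph Hth x r Hx. assert (Pr := gbd_pos Hx).
  unfold Rmin. destruct (Rle_dec 1 (h / t)) as [c|c].
  - apply gbd_le with (M0 * r + M0 * r); [|nra].
    apply gbd_sub; apply TM; try lra; exact Hx.
  - apply gbd_le with (C / t * norm x * (t + h - t)).
    + apply (mean_value_const (p := fun s => T s x)); [lra| |].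
      * intros s Hs. apply cont_sub with (icc 0 t0); [unfold icc; intros; lra|].
        apply (T_cont HM0 Ht0 TM). lra.
      * intros s Hs. destruct (Smooth s x ltac:(lra)) as [_ [B D]].
        exists (A (T s x)). split; [exact D|]. apply (gbd_le B).
        apply Rmult_le_compat_r; [apply norm_ge_0|]. apply Rmult_le_compat_l; [lra|].
        apply Rinv_le_contravar; lra.
    + assert (Hx' := proj1 (@bd_whole k E0 _ _) Hx).
      replace (C / t * norm x * (t + h - t)) with (C * (h / t) * norm x) by (field; lra).
      assert (Pht : 0 < h / t) by now apply Rdiv_lt_0_compat.
      apply Rle_trans with (C * (h / t) * r).
      * apply Rmult_le_compat_l; [|exact Hx']. apply Rmult_le_pos; lra.
      * apply Rmult_le_compat_r; [exact Pr|]. apply Rmult_le_compat_r; lra. }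
assert (A_diff : forall t h x, mem E1 x -> 0 < t -> 0 < h ->
  mem E1 (T (t + h) x -v T t x) /\ A (T (t + h) x -v T t x) = T (t + h) (A x) -v T t (A x)).
{ intros t h x Hx Pt Ph.
  destruct (@T_domain x (t + h) Hx ltac:(lra)) as [D1 D2].
  destruct (@T_domain x t Hx ltac:(lra)) as [D3 D4].
  split; [now apply mem_sub|]. rewrite A_sub by assumption. now rewrite D2, D4. }
pose (K1 := G * (M0 * t0 + C)). pose (K2 := G * M0 * (Ce + CA)).
pose (K3 := C + 2 * M0). pose (K4 := G * K3 * (Ce + CA)).
assert (P1 : 0 < K1).
{ apply Rmult_lt_0_compat; [exact HG0|].
  assert (0 < M0 * t0) by (apply Rmult_lt_0_compat; lra). lra. }
assert (P2 : 0 < K2) by (repeat apply Rmult_lt_0_compat; lra).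
assert (P3 : 0 < K3) by (unfold K3; lra).
assert (P4 : 0 < K4) by (repeat apply Rmult_lt_0_compat; lra).
exists t0, (M0 + K1 + K2 + K3 + K4 + CA + G). split.
- exact Ht0.
- lra.
- intros t. exact (@T_linear t).
- apply T_0.
- apply T_add.
- intros t Ht x r Hx. apply (gbd_le (TM t Ht x r Hx)).
  apply Rmult_le_compat_r; [exact (gbd_pos Hx)|lra].
- apply T_cont0.
- intros x y. apply gen_iff.
- intros x t. apply T_der.
- intros t Ht x r Hx. destruct (Smooth t x Ht) as [D1 [D2 _]].
  assert (Q := Graph _ _ _ D1 (TM t ltac:(lra) x r Hx) D2).
  apply (gbd_le Q). assert (Hx' := proj1 (@bd_whole k E0 _ _) Hx).
  assert (Pr := gbd_pos Hx).
  apply Rle_trans with (K1 / t * r).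
  + unfold K1. replace (G * (M0 * t0 + C) / t * r) with (G * (M0 * t0 / t * r + C / t * r))
      by (field; lra).
    apply Rmult_le_compat_l; [lra|]. apply Rplus_le_compat.
    * apply Rmult_le_compat_r; [exact Pr|].
      apply Rmult_le_reg_r with t; [lra|]. unfold Rdiv. rewrite Rmult_assoc, Rinv_l by lra. nra.
    * apply Rmult_le_compat_l; [left; apply Rdiv_lt_0_compat; lra|exact Hx'].
  + apply Rmult_le_compat_r; [exact Pr|]. apply Rmult_le_compat_r; [|lra].
    left. apply Rinv_0_lt_compat. lra.
- intros t Ht x r Hx. destruct (@T_domain x t (bd_mem Hx) (proj1 Ht)) as [D1 D2].
  assert (Q1 := TM t Ht _ _ (Emb _ _ Hx)). assert (Q2 := TM t Ht _ _ (AM _ _ Hx)).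
  rewrite <- D2 in Q2. apply (gbd_le (Graph _ _ _ D1 Q1 Q2)).
  apply Rle_trans with (K2 * r); [right; unfold K2; ring|].
  apply Rmult_le_compat_r; [exact (gbd_pos Hx)|lra].
- intros t h Pt Ph Hth x r Hx. apply (gbd_le (Diff t h Pt Ph Hth x r Hx)).
  apply Rmult_le_compat_r; [exact (gbd_pos Hx)|].
  apply Rmult_le_compat_r; [|unfold K3 in *; lra].
  apply Rmin_glb; [lra|]. left. now apply Rdiv_lt_0_compat.
- intros t h Pt Ph Hth x r Hx. destruct (A_diff t h x (bd_mem Hx) Pt Ph) as [D1 D2].
  assert (Q1 := Diff t h Pt Ph Hth _ _ (Emb _ _ Hx)).
  assert (Q2 := Diff t h Pt Ph Hth _ _ (AM _ _ Hx)). cbn beta in Q1, Q2.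
  rewrite <- D2 in Q2. apply (gbd_le (Graph _ _ _ D1 Q1 Q2)).
  assert (Pm : 0 <= Rmin 1 (h / t)).
  { apply Rmin_glb; [lra|]. left. now apply Rdiv_lt_0_compat. }
  apply Rle_trans with (K4 * Rmin 1 (h / t) * r); [right; unfold K4, K3; ring|].
  apply Rmult_le_compat_r; [exact (gbd_pos Hx)|]. apply Rmult_le_compat_r; lra.
- intros x y. apply A_sub.
- intros x r Hx. apply (gbd_le (AM x r Hx)).
  apply Rmult_le_compat_r; [exact (gbd_pos Hx)|lra].
- intros x r s Hx Hr Hs. apply (gbd_le (Graph x r s Hx Hr Hs)).
  assert (Q1 := gbd_pos Hr). assert (Q2 := gbd_pos Hs).
  apply Rmult_le_compat_r; lra.
- intros x y t Ht. apply JD. lra.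
Qed.

End Analysis.

End Semigroup.

(** * Interpolation of operators *)

Section Interpolate.

Context {k : scalar_field} {E0 : CompleteNormedModule (Kring k)}.
Implicit Types X Y Z : banach_in E0.

Lemma restr_bounded (S : E0 -> E0) X Y m : is_linear S -> 0 < m -> maps (bd X) (bd Y) S m ->
  bounded_between S X Y /\ opnorm (@restr (Kring k) E0 E0 S (X) (Y)) <= m.
Proof.
intros L Hm H.
assert (Mx : forall x : X, mem Y (S (emb x))).
{ intros x. apply (@bd_mem _ _ Y _ (m * norm x)). apply H, bd_emb. lra. }
assert (Nx : forall x : X, norm (@restr (Kring k) E0 E0 S (X) (Y) x) <= m * norm x).
{ intros x. apply norm_elt_le. apply H, bd_emb. lra. }
split; [split; [exact Mx|split]|].
- intros x y. apply emb_inj. unfold restr.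
  transitivity (S (emb (plus x y))); [now apply emb_elt|].
  transitivity (S (emb x +v emb y)); [f_equal; exact (emb_plus x y)|].
  transitivity (S (emb x) +v S (emb y)); [exact (linear_plus _ L _ _)|].
  transitivity (emb (elt Y (S (emb x))) +v emb (elt Y (S (emb y)))).
  + f_equal; symmetry; now apply emb_elt.
  + symmetry. exact (emb_plus _ _).
- intros c x. apply emb_inj. unfold restr.
  transitivity (S (emb (scal c x))); [now apply emb_elt|].
  transitivity (S (scal c (emb x))); [f_equal; exact (linear_scal _ (emb_linear X) c x)|].
  transitivity (scal c (S (emb x))); [exact (linear_scal _ L c _)|].
  transitivity (scal c (emb (elt Y (S (emb x))))).
  + f_equal. symmetry. now apply emb_elt.
  + symmetry. exact (linear_scal _ (emb_linear Y) c _).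
- exists m. split; [exact Hm|exact Nx].
- apply opnorm_le; [lra|exact Nx].
Qed.

(** Positive bounds in place of the operator norms, which may vanish, allow real
    powers that obey the usual laws. *)
Lemma interpolate_operator (F : couple_map (Kring k)) theta : 0 < theta < 1 ->
  functor_of_exponent F theta -> exists c, 0 < c /\
  forall X0 X1 Y0 Y1 (S : E0 -> E0) m0 m1, is_linear S -> 0 < m0 -> 0 < m1 ->
    maps (bd X0) (bd Y0) S m0 -> maps (bd X1) (bd Y1) S m1 ->
    maps (bd (F E0 X0 X1)) (bd (F E0 Y0 Y1)) S (c * (Rpower m0 (1 - theta) * Rpower m1 theta)).
Proof.
intros Hth [[_ F2] [c Hc]]. exists (Rabs c + 1). assert (Pc := Rabs_pos c).
split; [lra|]. intros X0 X1 Y0 Y1 S m0 m1 L H0 H1 B0 B1.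
destruct (restr_bounded L H0 B0) as [R0 O0]. destruct (restr_bounded L H1 B1) as [R1 O1].
assert (CM : couple_morphism S X0 X1 Y0 Y1).
{ split; [|split; assumption]. intros x0 x1. exact (linear_plus _ L _ _). }
destruct (F2 _ _ _ _ _ _ _ CM) as [R2 R3].
assert (O2 := Hc _ _ _ _ _ _ _ CM).
intros x r [z [<- Hz]].
assert (Q := opnorm_bound (k := k) z R3).
exists (@restr (Kring k) E0 E0 S (F E0 X0 X1) (F E0 Y0 Y1) z). split; [now apply emb_elt|].
assert (Pz := norm_ge_0 z).
assert (P0 := rpow_ge0 (opnorm (@restr (Kring k) E0 E0 S (X0) (Y0))) (1 - theta)).
assert (P1 := rpow_ge0 (opnorm (@restr (Kring k) E0 E0 S (X1) (Y1))) theta).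
assert (Q0 := rpow_le (a := 1 - theta) ltac:(lra) O0).
assert (Q1 := rpow_le (a := theta) ltac:(lra) O1).
rewrite (rpow_Rpower (1 - theta) H0) in Q0. rewrite (rpow_Rpower theta H1) in Q1.
eapply Rle_trans; [exact Q|].
set (p0 := rpow _ (1 - theta)) in *. set (p1 := rpow _ theta) in *.
apply Rle_trans with (c * p0 * p1 * norm z).
- apply Rmult_le_compat_r; [exact Pz|exact O2].
- apply Rmult_le_compat; [| |..].
  + destruct (Rle_lt_dec 0 (c * p0 * p1)) as [h|h]; [exact h|].
    exfalso. assert (N := opnorm_ge0 (k := k) R3). lra.
  + exact Pz.
  + rewrite Rmult_assoc. apply Rle_trans with (Rabs c * (p0 * p1)).
    * apply Rmult_le_compat_r; [now apply Rmult_le_pos|apply Rle_abs].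
    * apply Rmult_le_compat; try lra; [now apply Rmult_le_pos|]. apply Rmult_le_compat; lra.
  + exact Hz.
Qed.

Lemma intermediate_from X0 X1 Z C0 : intermediate X0 X1 Z ->
  (forall x r, bd X1 x r -> bd X0 x (C0 * r)) ->
  exists C, 0 < C /\ forall x r, bd X1 x r -> bd Z x (C * r).
Proof.
intros [[C H] _] Emb. exists (Rabs C * (Rabs C0 + 1) + 1).
assert (P := Rabs_pos C). assert (P0 := Rabs_pos C0).
split; [assert (0 <= Rabs C * (Rabs C0 + 1)) by (apply Rmult_le_pos; lra); lra|].
intros x r [x1 [<- Hx1]].
destruct (Emb _ _ (proj2 (bd_emb x1 _) Hx1)) as [x0 [E Hx0]].
destruct (H x0 x1 E) as [z [Ez Hz]]. exists z. split; [congruence|].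
assert (Pr : 0 <= r) by (assert (Q := norm_ge_0 x1); lra).
assert (Hm : Rmax (norm x0) (norm x1) <= (Rabs C0 + 1) * r).
{ apply Rmax_lub; [|nra]. assert (Q := Rle_abs C0).
  apply Rle_trans with (C0 * r); [exact Hx0|]. apply Rmult_le_compat_r; lra. }
assert (Pm : 0 <= Rmax (norm x0) (norm x1)).
{ apply Rle_trans with (norm x0); [apply norm_ge_0|apply Rmax_l]. }
apply Rle_trans with (Rabs C * Rmax (norm x0) (norm x1)).
- eapply Rle_trans; [exact Hz|]. apply Rmult_le_compat_r; [exact Pm|apply Rle_abs].
- apply Rle_trans with (Rabs C * ((Rabs C0 + 1) * r)); [now apply Rmult_le_compat_l|]. lra.
Qed.

Lemma intermediate_to X0 X1 Z C0 : intermediate X0 X1 Z ->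
  (forall x r, bd X1 x r -> bd X0 x (C0 * r)) ->
  exists C, 0 < C /\ forall x r, bd Z x r -> bd X0 x (C * r).
Proof.
intros [_ [C H]] Emb. exists (Rabs C * (Rabs C0 + 1) + 1).
assert (P := Rabs_pos C). assert (P0 := Rabs_pos C0).
split; [assert (0 <= Rabs C * (Rabs C0 + 1)) by (apply Rmult_le_pos; lra); lra|].
intros x r [z [<- Hz]].
destruct (H z) as [x0 [x1 [E Hn]]].
assert (Q0 : bd X0 (emb x0) (norm x0)) by (apply bd_emb; lra).
assert (Q1 : bd X1 (emb x1) (norm x1)) by (apply bd_emb; lra).
assert (P1 := norm_ge_0 x0). assert (P2 := norm_ge_0 x1). assert (P3 := norm_ge_0 z).
apply gbd_le with (norm x0 + C0 * norm x1).
- apply (gbd_eq (gbd_add Q0 (Emb _ _ Q1))). exact E.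
- assert (Q := Rle_abs C0). assert (Q' := Rle_abs C).
  apply Rle_trans with ((Rabs C0 + 1) * (norm x0 + norm x1)); [nra|].
  apply Rle_trans with ((Rabs C0 + 1) * (Rabs C * r)).
  + apply Rmult_le_compat_l; [lra|]. apply Rle_trans with (C * norm z); [exact Hn|].
    apply Rle_trans with (Rabs C * norm z); [now apply Rmult_le_compat_r|].
    now apply Rmult_le_compat_l.
  + nra.
Qed.

Lemma is_linear_sub (S S' : E0 -> E0) : is_linear S -> is_linear S' ->
  is_linear (fun x => S x -v S' x).
Proof.
intros L L'.
assert (Lo : is_linear (fun x => opp (S' x))).
{ apply (is_linear_comp S' (fun x : E0 => opp x) L').
  exact (is_linear_opp (V := E0)). }
exact (is_linear_comp (fun x => (S x, opp (S' x))) (fun p => plus (fst p) (snd p))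
  (is_linear_prod _ _ L Lo) is_linear_plus).
Qed.

End Interpolate.

(** * The semigroup on the interpolation scale *)

(** The bounds of a weakly singular convolution kernel. The one for increments
    yields the Hoelder continuity in time of convolutions. *)
Definition kernel {k} {V : NormedModule (Kring k)} (T : R -> V -> V) (t0 : R)
    (Y Z : gauge V) (a C : R) : Prop :=
  (forall t, 0 < t <= t0 -> maps Y Z (T t) (C * Rpower t (- a))) /\
  (forall mu t h, 0 <= mu <= 1 -> 0 < t -> 0 < h -> t + h <= t0 ->
     maps Y Z (fun x => T (t + h) x -v T t x) (C * (Rpower h mu * Rpower t (- a - mu)))).

Lemma kernel_le k (V : NormedModule (Kring k)) (T : R -> V -> V) t0 (Y Z : gauge V) a C C' :
  C <= C' -> kernel T t0 Y Z a C -> kernel T t0 Y Z a C'.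
Proof.
intros HC [H1 H2]. split.
- intros t Ht x r Hx. apply (gbd_le (H1 t Ht x r Hx)).
  apply Rmult_le_compat_r; [exact (gbd_pos Hx)|].
  apply Rmult_le_compat_r; [left; apply Rpower_pos|exact HC].
- intros mu t h Hmu Ht Hh Hth x r Hx. apply (gbd_le (H2 mu t h Hmu Ht Hh Hth x r Hx)).
  apply Rmult_le_compat_r; [exact (gbd_pos Hx)|].
  apply Rmult_le_compat_r; [|exact HC].
  left. apply Rmult_lt_0_compat; apply Rpower_pos.
Qed.

Lemma Rmin_Rpower x mu : 0 < x -> 0 <= mu <= 1 -> Rmin 1 x <= Rpower x mu.
Proof.
intros Hx Hmu. destruct (Rle_lt_dec 1 x) as [h|h].
- apply Rle_trans with 1; [apply Rmin_l|].
  rewrite <- (Rpower_O x Hx) at 1. apply Rle_Rpower; lra.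
- apply Rle_trans with x; [apply Rmin_r|].
  assert (E : Rpower x mu = x * Rpower (/ x) (1 - mu)).
  { rewrite <- (Rpower_1 x) at 2 by exact Hx. unfold Rpower. rewrite ln_Rinv by exact Hx.
    rewrite <- exp_plus. f_equal. ring. }
  rewrite E. rewrite <- (Rmult_1_r x) at 1. apply Rmult_le_compat_l; [lra|].
  assert (Hi : 1 <= / x).
  { rewrite <- Rinv_1 at 1. apply Rinv_le_contravar; lra. }
  rewrite <- (Rpower_O (/ x)) at 1 by lra. apply Rle_Rpower; lra.
Qed.

Lemma Rpower_div x c a : 0 < x -> 0 < c -> Rpower (x / c) a = Rpower x a * Rpower c (- a).
Proof.
intros Hx Hc. unfold Rpower, Rdiv. rewrite ln_mult; [|exact Hx|now apply Rinv_0_lt_compat].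
rewrite ln_Rinv by exact Hc. rewrite <- exp_plus. f_equal. ring.
Qed.

Section Scale.

Context {k : scalar_field} {E0 : CompleteNormedModule (Kring k)} (E1 : banach_in E0).
Context (A : E0 -> E0) (T : R -> E0 -> E0) (t0 M : R).
Context (SG : smoothing_semigroup E1 A T t0 M).
Context (F : R -> couple_map (Kring k)).
Arguments F : clear implicits.
Context (HF : forall theta, 0 < theta < 1 -> functor_of_exponent (F theta) theta).

Notation N0 := (bd (whole E0)).
Notation E := (interp_scale F E1).

Lemma scale_0 : E 0 = whole E0.
Proof. unfold interp_scale. destruct (Req_EM_T 0 0); [reflexivity|lra]. Qed.

Lemma scale_1 : E 1 = E1.
Proof.
unfold interp_scale. destruct (Req_EM_T 1 0); [lra|].
destruct (Req_EM_T 1 1); [reflexivity|lra].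
Qed.

Lemma scale_mid theta : 0 < theta < 1 -> E theta = F theta E0 (whole E0) E1.
Proof.
intros H. unfold interp_scale. destruct (Req_EM_T theta 0); [lra|].
destruct (Req_EM_T theta 1); [lra|reflexivity].
Qed.

Lemma scale_cases (P : R -> Prop) : P 0 -> P 1 -> (forall theta, 0 < theta < 1 -> P theta) ->
  forall theta, 0 <= theta <= 1 -> P theta.
Proof.
intros P0 P1 Pm theta H. destruct (Req_dec theta 0) as [->|H0]; [exact P0|].
destruct (Req_dec theta 1) as [->|H1]; [exact P1|]. apply Pm. lra.
Qed.

Lemma embed_scale_E0 : forall theta, 0 <= theta <= 1 ->
  exists C, 0 < C /\ forall x r, bd (E theta) x r -> N0 x (C * r).
Proof using HF.
destruct (N1_N0 E1) as [C1 [HC1 H1]].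
apply scale_cases.
- exists 1. split; [lra|]. rewrite scale_0. intros x r. now rewrite Rmult_1_l.
- exists C1. rewrite scale_1. auto.
- intros theta Hth. rewrite scale_mid by exact Hth.
  destruct (HF Hth) as [[I _] _]. exact (intermediate_to (I _ (whole E0) E1) H1).
Qed.

Lemma embed_E1_scale : forall theta, 0 <= theta <= 1 ->
  exists C, 0 < C /\ forall x r, bd E1 x r -> bd (E theta) x (C * r).
Proof using HF.
destruct (N1_N0 E1) as [C1 [HC1 H1]].
apply scale_cases.
- exists C1. rewrite scale_0. auto.
- exists 1. split; [lra|]. rewrite scale_1. intros x r. now rewrite Rmult_1_l.
- intros theta Hth. rewrite scale_mid by exact Hth.
  destruct (HF Hth) as [[I _] _]. exact (intermediate_from (I _ (whole E0) E1) H1).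
Qed.

Lemma Rpower_combine m th : 0 < m -> Rpower m (1 - th) * Rpower m th = m.
Proof.
intros Hm. rewrite <- Rpower_plus. replace (1 - th + th) with 1 by ring.
now apply Rpower_1.
Qed.

Lemma interpolate_endo theta : 0 <= theta <= 1 -> exists C, 0 < C /\
  forall S m, is_linear S -> 0 < m -> maps N0 N0 S m -> maps (bd E1) (bd E1) S m ->
  maps (bd (E theta)) (bd (E theta)) S (C * m).
Proof using HF.
revert theta. apply scale_cases.
- exists 1. split; [lra|]. rewrite scale_0. intros S m _ _ H _. now rewrite Rmult_1_l.
- exists 1. split; [lra|]. rewrite scale_1. intros S m _ _ _ H. now rewrite Rmult_1_l.
- intros theta Hth. rewrite scale_mid by exact Hth.
  destruct (@interpolate_operator k E0 (F theta) theta Hth (HF Hth)) as [c [Hc H]].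
  exists c. split; [exact Hc|]. intros S m L Hm H0 H1.
  assert (Q := H _ _ _ _ S m m L Hm Hm H0 H1). now rewrite Rpower_combine in Q.
Qed.

Lemma scale_bound theta : 0 <= theta <= 1 -> exists C, 0 < C /\
  forall t, 0 <= t <= t0 -> maps (bd (E theta)) (bd (E theta)) (T t) C.
Proof using HF SG.
intros Hth. destruct (interpolate_endo Hth) as [C [HC H]].
assert (HM := sg_M SG).
exists (C * M). split; [apply Rmult_lt_0_compat; lra|]. intros t Ht. apply H; [|lra|..].
- apply (sg_linear SG), Ht.
- now apply (sg_bound SG).
- now apply (sg_bound1 SG).
Qed.

Lemma scale_diff theta : 0 <= theta <= 1 -> exists C, 0 < C /\
  forall t h, 0 < t -> 0 < h -> t + h <= t0 ->
  maps (bd (E theta)) (bd (E theta)) (fun x => T (t + h) x -v T t x) (C * Rmin 1 (h / t)).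
Proof using HF SG.
intros Hth. destruct (interpolate_endo Hth) as [C [HC H]].
assert (HM := sg_M SG).
exists (C * M). split; [apply Rmult_lt_0_compat; lra|]. intros t h Ht Hh Hth'.
assert (Pm : 0 < Rmin 1 (h / t)) by (apply Rmin_glb_lt; [lra|now apply Rdiv_lt_0_compat]).
rewrite Rmult_assoc. apply H.
- apply is_linear_sub; apply (sg_linear SG); lra.
- apply Rmult_lt_0_compat; lra.
- now apply (sg_diff SG).
- now apply (sg_diff1 SG).
Qed.

(** Interpolation of [T t] between its bounds from [E0] to [E0] and from [E0] to
    [E1]; the functor maps the couple [(E0, E0)] to [E0]. *)
Lemma smoothing_from_E0 theta : 0 <= theta <= 1 -> exists C, 0 < C /\
  forall t, 0 < t <= t0 -> maps N0 (bd (E theta)) (T t) (C * Rpower t (- theta)).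
Proof using HF SG.
assert (HM := sg_M SG). revert theta. apply scale_cases.
- exists M. split; [lra|]. rewrite scale_0. intros t Ht.
  rewrite Ropp_0, Rpower_O, Rmult_1_r by lra. apply (sg_bound SG). lra.
- exists M. split; [lra|]. rewrite scale_1. intros t Ht.
  rewrite Rpower_Ropp, Rpower_1 by lra. now apply (sg_smooth SG).
- intros theta Hth. rewrite scale_mid by exact Hth.
  destruct (HF Hth) as [[I _] _].
  destruct (@interpolate_operator k E0 (F theta) theta Hth (HF Hth)) as [c [Hc H]].
  destruct (@intermediate_from k E0 _ _ _ 1 (I _ (whole E0) (whole E0))) as [C1 [HC1 H1]].
  { intros x r. now rewrite Rmult_1_l. }
  exists (c * M * C1). split; [repeat apply Rmult_lt_0_compat; lra|].
  intros t Ht x r Hx.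
  assert (Q := H _ _ _ _ (T t) M (M / t) (sg_linear SG (t := t) ltac:(lra)) ltac:(lra)
    ltac:(apply Rdiv_lt_0_compat; lra) (sg_bound SG (t := t) ltac:(lra)) (sg_smooth SG Ht)
    _ _ (H1 _ _ Hx)).
  apply (gbd_le Q). right. rewrite Rpower_div by lra.
  replace (c * (Rpower M (1 - theta) * (Rpower M theta * Rpower t (- theta))) * (C1 * r))
    with (c * (Rpower M (1 - theta) * Rpower M theta) * C1 * Rpower t (- theta) * r) by ring.
  rewrite Rpower_combine by lra. ring.
Qed.

(** The reiteration hypothesis of the theorem for the pair of indices. *)
Definition reiterated theta eta : Prop := exists G : couple_map (Kring k),
  functor_of_exponent G (theta / eta) /\ same_space (E theta) (G E0 (whole E0) (E eta)).

Lemma reiterated_1 theta : 0 < theta < 1 -> reiterated theta 1.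
Proof using HF.
intros Hth. exists (F theta). rewrite scale_1, scale_mid by exact Hth.
unfold Rdiv. rewrite Rinv_1, Rmult_1_r. split; [now apply HF|].
split; exists 1; intros x; exists x; (split; [reflexivity|lra]).
Qed.

Lemma scale_embed theta eta : 0 <= theta -> theta < eta -> eta <= 1 ->
  (0 < theta -> reiterated theta eta) ->
  exists C, 0 < C /\ forall x r, bd (E eta) x r -> bd (E theta) x (C * r).
Proof using HF.
intros H0 Hte H1 HR.
destruct (@embed_scale_E0 eta ltac:(lra)) as [C0 [HC0 Em]].
destruct (Req_dec theta 0) as [->|Hne].
- rewrite scale_0. now exists C0.
- destruct (HR ltac:(lra)) as [G [[[I _] _] [_ S2]]].
  destruct (intermediate_from (I _ (whole E0) (E eta)) Em) as [C1 [HC1 Em1]].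
  destruct (embedded_bd S2) as [C2 [HC2 Em2]].
  exists (C2 * C1). split; [now apply Rmult_lt_0_compat|]. intros x r Hx.
  apply (gbd_le (Em2 _ _ (Em1 _ _ Hx))). lra.
Qed.

(** For positive [theta], reiteration presents [E theta] as an interpolation space
    between [E0] and [E eta], and [T t] is interpolated between the smoothing from
    [E0] to [E eta] and its boundedness on [E eta]. *)
Lemma smoothing_scale theta eta : 0 <= theta -> theta < eta -> eta <= 1 ->
  (0 < theta -> reiterated theta eta) ->
  exists C, 0 < C /\ forall t, 0 < t <= t0 ->
    maps (bd (E theta)) (bd (E eta)) (T t) (C * Rpower t (- (eta - theta))).
Proof using HF SG.
intros H0 Hte H1 HR.
destruct (@smoothing_from_E0 eta ltac:(lra)) as [C0 [HC0 Sm]].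
destruct (Req_dec theta 0) as [->|Hne].
- rewrite scale_0. exists C0. split; [exact HC0|]. intros t Ht.
  rewrite Rminus_0_r. now apply Sm.
- destruct (HR ltac:(lra)) as [G [GF [S1 S2]]].
  assert (Hq : 0 < theta / eta < 1).
  { split; [apply Rdiv_lt_0_compat; lra|].
    apply Rmult_lt_reg_r with eta; [lra|]. unfold Rdiv. rewrite Rmult_assoc, Rinv_l; lra. }
  destruct (@interpolate_operator k E0 G _ Hq GF) as [c [Hc H]].
  destruct (@scale_bound eta ltac:(lra)) as [C1 [HC1 Bd]].
  destruct (embedded_bd S1) as [C2 [HC2 Em2]].
  destruct GF as [[I _] _].
  destruct (@intermediate_to k E0 _ _ _ 1 (I _ (E eta) (E eta))) as [C3 [HC3 Em3]].
  { intros x r. now rewrite Rmult_1_l. }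
  assert (P1 := Rpower_pos C0 (1 - theta / eta)). assert (P2 := Rpower_pos C1 (theta / eta)).
  exists (C3 * (c * (Rpower C0 (1 - theta / eta) * Rpower C1 (theta / eta))) * C2).
  split; [repeat apply Rmult_lt_0_compat; lra|]. intros t Ht x r Hx.
  assert (Pt := Rpower_pos t (- eta)).
  assert (Q := H _ _ _ _ (T t) (C0 * Rpower t (- eta)) C1 (sg_linear SG (t := t) ltac:(lra))
    ltac:(apply Rmult_lt_0_compat; lra) HC1 (Sm t Ht) (Bd t ltac:(lra)) _ _ (Em2 _ _ Hx)).
  apply (gbd_le (Em3 _ _ Q)). right.
  replace (Rpower (C0 * Rpower t (- eta)) (1 - theta / eta))
    with (Rpower C0 (1 - theta / eta) * Rpower t (- (eta - theta))); [ring|].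
  rewrite <- Rpower_mult_distr by lra. f_equal. rewrite Rpower_mult. f_equal. field. lra.
Qed.

(** Factor the increment as [(T (t / 2 + h) - T (t / 2)) T (t / 2)]: the right factor
    smooths, and the left one is small on the target space. *)
Lemma kernel_of_smoothing (Y : gauge E0) eta a C : 0 <= eta <= 1 -> 0 <= a -> 0 < C ->
  (forall t, 0 < t <= t0 -> maps Y (bd (E eta)) (T t) (C * Rpower t (- a))) ->
  exists C', 0 < C' /\ kernel T t0 Y (bd (E eta)) a C'.
Proof using HF SG.
intros Heta Ha HC H. destruct (scale_diff Heta) as [D [HD Df]].
pose (c := D * 2 * (C * Rpower 2 a)).
assert (Hc : 0 < c).
{ assert (P := Rpower_pos 2 a). unfold c. repeat apply Rmult_lt_0_compat; lra. }
exists (C + c). split; [lra|].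
apply (kernel_le (C := Rmax C c)); [apply Rmax_lub; lra|]. split.
- intros t Ht x r Hx. apply (gbd_le (H t Ht x r Hx)).
  apply Rmult_le_compat_r; [exact (gbd_pos Hx)|].
  apply Rmult_le_compat_r; [left; apply Rpower_pos|apply Rmax_l].
- intros mu t h Hmu Ht Hh Hth x r Hx.
  assert (Q := Df (t / 2) h ltac:(lra) Hh ltac:(lra) _ _ (H (t / 2) ltac:(lra) _ _ Hx)).
  cbn beta in Q. rewrite <- !(sg_add SG) in Q by lra.
  replace (t / 2 + h + t / 2) with (t + h) in Q by field.
  replace (t / 2 + t / 2) with t in Q by field.
  apply (gbd_le Q). rewrite Rpower_div by lra. rewrite Ropp_involutive.
  assert (Pr := gbd_pos Hx).
  assert (R1 : Rmin 1 (h / (t / 2)) <= 2 * (Rpower h mu * Rpower t (- mu))).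
  { eapply Rle_trans; [apply (@Rmin_Rpower _ mu); [apply Rdiv_lt_0_compat; lra|exact Hmu]|].
    rewrite Rpower_div by lra. rewrite Rpower_div by lra. rewrite Ropp_involutive.
    replace (Rpower h mu * (Rpower t (- mu) * Rpower 2 mu))
      with (Rpower 2 mu * (Rpower h mu * Rpower t (- mu))) by ring.
    apply Rmult_le_compat_r; [left; apply Rmult_lt_0_compat; apply Rpower_pos|].
    rewrite <- (Rpower_1 2) at 2 by lra. apply Rle_Rpower; lra. }
  replace (- a - mu) with (- mu + - a) by ring. rewrite Rpower_plus.
  assert (Pa := Rpower_pos t (- a)). assert (P2 := Rpower_pos 2 a).
  apply Rle_trans with (c * (Rpower h mu * (Rpower t (- mu) * Rpower t (- a))) * r).
  + unfold c.
    replace (D * 2 * (C * Rpower 2 a) * (Rpower h mu * (Rpower t (- mu) * Rpower t (- a))) * r)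
      with (D * (2 * (Rpower h mu * Rpower t (- mu))) * (C * (Rpower t (- a) * Rpower 2 a) * r)) by ring.
    apply Rmult_le_compat_r.
    * apply Rmult_le_pos; [|exact Pr]. left. repeat apply Rmult_lt_0_compat; lra.
    * apply Rmult_le_compat_l; lra.
  + apply Rmult_le_compat_r; [exact Pr|]. apply Rmult_le_compat_r; [|apply Rmax_r].
    left. repeat apply Rmult_lt_0_compat; apply Rpower_pos.
Qed.

Lemma kernel_scale theta eta : 0 <= theta -> theta < eta -> eta <= 1 ->
  (0 < theta -> reiterated theta eta) ->
  exists C, 0 < C /\ kernel T t0 (bd (E theta)) (bd (E eta)) (eta - theta) C.
Proof using HF SG.
intros H0 Hte H1 HR. destruct (smoothing_scale H0 Hte H1 HR) as [C [HC H]].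
exact (@kernel_of_smoothing _ eta (eta - theta) C ltac:(lra) ltac:(lra) HC H).
Qed.

Lemma cont0_E1 x e : mem E1 x -> 0 < e -> exists d, 0 < d /\
  forall h, 0 <= h < d -> bd E1 (T h x -v x) e.
Proof using SG.
intros Hx He. assert (HM := sg_M SG). assert (Ht0 := sg_t0 SG).
assert (He' : 0 < e / (2 * M)) by (apply Rdiv_lt_0_compat; lra).
destruct (sg_cont0 SG x He') as [d1 [Hd1 Q1]].
destruct (sg_cont0 SG (A x) He') as [d2 [Hd2 Q2]].
exists (Rmin t0 (Rmin d1 d2)). split; [apply Rmin_glb_lt; [exact Ht0|now apply Rmin_glb_lt]|].
intros h Hh. assert (M1 := Rmin_l t0 (Rmin d1 d2)). assert (M2 := Rmin_r t0 (Rmin d1 d2)).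
assert (M3 := Rmin_l d1 d2). assert (M4 := Rmin_r d1 d2).
assert (D := sg_der SG Hx (t := h) ltac:(lra)).
assert (MT : mem E1 (T h x) /\ A (T h x) = T h (A x)).
{ apply (sg_gen SG). intros e' He''. destruct (D e' He'') as [d [Hd Q]].
  exists d. split; [exact Hd|]. intros s Hs. assert (Q' := Q s Hs).
  rewrite Rplus_0_l, (sg_0 SG), <- (sg_add SG) by lra. now rewrite (Rplus_comm s h). }
replace e with (M * (e / (2 * M) + e / (2 * M))) by (field; lra).
apply (sg_graph SG).
- now apply mem_sub.
- apply Q1. lra.
- rewrite (sg_A_sub SG) by (try assumption; apply MT). rewrite (proj2 MT). apply Q2. lra.
Qed.

Context (theta : R) (Hth : 0 <= theta < 1).
Context (dense : forall x : E0, mem (E theta) x -> forall e, 0 < e ->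
  exists y, mem E1 y /\ bd (E theta) (x -v y) e).

Lemma cont0_scale x e : mem (E theta) x -> 0 < e -> exists d, 0 < d /\
  forall h, 0 <= h < d -> bd (E theta) (T h x -v x) e.
Proof using HF SG dense Hth.
intros Hx He. assert (Ht0 := sg_t0 SG).
destruct (@scale_bound theta ltac:(lra)) as [C [HC Bd]].
destruct (@embed_E1_scale theta ltac:(lra)) as [C1 [HC1 Em]].
destruct (@dense x Hx (e / (2 * (C + 1)))) as [y [My Hy]]; [apply Rdiv_lt_0_compat; lra|].
destruct (@cont0_E1 y (e / (2 * C1)) My) as [d [Hd Q]]; [apply Rdiv_lt_0_compat; lra|].
exists (Rmin t0 d). split; [now apply Rmin_glb_lt|]. intros h Hh.
assert (M1 := Rmin_l t0 d). assert (M2 := Rmin_r t0 d).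
assert (Q1 := Em _ _ (Q h ltac:(lra))). assert (Q2 := Bd h ltac:(lra) _ _ Hy).
rewrite (real_linear_sub _ _ (is_linear_real (sg_linear SG (proj1 Hh)))) in Q2.
eapply gbd_le.
- apply (gbd_eq (gbd_add (gbd_sub Q2 Hy) Q1)). vec.
- right. field. lra.
Qed.

(** The singularity of order [eta - theta] is attained at no single vector: there
    is none on [E1], which is dense. *)
Lemma decay_scale eta x e : theta < eta <= 1 -> (0 < theta -> reiterated theta eta) ->
  mem (E theta) x -> 0 < e -> exists d, 0 < d /\
  forall t, 0 < t < d -> bd (E eta) (T t x) (e * Rpower t (- (eta - theta))).
Proof using HF SG dense Hth.
intros Heta HR Hx He. assert (Ht0 := sg_t0 SG).
destruct (@smoothing_scale theta eta ltac:(lra) ltac:(lra) ltac:(lra) HR) as [C [HC Sm]].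
destruct (@scale_bound eta ltac:(lra)) as [C2 [HC2 Bd]].
destruct (@embed_E1_scale eta ltac:(lra)) as [C1 [HC1 Em]].
destruct (@dense x Hx (e / (2 * C))) as [y [My Hy]]; [apply Rdiv_lt_0_compat; lra|].
assert (By := bd_norm My). set (n := norm (elt E1 y)) in *.
assert (Pn : 0 <= n) by exact (gbd_pos By).
assert (Pc : 0 <= C2 * (C1 * n)) by (repeat apply Rmult_le_pos; lra).
destruct (@rpow_small (e / (2 * (C2 * (C1 * n) + 1))) (eta - theta)) as [d [Hd Q]];
  [lra|apply Rdiv_lt_0_compat; lra|].
exists (Rmin t0 d). split; [now apply Rmin_glb_lt|]. intros t Ht.
assert (M1 := Rmin_l t0 d). assert (M2 := Rmin_r t0 d).
assert (Q1 := Sm t ltac:(lra) _ _ Hy). assert (Q2 := Bd t ltac:(lra) _ _ (Em _ _ By)).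
rewrite (real_linear_sub _ _ (is_linear_real (sg_linear SG (t := t) ltac:(lra)))) in Q1.
assert (Q3 := Q t ltac:(lra)). rewrite rpow_Rpower in Q3 by lra.
assert (Pp := Rpower_pos t (- (eta - theta))). assert (Pq := Rpower_pos t (eta - theta)).
eapply gbd_le.
- apply (gbd_eq (gbd_add Q1 Q2)). vec.
- replace (C * Rpower t (- (eta - theta)) * (e / (2 * C)))
    with (e / 2 * Rpower t (- (eta - theta))) by (field; lra).
  assert (E1' : Rpower t (eta - theta) * Rpower t (- (eta - theta)) = 1).
  { rewrite <- Rpower_plus, Rplus_opp_r. apply Rpower_O. lra. }
  assert (C2 * (C1 * n) <= e / 2 * Rpower t (- (eta - theta))); [|lra].
  apply Rmult_le_reg_r with (Rpower t (eta - theta)); [exact Pq|].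
  replace (e / 2 * Rpower t (- (eta - theta)) * Rpower t (eta - theta))
    with (e / 2 * (Rpower t (eta - theta) * Rpower t (- (eta - theta)))) by ring.
  rewrite E1', Rmult_1_r.
  apply Rle_trans with ((C2 * (C1 * n) + 1) * (e / (2 * (C2 * (C1 * n) + 1)))).
  + apply Rmult_le_compat; lra.
  + right. field. lra.
Qed.

End Scale.

(** * Convolution with the semigroup *)

Section Reflect.

Context {k : scalar_field} {V : NormedModule (Kring k)}.
Implicit Types (B : gauge V).

Lemma increment_of_rder B (p : R -> V) (l : R -> V) l0 e a b : a <= b ->
  (forall t, a <= t <= b -> cont B p (icc a b) t) ->
  (forall t, a < t < b -> rder B p t (l t)) ->
  (forall t, a < t < b -> B (l t -v l0) e) ->
  (exists r, B l0 r) ->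
  B (p b -v p a -v (b - a) *v l0) (e * (b - a)).
Proof.
intros Hab Cp Dp Hl [r Hr].
assert (Q : B ((p b -v b *v l0) -v (p a -v a *v l0)) (e * (b - a))).
{ apply (mean_value_const (p := fun t => p t -v t *v l0)); [exact Hab| |].
  - intros t Ht. apply cont_minus; [now apply Cp|]. now apply cont_id with r.
  - intros t Ht. exists (l t -v l0). split; [|now apply Hl].
    apply rder_minus; [now apply Dp|]. apply rder_id. }
apply (gbd_eq Q). vec.
Qed.

(** Reflection exchanges left and right derivatives; the continuity of [g] makes
    them agree. *)
Lemma int_reflect B (g : R -> V) a b y c : is_int B g a b y ->
  (forall t, a < t < b -> cont B g (ioo a b) t /\ exists r, B (g t) r) ->
  is_int B (fun r => g (c - r)) (c - b) (c - a) y.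
Proof.
intros [Hab [G [CG [DG ->]]]] Cg. split; [lra|]. exists (fun r => (-1) *v G (c - r)).
repeat split.
- intros t Ht. apply cont_scal. intros e He.
  destruct (CG (c - t) ltac:(lra) e He) as [d [Hd Q]]. exists d. split; [exact Hd|].
  intros s Hs Hst. apply Q; [unfold icc in *; lra|].
  replace (c - s - (c - t)) with (- (s - t)) by ring. now rewrite Rabs_Ropp.
- intros t Ht e He.
  destruct (Cg (c - t) ltac:(lra)) as [Cgt Bgt].
  destruct (Cgt e He) as [d [Hd Q]].
  exists (Rmin d (c - t - a)). split; [apply Rmin_glb_lt; lra|]. intros h Hh.
  assert (M1 := Rmin_l d (c - t - a)). assert (M2 := Rmin_r d (c - t - a)).
  assert (I : B (G (c - t) -v G (c - (t + h)) -v (c - t - (c - (t + h))) *v g (c - t))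
    (e * (c - t - (c - (t + h))))).
  { apply increment_of_rder with g; [lra| | | |exact Bgt].
    - intros s Hs. apply cont_sub with (icc a b); [unfold icc; intros; lra|]. apply CG. lra.
    - intros s Hs. apply DG. lra.
    - intros s Hs. apply Q; [unfold ioo; lra|]. rewrite Rabs_left1; lra. }
  replace (c - t - (c - (t + h))) with h in I by ring.
  apply (gbd_eq I). vec.
- replace (c - (c - a)) with a by ring. replace (c - (c - b)) with b by ring. vec.
Qed.

End Reflect.

Section Convolution.

Context {k : scalar_field} {E0 : CompleteNormedModule (Kring k)} {E1 : banach_in E0}.
Context {A : E0 -> E0} {T : R -> E0 -> E0} {t0 M : R}.
Context (SG : smoothing_semigroup E1 A T t0 M).

Notation N0 := (bd (whole E0)).
Notation N1 := (bd E1).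

Lemma sg_rl t : 0 <= t -> real_linear (T t).
Proof using SG. intros Ht. apply is_linear_real, (sg_linear SG), Ht. Qed.

Lemma sg_cont x t : 0 <= t <= t0 -> cont N0 (fun s => T s x) (icc 0 t0) t.
Proof using SG.
apply (semigroup_cont (sg_M SG)).
- apply (sg_linear SG).
- apply (sg_add SG).
- apply (sg_bound SG).
- apply (sg_cont0 SG x).
Qed.

Definition conv (g : R -> E0) (t s : R) : E0 := T (t - s) (g s).

Lemma conv_cont (Y Z : gauge E0) a C g c t s r : kernel T t0 Y Z a C -> 0 <= a -> 0 < C ->
  t - c <= t0 -> c < s < t -> cont Y g (ioo c t) s -> Y (g s) r ->
  cont Z (conv g t) (ioo c t) s.
Proof using SG.
intros [K1 K2] Ha HC Htc Hs Cg Hr e He. assert (Pr := gbd_pos Hr).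
pose (l := (t - s) / 2). assert (Hl : 0 < l) by (unfold l; lra).
assert (P1 := Rpower_pos l (- a)). assert (P2 := Rpower_pos l (- a - 1)).
destruct (Cg (e / (2 * (C * Rpower l (- a))))) as [d [Hd Q]].
{ apply Rdiv_lt_0_compat; [exact He|]. apply Rmult_lt_0_compat; [lra|].
  apply Rmult_lt_0_compat; lra. }
pose (c2 := C * Rpower l (- a - 1) * (r + 1)).
assert (Hc2 : 0 < c2) by (unfold c2; repeat apply Rmult_lt_0_compat; lra).
exists (Rmin d (Rmin l (e / (2 * c2)))). split.
{ apply Rmin_glb_lt; [exact Hd|]. apply Rmin_glb_lt; [exact Hl|]. apply Rdiv_lt_0_compat; lra. }
intros s' Hs' Hss. unfold ioo in Hs'.
assert (M1 := Rmin_l d (Rmin l (e / (2 * c2)))). assert (M2 := Rmin_r d (Rmin l (e / (2 * c2)))).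
assert (M3 := Rmin_l l (e / (2 * c2))). assert (M4 := Rmin_r l (e / (2 * c2))).
assert (Hss' : Rabs (s' - s) < l) by lra. apply Rabs_def2 in Hss'.
assert (Hts : l <= t - s') by (unfold l in *; lra).
assert (F1 : Z (T (t - s') (g s' -v g s)) (e / 2)).
{ apply gbd_le with (C * Rpower (t - s') (- a) * (e / (2 * (C * Rpower l (- a))))).
  - apply K1; [lra|]. apply Q; [unfold ioo; lra|lra].
  - apply Rle_trans with (C * Rpower l (- a) * (e / (2 * (C * Rpower l (- a))))); [|right; field; lra].
    apply Rmult_le_compat_r.
    + left. apply Rdiv_lt_0_compat; [exact He|]. repeat apply Rmult_lt_0_compat; lra.
    + apply Rmult_le_compat_l; [lra|]. apply Rpower_antitone; lra. }
assert (F2 : forall u h, l <= u -> 0 < h -> u + h <= t0 -> h <= e / (2 * c2) ->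
  Z (T (u + h) (g s) -v T u (g s)) (e / 2)).
{ intros u h Hu Hh Huh Hhe.
  apply (gbd_le (K2 1 u h ltac:(lra) ltac:(lra) Hh Huh _ _ Hr)).
  rewrite Rpower_1 by exact Hh.
  apply Rle_trans with (c2 * (e / (2 * c2))); [|right; field; lra].
  apply Rle_trans with (c2 * h); [|apply Rmult_le_compat_l; lra].
  unfold c2. replace (C * Rpower l (- a - 1) * (r + 1) * h) with (C * (h * Rpower l (- a - 1)) * (r + 1)) by ring.
  apply Rmult_le_compat; [| |apply Rmult_le_compat_l; [lra|]|lra].
  - apply Rmult_le_pos; [lra|]. apply Rmult_le_pos; [lra|]. left. apply Rpower_pos.
  - exact Pr.
  - apply Rmult_le_compat_l; [lra|].
    replace (- a - 1) with (- (a + 1)) by ring. apply Rpower_antitone; lra. }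
assert (F3 : Z (T (t - s') (g s) -v T (t - s) (g s)) (e / 2)).
{ destruct (Rtotal_order s' s) as [h|[->|h]].
  - replace (t - s') with (t - s + (s - s')) by ring. rewrite Rabs_left in Hss by lra.
    apply F2; unfold l in *; lra.
  - apply gbd_le with 0; [|lra]. apply (gbd_eq (gbd_zero Z)). vec.
  - apply gbd_swap. replace (t - s) with (t - s' + (s' - s)) by ring.
    rewrite Rabs_pos_eq in Hss by lra. apply F2; lra. }
apply gbd_le with (e / 2 + e / 2); [|lra].
apply (gbd_eq (gbd_add F1 F3)). unfold conv.
rewrite (real_linear_sub _ _ (sg_rl (t := t - s') ltac:(lra))). vec.
Qed.

Section Bounds.

Context (Y : gauge E0) (a b C K : R) (Ha : 0 <= a < 1) (Hb : 0 <= b < 1) (HC : 0 < C) (HK : 0 <= K).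

Lemma conv_bound (Z : gauge E0) g c t y : kernel T t0 Y Z a C ->
  c < t -> t - c <= t0 ->
  (forall s, c < s < t -> Y (g s) (K * Rpower (s - c) (- b))) ->
  is_int Z (conv g t) c t y ->
  Z y (C * K * beta_const a b * Rpower (t - c) (1 - a - b)).
Proof using Ha Hb HC HK.
intros [K1 _] Hct Htc Hg I. apply int_beta_bound with (g := conv g t); try assumption.
- apply Rmult_le_pos; lra.
- intros s Hs. apply (gbd_le (K1 (t - s) ltac:(lra) _ _ (Hg s Hs))). right. ring.
Qed.

Lemma conv_exists (X : banach_in E0) g c t : kernel T t0 Y (bd X) a C ->
  c < t -> t - c <= t0 ->
  (forall s, c < s < t -> Y (g s) (K * Rpower (s - c) (- b))) ->
  (forall s, c < s < t -> cont Y g (ioo c t) s) ->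
  exists y, is_int (bd X) (conv g t) c t y.
Proof using Ha Hb HC HK SG.
intros Kn Hct Htc Hg Cg.
apply (@int_beta_exists _ _ (conv g t) c t a b (C * K)); try assumption.
- apply Rmult_le_pos; lra.
- intros s Hs. apply (conv_cont Kn (proj1 Ha) HC Htc Hs (Cg s Hs) (Hg s Hs)).
- intros s Hs. apply (gbd_le (proj1 Kn (t - s) ltac:(lra) _ _ (Hg s Hs))). right. ring.
Qed.

(** Hoelder continuity in time: the increment is the convolution with the
    increment of the kernel, plus the integral over the new interval. *)
Lemma conv_increment (Z : gauge E0) g c t h mu y y' : kernel T t0 Y Z a C ->
  0 <= mu -> a + mu < 1 -> c < t -> 0 < h -> t + h - c <= t0 ->
  (forall s, c < s < t + h -> Y (g s) (K * Rpower (s - c) (- b))) ->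
  is_int Z (conv g t) c t y -> is_int Z (conv g (t + h)) c (t + h) y' ->
  Z (y' -v y) (C * K * (beta_const (a + mu) b * Rpower (t - c) (1 - a - mu - b) * Rpower h mu
     + Rpower (t - c) (- b) * beta_const a 0 * Rpower h (1 - a))).
Proof using Ha Hb HC HK SG.
intros Kn Hmu Hamu Hct Hh Htc Hg I I'.
destruct (int_split (c := t) I' ltac:(lra)) as [y1 [y2 [I1 [I2 ->]]]].
assert (B1 : Z (y1 -v y) (C * (K * Rpower h mu) * beta_const (a + mu) b
    * Rpower (t - c) (1 - (a + mu) - b))).
{ assert (Ic := int_minus I1 I).
  apply (fun H1 H2 H3 H4 => int_beta_bound (p := a + mu) (q := b) (K := C * (K * Rpower h mu))
    H1 H2 H3 H4 Ic); try lra.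
  - apply Rmult_le_pos; [lra|]. apply Rmult_le_pos; [exact HK|]. left. apply Rpower_pos.
  - intros s Hs. unfold conv.
    replace (t + h - s) with (t - s + h) by ring.
    apply (gbd_le (proj2 Kn mu (t - s) h ltac:(lra) ltac:(lra) Hh ltac:(lra) _ _
      (Hg s ltac:(lra)))).
    right. replace (- (a + mu)) with (- a - mu) by ring. ring. }
assert (B2 : Z y2 (C * (K * Rpower (t - c) (- b)) * beta_const a 0 * Rpower (t + h - t) (1 - a - 0))).
{ apply (fun H1 H2 H3 H4 => int_beta_bound (p := a) (q := 0)
    (K := C * (K * Rpower (t - c) (- b))) H1 H2 H3 H4 I2); try lra.
  - apply Rmult_le_pos; [lra|]. apply Rmult_le_pos; [exact HK|]. left. apply Rpower_pos.
  - intros s Hs. rewrite Ropp_0, Rpower_O, Rmult_1_r by lra.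
    apply (gbd_le (proj1 Kn (t + h - s) ltac:(lra) _ _ (Hg s ltac:(lra)))).
    replace (C * (K * Rpower (t - c) (- b)) * Rpower (t + h - s) (- a))
      with (C * Rpower (t + h - s) (- a) * (K * Rpower (t - c) (- b))) by ring.
    apply Rmult_le_compat_l.
    + apply Rmult_le_pos; [lra|]. left. apply Rpower_pos.
    + apply Rmult_le_compat_l; [exact HK|]. apply Rpower_antitone; lra. }
eapply gbd_le.
- apply (gbd_eq (gbd_add B1 B2)). vec.
- right. replace (t + h - t) with h by ring. replace (1 - a - 0) with (1 - a) by ring.
  replace (1 - (a + mu) - b) with (1 - a - mu - b) by ring. ring.
Qed.

End Bounds.

(** * Mild solutions and their regularity *)

(** Stated between any two times, so that it can be restarted and localized. *)
Definition mild (g : R -> E0) (c d : R) (u : R -> E0) : Prop :=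
  forall s t, c <= s -> s < t -> t <= d ->
    is_int N0 (conv g t) s t (u t -v T (t - s) (u s)).

Lemma sg_maps t : 0 <= t -> exists C, maps N0 N0 (T t) C.
Proof using SG.
intros Ht. destruct (is_linear_nmaps (sg_linear SG Ht)) as [C H]. exists C. now apply maps_whole.
Qed.

Lemma conv_shift g c s t y : c <= s -> s < t -> is_int N0 (conv g s) c s y ->
  is_int N0 (conv g t) c s (T (t - s) y).
Proof using SG.
intros Hc Hst I. destruct (sg_maps (t := t - s) ltac:(lra)) as [C HC].
assert (Q := int_lin (sg_rl (t := t - s) ltac:(lra)) HC I).
revert Q. apply int_ext. intros r Hr. unfold conv.
rewrite <- (sg_add SG) by lra. f_equal. ring.
Qed.

Lemma mild_of_start g c d u :
  (forall t, c < t <= d -> is_int N0 (conv g t) c t (u t -v T (t - c) (u c))) ->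
  mild g c d u.
Proof using SG.
intros H s t Hs Hst Ht.
destruct (int_split (c := s) (H t ltac:(lra)) ltac:(lra)) as [y1 [y2 [I1 [I2 E]]]].
apply (int_eq I2).
assert (E1' : y1 = T (t - s) (u s) -v T (t - c) (u c)).
{ apply (int_unique I1). destruct (Req_dec c s) as [->|Hne].
  - apply int_eq with vzero; [apply int_point|vec].
  - apply int_eq with (T (t - s) (u s -v T (s - c) (u c))).
    + apply conv_shift; [exact Hs|exact Hst|]. apply H. lra.
    + rewrite (real_linear_sub _ _ (sg_rl (t := t - s) ltac:(lra))).
      rewrite <- (sg_add SG) by lra. do 3 f_equal. ring. }
rewrite E1' in E.
transitivity ((u t -v T (t - c) (u c)) -v (T (t - s) (u s) -v T (t - c) (u c))); [|vec].
rewrite E. vec.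
Qed.

Lemma mild_sub g c d u c' d' : c <= c' -> d' <= d -> mild g c d u -> mild g c' d' u.
Proof. intros H1 H2 H s t Hs Hst Ht. apply H; lra. Qed.

(** Strong solutions are mild: [T (t - s) (u s)] is an antiderivative of the
    convolution integrand. *)
Lemma mild_of_strong g u c d : d - c <= t0 ->
  (forall t, c <= t <= d -> cont N0 u (icc c d) t) ->
  (forall t, c < t < d -> mem E1 (u t) /\ rder N0 u t (A (u t) +v g t)) ->
  mild g c d u.
Proof using SG.
intros Hcd Cu Du. apply mild_of_start. intros t Ht. split; [lra|].
assert (HM := sg_M SG).
exists (fun r => T (t - r) (u r)). repeat split.
- intros r Hr e He.
  assert (He' : 0 < e / (2 * M)) by (apply Rdiv_lt_0_compat; lra).
  destruct (Cu r ltac:(lra) _ He') as [d1 [Hd1 Q1]].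
  destruct (@sg_cont (u r) (t - r) ltac:(lra) (e / 2) ltac:(lra)) as [d2 [Hd2 Q2]].
  exists (Rmin d1 d2). split; [now apply Rmin_glb_lt|]. intros s Hs Hsr. unfold icc in Hs.
  assert (M1 := Rmin_l d1 d2). assert (M2 := Rmin_r d1 d2).
  assert (F1 := sg_bound SG (t := t - s) ltac:(lra) (Q1 s ltac:(unfold icc; lra) ltac:(lra))).
  rewrite (real_linear_sub _ _ (sg_rl (t := t - s) ltac:(lra))) in F1.
  assert (F2 := Q2 (t - s) ltac:(unfold icc; lra)
    ltac:(replace (t - s - (t - r)) with (- (s - r)) by ring; rewrite Rabs_Ropp; lra)).
  eapply gbd_le; [exact (gbd_tri F1 F2)|]. right. field. lra.
- intros r Hr e He. destruct (Du r ltac:(lra)) as [Mr Dr].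
  assert (He' : 0 < e / (3 * M)) by (apply Rdiv_lt_0_compat; lra).
  destruct (Dr _ He') as [d1 [Hd1 Q1]].
  destruct (sg_der SG Mr (Rle_refl 0) He') as [d2 [Hd2 Q2]].
  destruct (@sg_cont (g r) (t - r) ltac:(lra) (e / 3) ltac:(lra)) as [d3 [Hd3 Q3]].
  exists (Rmin (Rmin d1 d2) (Rmin d3 (t - r))).
  split; [repeat apply Rmin_glb_lt; lra|]. intros h Hh.
  assert (M1 := Rmin_l (Rmin d1 d2) (Rmin d3 (t - r))).
  assert (M2 := Rmin_r (Rmin d1 d2) (Rmin d3 (t - r))).
  assert (M3 := Rmin_l d1 d2). assert (M4 := Rmin_r d1 d2).
  assert (M5 := Rmin_l d3 (t - r)). assert (M6 := Rmin_r d3 (t - r)).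
  set (s := t - (r + h)). assert (Hs : 0 <= s <= t0) by (unfold s; lra).
  assert (F1 := sg_bound SG Hs (Q1 h ltac:(lra))).
  assert (F2 := Q2 h ltac:(lra)). rewrite Rplus_0_l, !(sg_0 SG) in F2.
  apply (sg_bound SG Hs) in F2.
  assert (F3 := Q3 s ltac:(unfold icc; lra)
    ltac:(unfold s; replace (t - (r + h) - (t - r)) with (- h) by ring;
      rewrite Rabs_Ropp, Rabs_pos_eq; lra)).
  apply (gbd_scal_pos (c := h)) in F3; [|lra].
  assert (L := sg_rl (proj1 Hs)).
  rewrite !(real_linear_sub _ _ L), (proj2 L), ?(proj1 L) in F1.
  rewrite !(real_linear_sub _ _ L), (proj2 L) in F2.
  rewrite <- (sg_add SG) in F2 by lra.
  replace (s + h) with (t - r) in F2 by (unfold s; ring).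
  eapply gbd_le.
  + apply (gbd_eq (gbd_add (gbd_sub F1 F2) F3)). fold s. unfold conv. vec.
  + right. field. lra.
- rewrite Rminus_diag, (sg_0 SG). reflexivity.
Qed.

Section Regularity.

Context (g u : R -> E0) (c d K mu C : R).
Context (Hcd : d - c <= t0) (HK : 0 <= K) (Hmu : 0 < mu <= 1) (HC : 0 < C).
Context (K01 : kernel T t0 N0 N1 1 C).
Context (Hg : forall s t, c <= s -> s < t -> t <= d -> N0 (g t -v g s) (K * Rpower (t - s) mu)).
Context (Hu : mild g c d u) (Cu : forall t, c <= t <= d -> cont N0 u (icc c d) t).

Lemma holder_cont t : c <= t <= d -> cont N0 g (icc c d) t.
Proof using HK Hmu Hg.
intros Ht e He.
destruct (@rpow_small (e / (K + 1)) mu) as [d1 [Hd1 Q]]; [lra|apply Rdiv_lt_0_compat; lra|].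
exists d1. split; [exact Hd1|]. intros s Hs Hst. unfold icc in Hs.
assert (F : forall x, 0 < x < d1 -> K * Rpower x mu <= e).
{ intros x Hx. assert (Q' := Q x ltac:(lra)). rewrite rpow_Rpower in Q' by lra.
  assert (P := Rpower_pos x mu).
  apply Rle_trans with ((K + 1) * (e / (K + 1))); [|right; field; lra].
  apply Rmult_le_compat; lra. }
destruct (Rtotal_order s t) as [h|[->|h]].
- rewrite Rabs_left in Hst by lra. apply gbd_swap.
  apply (gbd_le (Hg (s := s) (t := t) ltac:(lra) h ltac:(lra))). apply F. lra.
- apply gbd_le with 0; [|lra]. apply (gbd_eq (gbd_zero N0)). vec.
- rewrite Rabs_pos_eq in Hst by lra.
  apply (gbd_le (Hg (s := t) (t := s) ltac:(lra) h ltac:(lra))). apply F. lra.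
Qed.

(** The part of a mild solution gained over a short interval [s, t]: freezing
    [g] at time [t] leaves an integrand that is integrable in [E1], and the
    frozen part is explicit. *)
Lemma tail_E1 s t r : c <= s -> s < t -> t <= d -> N0 (T (t - s) (g t) -v g t) r ->
  N1 (u t -v T (t - s) (u s))
    (C * K * beta_const (1 - mu) 0 * Rpower (t - s) mu
     + M * (M * norm (g t) * (t - s) + r)).
Proof using SG Hcd HK Hmu HC K01 Hg Hu.
intros Hs Hst Ht Hr.
assert (HM := sg_M SG).
assert (Cg : forall x, s < x < t -> cont N0 (fun r => g r -v g t) (ioo s t) x).
{ intros x Hx. apply cont_minus; [|apply cont_const].
  apply cont_sub with (icc c d); [unfold ioo, icc; intros; lra|]. apply holder_cont. lra. }
assert (Bg : forall x, s < x < t -> N0 (g x -v g t) (K * Rpower (t - x) mu)).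
{ intros x Hx. apply gbd_swap. apply Hg; lra. }
assert (HCK : 0 <= C * K) by (apply Rmult_le_pos; lra).
assert (Bc : forall x, s < x < t -> N1 (conv (fun r => g r -v g t) t x)
  (C * K * (Rpower (t - x) (- (1 - mu)) * Rpower (x - s) (- 0)))).
{ intros x Hx. apply (gbd_le (proj1 K01 (t - x) ltac:(lra) _ _ (Bg x Hx))).
  right. rewrite Ropp_0, (Rpower_O (x - s)) by lra.
  replace (- (1 - mu)) with (- (1) + mu) by ring. rewrite Rpower_plus. ring. }
destruct (@int_beta_exists _ _ (conv (fun r => g r -v g t) t) s t (1 - mu) 0 (C * K)
  Hst ltac:(lra) ltac:(lra) HCK E1) as [y1 I1]; [|exact Bc|].
{ intros x Hx. assert (Hts : t - s <= t0) by lra.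
  exact (conv_cont K01 Rle_0_1 HC Hts Hx (Cg x Hx) (Bg x Hx)). }
assert (B1 := int_beta_bound Hst (p := 1 - mu) (q := 0) ltac:(lra) ltac:(lra) HCK I1 Bc).
replace (1 - (1 - mu) - 0) with mu in B1 by ring.
destruct (N1_N0 E1) as [Ce [_ Em]].
assert (I1' := int_embed Em I1).
(* By [sg_int] the integral of [T r (g t)] is in [E1], and [sg_graph] bounds it. *)
destruct (@int_exists _ _ (whole E0) (fun r => T r (g t)) (fun r => M * norm (g t) * r)
  (fun _ => M * norm (g t)) 0 (t - s)) as [y2 I2].
{ lra. }
{ intros x Hx. apply cont_sub with (icc 0 t0); [unfold ioo, icc; intros; lra|].
  apply sg_cont. lra. }
{ intros x _. apply Rcont_scal, Rcont_continuous, continuous_id. }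
{ intros x _. auto_derive; [exact I|ring]. }
{ intros x Hx. apply (sg_bound SG); [lra|apply N0_norm]. }
destruct (sg_int SG (t := t - s) ltac:(lra) I2) as [D1 D2].
assert (B2 : N0 y2 (M * norm (g t) * (t - s - 0))).
{ apply (int_bound_const I2). intros x Hx. apply (sg_bound SG); [lra|apply N0_norm]. }
rewrite Rminus_0_r in B2.
rewrite <- D2 in Hr.
assert (B3 := sg_graph SG D1 B2 Hr).
assert (I2' : is_int N0 (conv (fun _ => g t) t) s t y2).
{ assert (Q := int_reflect t I2). replace (t - (t - s)) with s in Q by ring.
  rewrite Rminus_0_r in Q. apply Q. intros x Hx. split.
  - apply cont_sub with (icc 0 t0); [unfold ioo, icc; intros; lra|]. apply sg_cont. lra.
  - exists (norm (T x (g t))). apply N0_norm. }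
assert (I3 : is_int N0 (conv g t) s t (y1 +v y2)).
{ apply (int_ext (g := fun x => conv (fun r => g r -v g t) t x +v conv (fun _ => g t) t x)).
  - intros x Hx. unfold conv. rewrite (real_linear_sub _ _ (sg_rl (t := t - x) ltac:(lra))). vec.
  - now apply int_add. }
rewrite (int_unique (Hu Hs Hst Ht) I3).
exact (gbd_add B1 B3).
Qed.

Lemma mild_mem t : c < t <= d -> mem E1 (u t).
Proof using SG Hcd HK Hmu HC K01 Hg Hu.
intros Ht.
assert (Q := tail_E1 (s := c) (t := t) (Rle_refl c) ltac:(lra) ltac:(lra) (N0_norm _)).
assert (Q' := sg_smooth SG (t := t - c) ltac:(lra) (N0_norm (u c))).
apply (bd_mem (X := E1) (r := C * K * beta_const (1 - mu) 0 * Rpower (t - c) mu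
     + M * (M * norm (g t) * (t - c) + norm (T (t - c) (g t) -v g t)) + M / (t - c) * norm (u c))).
apply (gbd_eq (gbd_add Q Q')). vec.
Qed.

Lemma mild_cont_E1 t : c < t <= d -> cont N1 u (fun s => c < s <= d) t.
Proof using SG Hcd HK Hmu HC K01 Hg Hu Cu.
intros Ht e He. assert (HM := sg_M SG).
pose (b := C * K * beta_const (1 - mu) 0).
assert (Hb : 0 <= b).
{ apply Rmult_le_pos; [apply Rmult_le_pos; lra|].
  left. apply beta_const_pos; lra. }
pose (n := norm (g t)). assert (Pn : 0 <= n) by apply norm_ge_0.
(* A lag [l] for which the gained part is small, uniformly near [t]. *)
destruct (@rpow_small (e / (12 * (b + 1))) mu) as [l1 [Hl1 Q1]];
  [lra|apply Rdiv_lt_0_compat; lra|].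
destruct (sg_cont0 SG (g t) (e := e / (12 * M))) as [l2 [Hl2 Q2]]; [apply Rdiv_lt_0_compat; lra|].
pose (l3 := e / (12 * (M * M * (n + 1)))).
assert (HMMn : 0 < M * M * (n + 1)) by (repeat apply Rmult_lt_0_compat; lra).
assert (Hl3 : 0 < l3) by (apply Rdiv_lt_0_compat; lra).
pose (l := Rmin (Rmin l1 l2) (Rmin l3 (t - c)) / 2).
assert (Pm : 0 < Rmin (Rmin l1 l2) (Rmin l3 (t - c))) by (repeat apply Rmin_glb_lt; lra).
assert (M1 := Rmin_l (Rmin l1 l2) (Rmin l3 (t - c))).
assert (M2 := Rmin_r (Rmin l1 l2) (Rmin l3 (t - c))).
assert (M3 := Rmin_l l1 l2). assert (M4 := Rmin_r l1 l2).
assert (M5 := Rmin_l l3 (t - c)). assert (M6 := Rmin_r l3 (t - c)).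
assert (Hl : 0 < l) by (unfold l; lra).
assert (Hl' : l < l1 /\ l < l2 /\ l < l3 /\ 2 * l <= t - c) by (unfold l; lra).
assert (HeM : 0 < e / (12 * (M * (M + 1)))).
{ apply Rdiv_lt_0_compat; [exact He|]. repeat apply Rmult_lt_0_compat; lra. }
destruct (holder_cont (t := t) ltac:(lra) (e := Rmin 1 (e / (12 * (M * (M + 1)))))) as [d1 [Hd1 R1]];
  [apply Rmin_glb_lt; lra|].
destruct (Cu (t := t - l) ltac:(lra) (e := e / (4 * (M / l)))) as [d2 [Hd2 R2]].
{ apply Rdiv_lt_0_compat; [exact He|]. apply Rmult_lt_0_compat; [lra|].
  apply Rdiv_lt_0_compat; lra. }
assert (Tail : forall s, c <= s - l -> s <= d -> N0 (g s -v g t) (Rmin 1 (e / (12 * (M * (M + 1))))) ->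
  N1 (u s -v T l (u (s - l))) (e / 3)).
{ intros s Hs Hsd Hgs.
  assert (Hgs1 := gbd_le Hgs (Rmin_l _ _)). assert (Hgs2 := gbd_le Hgs (Rmin_r _ _)).
  assert (Hns : norm (g s) <= n + 1).
  { apply (proj1 (@bd_whole k E0 _ _)). rewrite Rplus_comm.
    apply (gbd_eq (gbd_add Hgs1 (N0_norm (g t)))). vec. }
  assert (F1 := sg_bound SG (t := l) ltac:(lra) Hgs2).
  rewrite (real_linear_sub _ _ (sg_rl (Rlt_le _ _ Hl))) in F1.
  assert (F2 : N0 (T l (g s) -v g s) (M * (e / (12 * (M * (M + 1)))) + e / (12 * M)
     + e / (12 * (M * (M + 1))))).
  { apply (gbd_eq (gbd_sub (gbd_add F1 (Q2 l ltac:(lra))) Hgs2)). vec. }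
  replace l with (s - (s - l)) in F2 at 1 by ring.
  assert (Q := tail_E1 Hs (t := s) ltac:(lra) Hsd F2).
  replace (s - (s - l)) with l in Q by ring.
  apply (gbd_le Q).
  assert (A1 : b * Rpower l mu <= e / 12).
  { assert (Q' := Q1 l ltac:(lra)). rewrite rpow_Rpower in Q' by lra.
    assert (P := Rpower_pos l mu).
    apply Rle_trans with ((b + 1) * (e / (12 * (b + 1)))); [|right; field; lra].
    apply Rmult_le_compat; lra. }
  assert (A2 : M * (M * norm (g s) * l) <= e / 12).
  { apply Rle_trans with (M * M * (n + 1) * l3); [|right; unfold l3; field; lra].
    replace (M * (M * norm (g s) * l)) with (M * M * norm (g s) * l) by ring.
    assert (0 <= M * M) by nra. assert (Pg := norm_ge_0 (g s)).
    apply Rmult_le_compat; try lra; [apply Rmult_le_pos; lra|].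
    apply Rmult_le_compat_l; lra. }
  assert (A3 : M * (M * (e / (12 * (M * (M + 1)))) + e / (12 * M) + e / (12 * (M * (M + 1))))
    = e / 6) by (field; lra).
  fold b. lra. }
exists (Rmin (Rmin d1 d2) l). split; [repeat apply Rmin_glb_lt; lra|]. intros s Hs Hst.
assert (M7 := Rmin_l (Rmin d1 d2) l). assert (M8 := Rmin_r (Rmin d1 d2) l).
assert (M9 := Rmin_l d1 d2). assert (M10 := Rmin_r d1 d2).
assert (Hst' : Rabs (s - t) < l) by lra. apply Rabs_def2 in Hst'.
assert (T1 := Tail s ltac:(lra) ltac:(lra) (R1 s ltac:(unfold icc; lra) ltac:(lra))).
assert (T2 := Tail t ltac:(lra) ltac:(lra) ltac:(eapply gbd_le;
  [apply (gbd_eq (gbd_zero N0)); vec|apply Rmin_glb; lra])).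
assert (T3 := sg_smooth SG (t := l) ltac:(lra) (R2 (s - l) ltac:(unfold icc; lra)
  ltac:(replace (s - l - (t - l)) with (s - t) by ring; lra))).
rewrite (real_linear_sub _ _ (sg_rl (Rlt_le _ _ Hl))) in T3.
eapply gbd_le.
- apply (gbd_eq (gbd_add (gbd_sub T1 T2) T3)). vec.
- replace (M / l * (e / (4 * (M / l)))) with (e / 4) by (field; lra). lra.
Qed.

Lemma mild_rder t : c < t < d -> rder N0 u t (A (u t) +v g t).
Proof using SG Hcd HK Hmu HC K01 Hg Hu.
intros Ht e He. assert (HM := sg_M SG).
assert (Mt := mild_mem (t := t) ltac:(lra)).
destruct (sg_der SG Mt (Rle_refl 0) (e := e / 3) ltac:(lra)) as [d1 [Hd1 Q1]].
destruct (sg_cont0 SG (g t) (e := e / 3) ltac:(lra)) as [d2 [Hd2 Q2]].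
destruct (holder_cont (t := t) ltac:(lra) (e := e / (3 * M))) as [d3 [Hd3 Q3]];
  [apply Rdiv_lt_0_compat; lra|].
exists (Rmin (Rmin d1 d2) (Rmin d3 (d - t))). split; [repeat apply Rmin_glb_lt; lra|].
intros h Hh.
assert (M1 := Rmin_l (Rmin d1 d2) (Rmin d3 (d - t))).
assert (M2 := Rmin_r (Rmin d1 d2) (Rmin d3 (d - t))).
assert (M3 := Rmin_l d1 d2). assert (M4 := Rmin_r d1 d2).
assert (M5 := Rmin_l d3 (d - t)). assert (M6 := Rmin_r d3 (d - t)).
assert (F1 := Q1 h ltac:(lra)). rewrite Rplus_0_l, !(sg_0 SG) in F1.
assert (I := Hu (s := t) (t := t + h) ltac:(lra) ltac:(lra) ltac:(lra)).
replace (t + h - t) with h in I by ring.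
assert (I' := int_minus I (int_const (a := t) (b := t + h) (N0_norm (g t)) ltac:(lra))).
assert (Hi : forall x, t < x < t + h ->
  N0 (conv g (t + h) x -v (fun _ : R => g t) x) (e / 3 + e / 3)).
{ intros x Hx. unfold conv.
  assert (G1 := sg_bound SG (t := t + h - x) ltac:(lra)
    (Q3 x ltac:(unfold icc; lra) ltac:(rewrite Rabs_pos_eq; lra))).
  rewrite (real_linear_sub _ _ (sg_rl (t := t + h - x) ltac:(lra))) in G1.
  assert (G2 := Q2 (t + h - x) ltac:(lra)).
  eapply gbd_le; [exact (gbd_tri G1 G2)|].
  replace (M * (e / (3 * M))) with (e / 3) by (field; lra). lra. }
assert (F2 := int_bound_const I' Hi).
replace (t + h - t) with h in F2 by ring.
eapply gbd_le.
- apply (gbd_eq (gbd_add F1 F2)). vec.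
- lra.
Qed.

End Regularity.

End Convolution.

Arguments conv {k E0} T g t s.
Arguments mild {k E0} T g c d u.

(** * The critical nonlinearity *)

Section Setting.

Context {k : scalar_field} {E0 : CompleteNormedModule (Kring k)}.

Notation N0 := (bd (whole E0)).

(** Everything that the semilinear theory needs from the semigroup and from the
    spaces of index [0], [gamma], [alpha], [xi] and [1]. *)
Record setting (E1 Xg Xa Xx : banach_in E0) (A : E0 -> E0) (T : R -> E0 -> E0)
    (t0 M gamma alpha xi C : R) : Prop := {
  st_sg : smoothing_semigroup E1 A T t0 M;
  st_ga : 0 <= gamma < alpha;
  st_ax : alpha < xi <= 1;
  st_crit : xi - gamma < 1;
  st_C : 1 <= C;
  st_kgx : kernel T t0 (bd Xg) (bd Xx) (xi - gamma) C;
  st_kga : kernel T t0 (bd Xg) (bd Xa) (alpha - gamma) C;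
  st_kax : kernel T t0 (bd Xa) (bd Xx) (xi - alpha) C;
  st_k0a : kernel T t0 N0 (bd Xa) alpha C;
  st_k01 : kernel T t0 N0 (bd E1) 1 C;
  st_aa : forall t, 0 <= t <= t0 -> maps (bd Xa) (bd Xa) (T t) C;
  st_cont0 : forall x e, mem Xa x -> 0 < e -> exists d, 0 < d /\
    forall h, 0 <= h < d -> bd Xa (T h x -v x) e;
  st_decay : forall x e, mem Xa x -> 0 < e -> exists d, 0 < d /\
    forall t, 0 < t < d -> bd Xx (T t x) (e * Rpower t (- (xi - alpha)));
  st_emb1x : forall x r, bd E1 x r -> bd Xx x (C * r);
  st_embxa : forall x r, bd Xx x r -> bd Xa x (C * r);
  st_emba0 : forall x r, bd Xa x r -> N0 x (C * r);
  st_embg0 : forall x r, bd Xg x r -> N0 x (C * r);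
  st_dense : forall x e, mem Xa x -> 0 < e -> exists y, mem E1 y /\ bd Xa (x -v y) e
}.

(** The growth hypothesis of the theorem, for vectors of [E0]; [m] bounds both
    norms in [Xx]. *)
Record nonlinearity (Xg Xa Xx : banach_in E0) (O : E0 -> Prop) (f : E0 -> E0) (q : R) : Prop := {
  nl_sub : forall x, O x -> mem Xa x;
  nl_open : forall x, O x -> exists r, 0 < r /\ forall y, bd Xa (y -v x) r -> O y;
  nl_mem : forall w, O w -> mem Xx w -> mem Xg (f w);
  nl_lip : forall r, 0 < r -> exists N, 0 < N /\ forall w v m Da Dx,
    O w -> O v -> bd Xa w r -> bd Xa v r -> bd Xx w m -> bd Xx v m ->
    bd Xa (w -v v) Da -> bd Xx (w -v v) Dx ->
    bd Xg (f w -v f v) (N * (1 + 2 * rpow m (q - 1)) * ((1 + 2 * m) * Da + Dx))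
}.

Context {E1 Xg Xa Xx : banach_in E0} {A : E0 -> E0} {T : R -> E0 -> E0}.
Context {t0 M gamma alpha xi C : R}.
Context (ST : setting E1 Xg Xa Xx A T t0 M gamma alpha xi C).
Context {O : E0 -> Prop} {f : E0 -> E0}.

Let d := xi - alpha.
Let b := 1 + gamma - alpha.
Let q := b / d.

Context (NL : nonlinearity Xg Xa Xx O f q).

Lemma exponents : 0 < d /\ 0 < b < 1 /\ 1 < q /\ d * q = b /\ 0 <= xi - gamma < 1 /\
  0 <= alpha - gamma < 1 /\ 0 < alpha < 1.
Proof using ST.
assert (H1 := st_ga ST). assert (H2 := st_ax ST). assert (H3 := st_crit ST).
assert (Hd : 0 < d) by (unfold d; lra).
assert (E : d * q = b) by (unfold q; field; lra).
repeat split; try (unfold d, b in *; lra).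
apply Rmult_lt_reg_l with d; [exact Hd|]. rewrite E. unfold d, b. lra.
Qed.

Lemma lip_bounded m : exists L, 0 < L /\ forall w v D, O w -> O v -> bd Xx w m -> bd Xx v m ->
  bd Xx (w -v v) D -> bd Xg (f w -v f v) (L * D).
Proof using ST NL.
assert (HC := st_C ST). pose (m' := Rabs m + 1). assert (Pm := Rabs_pos m).
destruct (nl_lip NL (r := C * m')) as [N [HN Q]]; [apply Rmult_lt_0_compat; unfold m'; lra|].
exists (N * (1 + 2 * rpow m' (q - 1)) * ((1 + 2 * m') * C + 1)).
assert (P := rpow_ge0 m' (q - 1)). split.
{ apply Rmult_lt_0_compat; [apply Rmult_lt_0_compat; lra|].
  assert (0 <= (1 + 2 * m') * C) by (apply Rmult_le_pos; unfold m'; lra). lra. }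
intros w v D Ow Ov Bw Bv BD.
assert (Hm : m <= m') by (assert (L := Rle_abs m); unfold m'; lra).
assert (Bw' := gbd_le Bw Hm). assert (Bv' := gbd_le Bv Hm).
apply (gbd_le (Q w v m' _ _ Ow Ov (st_embxa ST Bw') (st_embxa ST Bv') Bw' Bv'
  (st_embxa ST BD) BD)).
right. ring.
Qed.

(** Along a function with [norm (u s) <= eps * s ^ (- d)] in [Xx], the
    nonlinearity is bounded by a multiple of [s ^ (- b)], which is integrable,
    because [q * d = b]: this is where criticality enters. The powers of [eps]
    provide the smallness. *)
Lemma nl_scaled r : 0 < r -> exists N, 0 < N /\ forall eps s w v Da Dx,
  0 < eps -> 0 < s -> 1 <= eps * Rpower s (- d) -> O w -> O v -> bd Xa w r -> bd Xa v r ->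
  bd Xx w (eps * Rpower s (- d)) -> bd Xx v (eps * Rpower s (- d)) ->
  bd Xa (w -v v) Da -> bd Xx (w -v v) (Dx * Rpower s (- d)) ->
  bd Xg (f w -v f v) (N * Rpower s (- b) * (Rpower eps q * Da + Rpower eps (q - 1) * Dx)).
Proof using ST NL.
intros Hr. destruct (nl_lip NL Hr) as [N [HN Q]].
destruct exponents as [Hd [Hb [Hq [Hdq _]]]].
exists (9 * N). split; [lra|].
intros eps s w v Da Dx He Hs H1 Ow Ov Aw Av Bw Bv BDa BDx.
apply (gbd_le (Q w v _ _ _ Ow Ov Aw Av Bw Bv BDa BDx)).
set (p := Rpower s (- d)) in *. assert (Pp : 0 < p) by apply Rpower_pos.
set (m := eps * p) in *.
assert (Hm : 0 < m) by (unfold m; apply Rmult_lt_0_compat; lra).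
assert (PDa := gbd_pos BDa). assert (PDx := gbd_pos BDx).
assert (Em : forall a, Rpower m a = Rpower eps a * Rpower s (- d * a)).
{ intros a. unfold m. rewrite <- Rpower_mult_distr by assumption. f_equal.
  unfold p. apply Rpower_mult. }
rewrite rpow_Rpower by exact Hm.
assert (Pq1 : 1 <= Rpower m (q - 1)).
{ rewrite <- (Rpower_O m Hm) at 1. apply Rle_Rpower; lra. }
assert (Emq : Rpower m (q - 1) * m = Rpower eps q * Rpower s (- b)).
{ rewrite <- (Rpower_1 m) at 2 by exact Hm. rewrite <- Rpower_plus.
  replace (q - 1 + 1) with q by ring. rewrite Em. do 2 f_equal. rewrite <- Hdq. ring. }
assert (Emq' : Rpower m (q - 1) * p = Rpower eps (q - 1) * Rpower s (- b)).
{ rewrite Em, Rmult_assoc. f_equal. unfold p. rewrite <- Rpower_plus. f_equal.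
  rewrite <- Hdq. ring. }
replace (9 * N * Rpower s (- b) * (Rpower eps q * Da + Rpower eps (q - 1) * Dx))
  with (9 * N * ((Rpower eps q * Rpower s (- b)) * Da + (Rpower eps (q - 1) * Rpower s (- b)) * Dx))
  by ring.
rewrite <- Emq, <- Emq'.
set (pq := Rpower m (q - 1)) in *.
rewrite Rmult_assoc, (Rmult_comm 9 N), Rmult_assoc. apply Rmult_le_compat_l; [lra|].
apply Rle_trans with (3 * pq * (3 * m * Da + Dx * p)).
- apply Rmult_le_compat; [lra| |lra|].
  + apply Rplus_le_le_0_compat; [|exact PDx]. apply Rmult_le_pos; lra.
  + apply Rplus_le_compat_r. apply Rmult_le_compat_r; lra.
- assert (0 <= pq * (Dx * p)) by (apply Rmult_le_pos; lra). nra.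
Qed.

(** The two estimates that drive the contraction, near a point of [O]. Comparing
    with a fixed vector of [E1] close to it bounds the nonlinearity itself. *)
Definition local_bounds (c : E0) (rho N m0 : R) : Prop :=
  (forall y, bd Xa (y -v c) rho -> O y) /\
  (forall eps s w, 0 < eps -> 0 < s -> m0 <= eps * Rpower s (- d) -> bd Xa (w -v c) rho ->
     bd Xx w (eps * Rpower s (- d)) -> bd Xg (f w) (N * Rpower eps q * Rpower s (- b))) /\
  (forall eps s w v Da Dx, 0 < eps -> 0 < s -> m0 <= eps * Rpower s (- d) ->
     bd Xa (w -v c) rho -> bd Xa (v -v c) rho ->
     bd Xx w (eps * Rpower s (- d)) -> bd Xx v (eps * Rpower s (- d)) ->
     bd Xa (w -v v) Da -> bd Xx (w -v v) (Dx * Rpower s (- d)) ->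
     bd Xg (f w -v f v) (N * Rpower s (- b) * (Rpower eps q * Da + Rpower eps (q - 1) * Dx))).

Lemma local_bounds_exist c : O c -> exists rho N m0, 0 < rho /\ 0 < N /\ 1 <= m0 /\
  local_bounds c rho N m0.
Proof using ST NL.
intros Oc. destruct (nl_open NL Oc) as [rho [Hrho Op]].
assert (Mc := nl_sub NL Oc). assert (Bc := bd_norm Mc). set (nc := norm (elt Xa c)) in *.
assert (Pc : 0 <= nc) by exact (gbd_pos Bc).
assert (HC := st_C ST).
destruct exponents as [Hd [Hb [Hq [Hdq _]]]].
destruct (st_dense ST Mc Hrho) as [v0 [M1 Hv0]].
assert (Av0 := gbd_swap Hv0). assert (Ov0 := Op _ Av0).
assert (Mx : bd Xx v0 (C * norm (elt E1 v0))) by (apply (st_emb1x ST), bd_norm, M1).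
set (nx := C * norm (elt E1 v0)) in *.
assert (Bg := bd_norm (nl_mem NL Ov0 (bd_mem Mx))). set (ng := norm (elt Xg (f v0))) in *.
assert (Png : 0 <= ng) by exact (gbd_pos Bg). assert (Pnx : 0 <= nx) by exact (gbd_pos Mx).
assert (Near : forall w, bd Xa (w -v c) rho -> bd Xa w (rho + nc)).
{ intros w Hw. apply (gbd_eq (gbd_add Hw Bc)). vec. }
destruct (@nl_scaled (rho + nc) ltac:(lra)) as [N [HN Q]].
pose (m0 := 1 + nx + ng).
pose (N' := N * (2 * rho + 2) + 1).
assert (HN' : N <= N' /\ 0 < N').
{ assert (0 < N * (2 * rho + 1)) by (apply Rmult_lt_0_compat; lra). unfold N'. split; lra. }
exists rho, N', m0. split; [exact Hrho|]. split; [lra|]. split; [unfold m0; lra|].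
split; [exact Op|]. split.
- intros eps s w He Hs Hm Aw Bw.
  assert (Bv : bd Xx v0 (eps * Rpower s (- d))) by (apply (gbd_le Mx); unfold m0 in Hm; lra).
  assert (Da : bd Xa (w -v v0) (rho + rho)) by exact (gbd_tri Aw Hv0).
  assert (Dx : bd Xx (w -v v0) (2 * eps * Rpower s (- d))).
  { apply (gbd_le (gbd_sub Bw Bv)). lra. }
  assert (R1 := Q eps s w v0 _ _ He Hs ltac:(unfold m0 in Hm; lra) (Op _ Aw) Ov0 (Near _ Aw)
    (Near _ Av0) Bw Bv Da Dx).
  assert (R2 := gbd_add R1 Bg).
  assert (P1 : 0 < Rpower eps q * Rpower s (- b)) by (apply Rmult_lt_0_compat; apply Rpower_pos).
  apply gbd_le with (N * Rpower s (- b) *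
    (Rpower eps q * (rho + rho) + Rpower eps (q - 1) * (2 * eps)) + ng).
  + apply (gbd_eq R2). vec.
  + assert (Ee : Rpower eps (q - 1) * eps = Rpower eps q).
    { rewrite <- (Rpower_1 eps) at 2 by exact He. rewrite <- Rpower_plus. f_equal. ring. }
    replace (Rpower eps (q - 1) * (2 * eps)) with (2 * Rpower eps q) by (rewrite <- Ee; ring).
    assert (Hg : ng <= Rpower eps q * Rpower s (- b)).
    { assert (Hm' : 1 <= eps * Rpower s (- d)) by (unfold m0 in Hm; lra).
      replace (Rpower eps q * Rpower s (- b)) with (Rpower (eps * Rpower s (- d)) q).
      - apply Rle_trans with (eps * Rpower s (- d)); [unfold m0 in Hm; lra|].
        rewrite <- (Rpower_1 (eps * Rpower s (- d))) at 1 by lra. apply Rle_Rpower; lra.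
      - rewrite <- Rpower_mult_distr by (try assumption; apply Rpower_pos). f_equal.
        rewrite Rpower_mult. f_equal. rewrite <- Hdq. ring. }
    unfold N'. lra.
- intros eps s w v Da Dx He Hs Hm Aw Av Bw Bv BDa BDx.
  apply (gbd_le (Q eps s w v Da Dx He Hs ltac:(unfold m0 in Hm; lra) (Op _ Aw) (Op _ Av) (Near _ Aw)
    (Near _ Av) Bw Bv BDa BDx)).
  assert (PDa := gbd_pos BDa). assert (Ps := Rpower_pos s (- d)).
  assert (PDx : 0 <= Dx).
  { assert (P := gbd_pos BDx). apply Rnot_lt_le. intros h.
    assert (Dx * Rpower s (- d) < 0) by nra. lra. }
  assert (P1 := Rpower_pos eps q). assert (P2 := Rpower_pos eps (q - 1)).
  assert (P3 := Rpower_pos s (- b)).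
  apply Rmult_le_compat_r.
  + apply Rplus_le_le_0_compat; apply Rmult_le_pos; lra.
  + apply Rmult_le_compat_r; lra.
Qed.

(** * The fixed point *)

(** The graph of the integral operator of the problem, a relation because the
    improper integral does not exist for every [U]. *)
Definition image (tau : R) (u0 : E0) (U V : R -> E0) : Prop :=
  forall t, 0 < t <= tau ->
    is_int (bd Xx) (conv T (fun s => f (U s)) t) 0 t (V t -v T t u0).

Definition small_at (c : E0) (rho eps : R) (U : R -> E0) (t : R) : Prop :=
  bd Xa (U t -v c) rho /\ bd Xx (U t) (eps * Rpower t (- d)).

Definition vanishing (U : R -> E0) : Prop :=
  forall e, 0 < e -> exists s, 0 < s /\ forall t, 0 < t < s -> bd Xx (U t) (e * Rpower t (- d)).

Definition beta : R := C * beta_const (xi - gamma) b + C * beta_const (alpha - gamma) b.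

Lemma beta_pos : 0 < beta.
Proof using ST.
destruct exponents as [_ [Hb [_ [_ [H1 [H2 _]]]]]]. assert (HC := st_C ST).
assert (P1 := beta_const_pos (proj2 H1) (proj2 Hb)).
assert (P2 := beta_const_pos (proj2 H2) (proj2 Hb)).
unfold beta. apply Rplus_lt_0_compat; apply Rmult_lt_0_compat; lra.
Qed.

Lemma integral_bounds g t y K : 0 < t <= t0 -> 0 <= K ->
  (forall s, 0 < s < t -> bd Xg (g s) (K * Rpower s (- b))) ->
  is_int (bd Xx) (conv T g t) 0 t y ->
  bd Xa y (beta * K) /\ bd Xx y (beta * K * Rpower t (- d)).
Proof using ST.
intros Ht HK Hg I. destruct exponents as [_ [Hb [_ [_ [H1 [H2 _]]]]]].
assert (HC := st_C ST).
assert (P1 := beta_const_pos (proj2 H1) (proj2 Hb)).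
assert (P2 := beta_const_pos (proj2 H2) (proj2 Hb)).
assert (Hg' : forall s, 0 < s < t -> bd Xg (g s) (K * Rpower (s - 0) (- b))).
{ intros s Hs. rewrite Rminus_0_r. now apply Hg. }
assert (HC0 : 0 < C) by lra. assert (Hb' : 0 <= b < 1) by lra.
assert (Ht' : t - 0 <= t0) by lra.
assert (B1 := conv_bound H1 Hb' HC0 HK (st_kgx ST) (proj1 Ht) Ht' Hg' I).
assert (B2 := conv_bound H2 Hb' HC0 HK (st_kga ST) (proj1 Ht) Ht' Hg'
  (int_embed (st_embxa ST) I)).
rewrite Rminus_0_r in B1, B2.
assert (Q1 : 0 < C * beta_const (xi - gamma) b) by (apply Rmult_lt_0_compat; lra).
assert (Q2 : 0 < C * beta_const (alpha - gamma) b) by (apply Rmult_lt_0_compat; lra).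
split.
- apply (gbd_le B2).
  replace (1 - (alpha - gamma) - b) with 0 by (unfold b; ring).
  rewrite Rpower_O, Rmult_1_r by lra. unfold beta.
  replace (C * K * beta_const (alpha - gamma) b) with (C * beta_const (alpha - gamma) b * K) by ring.
  apply Rmult_le_compat_r; lra.
- apply (gbd_le B1).
  replace (1 - (xi - gamma) - b) with (- d) by (unfold b, d; ring).
  apply Rmult_le_compat_r; [left; apply Rpower_pos|]. unfold beta.
  replace (C * K * beta_const (xi - gamma) b) with (C * beta_const (xi - gamma) b * K) by ring.
  apply Rmult_le_compat_r; lra.
Qed.

Lemma lag_power s t m0 eps : 0 < s <= t -> 0 < eps -> m0 <= eps * Rpower t (- d) ->
  m0 <= eps * Rpower s (- d).
Proof using ST.
intros Hs He H. destruct exponents as [Hd _].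
apply Rle_trans with (eps * Rpower t (- d)); [exact H|].
apply Rmult_le_compat_l; [lra|]. apply Rpower_antitone; lra.
Qed.

(** In [local_bounds] a distance between trajectories is multiplied by at most
    [Rpower eps (q - 1)], up to a constant; a small [eps] makes this factor [1/2]. *)
Lemma image_contract c rho N m0 eps tau U U' V V' u0 u0' D r t :
  local_bounds c rho N m0 -> 0 < N -> 0 < eps <= 1 -> 0 <= D ->
  4 * beta * N * Rpower eps (q - 1) <= 1 ->
  0 < tau <= t0 -> m0 <= eps * Rpower tau (- d) ->
  (forall t, 0 < t <= tau -> small_at c rho eps U t /\ small_at c rho eps U' t /\
     bd Xa (U t -v U' t) D /\ bd Xx (U t -v U' t) (D * Rpower t (- d))) ->
  image tau u0 U V -> image tau u0' U' V' -> bd Xa (u0 -v u0') r ->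
  0 < t <= tau ->
  bd Xa (V t -v V' t) (C * r + D / 2) /\
  bd Xx (V t -v V' t) ((C * r + D / 2) * Rpower t (- d)).
Proof using ST.
intros [_ [_ LB]] HN He HD Hsmall Htau Hm HU HV HV' Hr Ht.
destruct exponents as [Hd [Hb [Hq _]]]. assert (PB := beta_pos).
assert (SG := st_sg ST).
assert (Pe := Rpower_pos eps (q - 1)).
assert (Heq : Rpower eps q <= Rpower eps (q - 1)).
{ replace q with (1 + (q - 1)) at 1 by ring. rewrite Rpower_plus, Rpower_1 by lra.
  rewrite <- (Rmult_1_l (Rpower eps (q - 1))) at 2. apply Rmult_le_compat_r; lra. }
pose (K := N * (2 * Rpower eps (q - 1) * D)).
assert (HK : 0 <= K) by (unfold K; repeat apply Rmult_le_pos; lra).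
assert (I := int_minus (HV t Ht) (HV' t Ht)).
apply (int_ext (g' := conv T (fun s => f (U s) -v f (U' s)) t)) in I.
2:{ intros s Hs. unfold conv.
    now rewrite (real_linear_sub _ _ (sg_rl SG (t := t - s) ltac:(lra))). }
assert (Hg : forall s, 0 < s < t -> bd Xg (f (U s) -v f (U' s)) (K * Rpower s (- b))).
{ intros s Hs. destruct (HU s ltac:(lra)) as [[U1 U2] [[U3 U4] [U5 U6]]].
  assert (Hms : m0 <= eps * Rpower s (- d)) by (apply (@lag_power s tau); lra).
  apply (gbd_le (LB eps s (U s) (U' s) D D ltac:(lra) ltac:(lra) Hms U1 U3 U2 U4 U5 U6)).
  unfold K. rewrite <- Rmult_plus_distr_r.
  replace (N * (2 * Rpower eps (q - 1) * D) * Rpower s (- b))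
    with (N * Rpower s (- b) * (2 * Rpower eps (q - 1) * D)) by ring.
  apply Rmult_le_compat_l; [apply Rmult_le_pos; [lra|left; apply Rpower_pos]|].
  apply Rmult_le_compat_r; lra. }
assert (Ht' : 0 < t <= t0) by lra.
destruct (integral_bounds Ht' HK Hg I) as [B1 B2].
assert (HBK : beta * K <= D / 2).
{ unfold K. replace (beta * (N * (2 * Rpower eps (q - 1) * D)))
    with (4 * beta * N * Rpower eps (q - 1) * (D / 2)) by field. nra. }
assert (T1 := st_aa ST (t := t) ltac:(lra) Hr).
assert (T2 := proj1 (st_kax ST) t ltac:(lra) _ _ Hr).
rewrite (real_linear_sub _ _ (sg_rl SG (t := t) ltac:(lra))) in T1, T2. fold d in T2.
assert (Pt := Rpower_pos t (- d)).
split.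
- apply gbd_le with (C * r + beta * K); [|lra].
  apply (gbd_eq (gbd_add T1 B1)). vec.
- apply gbd_le with (C * Rpower t (- d) * r + beta * K * Rpower t (- d)); [|nra].
  apply (gbd_eq (gbd_add T2 B2)). vec.
Qed.

Lemma image_bounds c rho N m0 eps tau U V u0 r t :
  local_bounds c rho N m0 -> 0 < N -> 0 < eps ->
  4 * beta * N * Rpower eps (q - 1) <= 1 ->
  0 < tau <= t0 -> m0 <= eps * Rpower tau (- d) ->
  (forall t, 0 < t <= tau -> small_at c rho eps U t) ->
  image tau u0 U V -> bd Xa (u0 -v c) r -> 0 < t <= tau ->
  bd Xa (V t -v T t u0) (eps / 4) /\ bd Xx (V t -v T t u0) (eps / 4 * Rpower t (- d)).
Proof using ST.
intros [_ [LB _]] HN He Hsmall Htau Hm HU HV Hr Ht.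
destruct exponents as [Hd [Hb [Hq _]]]. assert (PB := beta_pos).
assert (Pq := Rpower_pos eps q).
destruct (@integral_bounds (fun s => f (U s)) t (V t -v T t u0) (N * Rpower eps q)) as [B1 B2].
- lra.
- apply Rmult_le_pos; lra.
- intros s Hs. destruct (HU s ltac:(lra)) as [U1 U2].
  apply (LB eps s (U s)); try assumption; [lra|]. apply (@lag_power s tau); lra.
- exact (HV t Ht).
- assert (Hq4 : beta * (N * Rpower eps q) <= eps / 4).
  { replace q with (1 + (q - 1)) by ring. rewrite Rpower_plus, Rpower_1 by lra.
    replace (beta * (N * (eps * Rpower eps (q - 1))))
      with (4 * beta * N * Rpower eps (q - 1) * (eps / 4)) by field. nra. }
  assert (Pt := Rpower_pos t (- d)). split.
  + now apply (gbd_le B1).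
  + apply (gbd_le B2). apply Rmult_le_compat_r; lra.
Qed.

(** Iterate the contraction, starting from the crude bound that [small_at] gives
    for the distance. *)
Lemma image_stable c rho N m0 eps tau U U' u0 u0' r t :
  local_bounds c rho N m0 -> 0 < N -> 0 < rho -> 0 < eps <= 1 ->
  4 * beta * N * Rpower eps (q - 1) <= 1 ->
  0 < tau <= t0 -> m0 <= eps * Rpower tau (- d) ->
  (forall t, 0 < t <= tau -> small_at c rho eps U t /\ small_at c rho eps U' t) ->
  image tau u0 U U -> image tau u0' U' U' -> bd Xa (u0 -v u0') r ->
  0 < t <= tau -> bd Xa (U t -v U' t) (2 * C * r).
Proof using ST.
intros LB HN Hrho He Hsmall Htau Hm HU HV HV' Hr Ht.
assert (HC := st_C ST). assert (Pr := gbd_pos Hr). assert (PCr : 0 <= C * r) by nra.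
pose (D0 := 2 * (rho + eps)).
assert (Iter : forall n, forall t, 0 < t <= tau ->
  bd Xa (U t -v U' t) (D0 * (/ 2) ^ n + 2 * C * r) /\
  bd Xx (U t -v U' t) ((D0 * (/ 2) ^ n + 2 * C * r) * Rpower t (- d))).
{ induction n as [|n IH]; intros s Hs.
  - destruct (HU s Hs) as [[U1 U2] [U3 U4]].
    assert (Ps := Rpower_pos s (- d)). simpl. unfold D0. split.
    + apply gbd_le with (rho + rho); [|lra].
      apply (gbd_eq (gbd_sub U1 U3)). vec.
    + apply (gbd_le (gbd_sub U2 U4)). nra.
  - assert (Pn := half_pow_pos n).
    assert (HD : 0 <= D0 * (/ 2) ^ n + 2 * C * r).
    { apply Rplus_le_le_0_compat; [|lra]. apply Rmult_le_pos; unfold D0; lra. }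
    destruct (@image_contract c rho N m0 eps tau U U' U U' u0 u0' _ r s LB HN He HD Hsmall Htau Hm)
      as [B1 B2]; try assumption.
    + intros s' Hs'. destruct (HU s' Hs') as [S1 S2]. destruct (IH s' Hs') as [S3 S4]. auto.
    + replace (D0 * (/ 2) ^ S n + 2 * C * r)
        with (C * r + (D0 * (/ 2) ^ n + 2 * C * r) / 2) by (simpl; field). split; assumption. }
apply gbd_eps. intros e He'.
destruct (half_pow_small (e := e / D0)) as [n Hn]; [apply Rdiv_lt_0_compat; unfold D0; lra|].
destruct (Iter n t Ht) as [B _]. apply (gbd_le B).
assert (D0 * (/ 2) ^ n <= e); [|lra].
apply Rle_trans with (D0 * (e / D0)); [|right; field; unfold D0; lra].
apply Rmult_le_compat_l; [unfold D0; lra|]. left. now apply Hn.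
Qed.

(** Half of the largest exponent that [conv_increment] allows in [Xx]. *)
Definition holder_exp : R := (1 - (xi - gamma)) / 2.

Lemma image_holder tau u0 U V K sigma : 0 < tau <= t0 -> tau <= 1 -> 0 <= K -> 0 < sigma ->
  mem Xa u0 ->
  (forall s, 0 < s <= tau -> bd Xg (f (U s)) (K * Rpower s (- b))) ->
  image tau u0 U V -> exists L, 0 <= L /\ forall s t, sigma <= s -> s < t -> t <= tau ->
    bd Xx (V t -v V s) (L * Rpower (t - s) holder_exp).
Proof using ST.
intros Htau Htau1 HK Hsig Mu Hg HV. assert (SG := st_sg ST). assert (HC := st_C ST).
destruct exponents as [Hd [Hb [_ [_ [H1 _]]]]]. set (mu := holder_exp).
assert (Hmu : 0 < mu < 1 /\ xi - gamma + mu < 1 /\ mu < 1 - (xi - gamma)) by (unfold mu, holder_exp; lra).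
assert (Bu := bd_norm Mu). set (nu := norm (elt Xa u0)) in *.
assert (Pnu : 0 <= nu) by exact (gbd_pos Bu).
assert (P1 := beta_const_pos (p := xi - gamma + mu) (q := b) ltac:(lra) ltac:(lra)).
assert (P2 := beta_const_pos (p := xi - gamma) (q := 0) ltac:(lra) ltac:(lra)).
pose (L1 := C * Rpower sigma (- (d + mu)) * nu).
pose (L2 := C * K * (beta_const (xi - gamma + mu) b * Rpower sigma (- (d + mu))
   + Rpower sigma (- b) * beta_const (xi - gamma) 0)).
assert (PL1 : 0 <= L1).
{ unfold L1. repeat apply Rmult_le_pos; try lra. left. apply Rpower_pos. }
assert (PL2 : 0 <= L2).
{ apply Rmult_le_pos; [apply Rmult_le_pos; lra|].
  apply Rplus_le_le_0_compat; apply Rmult_le_pos; try lra; left; apply Rpower_pos. }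
exists (L1 + L2). split; [lra|]. intros s t Hs Hst Ht.
pose (h := t - s). assert (Hh : 0 < h <= 1) by (unfold h; lra).
assert (B1 : bd Xx (T t u0 -v T s u0) (L1 * Rpower h mu)).
{ replace t with (s + h) by (unfold h; ring).
  apply (gbd_le (proj2 (st_kax ST) mu s h ltac:(lra) ltac:(lra) ltac:(lra) ltac:(unfold h; lra) _ _ Bu)).
  unfold L1. replace (C * Rpower sigma (- (d + mu)) * nu * Rpower h mu)
    with (C * (Rpower h mu * Rpower sigma (- (d + mu))) * nu) by ring.
  apply Rmult_le_compat_r; [exact Pnu|]. apply Rmult_le_compat_l; [lra|].
  apply Rmult_le_compat_l; [left; apply Rpower_pos|].
  replace (- (xi - alpha) - mu) with (- (d + mu)) by (unfold d; ring).
  apply Rpower_antitone; lra. }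
assert (B2 : bd Xx ((V t -v T t u0) -v (V s -v T s u0)) (L2 * Rpower h mu)).
{ assert (I1 := HV s ltac:(lra)). assert (I2 := HV t ltac:(lra)).
  replace t with (s + h) in I2 |- * by (unfold h; ring).
  assert (HC0 : 0 < C) by lra. assert (Hb' : 0 <= b < 1) by lra.
  assert (Hmu0 : 0 <= mu) by lra. assert (Hamu : xi - gamma + mu < 1) by lra.
  assert (H0s : 0 < s) by lra. assert (H0h : 0 < h) by lra.
  assert (Hsh : s + h - 0 <= t0) by (unfold h; lra).
  assert (Hg' : forall r, 0 < r < s + h -> bd Xg ((fun s => f (U s)) r) (K * Rpower (r - 0) (- b))).
  { intros r Hr. rewrite Rminus_0_r. apply Hg. unfold h in Hr. lra. }
  assert (Q := conv_increment SG H1 Hb' HC0 HK (st_kgx ST) Hmu0 Hamu H0s H0h Hsh Hg' I1 I2).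
  apply (gbd_le Q). rewrite Rminus_0_r. unfold L2.
  replace (1 - (xi - gamma) - mu - b) with (- (d + mu)) by (unfold b, d; ring).
  rewrite (Rmult_assoc (C * K)). apply Rmult_le_compat_l; [apply Rmult_le_pos; lra|].
  rewrite Rmult_plus_distr_r.
  assert (Ph := Rpower_pos h mu).
  assert (Hh1 : Rpower h (1 - (xi - gamma)) <= Rpower h mu).
  { replace (1 - (xi - gamma)) with (mu + mu) by (unfold mu, holder_exp; field).
    rewrite Rpower_plus. rewrite <- (Rmult_1_r (Rpower h mu)) at 3.
    apply Rmult_le_compat_l; [lra|].
    replace 1 with (Rpower 1 mu) by (unfold Rpower; now rewrite ln_1, Rmult_0_r, exp_0).
    apply Rle_Rpower_l; lra. }
  apply Rplus_le_compat.
  - apply Rmult_le_compat_r; [lra|]. apply Rmult_le_compat_l; [lra|].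
    apply Rpower_antitone; lra.
  - apply Rmult_le_compat; try lra.
    + apply Rmult_le_pos; [left; apply Rpower_pos|lra].
    + left. apply Rpower_pos.
    + apply Rmult_le_compat_r; [lra|]. apply Rpower_antitone; lra. }
fold h. apply gbd_le with (L1 * Rpower h mu + L2 * Rpower h mu); [|lra].
apply (gbd_eq (gbd_add B1 B2)). vec.
Qed.

Lemma holder_continuous (V : R -> E0) tau mu : 0 < mu ->
  (forall sigma, 0 < sigma -> exists L, 0 <= L /\ forall s t, sigma <= s -> s < t -> t <= tau ->
    bd Xx (V t -v V s) (L * Rpower (t - s) mu)) ->
  forall t, 0 < t <= tau -> cont (bd Xx) V (fun s => 0 < s <= tau) t.
Proof.
intros Hmu H t Ht e He. destruct (H (t / 2) ltac:(lra)) as [L [HL Q]].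
destruct (@rpow_small (e / (L + 1)) mu Hmu) as [d1 [Hd1 Q1]]; [apply Rdiv_lt_0_compat; lra|].
exists (Rmin d1 (t / 2)). split; [apply Rmin_glb_lt; lra|]. intros s Hs Hst.
assert (M1 := Rmin_l d1 (t / 2)). assert (M2 := Rmin_r d1 (t / 2)).
assert (F : forall x, 0 < x < d1 -> L * Rpower x mu <= e).
{ intros x Hx. assert (Q' := Q1 x ltac:(lra)). rewrite rpow_Rpower in Q' by lra.
  assert (P := Rpower_pos x mu).
  apply Rle_trans with ((L + 1) * (e / (L + 1))); [|right; field; lra].
  apply Rmult_le_compat; lra. }
destruct (Rtotal_order s t) as [h|[->|h]].
- rewrite Rabs_left in Hst by lra. apply gbd_swap.
  apply (gbd_le (Q s t ltac:(lra) h ltac:(lra))). apply F. lra.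
- apply gbd_le with 0; [|lra]. apply (gbd_eq (gbd_zero (bd Xx))). vec.
- rewrite Rabs_pos_eq in Hst by lra.
  apply (gbd_le (Q t s ltac:(lra) h ltac:(lra))). apply F. lra.
Qed.

Lemma nl_cont (U : R -> E0) (D : R -> Prop) t : (forall s, D s -> O (U s)) -> D t ->
  mem Xx (U t) -> cont (bd Xx) U D t -> cont (bd Xg) (fun s => f (U s)) D t.
Proof using ST NL.
intros HO Dt Mt CU e He. assert (Bt := bd_norm Mt). set (n := norm (elt Xx (U t))) in *.
destruct (lip_bounded (n + 1)) as [L [HL Q]].
destruct (CU (Rmin 1 (e / L))) as [d1 [Hd1 Q1]].
{ apply Rmin_glb_lt; [lra|now apply Rdiv_lt_0_compat]. }
exists d1. split; [exact Hd1|]. intros s Ds Hst.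
assert (Q2 := Q1 s Ds Hst).
assert (M1 := gbd_le Q2 (Rmin_l _ _)). assert (M2 := gbd_le Q2 (Rmin_r _ _)).
apply gbd_le with (L * (e / L)); [|right; field; lra].
apply Q; auto.
- apply gbd_le with (1 + n); [|lra]. apply (gbd_eq (gbd_add M1 Bt)). vec.
- apply (gbd_le Bt). lra.
Qed.

Lemma small_time m0 e sigma : 0 < m0 -> 0 < e -> 0 < sigma ->
  exists tau, 0 < tau <= sigma /\ m0 <= e * Rpower tau (- d).
Proof using ST.
intros Hm He Hs. destruct exponents as [Hd _].
destruct (@rpow_small (e / m0) d Hd) as [s [Hs' Q]]; [now apply Rdiv_lt_0_compat|].
exists (Rmin sigma (s / 2)).
assert (M1 := Rmin_l sigma (s / 2)). assert (M2 := Rmin_r sigma (s / 2)).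
assert (P : 0 < Rmin sigma (s / 2)) by (apply Rmin_glb_lt; lra).
split; [lra|]. assert (Q' := Q (Rmin sigma (s / 2)) ltac:(lra)).
rewrite rpow_Rpower in Q' by exact P. rewrite Rpower_Ropp.
assert (Pp := Rpower_pos (Rmin sigma (s / 2)) d).
apply Rmult_le_reg_r with (Rpower (Rmin sigma (s / 2)) d); [exact Pp|].
rewrite Rmult_assoc, Rinv_l, Rmult_1_r by lra.
apply Rle_trans with (m0 * (e / m0)); [|right; field; lra].
apply Rmult_le_compat_l; lra.
Qed.

Definition trajectory (c : E0) (rho eps tau : R) (U : R -> E0) : Prop :=
  (forall t, 0 < t <= tau -> small_at c rho eps U t) /\
  (forall t, 0 < t <= tau -> cont (bd Xx) U (fun s => 0 < s <= tau) t) /\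
  vanishing U.

(** The choice of constants that makes the integral operator a contraction of
    the set of trajectories, for all data in the ball of radius [r]. *)
Record admissible_constants (c : E0) (rho N m0 eps tau r : R) : Prop := {
  ac_bounds : local_bounds c rho N m0;
  ac_N : 0 < N;
  ac_m0 : 1 <= m0;
  ac_rho : 0 < rho;
  ac_eps : 0 < eps <= 1;
  ac_eps_rho : eps <= rho;
  ac_contract : 4 * beta * N * Rpower eps (q - 1) <= 1;
  ac_tau : 0 < tau <= t0;
  ac_tau1 : tau <= 1;
  ac_scale : m0 <= eps * Rpower tau (- d);
  ac_r : 0 < r;
  ac_r_eps : C * r <= eps / 4;
  ac_decay : forall t, 0 < t <= tau -> bd Xx (T t c) (eps / 4 * Rpower t (- d));
  ac_cont : forall t, 0 < t <= tau -> bd Xa (T t c -v c) (rho / 4)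
}.

Lemma admissible_constants_exist c : O c ->
  exists rho N m0 eps tau r, admissible_constants c rho N m0 eps tau r.
Proof using ST NL.
intros Oc. assert (HC := st_C ST). assert (SG := st_sg ST). assert (Ht0 := sg_t0 SG).
destruct exponents as [Hd [Hb [Hq _]]]. assert (PB := beta_pos).
assert (Mc := nl_sub NL Oc).
destruct (local_bounds_exist Oc) as [rho [N [m0 [Hrho [HN [Hm0 LB]]]]]].
destruct (@rpow_small (/ (4 * beta * N)) (q - 1)) as [e0 [He0 Q]]; [lra| |].
{ apply Rinv_0_lt_compat. repeat apply Rmult_lt_0_compat; lra. }
pose (eps := Rmin (Rmin 1 rho) (e0 / 2)).
assert (Heps : 0 < eps) by (repeat apply Rmin_glb_lt; lra).
assert (E1' : eps <= Rmin 1 rho) by apply Rmin_l. assert (E2 : eps <= e0 / 2) by apply Rmin_r.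
assert (E3 := Rmin_l 1 rho). assert (E4 := Rmin_r 1 rho).
destruct (st_decay ST Mc (e := eps / 4) ltac:(lra)) as [s1 [Hs1 Q1]].
destruct (st_cont0 ST Mc (e := rho / 4) ltac:(lra)) as [s2 [Hs2 Q2]].
pose (sigma := Rmin (Rmin t0 1) (Rmin (s1 / 2) (s2 / 2))).
assert (Hsig : 0 < sigma) by (repeat apply Rmin_glb_lt; lra).
assert (F1 : sigma <= Rmin t0 1) by apply Rmin_l.
assert (F2 : sigma <= Rmin (s1 / 2) (s2 / 2)) by apply Rmin_r.
assert (F3 := Rmin_l t0 1). assert (F4 := Rmin_r t0 1).
assert (F5 := Rmin_l (s1 / 2) (s2 / 2)). assert (F6 := Rmin_r (s1 / 2) (s2 / 2)).
destruct (@small_time m0 eps sigma ltac:(lra) Heps Hsig) as [tau [Htau Hsc]].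
exists rho, N, m0, eps, tau, (eps / (4 * C)). split; try assumption; try lra.
- assert (Q' := Q eps ltac:(lra)). rewrite rpow_Rpower in Q' by exact Heps.
  assert (P4 : 0 < 4 * beta * N) by (repeat apply Rmult_lt_0_compat; lra).
  apply Rle_trans with (4 * beta * N * / (4 * beta * N)); [|right; field; lra].
  apply Rmult_le_compat_l; lra.
- apply Rdiv_lt_0_compat; lra.
- right. field. lra.
- intros t Ht. apply Q1. lra.
- intros t Ht. apply Q2. lra.
Qed.

Section Picard.

Context {c : E0} {rho N m0 eps tau r : R} (AC : admissible_constants c rho N m0 eps tau r).

Lemma trajectory_O U t : small_at c rho eps U t -> O (U t).
Proof using AC. intros [H _]. now apply (ac_bounds AC). Qed.

Lemma trajectory_nl_bound U t : small_at c rho eps U t -> 0 < t <= tau ->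
  bd Xg (f (U t)) (N * Rpower eps q * Rpower t (- b)).
Proof using AC ST.
intros [H1 H2] Ht. destruct (ac_bounds AC) as [_ [LB _]].
assert (He := ac_eps AC).
apply LB; try assumption; [lra|lra|]. apply (lag_power (t := tau)); [lra|lra|exact (ac_scale AC)].
Qed.

Lemma trajectory_integral U t :
  (forall t, 0 < t <= tau -> small_at c rho eps U t) ->
  (forall t, 0 < t <= tau -> cont (bd Xx) U (fun s => 0 < s <= tau) t) ->
  0 < t <= tau -> exists y, is_int (bd Xx) (conv T (fun s => f (U s)) t) 0 t y.
Proof using AC ST NL.
intros HU CU Ht. destruct exponents as [Hd [Hb [Hq [_ [H1 _]]]]].
assert (HC := st_C ST). assert (Htau := ac_tau AC). assert (HN := ac_N AC).
assert (Hb' : 0 <= b < 1) by lra. assert (HC0 : 0 < C) by lra.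
assert (HK : 0 <= N * Rpower eps q) by (apply Rmult_le_pos; [lra|left; apply Rpower_pos]).
apply (conv_exists (st_sg ST) H1 Hb' HC0 HK (st_kgx ST)); [lra|lra| |].
- intros s Hs. rewrite Rminus_0_r. apply trajectory_nl_bound; [apply HU; lra|lra].
- intros s Hs. apply cont_sub with (fun s => 0 < s <= tau); [unfold ioo; intros; lra|].
  apply nl_cont; [|lra| |apply CU; lra].
  + intros x Hx. now apply trajectory_O, HU.
  + destruct (HU s ltac:(lra)) as [_ B]. exact (bd_mem B).
Qed.

Lemma image_vanishing U V u0 :
  (forall t, 0 < t <= tau -> small_at c rho eps U t) -> vanishing U ->
  image tau u0 U V -> bd Xa (u0 -v c) r ->
  forall e, 0 < e -> exists s, 0 < s /\ forall t, 0 < t < s ->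
    bd Xa (V t -v T t u0) e /\ bd Xx (V t -v T t u0) (e * Rpower t (- d)).
Proof using AC ST.
intros HU VU HV Hr e He. destruct exponents as [Hd [Hb [Hq _]]].
assert (Heps := ac_eps AC). assert (Htau := ac_tau AC). assert (HN := ac_N AC).
assert (PB := beta_pos). assert (Hm0 := ac_m0 AC).
pose (e' := Rmin eps e). assert (He' : 0 < e') by (apply Rmin_glb_lt; lra).
assert (E1' : e' <= eps) by apply Rmin_l. assert (E2 : e' <= e) by apply Rmin_r.
destruct (VU e' He') as [s1 [Hs1 Q1]].
destruct (@small_time m0 e' (Rmin tau (s1 / 2)) ltac:(lra) He' ltac:(apply Rmin_glb_lt; lra))
  as [tau' [Htau' Hsc]].
assert (M1 := Rmin_l tau (s1 / 2)). assert (M2 := Rmin_r tau (s1 / 2)).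
exists tau'. split; [lra|]. intros t Ht.
destruct (@image_bounds c rho N m0 e' tau' U V u0 r t) as [B1 B2]; try assumption.
- exact (ac_bounds AC).
- apply Rle_trans with (4 * beta * N * Rpower eps (q - 1)); [|exact (ac_contract AC)].
  apply Rmult_le_compat_l; [repeat apply Rmult_le_pos; lra|].
  apply Rle_Rpower_l; lra.
- lra.
- intros s Hs. split; [apply HU; lra|apply Q1; lra].
- intros s Hs. apply HV. lra.
- lra.
- assert (Pt := Rpower_pos t (- d)). split.
  + apply (gbd_le B1). lra.
  + apply (gbd_le B2). apply Rmult_le_compat_r; lra.
Qed.

Lemma data_mem u0 : bd Xa (u0 -v c) r -> mem Xa u0.
Proof using AC NL.
intros H. assert (HO : O c).
{ apply (ac_bounds AC). apply (gbd_eq (gbd_le (gbd_zero (bd Xa)) (Rlt_le _ _ (ac_rho AC)))). vec. }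
assert (Bc := bd_norm (nl_sub NL HO)).
apply (@bd_mem _ _ Xa _ (r + norm (elt Xa c))). apply (gbd_eq (gbd_add H Bc)). vec.
Qed.

Lemma image_trajectory U V u0 : trajectory c rho eps tau U ->
  image tau u0 U V -> bd Xa (u0 -v c) r -> trajectory c rho eps tau V.
Proof using AC ST NL.
intros [HU [CU VU]] HV Hr. destruct exponents as [Hd [Hb [Hq _]]].
assert (Heps := ac_eps AC). assert (Htau := ac_tau AC). assert (HN := ac_N AC).
assert (Her := ac_eps_rho AC). assert (Hre := ac_r_eps AC). assert (SG := st_sg ST).
assert (Mu := data_mem Hr).
split; [|split].
- intros t Ht.
  destruct (image_bounds (ac_bounds AC) HN (proj1 Heps) (ac_contract AC) Htau (ac_scale AC)
    HU HV Hr Ht) as [B1 B2].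
  assert (T1 := st_aa ST (t := t) ltac:(lra) Hr).
  assert (T2 := proj1 (st_kax ST) t ltac:(lra) _ _ Hr).
  rewrite (real_linear_sub _ _ (sg_rl SG (t := t) ltac:(lra))) in T1, T2. fold d in T2.
  assert (D1 := ac_decay AC Ht). assert (D2 := ac_cont AC Ht).
  assert (Pt := Rpower_pos t (- d)). split.
  + apply gbd_le with (eps / 4 + (C * r + rho / 4)); [|lra].
    apply (gbd_eq (gbd_add B1 (gbd_add T1 D2))). vec.
  + apply gbd_le with (eps / 4 * Rpower t (- d) + (C * Rpower t (- d) * r + eps / 4 * Rpower t (- d))).
    * apply (gbd_eq (gbd_add B2 (gbd_add T2 D1))). vec.
    * nra.
- assert (HK : 0 <= N * Rpower eps q) by (apply Rmult_le_pos; [lra|left; apply Rpower_pos]).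
  assert (Hmu : 0 < holder_exp) by (unfold holder_exp; assert (Hx := st_crit ST); lra).
  apply (holder_continuous Hmu). intros sigma Hs.
  apply (@image_holder tau u0 U V (N * Rpower eps q) sigma Htau (ac_tau1 AC) HK Hs Mu); [|exact HV].
  intros s Hs'. apply trajectory_nl_bound; [now apply HU|exact Hs'].
- intros e He. destruct (image_vanishing HU VU HV Hr (e := e / 2) ltac:(lra)) as [s1 [Hs1 Q1]].
  destruct (st_decay ST Mu (e := e / 2) ltac:(lra)) as [s2 [Hs2 Q2]].
  exists (Rmin s1 s2). split; [now apply Rmin_glb_lt|]. intros t Ht.
  assert (M1 := Rmin_l s1 s2). assert (M2 := Rmin_r s1 s2).
  destruct (Q1 t ltac:(lra)) as [_ B1]. assert (B2 := Q2 t ltac:(lra)). fold d in B2.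
  apply gbd_le with (e / 2 * Rpower t (- d) + e / 2 * Rpower t (- d)); [|lra].
  apply (gbd_eq (gbd_add B1 B2)). vec.
Qed.

Lemma image_exists U u0 : trajectory c rho eps tau U -> exists V, image tau u0 U V.
Proof using AC ST NL.
intros [HU [CU _]].
exists (fun t => T t u0 +v epsilon (inhabits (vzero : E0))
  (fun y => is_int (bd Xx) (conv T (fun s => f (U s)) t) 0 t y)).
intros t Ht.
apply (int_eq (epsilon_spec (inhabits (vzero : E0)) (fun y => is_int _ _ 0 t y)
  (trajectory_integral HU CU Ht))). vec.
Qed.

Lemma start_trajectory u0 : bd Xa (u0 -v c) r ->
  trajectory c rho eps tau (fun t => T t u0).
Proof using AC ST NL.
intros Hr. destruct exponents as [Hd [Hb [Hq [_ [H1 _]]]]].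
assert (Heps := ac_eps AC). assert (Htau := ac_tau AC). assert (SG := st_sg ST).
assert (Her := ac_eps_rho AC). assert (Hre := ac_r_eps AC). assert (HC := st_C ST).
assert (Mu := data_mem Hr). assert (Bu := bd_norm Mu).
split; [|split].
- intros t Ht.
  assert (T1 := st_aa ST (t := t) ltac:(lra) Hr).
  assert (T2 := proj1 (st_kax ST) t ltac:(lra) _ _ Hr).
  rewrite (real_linear_sub _ _ (sg_rl SG (t := t) ltac:(lra))) in T1, T2. fold d in T2.
  assert (D1 := ac_decay AC Ht). assert (D2 := ac_cont AC Ht).
  assert (Pt := Rpower_pos t (- d)). split.
  + apply gbd_le with (C * r + rho / 4); [|assert (Q := ac_rho AC); lra].
    apply (gbd_eq (gbd_add T1 D2)). vec.
  + apply gbd_le with (C * Rpower t (- d) * r + eps / 4 * Rpower t (- d)).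
    * apply (gbd_eq (gbd_add T2 D1)). vec.
    * nra.
- apply (holder_continuous Rlt_0_1). intros sigma Hs.
  exists (C * Rpower sigma (- (d + 1)) * norm (elt Xa u0)). split.
  { repeat apply Rmult_le_pos; [lra|left; apply Rpower_pos|apply norm_ge_0]. }
  intros s t Hs' Hst Ht.
  assert (Q := proj2 (st_kax ST) 1 s (t - s) ltac:(lra) ltac:(lra) ltac:(lra) ltac:(lra) _ _ Bu).
  cbn beta in Q. replace (s + (t - s)) with t in Q by ring.
  apply (gbd_le Q).
  replace (C * Rpower sigma (- (d + 1)) * norm (elt Xa u0) * Rpower (t - s) 1)
    with (C * (Rpower (t - s) 1 * Rpower sigma (- (d + 1))) * norm (elt Xa u0)) by ring.
  apply Rmult_le_compat_r; [apply norm_ge_0|]. apply Rmult_le_compat_l; [lra|].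
  apply Rmult_le_compat_l; [left; apply Rpower_pos|].
  replace (- (xi - alpha) - 1) with (- (d + 1)) by (unfold d; ring).
  apply Rpower_antitone; lra.
- intros e He. exact (st_decay ST Mu He).
Qed.

(** Banach's fixed point argument, carried out by successive approximation. *)
Lemma picard u0 : bd Xa (u0 -v c) r ->
  exists U, image tau u0 U U /\ trajectory c rho eps tau U.
Proof using AC ST NL.
intros Hr.
assert (Heps := ac_eps AC). assert (Htau := ac_tau AC). assert (HN := ac_N AC).
assert (Hrho := ac_rho AC). assert (HC := st_C ST).
pose (next := fun U => epsilon (inhabits (fun _ : R => vzero : E0))
  (fun V => image tau u0 U V /\ trajectory c rho eps tau V)).
assert (Hnext : forall U, trajectory c rho eps tau U ->
  image tau u0 U (next U) /\ trajectory c rho eps tau (next U)).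
{ intros U HU. unfold next.
  apply (epsilon_spec (inhabits (fun _ : R => vzero : E0))
    (fun V => image tau u0 U V /\ trajectory c rho eps tau V)).
  destruct (image_exists u0 HU) as [V HV]. exists V. split; [exact HV|].
  exact (image_trajectory HU HV Hr). }
pose (P := fix P n := match n with Datatypes.O => (fun t => T t u0) | S m => next (P m) end).
assert (HP : forall n, trajectory c rho eps tau (P n)).
{ induction n as [|n IH]; [now apply start_trajectory|]. now apply Hnext. }
assert (IP : forall n, image tau u0 (P n) (P (S n))) by (intros n; now apply Hnext).
pose (D0 := 2 * (rho + eps)). assert (HD0 : 0 < D0) by (unfold D0; lra).
assert (Hz : bd Xa (u0 -v u0) 0) by (apply (gbd_eq (gbd_zero (bd Xa))); vec).
assert (Diff : forall n t, 0 < t <= tau -> bd Xa (P (S n) t -v P n t) (D0 * (/ 2) ^ n) /\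
  bd Xx (P (S n) t -v P n t) (D0 * (/ 2) ^ n * Rpower t (- d))).
{ induction n as [|n IH]; intros t Ht.
  - destruct (proj1 (HP 1%nat) t Ht) as [A1 A2]. destruct (proj1 (HP 0%nat) t Ht) as [A3 A4].
    assert (Pt := Rpower_pos t (- d)). simpl pow. unfold D0. split.
    + apply gbd_le with (rho + rho); [|lra].
      apply (gbd_eq (gbd_sub A1 A3)). vec.
    + apply (gbd_le (gbd_sub A2 A4)). nra.
  - assert (Pn := half_pow_pos n).
    destruct (@image_contract c rho N m0 eps tau (P (S n)) (P n) (P (S (S n))) (P (S n)) u0 u0
      (D0 * (/ 2) ^ n) 0 t) as [B1 B2]; try assumption.
    + exact (ac_bounds AC).
    + apply Rmult_le_pos; lra.
    + exact (ac_contract AC).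
    + exact (ac_scale AC).
    + intros s Hs. destruct (IH s Hs). repeat split; try assumption; apply (HP _); exact Hs.
    + apply IP.
    + apply IP.
    + replace (D0 * (/ 2) ^ S n) with (C * 0 + D0 * (/ 2) ^ n / 2) by (simpl; field).
      split; assumption. }
assert (Lim : forall t, 0 < t <= tau -> exists l, forall n,
  bd Xa (l -v P n t) (2 * D0 * (/ 2) ^ n) /\
  bd Xx (l -v P n t) (2 * D0 * (/ 2) ^ n * Rpower t (- d))).
{ intros t Ht. assert (Pt := Rpower_pos t (- d)).
  destruct (@geometric_limit _ _ (bd Xx) (fun n => P n t) (D0 * Rpower t (- d))
    (bd_complete (X := Xx))) as [l Hl].
  { intros n. apply (gbd_le (proj2 (Diff n t Ht))). right. ring. }
  destruct (@geometric_limit _ _ (bd Xa) (fun n => P n t) D0 (bd_complete (X := Xa))) as [l' Hl'].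
  { intros n. apply (Diff n t Ht). }
  assert (E : l = l').
  { apply (@gbd_eq_eps _ _ (bd Xa)). intros e He.
    assert (PC : 0 < C * Rpower t (- d)) by (apply Rmult_lt_0_compat; lra).
    assert (Pc : 0 < 2 * D0 * (C * Rpower t (- d) + 1)).
    { repeat apply Rmult_lt_0_compat; lra. }
    destruct (half_pow_small (e := e / (2 * D0 * (C * Rpower t (- d) + 1)))) as [n Hn];
      [now apply Rdiv_lt_0_compat|].
    specialize (Hn n (le_n n)).
    apply (gbd_le (gbd_tri (st_embxa ST (Hl n)) (gbd_swap (Hl' n)))).
    apply Rle_trans with (2 * D0 * (C * Rpower t (- d) + 1) * (e / (2 * D0 * (C * Rpower t (- d) + 1))));
      [|right; field; lra].
    replace (C * (2 * (D0 * Rpower t (- d)) * (/ 2) ^ n) + 2 * D0 * (/ 2) ^ n)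
      with (2 * D0 * (C * Rpower t (- d) + 1) * (/ 2) ^ n) by ring.
    apply Rmult_le_compat_l; lra. }
  exists l. intros n. split.
  - rewrite E. apply Hl'.
  - apply (gbd_le (Hl n)). right. ring. }
pose (U := fun t => epsilon (inhabits (vzero : E0)) (fun l => forall n,
  bd Xa (l -v P n t) (2 * D0 * (/ 2) ^ n) /\
  bd Xx (l -v P n t) (2 * D0 * (/ 2) ^ n * Rpower t (- d)))).
assert (HU : forall t, 0 < t <= tau -> forall n,
  bd Xa (U t -v P n t) (2 * D0 * (/ 2) ^ n) /\
  bd Xx (U t -v P n t) (2 * D0 * (/ 2) ^ n * Rpower t (- d))).
{ intros t Ht. unfold U. apply (epsilon_spec (inhabits (vzero : E0)) (fun l => forall n,
    bd Xa (l -v P n t) (2 * D0 * (/ 2) ^ n) /\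
    bd Xx (l -v P n t) (2 * D0 * (/ 2) ^ n * Rpower t (- d)))).
  now apply Lim. }
assert (Small : forall e, 0 < e -> exists n, 2 * D0 * (/ 2) ^ n <= e).
{ intros e He. destruct (half_pow_small (e := e / (2 * D0))) as [n Hn];
    [apply Rdiv_lt_0_compat; lra|].
  exists n. apply Rle_trans with (2 * D0 * (e / (2 * D0))); [|right; field; lra].
  apply Rmult_le_compat_l; [lra|]. left. now apply Hn. }
assert (TU : trajectory c rho eps tau U).
{ split; [|split].
  - intros t Ht. assert (Pt := Rpower_pos t (- d)). split; apply gbd_eps; intros e He.
    + destruct (Small e He) as [n Hn]. rewrite Rplus_comm.
      apply (gbd_tri (gbd_le (proj1 (HU t Ht n)) Hn)). apply (HP n); exact Ht.
    + destruct (Small (e / Rpower t (- d))) as [n Hn]; [now apply Rdiv_lt_0_compat|].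
      destruct (proj1 (HP n) t Ht) as [_ B].
      apply gbd_le with (2 * D0 * (/ 2) ^ n * Rpower t (- d) + eps * Rpower t (- d)).
      * apply (gbd_eq (gbd_add (proj2 (HU t Ht n)) B)). vec.
      * assert (2 * D0 * (/ 2) ^ n * Rpower t (- d) <= e); [|lra].
        apply Rle_trans with (e / Rpower t (- d) * Rpower t (- d)); [|right; field; lra].
        apply Rmult_le_compat_r; lra.
  - intros t Ht e He. assert (Pt := Rpower_pos (t / 2) (- d)).
    destruct (Small (e / (3 * Rpower (t / 2) (- d)))) as [n Hn]; [apply Rdiv_lt_0_compat; lra|].
    destruct (HP n) as [_ [CP _]]. destruct (CP t Ht (e / 3) ltac:(lra)) as [d1 [Hd1 Q1]].
    exists (Rmin d1 (t / 2)). split; [apply Rmin_glb_lt; lra|]. intros s Hs Hst.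
    assert (M1 := Rmin_l d1 (t / 2)). assert (M2 := Rmin_r d1 (t / 2)).
    assert (Hst2 : Rabs (s - t) < t / 2) by lra. apply Rabs_def2 in Hst2.
    destruct exponents as [Hd _].
    assert (F : forall x, t / 2 <= x -> x <= tau -> bd Xx (U x -v P n x) (e / 3)).
    { intros x Hx Hx'. apply (gbd_le (proj2 (HU x ltac:(lra) n))).
      apply Rle_trans with (e / (3 * Rpower (t / 2) (- d)) * Rpower (t / 2) (- d)); [|right; field; lra].
      apply Rmult_le_compat; [|left; apply Rpower_pos|exact Hn|apply Rpower_antitone; lra].
      assert (P2 := half_pow_pos n). apply Rmult_le_pos; lra. }
    apply gbd_le with (e / 3 + (e / 3 + e / 3)); [|lra].
    apply (gbd_tri (F s ltac:(lra) ltac:(lra))).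
    apply (gbd_tri (Q1 s Hs ltac:(lra))). apply gbd_swap, F; lra.
  - intros e He. destruct (Small (e / 2) ltac:(lra)) as [n Hn].
    destruct (HP n) as [_ [_ VP]]. destruct (VP (e / 2) ltac:(lra)) as [s [Hs Q]].
    exists (Rmin s tau). split; [apply Rmin_glb_lt; lra|]. intros t Ht.
    assert (M1 := Rmin_l s tau). assert (M2 := Rmin_r s tau).
    assert (Pt := Rpower_pos t (- d)).
    apply gbd_le with (2 * D0 * (/ 2) ^ n * Rpower t (- d) + e / 2 * Rpower t (- d)); [|nra].
    apply (gbd_eq (gbd_add (proj2 (HU t ltac:(lra) n)) (Q t ltac:(lra)))). vec. }
exists U. split; [|exact TU].
destruct (image_exists u0 TU) as [V HV].
assert (EV : forall t, 0 < t <= tau -> V t = U t).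
{ intros t Ht. apply (@gbd_eq_eps _ _ (bd Xa)). intros e He.
  destruct (Small (e / 2) ltac:(lra)) as [n Hn].
  assert (Pn := half_pow_pos n).
  destruct (@image_contract c rho N m0 eps tau U (P n) V (P (S n)) u0 u0
      (2 * D0 * (/ 2) ^ n) 0 t) as [B1 _]; try assumption.
  - exact (ac_bounds AC).
  - apply Rmult_le_pos; lra.
  - exact (ac_contract AC).
  - exact (ac_scale AC).
  - intros s Hs. destruct (HU s Hs n).
    repeat split; try assumption; first [apply TU|apply (HP n)]; exact Hs.
  - apply IP.
  - assert (B2 := proj1 (HU t Ht (S n))).
    apply (gbd_le (gbd_tri B1 (gbd_swap B2))). simpl. lra. }
intros t Ht. rewrite <- EV by exact Ht. now apply HV.
Qed.

End Picard.

End Setting.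

(** * Strong solutions on compact intervals *)

Section Strong.

Context {k : scalar_field} {E0 : CompleteNormedModule (Kring k)}.
Context {E1 Xg Xa Xx : banach_in E0} {A : E0 -> E0} {T : R -> E0 -> E0}.
Context {t0 M gamma alpha xi C : R}.
Context (ST : setting E1 Xg Xa Xx A T t0 M gamma alpha xi C).
Context {O : E0 -> Prop} {f : E0 -> E0}.
Context (NL : nonlinearity Xg Xa Xx O f ((1 + gamma - alpha) / (xi - alpha))).

Notation N0 := (bd (whole E0)).
Notation N1 := (bd E1).
Notation van := (@vanishing k E0 Xx alpha xi).
Notation lbounds := (@local_bounds k E0 Xg Xa Xx gamma alpha xi O f).
Notation hexp := (@holder_exp gamma xi).
Notation small := (@small_at k E0 Xa Xx alpha xi).
Notation img := (@image k E0 Xx T f).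
Notation traj := (@trajectory k E0 Xa Xx alpha xi).
Notation consts := (@admissible_constants k E0 Xg Xa Xx T t0 gamma alpha xi C O f).

Let SG := st_sg ST.

(** Only the right derivative is mentioned: it is continuous, because [u] is
    continuous in [E1], and therefore it is the two-sided derivative. *)
Record strong (tau : R) (u0 : E0) (u : R -> E0) : Prop := {
  so_pos : 0 < tau;
  so_init : u 0 = u0;
  so_range : forall t, 0 <= t <= tau -> O (u t);
  so_cont : forall t, 0 <= t <= tau -> cont (bd Xa) u (icc 0 tau) t;
  so_mem : forall t, 0 < t <= tau -> mem E1 (u t);
  so_cont1 : forall t, 0 < t <= tau -> cont N1 u (fun s => 0 < s <= tau) t;
  so_rder : forall t, 0 < t < tau -> rder N0 u t (A (u t) +v f (u t));
  so_van : van u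
}.

Lemma strong_restrict tau tau' u0 u : 0 < tau' <= tau -> strong tau u0 u -> strong tau' u0 u.
Proof.
intros H [H1 H2 H3 H4 H5 H6 H7 H8]. split; auto; try lra.
- intros t Ht. apply H3. lra.
- intros t Ht. apply cont_sub with (icc 0 tau); [unfold icc; intros; lra|]. apply H4. lra.
- intros t Ht. apply H5. lra.
- intros t Ht. apply cont_sub with (fun s => 0 < s <= tau); [intros; lra|]. apply H6. lra.
- intros t Ht. apply H7. lra.
Qed.

Lemma strong_contx tau u0 u t : strong tau u0 u -> 0 < t <= tau ->
  cont (bd Xx) u (fun s => 0 < s <= tau) t.
Proof using ST. intros S Ht. apply (cont_embed (st_emb1x ST)). now apply (so_cont1 S). Qed.

Lemma strong_memx tau u0 u t : strong tau u0 u -> 0 < t <= tau -> mem Xx (u t).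
Proof using ST.
intros S Ht. assert (B := bd_norm (so_mem S Ht)). exact (bd_mem (st_emb1x ST B)).
Qed.

Lemma strong_cont0 tau u0 u t : strong tau u0 u -> 0 <= t <= tau -> cont N0 u (icc 0 tau) t.
Proof using ST. intros S Ht. apply (cont_embed (st_emba0 ST)). now apply (so_cont S). Qed.

Lemma exponent_pos : 0 < xi - alpha.
Proof using ST. assert (H := st_ax ST). lra. Qed.

(** Hence the weighted limit is automatic for solutions restarted at a positive
    time. *)
Lemma bounded_vanishing (u : R -> E0) m s : 0 < s ->
  (forall t, 0 < t < s -> bd Xx (u t) m) -> van u.
Proof using ST.
intros Hs H e He. assert (Hd := exponent_pos).
destruct (@small_time _ _ _ _ _ _ _ _ _ _ _ _ _ _ ST (Rabs m + 1) e s) as [tau [Ht Q]];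
  [assert (P := Rabs_pos m); lra|exact He|exact Hs|].
exists tau. split; [lra|]. intros t Htt. apply (gbd_le (H t ltac:(lra))).
assert (L := Rle_abs m).
apply Rle_trans with (e * Rpower tau (- (xi - alpha))); [lra|].
apply Rmult_le_compat_l; [lra|]. apply Rpower_antitone; lra.
Qed.

Lemma strong_shift tau u0 u s : strong tau u0 u -> 0 < s < tau ->
  strong (tau - s) (u s) (fun t => u (t + s)).
Proof using ST.
intros S Hs. split.
- lra.
- now rewrite Rplus_0_l.
- intros t Ht. apply (so_range S). lra.
- intros t Ht. apply cont_sub with (fun t => icc 0 tau (t + s)); [unfold icc; intros; lra|].
  apply cont_shift, (so_cont S). lra.
- intros t Ht. apply (so_mem S). lra.
- intros t Ht. apply cont_sub with (fun t => 0 < t + s <= tau); [intros; lra|].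
  apply (cont_shift (D := fun t => 0 < t <= tau)), (so_cont1 S). lra.
- intros t Ht. apply rder_shift, (so_rder S). lra.
- destruct (strong_contx S (t := s) ltac:(lra) Rlt_0_1) as [d [Hd Q]].
  assert (B := bd_norm (strong_memx S (t := s) ltac:(lra))).
  apply (@bounded_vanishing _ (1 + norm (elt Xx (u s))) (Rmin d (tau - s))).
  { apply Rmin_glb_lt; lra. }
  intros t Ht. assert (M1 := Rmin_l d (tau - s)). assert (M2 := Rmin_r d (tau - s)).
  assert (Q' := Q (t + s) ltac:(lra) ltac:(rewrite Rabs_pos_eq; lra)).
  apply (gbd_eq (gbd_add Q' B)). vec.
Qed.

Lemma strong_mild tau u0 u c d : strong tau u0 u -> 0 <= c -> d <= tau -> d - c <= t0 ->
  mild T (fun s => f (u s)) c d u.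
Proof using ST.
intros S Hc Hd Hcd. apply (mild_of_strong SG Hcd).
- intros t Ht. apply cont_sub with (icc 0 tau); [unfold icc; intros; lra|].
  apply (strong_cont0 S). lra.
- intros t Ht. split; [apply (so_mem S)|apply (so_rder S)]; lra.
Qed.

(** Smallness in the weighted norm makes [f (u s)] integrable in [Xg] down to
    [s = 0], so that the mild formula holds in [Xx] and not only in [E0]. *)
Lemma strong_image c rho N m0 eps tau u0 u :
  lbounds c rho N m0 -> 0 < N -> 0 < eps ->
  0 < tau <= t0 -> m0 <= eps * Rpower tau (- (xi - alpha)) ->
  (forall t, 0 < t <= tau -> small c rho eps u t) ->
  strong tau u0 u -> img tau u0 u u.
Proof using ST NL.
intros LB HN He Htau Hm Hsm S t Ht.
destruct (exponents ST) as [Hd [Hb [Hq [_ [H1 _]]]]]. assert (HC := st_C ST).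
set (b := 1 + gamma - alpha) in *. set (q := b / (xi - alpha)) in *.
assert (Hb' : 0 <= b < 1) by lra. assert (HC0 : 0 < C) by lra.
assert (HK : 0 <= N * Rpower eps q) by (apply Rmult_le_pos; [lra|left; apply Rpower_pos]).
assert (Hg : forall s, 0 < s < t -> bd Xg ((fun s => f (u s)) s) (N * Rpower eps q * Rpower (s - 0) (- b))).
{ intros s Hs. rewrite Rminus_0_r. destruct (Hsm s ltac:(lra)) as [S1 S2].
  destruct LB as [_ [LB _]]. apply LB; try assumption; [lra|].
  apply (lag_power ST (t := tau)); [lra|lra|exact Hm]. }
assert (Hct : 0 < t) by lra. assert (Hct' : t - 0 <= t0) by lra.
destruct (conv_exists SG H1 Hb' HC0 HK (st_kgx ST) Hct Hct' Hg) as [y I].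
{ intros s Hs. apply cont_sub with (fun s => 0 < s <= tau); [unfold ioo; intros; lra|].
  apply (nl_cont ST NL).
  - intros x Hx. apply (so_range S). lra.
  - lra.
  - apply (strong_memx S). lra.
  - apply (strong_contx S). lra. }
assert (I0 := int_embed (st_emba0 ST) (int_embed (st_embxa ST) I)).
assert (Mi := strong_mild S (c := 0) (d := t) (Rle_refl 0) ltac:(lra) Hct' (Rle_refl 0) Hct (Rle_refl t)).
rewrite Rminus_0_r, (so_init S) in Mi.
now rewrite (int_unique Mi I0).
Qed.

(** The weighted limit required of solutions brings all of them into the set on
    which the integral operator contracts; this is the source of uniqueness. *)
Lemma strong_small c rho r eps tau u0 u : strong tau u0 u -> bd Xa (u0 -v c) r -> r < rho ->
  0 < eps -> exists s, 0 < s <= tau /\ forall t, 0 < t <= s -> small c rho eps u t.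
Proof.
intros S Hr Hrr He. assert (Ht := so_pos S).
destruct (so_cont S (t := 0) ltac:(lra) (e := rho - r) ltac:(lra)) as [d [Hd Q]].
destruct (so_van S He) as [s [Hs Q']].
exists (Rmin tau (Rmin (d / 2) (s / 2))).
assert (M1 := Rmin_l tau (Rmin (d / 2) (s / 2))). assert (M2 := Rmin_r tau (Rmin (d / 2) (s / 2))).
assert (M3 := Rmin_l (d / 2) (s / 2)). assert (M4 := Rmin_r (d / 2) (s / 2)).
split; [split; [repeat apply Rmin_glb_lt; lra|lra]|]. intros t Htt. split; [|apply Q'; lra].
assert (B := Q t ltac:(unfold icc; lra) ltac:(rewrite Rminus_0_r, Rabs_pos_eq; lra)).
rewrite (so_init S) in B.
apply gbd_le with (rho - r + r); [|lra]. exact (gbd_tri B Hr).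
Qed.

Lemma strong_unique_local tau u0 u u' : strong tau u0 u -> strong tau u0 u' ->
  exists s, 0 < s <= tau /\ forall t, 0 <= t <= s -> u t = u' t.
Proof using ST NL.
intros S S'. assert (Ht := so_pos S).
assert (Ou : O u0). { rewrite <- (so_init S). apply (so_range S). lra. }
destruct (admissible_constants_exist ST NL Ou) as [rho [N [m0 [eps [tau0 [r AC]]]]]].
assert (Hz : forall e, 0 <= e -> bd Xa (u0 -v u0) e).
{ intros e He. apply (gbd_eq (gbd_le (gbd_zero (bd Xa)) He)). vec. }
destruct (strong_small S (Hz 0 (Rle_refl 0)) (ac_rho AC) (proj1 (ac_eps AC))) as [s1 [Hs1 Q1]].
destruct (strong_small S' (Hz 0 (Rle_refl 0)) (ac_rho AC) (proj1 (ac_eps AC))) as [s2 [Hs2 Q2]].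
assert (Htau := ac_tau AC). assert (Heps := ac_eps AC).
pose (s := Rmin tau0 (Rmin s1 s2)).
assert (M1 : s <= tau0) by apply Rmin_l. assert (M2 : s <= Rmin s1 s2) by apply Rmin_r.
assert (M3 := Rmin_l s1 s2). assert (M4 := Rmin_r s1 s2).
assert (Hs : 0 < s) by (repeat apply Rmin_glb_lt; lra).
exists s. split; [lra|]. intros t Htt.
destruct (Req_dec t 0) as [->|Hne]; [now rewrite (so_init S), (so_init S')|].
assert (Hsc : m0 <= eps * Rpower s (- (xi - alpha))).
{ apply (lag_power ST (t := tau0)); [lra|lra|exact (ac_scale AC)]. }
assert (R1 := strong_restrict (tau := tau) (tau' := s) ltac:(lra) S).
assert (R2 := strong_restrict (tau := tau) (tau' := s) ltac:(lra) S').
assert (Hst0 : 0 < s <= t0) by lra.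
assert (I1 := strong_image (ac_bounds AC) (ac_N AC) (proj1 Heps) Hst0 Hsc
  ltac:(intros; apply Q1; lra) R1).
assert (I2 := strong_image (ac_bounds AC) (ac_N AC) (proj1 Heps) Hst0 Hsc
  ltac:(intros; apply Q2; lra) R2).
apply (@gbd_sub_eq _ _ (bd Xa)).
rewrite <- (Rmult_0_r (2 * C)).
apply (image_stable ST (ac_bounds AC) (ac_N AC) (ac_rho AC) Heps (ac_contract AC) Hst0 Hsc
  (U := u) (U' := u') (u0 := u0) (u0' := u0)); try assumption; [|apply Hz; lra|lra].
intros x Hx. split; [apply Q1|apply Q2]; lra.
Qed.

Lemma strong_unique tau u0 u u' : strong tau u0 u -> strong tau u0 u' ->
  forall t, 0 <= t <= tau -> u t = u' t.
Proof using ST NL.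
intros S S'. assert (Ht := so_pos S).
pose (P := fun s => s <= tau /\ forall t, 0 <= t <= s -> u t = u' t).
assert (P0 : P 0).
{ split; [lra|]. intros t Htt. replace t with 0 by lra. now rewrite (so_init S), (so_init S'). }
destruct (completeness P) as [c [Ub Lub]].
{ exists tau. intros s [Hs _]. exact Hs. } { now exists 0. }
assert (Hc0 : 0 <= c) by now apply Ub.
assert (Hct : c <= tau) by (apply Lub; intros s [Hs _]; exact Hs).
assert (Below : forall t, 0 <= t < c -> u t = u' t).
{ intros t Htt. apply NNPP. intros Hne. apply (Rlt_not_le c t); [lra|].
  apply Lub. intros s [_ Hs]. apply Rnot_lt_le. intros h. apply Hne, Hs. lra. }
assert (Atc : u c = u' c).
{ destruct Hc0 as [Hc0|<-]; [|apply P0; lra].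
  apply (@gbd_eq_eps _ _ (bd Xa)). intros e He.
  destruct (so_cont S (t := c) ltac:(lra) (e := e / 2) ltac:(lra)) as [d1 [Hd1 Q1]].
  destruct (so_cont S' (t := c) ltac:(lra) (e := e / 2) ltac:(lra)) as [d2 [Hd2 Q2]].
  pose (s := Rmax 0 (c - Rmin d1 d2 / 2)).
  assert (Pm : 0 < Rmin d1 d2) by now apply Rmin_glb_lt.
  assert (M1 := Rmin_l d1 d2). assert (M2 := Rmin_r d1 d2).
  assert (M3 : 0 <= s) by apply Rmax_l. assert (M4 : c - Rmin d1 d2 / 2 <= s) by apply Rmax_r.
  assert (M5 : s < c) by (apply Rmax_lub_lt; lra).
  assert (R1 := Q1 s ltac:(unfold icc; lra) ltac:(rewrite Rabs_left; lra)).
  assert (R2 := Q2 s ltac:(unfold icc; lra) ltac:(rewrite Rabs_left; lra)).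
  rewrite (Below s) in R1 by lra.
  apply gbd_le with (e / 2 + e / 2); [|lra]. exact (gbd_tri (gbd_swap R1) R2). }
assert (Ext : forall s, 0 < s -> c + s <= tau -> (forall t, 0 <= t <= s -> u (c + t) = u' (c + t)) -> False).
{ intros s Hs Hcs H. assert (c + s <= c); [|lra]. apply Ub. split; [exact Hcs|].
  intros t Htt. destruct (Rlt_le_dec t c) as [h|h]; [apply Below; lra|].
  replace t with (c + (t - c)) by ring. apply H. lra. }
destruct (Rle_lt_or_eq_dec _ _ Hct) as [Hlt|Heq].
- exfalso. destruct Hc0 as [Hc0|<-].
  + destruct (strong_unique_local (strong_shift S (s := c) ltac:(lra))
      (u' := fun t => u' (t + c))) as [s [Hs Q]].
    { rewrite Atc. apply (strong_shift S'). lra. }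
    apply (Ext s); [lra|lra|]. intros t Htt. rewrite !(Rplus_comm c). now apply Q.
  + destruct (strong_unique_local S S') as [s [Hs Q]].
    apply (Ext s); [lra|lra|]. intros t Htt. rewrite Rplus_0_l. now apply Q.
- intros t Htt. destruct (Rlt_le_dec t c) as [h|h]; [apply Below; lra|].
  replace t with c by lra. exact Atc.
Qed.

(** Conversely a fixed point is a strong solution: it is Hoelder continuous in
    [Xx] away from [t = 0], hence so is the inhomogeneity [f (u t)]. *)
Lemma strong_of_image c rho N m0 eps tau r u0 U : consts c rho N m0 eps tau r ->
  bd Xa (u0 -v c) r -> img tau u0 U U -> traj c rho eps tau U ->
  O u0 -> strong tau u0 (fun t => if Rle_dec t 0 then u0 else U t).
Proof using ST NL.
intros AC Hr HI HT Ou. set (u := fun t => if Rle_dec t 0 then u0 else U t).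
assert (Eu : forall t, 0 < t -> u t = U t).
{ intros t Ht. unfold u. destruct (Rle_dec t 0); [lra|reflexivity]. }
assert (E0u : u 0 = u0) by (unfold u; destruct (Rle_dec 0 0); [reflexivity|lra]).
destruct (exponents ST) as [Hd [Hb [Hq _]]].
assert (Htau := ac_tau AC). assert (Heps := ac_eps AC). assert (HN := ac_N AC).
assert (HC := st_C ST). assert (Hga := st_ga ST). assert (Hcr := st_crit ST).
assert (Mu := nl_sub NL Ou).
destruct HT as [Hsm [CU VU]].
assert (Ca : forall t, 0 <= t <= tau -> cont (bd Xa) u (icc 0 tau) t).
{ intros t [[Ht| <-] Ht'] e He.
  - destruct (cont_embed (st_embxa ST) (CU t ltac:(lra)) He) as [d [Hd' Q]].
    exists (Rmin d t). split; [now apply Rmin_glb_lt|]. intros s Hs Hst. unfold icc in Hs.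
    assert (M1 := Rmin_l d t). assert (M2 := Rmin_r d t).
    assert (Hst' : Rabs (s - t) < t) by lra. apply Rabs_def2 in Hst'.
    rewrite !Eu by lra. apply Q; lra.
  - destruct (image_vanishing ST AC Hsm VU HI Hr (e := e / 2) ltac:(lra)) as [s1 [Hs1 Q1]].
    destruct (st_cont0 ST Mu (e := e / 2) ltac:(lra)) as [s2 [Hs2 Q2]].
    exists (Rmin s1 s2). split; [now apply Rmin_glb_lt|]. intros s Hs Hst. unfold icc in Hs.
    assert (M1 := Rmin_l s1 s2). assert (M2 := Rmin_r s1 s2).
    rewrite Rminus_0_r, Rabs_pos_eq in Hst by lra. rewrite E0u.
    destruct (Req_dec s 0) as [->|Hne].
    + rewrite E0u. eapply gbd_le; [apply (gbd_eq (gbd_zero (bd Xa))); vec|lra].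
    + rewrite Eu by lra. destruct (Q1 s ltac:(lra)) as [B1 _].
      apply gbd_le with (e / 2 + e / 2); [|lra]. exact (gbd_tri B1 (Q2 s ltac:(lra))). }
assert (SI : forall s t, 0 < s -> s <= t -> t <= tau ->
  small c rho eps U s /\ bd Xx (U t) (eps * Rpower s (- (xi - alpha)))).
{ intros s t Hs Hst Ht. split; [apply Hsm; lra|].
  destruct (Hsm t ltac:(lra)) as [_ B]. apply (gbd_le B).
  apply Rmult_le_compat_l; [lra|]. apply Rpower_antitone; lra. }
assert (OU : forall t, 0 < t <= tau -> O (U t)).
{ intros t Ht. apply (trajectory_O AC). now apply Hsm. }
assert (Mi : mild T (fun s => f (u s)) 0 tau u).
{ apply (mild_of_start SG). intros t Ht. rewrite Rminus_0_r, E0u, Eu by lra.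
  apply (int_ext (g := conv T (fun s => f (U s)) t)).
  - intros s Hs. unfold conv. now rewrite Eu.
  - exact (int_embed (st_emba0 ST) (int_embed (st_embxa ST) (HI t Ht))). }
assert (Hmu : 0 < hexp <= 1) by (unfold holder_exp; lra).
assert (Hol : forall sigma, 0 < sigma -> exists K, 0 <= K /\ forall s t, sigma <= s -> s < t -> t <= tau ->
  N0 (f (u t) -v f (u s)) (K * Rpower (t - s) hexp)).
{ intros sigma Hs.
  assert (HK : 0 <= N * Rpower eps ((1 + gamma - alpha) / (xi - alpha)))
    by (apply Rmult_le_pos; [lra|left; apply Rpower_pos]).
  destruct (image_holder ST Htau (ac_tau1 AC) HK Hs Mu (f := f) (U := U) (V := U)) as [L [HL Q]].
  { intros s Hs'. apply (trajectory_nl_bound ST AC); [now apply Hsm|exact Hs']. }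
  { exact HI. }
  destruct (lip_bounded ST NL (eps * Rpower sigma (- (xi - alpha)))) as [L' [HL' Q']].
  exists (C * (L' * L)). split; [repeat apply Rmult_le_pos; lra|].
  intros s t Hss Hst Ht. rewrite !Eu by lra.
  assert (B := Q' (U t) (U s) _ (OU t ltac:(lra)) (OU s ltac:(lra))
    (proj2 (SI sigma t Hs ltac:(lra) Ht)) (proj2 (SI sigma s Hs Hss ltac:(lra))) (Q s t Hss Hst Ht)).
  apply (gbd_le (st_embg0 ST B)). right. ring. }
assert (C0u : forall t, 0 <= t <= tau -> cont N0 u (icc 0 tau) t).
{ intros t Ht. apply (cont_embed (st_emba0 ST)). now apply Ca. }
assert (HC0 : 0 < C) by lra.
assert (Reg : forall sigma, 0 < sigma < tau -> exists K, 0 <= K /\ tau - sigma <= t0 /\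
  (forall s t, sigma <= s -> s < t -> t <= tau ->
     N0 (f (u t) -v f (u s)) (K * Rpower (t - s) hexp)) /\
  mild T (fun s => f (u s)) sigma tau u /\
  (forall t, sigma <= t <= tau -> cont N0 u (icc sigma tau) t)).
{ intros sigma Hs. destruct (Hol sigma (proj1 Hs)) as [K [HK Q]]. exists K.
  split; [exact HK|]. split; [lra|]. split; [exact Q|]. split.
  - apply (mild_sub (c := 0) (d := tau)); [lra|lra|exact Mi].
  - intros t Ht. apply cont_sub with (icc 0 tau); [unfold icc; intros; lra|]. apply C0u. lra. }
change (strong tau u0 u). split.
- lra.
- exact E0u.
- intros t Ht. destruct (Req_dec t 0) as [->|Hne]; [now rewrite E0u|].
  rewrite Eu by lra. apply OU. lra.
- exact Ca.
- intros t Ht. destruct (Reg (t / 2) ltac:(lra)) as [K [HK [Hcd [Hg [Hm Hc]]]]].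
  apply (mild_mem SG Hcd HK Hmu HC0 (st_k01 ST) Hg Hm). lra.
- intros t Ht. destruct (Reg (t / 2) ltac:(lra)) as [K [HK [Hcd [Hg [Hm Hc]]]]].
  apply (cont_local (D := fun s => t / 2 < s <= tau) (r := t / 2)); [lra| |].
  + intros s Hs Hst. apply Rabs_def2 in Hst. lra.
  + apply (mild_cont_E1 SG Hcd HK Hmu HC0 (st_k01 ST) Hg Hm Hc). lra.
- intros t Ht. destruct (Reg (t / 2) ltac:(lra)) as [K [HK [Hcd [Hg [Hm Hc]]]]].
  apply (mild_rder SG Hcd HK Hmu HC0 (st_k01 ST) Hg Hm). lra.
- intros e He. destruct (VU e He) as [s [Hs Q]]. exists s. split; [exact Hs|].
  intros t Ht. rewrite Eu by lra. now apply Q.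
Qed.

(** The constants of the contraction depend on the centre [c] only and serve all
    data in a ball. *)
Lemma strong_exists c : O c -> exists r tau, 0 < r /\ 0 < tau /\
  forall u0, bd Xa (u0 -v c) r -> exists u, strong tau u0 u.
Proof using ST NL.
intros Oc.
destruct (admissible_constants_exist ST NL Oc) as [rho [N [m0 [eps [tau [r AC]]]]]].
assert (Hrho := ac_rho AC).
exists (Rmin r rho), tau. split; [apply Rmin_glb_lt; [exact (ac_r AC)|exact Hrho]|].
split; [apply (ac_tau AC)|]. intros u0 Hu.
assert (Hr := gbd_le Hu (Rmin_l _ _)).
destruct (picard ST NL AC Hr) as [U [HI HT]].
eexists. apply (strong_of_image AC Hr HI HT).
apply (ac_bounds AC). exact (gbd_le Hu (Rmin_r _ _)).
Qed.

(** By uniqueness both solutions are fixed points found with the same constants,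
    so that [image_stable] compares them. *)
Lemma strong_stable c : O c -> exists r tau, 0 < r /\ 0 < tau /\
  forall u0 u0' u u' s e t, bd Xa (u0 -v c) r -> bd Xa (u0' -v c) r ->
    strong s u0 u -> strong s u0' u' -> bd Xa (u0 -v u0') e ->
    0 <= t <= tau -> t <= s -> bd Xa (u t -v u' t) (2 * C * e).
Proof using ST NL.
intros Oc. assert (HC := st_C ST).
destruct (admissible_constants_exist ST NL Oc) as [rho [N [m0 [eps [tau [r AC]]]]]].
assert (Htau := ac_tau AC). assert (Heps := ac_eps AC). assert (Hrho := ac_rho AC).
exists (Rmin r rho), tau. split; [apply Rmin_glb_lt; [exact (ac_r AC)|exact Hrho]|].
split; [lra|]. intros u0 u0' u u' s e t Hu Hu' S S' He Ht Hts.
destruct (Req_dec t 0) as [->|Hne].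
{ rewrite (so_init S), (so_init S'). apply (gbd_le He).
  assert (P := gbd_pos He). nra. }
assert (Fix : forall u0 u, bd Xa (u0 -v c) (Rmin r rho) -> strong s u0 u -> exists U,
  img tau u0 U U /\ traj c rho eps tau U /\ forall x, 0 < x <= Rmin s tau -> u x = U x).
{ clear u0 u0' u u' Hu Hu' S S' He. intros u0 u Hu S.
  assert (Hr := gbd_le Hu (Rmin_l _ _)).
  destruct (picard ST NL AC Hr) as [U [HI HT]]. exists U. split; [exact HI|]. split; [exact HT|].
  intros x Hx. assert (P := so_pos S).
  assert (M1 := Rmin_l s tau). assert (M2 := Rmin_r s tau).
  assert (S2 := strong_of_image AC Hr HI HT (proj1 (ac_bounds AC) _ (gbd_le Hu (Rmin_r _ _)))).
  assert (R1 := strong_restrict (tau := s) (tau' := Rmin s tau) ltac:(lra) S).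
  assert (R2 := strong_restrict (tau := tau) (tau' := Rmin s tau) ltac:(lra) S2).
  rewrite (strong_unique R1 R2) by lra. destruct (Rle_dec x 0); [lra|reflexivity]. }
destruct (Fix u0 u Hu S) as [U [HI [HT EU]]].
destruct (Fix u0' u' Hu' S') as [U' [HI' [HT' EU']]].
assert (Htm : 0 < t <= Rmin s tau) by (split; [lra|apply Rmin_glb; lra]).
rewrite EU, EU' by exact Htm.
apply (image_stable ST (ac_bounds AC) (ac_N AC) Hrho Heps (ac_contract AC) Htau (ac_scale AC)
  (u0 := u0) (u0' := u0')); try assumption; [|lra].
intros x Hx. split; [apply HT|apply HT']; exact Hx.
Qed.

End Strong.

(** * The maximal solution and its blow-up *)

Section Maximal.

Context {k : scalar_field} {E0 : CompleteNormedModule (Kring k)}.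
Context {E1 Xg Xa Xx : banach_in E0} {A : E0 -> E0} {T : R -> E0 -> E0}.
Context {t0 M gamma alpha xi C : R}.
Context (ST : setting E1 Xg Xa Xx A T t0 M gamma alpha xi C).
Context {O : E0 -> Prop} {f : E0 -> E0}.
Context (NL : nonlinearity Xg Xa Xx O f ((1 + gamma - alpha) / (xi - alpha))).

Notation N0 := (bd (whole E0)).
Notation N1 := (bd E1).
Notation strong := (@strong k E0 E1 Xa Xx A alpha xi O f).

Lemma cont_germ (B : gauge E0) p p' (D D' : R -> Prop) t r : 0 < r -> p t = p' t ->
  (forall x, D' x -> Rabs (x - t) < r -> D x /\ p x = p' x) -> cont B p D t -> cont B p' D' t.
Proof.
intros Hr Et H Cp e He. destruct (Cp e He) as [d [Hd Q]].
exists (Rmin d r). split; [now apply Rmin_glb_lt|]. intros x Dx Hx.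
assert (M1 := Rmin_l d r). assert (M2 := Rmin_r d r).
destruct (H x Dx ltac:(lra)) as [H1 H2]. rewrite <- H2, <- Et. apply Q; [exact H1|lra].
Qed.

Lemma vanishing_germ (u u' : R -> E0) r : 0 < r -> (forall t, 0 < t < r -> u t = u' t) ->
  @vanishing k E0 Xx alpha xi u -> @vanishing k E0 Xx alpha xi u'.
Proof.
intros Hr E V e He. destruct (V e He) as [s [Hs Q]].
exists (Rmin s r). split; [now apply Rmin_glb_lt|]. intros t Ht.
assert (M1 := Rmin_l s r). assert (M2 := Rmin_r s r).
rewrite <- E by lra. apply Q. lra.
Qed.

Lemma strong_ext tau u0 u u' : (forall t, 0 <= t <= tau -> u t = u' t) ->
  strong tau u0 u -> strong tau u0 u'.
Proof.
intros E S. assert (Ht := so_pos S). split.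
- exact Ht.
- rewrite <- E by lra. exact (so_init S).
- intros t Htt. rewrite <- E by exact Htt. now apply (so_range S).
- intros t Htt. apply (cont_ext (p := u)); [now apply E|exact E|]. now apply (so_cont S).
- intros t Htt. rewrite <- E by lra. now apply (so_mem S).
- intros t Htt. apply (cont_ext (p := u)); [apply E; lra|intros; apply E; lra|].
  now apply (so_cont1 S).
- intros t Htt. rewrite <- E by lra.
  apply (rder_local (p := u) (r := tau - t)); [lra|intros; apply E; lra|]. now apply (so_rder S).
- apply (vanishing_germ Ht (u := u)); [intros; apply E; lra|exact (so_van S)].
Qed.

(** Continuation: all conditions at positive times are local, and by uniqueness
    the two solutions agree on the overlap. *)
Lemma strong_glue tau sigma u0 u w s : strong tau u0 u -> 0 <= s < tau ->
  strong sigma (u s) w -> exists u', strong (Rmax tau (s + sigma)) u0 u'.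
Proof using ST NL.
intros S Hs W. assert (Hsig := so_pos W).
destruct (Rle_lt_dec (s + sigma) tau) as [h|h].
{ exists u. now rewrite Rmax_left. }
rewrite Rmax_right by lra.
destruct (Rle_lt_or_eq_dec 0 s (proj1 Hs)) as [Hs0|<-].
2:{ exists w. rewrite Rplus_0_l. now rewrite (so_init S) in W. }
assert (Ov : forall t, s <= t <= tau -> u t = w (t - s)).
{ intros t Ht. assert (S' := strong_shift ST S (s := s) ltac:(lra)).
  assert (W' := strong_restrict (tau := sigma) (tau' := tau - s) ltac:(lra) W).
  rewrite <- (strong_unique ST NL S' W') by lra. f_equal. ring. }
pose (v := fun t => if Rle_dec t tau then u t else w (t - s)).
assert (V1 : forall t, t <= tau -> v t = u t).
{ intros t Ht. unfold v. destruct (Rle_dec t tau); [reflexivity|lra]. }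
assert (V2 : forall t, s <= t -> v t = w (t - s)).
{ intros t Ht. unfold v. destruct (Rle_dec t tau); [apply Ov; lra|reflexivity]. }
exists v. split.
- lra.
- rewrite V1 by lra. exact (so_init S).
- intros t Ht. destruct (Rle_lt_dec t tau) as [c|c].
  + rewrite V1 by exact c. apply (so_range S). lra.
  + rewrite V2 by lra. apply (so_range W). lra.
- intros t Ht. destruct (Rlt_le_dec t tau) as [c|c].
  + apply (cont_germ (p := u) (D := icc 0 tau) (r := tau - t)); [lra|rewrite V1; [reflexivity|lra]| |].
    * intros x Hx Hxt. unfold icc in *. apply Rabs_def2 in Hxt. rewrite V1 by lra. split; [lra|reflexivity].
    * apply (so_cont S). lra.
  + apply (cont_germ (p := fun t => w (t - s)) (D := fun t => icc 0 sigma (t - s)) (r := t - s));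
      [lra|rewrite V2; [reflexivity|lra]| |].
    * intros x Hx Hxt. unfold icc in *. apply Rabs_def2 in Hxt. rewrite V2 by lra. split; [lra|reflexivity].
    * apply (cont_shift (c := - s) (D := icc 0 sigma)). apply (so_cont W). lra.
- intros t Ht. destruct (Rle_lt_dec t tau) as [c|c].
  + rewrite V1 by exact c. apply (so_mem S). lra.
  + rewrite V2 by lra. apply (so_mem W). lra.
- intros t Ht. destruct (Rlt_le_dec t tau) as [c|c].
  + apply (cont_germ (p := u) (D := fun t => 0 < t <= tau) (r := tau - t));
      [lra|rewrite V1; [reflexivity|lra]| |].
    * intros x Hx Hxt. apply Rabs_def2 in Hxt. rewrite V1 by lra. split; [lra|reflexivity].
    * apply (so_cont1 S). lra.
  + apply (cont_germ (p := fun t => w (t - s)) (D := fun t => 0 < t - s <= sigma) (r := t - s));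
      [lra|rewrite V2; [reflexivity|lra]| |].
    * intros x Hx Hxt. apply Rabs_def2 in Hxt. rewrite V2 by lra. split; [lra|reflexivity].
    * apply (cont_shift (c := - s) (D := fun t => 0 < t <= sigma)). apply (so_cont1 W). lra.
- intros t Ht. destruct (Rlt_le_dec t tau) as [c|c].
  + rewrite V1 by lra.
    apply (rder_local (p := u) (r := tau - t)); [lra|intros; symmetry; apply V1; lra|].
    apply (so_rder S). lra.
  + rewrite V2 by lra.
    apply (rder_local (p := fun t => w (t - s)) (r := 1)); [lra|intros; symmetry; apply V2; lra|].
    apply (rder_shift (c := - s)). apply (so_rder W). lra.
- apply (vanishing_germ (so_pos S) (u := u)); [intros; symmetry; apply V1; lra|exact (so_van S)].
Qed.

Lemma strong_extend tau u0 u : strong tau u0 u ->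
  exists tau' u', tau < tau' /\ strong tau' u0 u'.
Proof using ST NL.
intros S. assert (Ht := so_pos S).
destruct (strong_exists ST NL (so_range S (t := tau) ltac:(lra))) as [r [sigma [Hr [Hsig Ex]]]].
destruct (so_cont S (t := tau) ltac:(lra) Hr) as [d [Hd Q]].
pose (s := Rmax (tau / 2) (tau - Rmin d sigma / 2)).
assert (Pm : 0 < Rmin d sigma) by now apply Rmin_glb_lt.
assert (M1 := Rmin_l d sigma). assert (M2 := Rmin_r d sigma).
assert (M3 : tau / 2 <= s) by apply Rmax_l. assert (M4 : tau - Rmin d sigma / 2 <= s) by apply Rmax_r.
assert (M5 : s < tau) by (apply Rmax_lub_lt; lra).
destruct (Ex (u s)) as [w W]; [apply Q; [unfold icc; lra|rewrite Rabs_left; lra]|].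
destruct (strong_glue S (s := s) ltac:(lra) W) as [u' S'].
rewrite Rmax_right in S' by lra. exists (s + sigma), u'. split; [lra|exact S'].
Qed.

Definition tplus (u0 : E0) : Rbar := Lub_Rbar (fun tau => exists u, strong tau u0 u).

Definition flow (u0 : E0) (t : R) : E0 :=
  epsilon (inhabits (vzero : E0)) (fun x => exists tau u, strong tau u0 u /\ t <= tau /\ x = u t).

Lemma strong_tplus tau u0 u : strong tau u0 u -> Rbar_lt tau (tplus u0).
Proof using ST NL.
intros S. destruct (strong_extend S) as [tau' [u' [Ht S']]].
apply Rbar_lt_le_trans with tau'; [exact Ht|].
apply (proj1 (Lub_Rbar_correct _)). now exists u'.
Qed.

Lemma below_tplus (t : R) u0 : Rbar_lt t (tplus u0) -> exists tau u, t < tau /\ strong tau u0 u.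
Proof.
intros H. apply NNPP. intros No. apply (Rbar_lt_not_le _ _ H).
apply (proj2 (Lub_Rbar_correct _)). intros tau [u S]. simpl.
apply Rnot_lt_le. intros h. apply No. now exists tau, u.
Qed.

Lemma flow_eq tau u0 u t : strong tau u0 u -> 0 <= t <= tau -> flow u0 t = u t.
Proof using ST NL.
intros S Ht.
destruct (epsilon_spec (inhabits (vzero : E0))
  (fun x => exists tau u, strong tau u0 u /\ t <= tau /\ x = u t)) as [tau' [u' [S' [Ht' E]]]].
{ exists (u t), tau, u. split; [exact S|]. split; [lra|reflexivity]. }
unfold flow. rewrite E. assert (P1 := so_pos S). assert (P2 := so_pos S').
assert (M1 := Rmin_l tau tau'). assert (M2 := Rmin_r tau tau').
assert (Pm : 0 < Rmin tau tau') by now apply Rmin_glb_lt.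
assert (R1 := strong_restrict (tau := tau) (tau' := Rmin tau tau') ltac:(lra) S).
assert (R2 := strong_restrict (tau := tau') (tau' := Rmin tau tau') ltac:(lra) S').
apply (strong_unique ST NL R2 R1). split; [lra|]. apply Rmin_glb; lra.
Qed.

Lemma flow_strong (tau : R) u0 : 0 < tau -> Rbar_lt tau (tplus u0) -> strong tau u0 (flow u0).
Proof using ST NL.
intros H0 H. destruct (below_tplus H) as [tau' [u [Ht S]]].
assert (R := strong_restrict (tau := tau') (tau' := tau) ltac:(lra) S).
apply (strong_ext (u := u)); [|exact R]. intros t Htt. symmetry. now apply (flow_eq R).
Qed.

Lemma tplus_pos u0 : O u0 -> Rbar_lt 0 (tplus u0).
Proof using ST NL.
intros Ou. destruct (strong_exists ST NL Ou) as [r [tau [Hr [Ht Ex]]]].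
destruct (Ex u0) as [u S].
{ apply gbd_le with 0; [|lra]. apply (gbd_eq (gbd_zero (bd Xa))). vec. }
apply Rbar_lt_trans with tau; [exact Ht|]. exact (strong_tplus S).
Qed.

Lemma tplus_between (t : R) u0 : Rbar_lt t (tplus u0) -> exists tau, t < tau /\ Rbar_lt tau (tplus u0).
Proof using ST NL.
intros H. destruct (below_tplus H) as [tau [u [Ht S]]]. exists tau.
split; [exact Ht|exact (strong_tplus S)].
Qed.

Lemma Rbar_lt_real_trans (s t : R) (b : Rbar) : s <= t -> Rbar_lt t b -> Rbar_lt s b.
Proof. intros H1 H2. apply Rbar_le_lt_trans with t; [exact H1|exact H2]. Qed.

Lemma flow_0 u0 : O u0 -> flow u0 0 = u0.
Proof using ST NL.
intros Ou. destruct (tplus_between (tplus_pos Ou)) as [tau [Ht H]].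
exact (so_init (flow_strong Ht H)).
Qed.

Lemma flow_range u0 (t : R) : O u0 -> 0 <= t -> Rbar_lt t (tplus u0) -> O (flow u0 t).
Proof using ST NL.
intros Ou Ht H. destruct (tplus_between H) as [tau [Ht' H']].
apply (so_range (flow_strong (tau := tau) ltac:(lra) H')). lra.
Qed.

Lemma flow_shift u0 (s t : R) : O u0 -> 0 <= s -> 0 <= t -> Rbar_lt s (tplus u0) ->
  (Rbar_lt t (tplus (flow u0 s)) <-> Rbar_lt (t + s) (tplus u0)) /\
  (Rbar_lt (t + s) (tplus u0) -> flow u0 (t + s) = flow (flow u0 s) t).
Proof using ST NL.
intros Ou Hs Ht H.
assert (Shift : Rbar_lt (t + s) (tplus u0) ->
  exists tau, t < tau /\ strong tau (flow u0 s) (fun t => flow u0 (t + s))).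
{ intros H'. destruct (tplus_between H') as [tau [Ht' H'']].
  assert (S := flow_strong (tau := tau) ltac:(lra) H'').
  destruct (Rle_lt_or_eq_dec 0 s Hs) as [Hs0|<-].
  - exists (tau - s). split; [lra|]. apply (strong_shift ST S). lra.
  - exists tau. split; [lra|]. rewrite flow_0 by exact Ou.
    apply (strong_ext (u := flow u0)); [intros; now rewrite Rplus_0_r|exact S]. }
split; [split|].
- intros H'. destruct (below_tplus H') as [sigma [w [Hw W]]].
  destruct (tplus_between H) as [tau [Ht' H'']].
  destruct (strong_glue (flow_strong (tau := tau) ltac:(lra) H'') (s := s) ltac:(lra) W) as [u' S'].
  apply (Rbar_lt_real_trans (t := Rmax tau (s + sigma))); [|exact (strong_tplus S')].
  apply Rle_trans with (s + sigma); [lra|apply Rmax_r].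
- intros H'. destruct (Shift H') as [tau [Ht' S]].
  apply (Rbar_lt_real_trans (t := tau)); [lra|exact (strong_tplus S)].
- intros H'. destruct (Shift H') as [tau [Ht' S]].
  symmetry. exact (flow_eq S (t := t) ltac:(lra)).
Qed.

Lemma uniform_existence c : O c -> exists r tau, 0 < r /\ 0 < tau /\
  forall v, bd Xa (v -v c) r -> Rbar_lt tau (tplus v).
Proof using ST NL.
intros Oc. destruct (strong_exists ST NL Oc) as [r [tau [Hr [Ht Ex]]]].
exists r, tau. split; [exact Hr|]. split; [exact Ht|]. intros v Hv.
destruct (Ex v Hv) as [u S]. exact (strong_tplus S).
Qed.

Lemma flow_cont u0 t : O u0 -> 0 <= t -> Rbar_lt t (tplus u0) ->
  forall e, 0 < e -> exists d, 0 < d /\ forall s, 0 <= s -> Rabs (s - t) < d ->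
    Rbar_lt s (tplus u0) /\ bd Xa (flow u0 s -v flow u0 t) e.
Proof using ST NL.
intros Ou Ht H e He. destruct (tplus_between H) as [tau [Ht' H']].
assert (S := flow_strong (tau := tau) ltac:(lra) H').
destruct (so_cont S (t := t) ltac:(lra) He) as [d [Hd Q]].
exists (Rmin d (tau - t)). split; [apply Rmin_glb_lt; lra|]. intros s Hs Hst.
assert (M1 := Rmin_l d (tau - t)). assert (M2 := Rmin_r d (tau - t)).
assert (Hst' : Rabs (s - t) < tau - t) by lra. apply Rabs_def2 in Hst'.
split; [apply (Rbar_lt_real_trans (t := tau)); [lra|exact H']|].
apply Q; [unfold icc; lra|lra].
Qed.

Definition stable_until (u0 : E0) (t : R) : Prop := exists d L, 0 < d /\ 0 <= L /\
  forall v, bd Xa (v -v u0) d -> O v /\ Rbar_lt t (tplus v) /\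
    forall s e, 0 <= s <= t -> bd Xa (v -v u0) e -> bd Xa (flow v s -v flow u0 s) (L * e).

(** The step [h] is the same for all [s] slightly before [t]; so the times [s] with
    [stable_until u0 s] have no supremum inside the interval of existence. *)
Lemma stable_until_step u0 t : O u0 -> 0 <= t -> Rbar_lt t (tplus u0) ->
  exists h, 0 < h /\ forall s, 0 <= s -> t - h < s <= t ->
    stable_until u0 s -> stable_until u0 (s + h).
Proof using ST NL.
intros Ou Ht H. assert (HC := st_C ST).
assert (Oc := flow_range Ou Ht H). set (c := flow u0 t) in *.
destruct (uniform_existence Oc) as [r1 [s1 [Hr1 [Hs1 Ex]]]].
destruct (strong_stable ST NL Oc) as [r2 [s2 [Hr2 [Hs2 Stb]]]].
pose (r := Rmin r1 r2 / 2).
assert (M1 := Rmin_l r1 r2). assert (M2 := Rmin_r r1 r2).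
assert (Pm : 0 < Rmin r1 r2) by now apply Rmin_glb_lt.
assert (Hr : 0 < r) by (unfold r; lra).
destruct (flow_cont Ou Ht H Hr) as [d [Hd Q]].
pose (h := Rmin (Rmin s1 s2) d / 2).
assert (M3 := Rmin_l (Rmin s1 s2) d). assert (M4 := Rmin_r (Rmin s1 s2) d).
assert (M5 := Rmin_l s1 s2). assert (M6 := Rmin_r s1 s2).
assert (Ph : 0 < Rmin (Rmin s1 s2) d) by (repeat apply Rmin_glb_lt; lra).
assert (Hh : 0 < h) by (unfold h; lra).
exists h. split; [exact Hh|]. intros s Hs Hst [d' [L [Hd' [HL St]]]].
destruct (Q s Hs) as [Hsp Hsc].
{ rewrite Rabs_left1 by lra. unfold h in Hst. lra. }
exists (Rmin d' (r / (L + 1))), (L + 2 * C * L).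
assert (PCL : 0 <= 2 * C * L) by (repeat apply Rmult_le_pos; lra).
split; [apply Rmin_glb_lt; [exact Hd'|apply Rdiv_lt_0_compat; lra]|]. split; [lra|].
intros v Hv. destruct (St v (gbd_le Hv (Rmin_l _ _))) as [Ov [Tv Lv]].
assert (Near : forall x, bd Xa (x -v flow u0 s) r -> bd Xa (x -v c) (r + r)).
{ intros x Hx. exact (gbd_tri Hx Hsc). }
assert (Bv : bd Xa (flow v s -v flow u0 s) r).
{ apply (gbd_le (Lv s _ ltac:(lra) (gbd_le Hv (Rmin_r _ _)))).
  apply Rle_trans with ((L + 1) * (r / (L + 1))); [|right; field; lra].
  apply Rmult_le_compat_r; [left; apply Rdiv_lt_0_compat; lra|lra]. }
assert (Bu : bd Xa (flow u0 s -v flow u0 s) r).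
{ apply gbd_le with 0; [|lra]. apply (gbd_eq (gbd_zero (bd Xa))). vec. }
assert (Long : forall x, O x -> Rbar_lt s (tplus x) -> bd Xa (flow x s -v flow u0 s) r ->
  Rbar_lt (s + h) (tplus x) /\
  (forall x', 0 <= x' <= h -> flow x (x' + s) = flow (flow x s) x') /\
  strong h (flow x s) (flow (flow x s))).
{ intros x Ox Hx Bx.
  assert (Tx := Ex _ (gbd_le (Near _ Bx) (s := r1) ltac:(unfold r; lra))).
  assert (Th : Rbar_lt h (tplus (flow x s))).
  { apply (Rbar_lt_real_trans (t := s1)); [unfold h; lra|exact Tx]. }
  assert (Tsh : Rbar_lt (h + s) (tplus x)).
  { apply (flow_shift (t := h) Ox Hs ltac:(lra) Hx). exact Th. }
  split; [now rewrite Rplus_comm|]. split.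
  - intros x' Hx'. apply (flow_shift (t := x') Ox Hs ltac:(lra) Hx).
    apply (Rbar_lt_real_trans (t := h + s)); [lra|exact Tsh].
  - now apply flow_strong. }
destruct (Long v Ov Tv Bv) as [F1 [F2 F3]].
destruct (Long u0 Ou Hsp Bu) as [_ [G2 G3]].
split; [exact Ov|]. split; [exact F1|]. intros x e Hx He.
assert (Pe := gbd_pos He).
assert (PLe : 0 <= L * e) by (apply Rmult_le_pos; lra).
assert (PCLe : 0 <= 2 * C * L * e) by (apply Rmult_le_pos; lra).
destruct (Rle_lt_dec x s) as [hx|hx].
- apply (gbd_le (Lv x e ltac:(lra) He)). lra.
- replace x with ((x - s) + s) by ring. rewrite F2, G2 by lra.
  assert (Bv2 := gbd_le (Near _ Bv) (s := r2) ltac:(unfold r; lra)).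
  assert (Bu2 := gbd_le (Near _ Bu) (s := r2) ltac:(unfold r; lra)).
  assert (B := Stb (flow v s) (flow u0 s) _ _ h (L * e) (x - s) Bv2 Bu2
    F3 G3 (Lv s e ltac:(lra) He) ltac:(unfold h in *; lra) ltac:(lra)).
  apply (gbd_le B). lra.
Qed.

Lemma stable u0 t : O u0 -> 0 <= t -> Rbar_lt t (tplus u0) -> stable_until u0 t.
Proof using ST NL.
intros Ou Ht H. apply NNPP. intros No.
assert (Down : forall s s', s' <= s -> stable_until u0 s -> stable_until u0 s').
{ intros s s' Hs [d [L [Hd [HL St]]]]. exists d, L. split; [exact Hd|]. split; [exact HL|].
  intros v Hv. destruct (St v Hv) as [Ov [Tv Lv]]. split; [exact Ov|]. split.
  - apply (Rbar_lt_real_trans (t := s)); assumption.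
  - intros x e Hx. apply Lv. lra. }
assert (S0 : stable_until u0 0).
{ destruct (nl_open NL Ou) as [r [Hr Op]]. exists r, 1. split; [exact Hr|]. split; [lra|].
  intros v Hv. assert (Ov := Op v Hv). split; [exact Ov|]. split; [now apply tplus_pos|].
  intros s e Hs He. replace s with 0 by lra. rewrite !flow_0 by assumption.
  now rewrite Rmult_1_l. }
pose (P := fun s => 0 <= s /\ stable_until u0 s).
assert (Bd : forall s, P s -> s <= t).
{ intros s [_ Hs]. apply Rnot_lt_le. intros h. apply No. apply (Down s); [lra|exact Hs]. }
destruct (completeness P) as [c [Ub Lub]].
{ exists t. exact Bd. } { exists 0. split; [lra|exact S0]. }
assert (Hc0 : 0 <= c) by (apply Ub; split; [lra|exact S0]).
assert (Hct : c <= t) by (apply Lub; exact Bd).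
destruct (stable_until_step Ou Hc0 (Rbar_lt_real_trans Hct H)) as [h [Hh Step]].
destruct (classic (exists s, P s /\ c - h < s)) as [[s [[Hs0 Hs] Hsc]]|No'].
- assert (Hs' : s <= c) by (apply Ub; split; assumption).
  assert (Ps : P (s + h)) by (split; [lra|apply Step; try lra; exact Hs]).
  apply Ub in Ps. lra.
- assert (c <= c - h); [|lra]. apply Lub. intros s Hs. apply Rnot_lt_le. intros h'.
  apply No'. now exists s.
Qed.

Section BlowUp.

Context {u0 : E0} {S : R} (Ou : O u0) (HS : tplus u0 = Finite S).

Lemma life_pos : 0 < S.
Proof using ST NL Ou HS. assert (H := tplus_pos Ou). rewrite HS in H. exact H. Qed.

Lemma life_below (t : R) : t < S -> Rbar_lt t (tplus u0).
Proof using HS. intros H. rewrite HS. exact H. Qed.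

(** Existence times are bounded below near [c], so an orbit that visits this
    neighbourhood late would outlive [S]. *)
Lemma no_late_visit c : O c -> exists r d, 0 < r /\ 0 < d /\
  forall t, 0 <= t -> S - d < t < S -> ~ bd Xa (flow u0 t -v c) r.
Proof using ST NL Ou HS.
intros Oc. destruct (uniform_existence Oc) as [r [tau [Hr [Ht Ex]]]].
exists r, tau. split; [exact Hr|]. split; [exact Ht|]. intros t Ht0 HtS Hb.
assert (Hlt := Ex _ Hb).
destruct (flow_shift (t := tau) Ou Ht0 ltac:(lra) (life_below (proj2 HtS))) as [Sh _].
apply Sh in Hlt. rewrite HS in Hlt. simpl in Hlt. lra.
Qed.

Definition cauchy_late : Prop := forall e, 0 < e -> exists d, 0 < d /\
  forall s t, 0 <= s -> 0 <= t -> S - d < s < S -> S - d < t < S ->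
    bd Xa (flow u0 s -v flow u0 t) e.

(** The limit is not in [O], for the orbit visits every ball around it late, which
    [no_late_visit] excludes at points of [O]. *)
Lemma cauchy_late_limit : cauchy_late -> exists c, mem Xa c /\ ~ O c /\
  forall e, 0 < e -> exists d, 0 < d /\
    forall t, 0 <= t -> S - d < t < S -> bd Xa (flow u0 t -v c) e.
Proof using ST NL Ou HS.
intros Cau. assert (PS := life_pos).
pose (s := fun n : nat => S - S * (/ 2) ^ n).
assert (Hs : forall n, 0 <= s n < S).
{ intros n. assert (P := half_pow_pos n).
  assert (P' : (/ 2) ^ n <= 1) by (rewrite <- (pow1 n); apply pow_incr; lra).
  unfold s. split; nra. }
assert (Late : forall d, 0 < d -> exists N, forall n, (N <= n)%nat -> S - d < s n).
{ intros d Hd. destruct (half_pow_small (e := d / S)) as [N HN]; [now apply Rdiv_lt_0_compat|].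
  exists N. intros n Hn. unfold s.
  assert (S * (/ 2) ^ n < S * (d / S)) by (apply Rmult_lt_compat_l; [exact PS|now apply HN]).
  replace (S * (d / S)) with d in * by (field; lra). lra. }
destruct (@bd_complete _ _ Xa (fun n => flow u0 (s n))) as [c Hc].
{ intros e He. destruct (Cau e He) as [d [Hd Q]]. destruct (Late d Hd) as [N HN].
  exists N. intros n m Hn Hm. assert (H1 := Hs n). assert (H2 := Hs m).
  apply Q; try lra; (split; [now apply HN|lra]). }
assert (Lim : forall e, 0 < e -> exists d, 0 < d /\
    forall t, 0 <= t -> S - d < t < S -> bd Xa (flow u0 t -v c) e).
{ intros e He. destruct (Cau (e / 2) ltac:(lra)) as [d [Hd Q]].
  exists d. split; [exact Hd|]. intros t Ht HtS.
  destruct (Late d Hd) as [N HN]. destruct (Hc (e / 2) ltac:(lra)) as [N' HN'].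
  pose (n := Nat.max N N'). assert (H1 := Hs n).
  apply gbd_le with (e / 2 + e / 2); [|lra].
  apply (gbd_tri (y := flow u0 (s n))).
  - apply Q; try lra. split; [apply HN; lia|lra].
  - apply HN'. lia. }
exists c. split; [|split; [|exact Lim]].
- destruct (Lim 1 Rlt_0_1) as [d [Hd Q]].
  pose (t := Rmax 0 (S - d / 2)).
  assert (Ht : 0 <= t) by apply Rmax_l. assert (Ht' : S - d / 2 <= t) by apply Rmax_r.
  assert (Ht'' : t < S) by (apply Rmax_lub_lt; lra).
  assert (B := bd_norm (nl_sub NL (flow_range Ou Ht (life_below Ht'')))).
  apply (@bd_mem _ _ Xa _ (norm (elt Xa (flow u0 t)) + 1)).
  apply (gbd_eq (gbd_sub B (Q t Ht ltac:(lra)))). vec.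
- intros Oc. destruct (no_late_visit Oc) as [r [d [Hr [Hd No]]]].
  destruct (Lim r Hr) as [d' [Hd' Q]].
  pose (t := Rmax 0 (S - Rmin d d' / 2)).
  assert (M1 := Rmin_l d d'). assert (M2 := Rmin_r d d').
  assert (Pm : 0 < Rmin d d') by now apply Rmin_glb_lt.
  assert (Ht : 0 <= t) by apply Rmax_l. assert (Ht' : S - Rmin d d' / 2 <= t) by apply Rmax_r.
  assert (Ht'' : t < S) by (apply Rmax_lub_lt; lra).
  apply (No t Ht ltac:(lra)). apply Q; [exact Ht|lra].
Qed.

(** If [f] stays bounded in [E0] along the orbit, the variation of constants
    formula makes the orbit Hoelder continuous in [Xa] up to its end. *)
Lemma bounded_cauchy_late K d : 0 < d ->
  (forall t, 0 <= t -> S - d < t < S -> N0 (f (flow u0 t)) K) -> cauchy_late.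
Proof using ST NL Ou HS.
intros Hd Hf. assert (PS := life_pos). assert (SG := st_sg ST). assert (Ht0 := sg_t0 SG).
assert (HC := st_C ST). assert (Hga := st_ga ST). assert (Hax := st_ax ST).
pose (c := Rmax (S / 2) (S - Rmin d (Rmin t0 1) / 2)).
assert (M1 := Rmin_l d (Rmin t0 1)). assert (M2 := Rmin_r d (Rmin t0 1)).
assert (M3 := Rmin_l t0 1). assert (M4 := Rmin_r t0 1).
assert (Pm : 0 < Rmin d (Rmin t0 1)) by (repeat apply Rmin_glb_lt; lra).
assert (Hc1 : S / 2 <= c) by apply Rmax_l.
assert (Hc2 : S - Rmin d (Rmin t0 1) / 2 <= c) by apply Rmax_r.
assert (Hc3 : c < S) by (apply Rmax_lub_lt; lra).
pose (mu := (1 - alpha) / 2).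
assert (Ha : 0 <= alpha < 1) by lra. assert (H0 : 0 <= 0 < 1) by lra.
assert (HC0 : 0 < C) by lra.
assert (HK : 0 <= Rabs K) by apply Rabs_pos.
assert (Hmu : 0 <= mu) by (unfold mu; lra). assert (Hamu : alpha + mu < 1) by (unfold mu; lra).
assert (Hg : forall t s, c < s < t -> t < S ->
  N0 ((fun s => f (flow u0 s)) s) (Rabs K * Rpower (s - c) (- 0))).
{ intros t s Hs Ht. rewrite Ropp_0, Rpower_O, Rmult_1_r by lra.
  apply (gbd_le (Hf s ltac:(lra) ltac:(lra))). apply Rle_abs. }
assert (Str : forall t, 0 < t < S -> strong t u0 (flow u0)).
{ intros t Ht. apply flow_strong; [lra|]. apply life_below. lra. }
assert (Int : forall t, c < t < S ->
  is_int (bd Xa) (conv T (fun s => f (flow u0 s)) t) c t (flow u0 t -v T (t - c) (flow u0 c))).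
{ intros t Ht. assert (Hct : c < t) by lra. assert (Hct' : t - c <= t0) by lra.
  assert (S' := Str t ltac:(lra)).
  destruct (conv_exists SG Ha H0 HC0 HK (st_k0a ST) Hct Hct' (fun s Hs => Hg t s Hs (proj2 Ht)))
    as [y I].
  { intros s Hs. apply (cont_embed (st_embg0 ST)).
    apply cont_sub with (fun s => 0 < s <= t); [unfold ioo; intros; lra|].
    apply (nl_cont ST NL).
    - intros x Hx. apply (so_range S'). lra.
    - lra.
    - apply (strong_memx ST S'). lra.
    - apply (strong_contx ST S'). lra. }
  assert (Mi := strong_mild ST S' (c := c) (d := t) ltac:(lra) (Rle_refl t) Hct'
    (Rle_refl c) Hct (Rle_refl t)).
  now rewrite (int_unique Mi (int_embed (st_emba0 ST) I)). }
set (b1 := beta_const (alpha + mu) 0). set (b2 := beta_const alpha 0).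
assert (Pb1 : 0 < b1) by (apply beta_const_pos; lra).
assert (Pb2 : 0 < b2) by (apply beta_const_pos; lra).
pose (L := C * Rabs K * (b1 + b2)).
assert (HL : 0 <= L) by (unfold L; repeat apply Rmult_le_pos; lra).
assert (Inc : forall t h, c < t -> 0 < h -> t + h < S ->
  bd Xa ((flow u0 (t + h) -v T (t + h - c) (flow u0 c)) -v (flow u0 t -v T (t - c) (flow u0 c)))
    (L * Rpower h mu)).
{ intros t h Hct Hh HtS. assert (Hth : t + h - c <= t0) by lra.
  assert (Q := conv_increment SG Ha H0 HC0 HK (st_k0a ST) Hmu Hamu Hct Hh Hth
    (fun s Hs => Hg (t + h) s Hs HtS) (Int t ltac:(lra)) (Int (t + h) ltac:(lra))).
  apply (gbd_le Q). unfold L.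
  replace (C * Rabs K * (b1 + b2) * Rpower h mu) with (C * Rabs K * ((b1 + b2) * Rpower h mu)) by ring.
  apply Rmult_le_compat_l; [apply Rmult_le_pos; lra|].
  assert (One : forall x p, 0 < x <= 1 -> 0 <= p -> Rpower x p <= 1).
  { intros x p Hx Hp. replace 1 with (Rpower 1 p) by (unfold Rpower; now rewrite ln_1, Rmult_0_r, exp_0).
    apply Rle_Rpower_l; lra. }
  assert (P1 := Rpower_pos h mu).
  assert (P2 : Rpower h (1 - alpha) <= Rpower h mu).
  { replace (1 - alpha) with (mu + mu) by (unfold mu; field). rewrite Rpower_plus.
    rewrite <- (Rmult_1_r (Rpower h mu)) at 3. apply Rmult_le_compat_l; [lra|]. apply One; lra. }
  fold b1 b2. rewrite Ropp_0, Rpower_O, Rmult_1_l by lra.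
  assert (P3 := One (t - c) (1 - alpha - mu - 0) ltac:(lra) ltac:(lra)).
  rewrite Rmult_plus_distr_r. apply Rplus_le_compat.
  - apply Rmult_le_compat_r; [lra|]. rewrite <- (Rmult_1_r b1) at 2. apply Rmult_le_compat_l; lra.
  - apply Rmult_le_compat_l; lra. }
intros e He.
assert (Mc := nl_sub NL (flow_range Ou (t := c) ltac:(lra) (life_below Hc3))).
destruct (st_cont0 ST Mc (e := e / (2 * C))) as [d1 [Hd1 Q1]]; [apply Rdiv_lt_0_compat; lra|].
destruct (@rpow_small (e / (2 * (L + 1))) mu) as [d2 [Hd2 Q2]];
  [unfold mu; lra|apply Rdiv_lt_0_compat; lra|].
pose (D := Rmin (Rmin d1 d2) (S - c)).
assert (N1' := Rmin_l (Rmin d1 d2) (S - c)). assert (N2 := Rmin_r (Rmin d1 d2) (S - c)).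
assert (N3 := Rmin_l d1 d2). assert (N4 := Rmin_r d1 d2).
assert (HD : 0 < D) by (repeat apply Rmin_glb_lt; lra).
assert (Main : forall t h, S - D < t -> 0 < h -> t + h < S ->
  bd Xa (flow u0 (t + h) -v flow u0 t) e).
{ intros t h Ht Hh HtS. unfold D in Ht.
  assert (B1 := Inc t h ltac:(lra) Hh HtS).
  assert (B2 := st_aa ST (t := t - c) ltac:(lra) (Q1 h ltac:(lra))).
  rewrite (real_linear_sub _ _ (sg_rl SG (t := t - c) ltac:(lra))), <- (sg_add SG) in B2 by lra.
  replace (t - c + h) with (t + h - c) in B2 by ring.
  assert (Q := Q2 h ltac:(lra)). rewrite rpow_Rpower in Q by exact Hh.
  eapply gbd_le.
  - apply (gbd_eq (gbd_add B1 B2)). vec.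
  - assert (P := Rpower_pos h mu).
    assert (L * Rpower h mu <= e / 2).
    { apply Rle_trans with ((L + 1) * (e / (2 * (L + 1)))); [|right; field; lra].
      apply Rmult_le_compat; lra. }
    replace (C * (e / (2 * C))) with (e / 2) by (field; lra). lra. }
exists D. split; [exact HD|]. intros s t Hs Ht HsS HtS.
destruct (Rtotal_order s t) as [h|[->|h]].
- apply gbd_swap. replace t with (s + (t - s)) by ring. apply Main; lra.
- apply gbd_le with 0; [|lra]. apply (gbd_eq (gbd_zero (bd Xa))). vec.
- replace s with (t + (s - t)) by ring. apply Main; lra.
Qed.

End BlowUp.

End Maximal.

(** * Translation to filters *)

Lemma filterlim_within_eps {K : AbsRing} {E : NormedModule K} (J : R -> Prop) (p : R -> E) t l :
  filterlim p (within J (locally t)) (locally l) <->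
  forall e, 0 < e -> exists d, 0 < d /\
    forall s, J s -> Rabs (s - t) < d -> norm (minus (p s) l) <= e.
Proof.
split; intros H.
- intros e He.
  destruct (proj1 (@filterlim_locally_ball_norm K R E _ _ p l) H (mkposreal e He)) as [d Hd].
  exists d. split; [apply cond_pos|]. intros s Js Hs. left. now apply Hd.
- apply (proj2 (@filterlim_locally_ball_norm K R E _ _ p l)). intros [e He].
  destruct (H (e / 2) ltac:(lra)) as [d [Hd Q]].
  exists (mkposreal d Hd). intros s Hs Js. change (Rabs (s - t) < d) in Hs.
  apply Rle_lt_trans with (e / 2); [|simpl; lra]. now apply Q.
Qed.

Lemma filterlim_within'_eps {K : AbsRing} {E : NormedModule K} (J : R -> Prop) (p : R -> E) t l :
  filterlim p (within J (locally' t)) (locally l) <->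
  forall e, 0 < e -> exists d, 0 < d /\
    forall s, J s -> s <> t -> Rabs (s - t) < d -> norm (minus (p s) l) <= e.
Proof.
split; intros H.
- intros e He.
  destruct (proj1 (@filterlim_locally_ball_norm K R E _ _ p l) H (mkposreal e He)) as [d Hd].
  exists d. split; [apply cond_pos|]. intros s Js Hne Hs. left. now apply Hd.
- apply (proj2 (@filterlim_locally_ball_norm K R E _ _ p l)). intros [e He].
  destruct (H (e / 2) ltac:(lra)) as [d [Hd Q]].
  exists (mkposreal d Hd). intros s Hs Hne Js. change (Rabs (s - t) < d) in Hs.
  apply Rle_lt_trans with (e / 2); [|simpl; lra]. now apply Q.
Qed.

Lemma at_left_eps (T : R) (P : R -> Prop) :
  at_left T P <-> exists d, 0 < d /\ forall t, T - d < t < T -> P t.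
Proof.
split.
- intros [d Hd]. exists d. split; [apply cond_pos|]. intros t Ht. apply Hd; [|lra].
  change (Rabs (t - T) < d). rewrite Rabs_left; lra.
- intros [d [Hd H]]. exists (mkposreal d Hd). intros t Ht HtT.
  change (Rabs (t - T) < d) in Ht. apply Rabs_def2 in Ht. apply H. lra.
Qed.

(** * The semiflow in [Ea] *)

Section Bridge.

Context {k : scalar_field} {E0 : CompleteNormedModule (Kring k)}.
Context {E1 Eg Ea Ex : banach_in E0} (A : E1 -> E0) (O : Ea -> Prop) (f : Ex -> Eg).
Context {T : R -> E0 -> E0} {t0 M gamma alpha xi C : R}.

(** The operator, the domain and the nonlinearity of the problem on vectors of
    [E0]; the values off their domains are arbitrary. *)
Definition op_on (x : E0) : E0 := A (elt E1 x).
Definition set_on (x : E0) : Prop := exists y : Ea, O y /\ emb y = x.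
Definition fun_on (x : E0) : E0 := emb (f (elt Ex x)).

Context (ST : setting E1 Eg Ea Ex op_on T t0 M gamma alpha xi C).
Context (NL : nonlinearity Eg Ea Ex set_on fun_on ((1 + gamma - alpha) / (xi - alpha))).

Notation N0 := (bd (whole E0)).
Notation strong := (@strong k E0 E1 Ea Ex op_on alpha xi set_on fun_on).
Notation d := (xi - alpha).
Notation sol := (solution A O f d).

Definition life (u0 : Ea) : Rbar :=
  @tplus k E0 E1 Ea Ex op_on alpha xi set_on fun_on (emb u0).
Definition orbit (t : R) (u0 : Ea) : Ea :=
  elt Ea (@flow k E0 E1 Ea Ex op_on alpha xi set_on fun_on (emb u0) t).

Notation flow := (@flow k E0 E1 Ea Ex op_on alpha xi set_on fun_on).
Notation tplus := (@tplus k E0 E1 Ea Ex op_on alpha xi set_on fun_on).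

Lemma set_on_emb (u : Ea) : set_on (emb u) <-> O u.
Proof.
split; [|intros H; now exists u]. intros [y [Oy E]]. apply emb_inj in E. now subst y.
Qed.

Lemma strong_of_solution u0 J v tau : sol u0 J v -> J tau -> 0 < tau ->
  strong tau (emb u0) (fun t => emb (v t)).
Proof using ST.
intros [S1 S2 S3 S4 S5 S6 S7 S8] Jt Ht.
destruct S1 as [I1 [I2 _]].
assert (Jin : forall t, 0 <= t <= tau -> J t) by (intros; now apply (I2 t tau)).
split.
- exact Ht.
- now rewrite S2.
- intros t Htt. exists (v t). split; [apply S3, Jin, Htt|reflexivity].
- intros t Htt e He.
  destruct (proj1 (@filterlim_within_eps _ Ea J v t (v t)) (S4 t (Jin t Htt)) e He) as [r [Hr Q]].
  exists r. split; [exact Hr|]. intros s Hs Hst.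
  rewrite <- emb_minus. apply bd_emb. apply Q; [apply Jin, Hs|exact Hst].
- intros t Htt. apply S5; [apply Jin; lra|lra].
- intros t Htt e He.
  destruct (proj1 (@filterlim_within_eps _ E1 J (fun s => coe E1 (v s)) t (coe E1 (v t)))
    (S6 t ltac:(apply Jin; lra) ltac:(lra)) e He) as [r [Hr Q]].
  exists r. split; [exact Hr|]. intros s Hs Hst.
  assert (Js : J s) by (apply Jin; lra).
  assert (B := proj2 (@bd_emb _ _ E1 _ _) (Q s Js Hst)).
  apply (gbd_eq B). unfold coe.
  rewrite <- (emb_elt (S5 s Js ltac:(lra))) at 1.
  rewrite <- (emb_elt (S5 t ltac:(apply Jin; lra) ltac:(lra))) at 1.
  symmetry. exact (emb_minus _ _).
- intros t Htt e He. destruct S7 as [u' S7].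
  destruct (S7 t ltac:(apply Jin; lra) ltac:(lra)) as [D [_ E]].
  destruct (proj1 (@filterlim_within'_eps _ E0 J _ t (u' t)) D e He) as [r [Hr Q]].
  exists (Rmin r (tau - t)). split; [apply Rmin_glb_lt; lra|]. intros h Hh.
  assert (M1 := Rmin_l r (tau - t)). assert (M2 := Rmin_r r (tau - t)).
  assert (Q' := Q (t + h) ltac:(apply Jin; lra) ltac:(lra)
    ltac:(replace (t + h - t) with h by ring; rewrite Rabs_pos_eq; lra)).
  replace (t + h - t) with h in Q' by ring.
  change (norm ((/ h) *v (emb (v (t + h)%R) -v emb (v t)) -v u' t) <= e) in Q'.
  apply bd_whole in Q'. apply (gbd_scal_pos (c := h)) in Q'; [|lra].
  rewrite Rmult_comm. apply (gbd_eq Q').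
  replace (op_on (emb (v t)) +v fun_on (emb (v t))) with (u' t) by exact E.
  vec_goal; repeat split; field; lra.
- intros e He.
  destruct (proj1 (@filterlim_at_right_eps _ R_NormedModule
    (fun t => Rpower t d * norm (coe Ex (v t))) 0 0) S8 e He) as [r [Hr Q]].
  exists (Rmin r tau). split; [apply Rmin_glb_lt; lra|]. intros t Htt.
  assert (M1 := Rmin_l r tau). assert (M2 := Rmin_r r tau).
  assert (Q' := Q t ltac:(lra)). rewrite Rplus_0_l in Q'.
  change (Rabs (Rpower t d * norm (coe Ex (v t)) - 0) <= e) in Q'.
  rewrite Rminus_0_r in Q'. assert (Q2 := Rle_trans _ _ _ (Rle_abs _) Q').
  assert (Mx : mem Ex (emb (v t))).
  { assert (B := bd_norm (S5 t ltac:(apply Jin; lra) ltac:(lra))).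
    exact (bd_mem (st_emb1x ST B)). }
  apply (gbd_le (bd_norm Mx)). change (elt Ex (emb (v t))) with (coe Ex (v t)).
  assert (P := Rpower_pos t d). rewrite Rpower_Ropp.
  apply Rmult_le_reg_r with (Rpower t d); [exact P|].
  rewrite Rmult_assoc, Rinv_l by lra. lra.
Qed.

Lemma emb_orbit u0 t : O u0 -> 0 <= t -> Rbar_lt t (life u0) ->
  emb (orbit t u0) = flow (emb u0) t.
Proof using ST NL.
intros Ou Ht H. apply emb_elt. apply (nl_sub NL).
apply (flow_range ST NL); [now apply set_on_emb|exact Ht|exact H].
Qed.

Lemma orbit_range u0 t : O u0 -> 0 <= t -> Rbar_lt t (life u0) -> O (orbit t u0).
Proof using ST NL.
intros Ou Ht H. apply set_on_emb. rewrite emb_orbit by assumption.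
apply (flow_range ST NL); [now apply set_on_emb|exact Ht|exact H].
Qed.

Lemma life_pos0 u0 : O u0 -> Rbar_lt 0 (life u0).
Proof using ST NL. intros Ou. apply (tplus_pos ST NL). now apply set_on_emb. Qed.

Lemma half_open_after u0 t : half_open (life u0) t -> exists tau, t < tau /\ 0 < tau /\
  strong tau (emb u0) (flow (emb u0)).
Proof using ST NL.
intros [Ht H]. destruct (tplus_between ST NL H) as [tau [Ht' H']].
exists tau. split; [exact Ht'|]. split; [lra|]. apply (flow_strong ST NL); [lra|exact H'].
Qed.

Lemma op_on_cont (p : R -> E0) (D : R -> Prop) t : D t -> (forall s, D s -> mem E1 (p s)) ->
  cont (bd E1) p D t -> cont N0 (fun s => op_on (p s)) D t.
Proof using ST.
intros Dt Mp Cp e He. assert (SG := st_sg ST). assert (HM := sg_M SG).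
destruct (Cp (e / M)) as [r [Hr Q]]; [apply Rdiv_lt_0_compat; lra|].
exists r. split; [exact Hr|]. intros s Ds Hs.
rewrite <- (sg_A_sub SG) by (apply Mp; assumption).
apply (gbd_le (sg_A SG (Q s Ds Hs))). right. field. lra.
Qed.

(** The right derivative of the flow is continuous, so it is a derivative from
    both sides. *)
Lemma orbit_solution u0 : O u0 -> sol u0 (half_open (life u0)) (fun t => orbit t u0).
Proof using ST NL.
intros Ou. assert (Oe : set_on (emb u0)) by now apply set_on_emb.
assert (SG := st_sg ST).
assert (Emb : forall t, half_open (life u0) t -> emb (orbit t u0) = flow (emb u0) t).
{ intros t [H1 H2]. now apply emb_orbit. }
split.
- split; [|split].
  + now intros t [H _].
  + intros s t [H1 H2] Hs. split; [lra|]. apply Rbar_le_lt_trans with t; [|exact H2]. simpl. lra.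
  + destruct (tplus_between ST NL (tplus_pos ST NL Oe)) as [tau [Ht H]].
    exists tau. split; [exact Ht|]. split; [lra|exact H].
- unfold orbit. rewrite (flow_0 ST NL Oe). apply elt_emb.
- intros t [H1 H2]. now apply orbit_range.
- intros t Ht. apply (proj2 (@filterlim_within_eps _ Ea _ _ t _)). intros e He.
  destruct (flow_cont ST NL Oe (proj1 Ht) (proj2 Ht) He) as [r [Hr Q]].
  exists r. split; [exact Hr|]. intros s Js Hs.
  apply (proj1 (@bd_emb _ _ Ea _ _)).
  apply (gbd_eq (y := emb (orbit s u0) -v emb (orbit t u0))); [|exact (emb_minus _ _)].
  rewrite !Emb by assumption. apply Q; [apply Js|exact Hs].
- intros t Ht H0. rewrite Emb by exact Ht.
  destruct (half_open_after Ht) as [tau [Htau [Hp S]]]. apply (so_mem S). lra.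
- intros t Ht H0. apply (proj2 (@filterlim_within_eps _ E1 _ _ t _)). intros e He.
  destruct (half_open_after Ht) as [tau [Htau [Hp S]]].
  destruct (so_cont1 S (t := t) ltac:(lra) He) as [r [Hr Q]].
  exists (Rmin r (Rmin t (tau - t))). split; [repeat apply Rmin_glb_lt; lra|]. intros s Js Hs.
  assert (M1 := Rmin_l r (Rmin t (tau - t))). assert (M2 := Rmin_r r (Rmin t (tau - t))).
  assert (M3 := Rmin_l t (tau - t)). assert (M4 := Rmin_r t (tau - t)).
  assert (Hst : Rabs (s - t) < Rmin t (tau - t)) by lra. apply Rabs_def2 in Hst.
  apply (proj1 (@bd_emb _ _ E1 _ _)). unfold coe.
  apply (gbd_eq (y := emb (elt E1 (emb (orbit s u0))) -v emb (elt E1 (emb (orbit t u0)))));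
    [|exact (emb_minus _ _)].
  rewrite !Emb by assumption. rewrite !emb_elt by (apply (so_mem S); lra).
  apply Q; lra.
- exists (fun t => plus (A (coe E1 (orbit t u0))) (emb (f (coe Ex (orbit t u0))))).
  intros t Ht H0.
  destruct (half_open_after Ht) as [tau [Htau [Hp S]]].
  pose (l := fun s => op_on (flow (emb u0) s) +v fun_on (flow (emb u0) s)).
  assert (Cl : cont N0 l (fun s => 0 < s <= tau) t).
  { apply cont_add.
    - apply op_on_cont; [lra|intros s Hs; apply (so_mem S); lra|]. apply (so_cont1 S). lra.
    - apply (cont_embed (st_embg0 ST)). apply (nl_cont ST NL).
      + intros s Hs. apply (so_range S). lra.
      + lra.
      + apply (strong_memx ST S). lra.
      + apply (strong_contx ST S). lra. }
  assert (El : forall s, half_open (life u0) s ->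
    plus (A (coe E1 (orbit s u0))) (emb (f (coe Ex (orbit s u0)))) = l s).
  { intros s Hs. unfold coe. now rewrite Emb. }
  split; [|split; [|reflexivity]].
  + apply (proj2 (@filterlim_within'_eps _ E0 _ _ t _)). intros e He.
    destruct (Cl e He) as [r [Hr Q]].
    exists (Rmin r (Rmin t (tau - t))). split; [repeat apply Rmin_glb_lt; lra|].
    intros s Js Hne Hs.
    assert (M1 := Rmin_l r (Rmin t (tau - t))). assert (M2 := Rmin_r r (Rmin t (tau - t))).
    assert (M3 := Rmin_l t (tau - t)). assert (M4 := Rmin_r t (tau - t)).
    assert (Hst : Rabs (s - t) < Rmin t (tau - t)) by lra. apply Rabs_def2 in Hst.
    rewrite El by exact Ht. rewrite !Emb by assumption.
    change (norm ((/ (s - t)) *v (flow (emb u0) s -v flow (emb u0) t) -v l t) <= e).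
    apply (proj1 (@bd_whole k E0 _ _)).
    assert (Inc : forall a b, a <= b -> 0 < a -> b < tau ->
      (forall x, a <= x <= b -> Rabs (x - t) < r) ->
      N0 (flow (emb u0) b -v flow (emb u0) a -v (b - a) *v l t) (e * (b - a))).
    { intros a b Hab Ha Hb Hx. apply increment_of_rder with l; [exact Hab| | | |].
      - intros x Hx'. apply cont_sub with (icc 0 tau); [unfold icc; intros; lra|].
        apply (strong_cont0 ST S). lra.
      - intros x Hx'. apply (so_rder S). lra.
      - intros x Hx'. apply Q; [lra|apply Hx; lra].
      - exists (norm (l t)). apply N0_norm. }
    destruct (Rlt_le_dec s t) as [h|h].
    * assert (B := Inc s t ltac:(lra) ltac:(lra) ltac:(lra)
        ltac:(intros x Hx; rewrite Rabs_left1 by lra; rewrite Rabs_left in Hs by lra; lra)).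
      apply (gbd_scal_pos (c := / (t - s))) in B; [|left; apply Rinv_0_lt_compat; lra].
      replace (/ (t - s) * (e * (t - s))) with e in B by (field; lra).
      apply (gbd_eq B). vec_goal; repeat split; field; lra.
    * assert (B := Inc t s ltac:(lra) ltac:(lra) ltac:(lra)
        ltac:(intros x Hx; rewrite Rabs_pos_eq by lra; rewrite Rabs_pos_eq in Hs by lra; lra)).
      apply (gbd_scal_pos (c := / (s - t))) in B; [|left; apply Rinv_0_lt_compat; lra].
      replace (/ (s - t) * (e * (s - t))) with e in B by (field; lra).
      apply (gbd_eq B). vec_goal; repeat split; field; lra.
  + apply (proj2 (@filterlim_within_eps _ E0 _ _ t _)). intros e He.
    destruct (Cl e He) as [r [Hr Q]].
    exists (Rmin r (Rmin t (tau - t))). split; [repeat apply Rmin_glb_lt; lra|]. intros s Js Hs.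
    assert (M1 := Rmin_l r (Rmin t (tau - t))). assert (M2 := Rmin_r r (Rmin t (tau - t))).
    assert (M3 := Rmin_l t (tau - t)). assert (M4 := Rmin_r t (tau - t)).
    assert (Hst : Rabs (s - t) < Rmin t (tau - t)) by lra. apply Rabs_def2 in Hst.
    rewrite !El by assumption.
    apply (proj1 (@bd_whole k E0 (l s -v l t) _)). apply Q; lra.
- apply (proj2 (@filterlim_at_right_eps _ R_NormedModule _ 0 0)). intros e He.
  assert (H0 : half_open (life u0) 0) by (split; [lra|exact (tplus_pos ST NL Oe)]).
  destruct (half_open_after H0) as [tau [Htau [Hp S]]].
  destruct (so_van S He) as [r [Hr Q]].
  exists (Rmin r tau). split; [apply Rmin_glb_lt; lra|]. intros t Ht.
  assert (M1 := Rmin_l r tau). assert (M2 := Rmin_r r tau). rewrite Rplus_0_l.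
  change (Rabs (Rpower t d * norm (coe Ex (orbit t u0)) - 0) <= e).
  assert (P := Rpower_pos t d).
  rewrite Rminus_0_r, Rabs_pos_eq by (apply Rmult_le_pos; [lra|apply norm_ge_0]).
  assert (Jt : half_open (life u0) t).
  { split; [lra|]. apply (strong_tplus ST NL (strong_restrict (tau := tau) (tau' := t) ltac:(lra) S)). }
  assert (B : norm (coe Ex (orbit t u0)) <= e * Rpower t (- d)).
  { apply norm_elt_le. rewrite Emb by exact Jt. apply Q. lra. }
  apply Rle_trans with (Rpower t d * (e * Rpower t (- d))); [apply Rmult_le_compat_l; lra|].
  right. rewrite Rpower_Ropp. field. lra.
Qed.

Lemma solution_orbit u0 J v : O u0 -> sol u0 J v ->
  forall t, J t -> half_open (life u0) t /\ v t = orbit t u0.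
Proof using ST NL.
intros Ou S t Jt. assert (Oe : set_on (emb u0)) by now apply set_on_emb.
assert (Ht : 0 <= t) by now apply (proj1 (sol_interval S)).
destruct (Rle_lt_or_eq_dec 0 t Ht) as [H0|<-].
- assert (S' := strong_of_solution S Jt H0). split.
  + split; [exact Ht|]. exact (strong_tplus ST NL S').
  + unfold orbit. rewrite (flow_eq ST NL S') by lra. now rewrite elt_emb.
- split; [split; [lra|exact (tplus_pos ST NL Oe)]|].
  rewrite (sol_init S). unfold orbit. rewrite (flow_0 ST NL Oe). now rewrite elt_emb.
Qed.

Lemma orbit_maximal u0 : O u0 ->
  maximal_solution A O f d u0 (half_open (life u0)) (fun t => orbit t u0).
Proof using ST NL.
intros Ou. split; [now apply orbit_solution|]. intros J v S _ t Jt.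
now apply (solution_orbit Ou S).
Qed.

Lemma maximal_unique u0 J v : O u0 -> maximal_solution A O f d u0 J v ->
  (forall t, J t <-> half_open (life u0) t) /\ (forall t, J t -> v t = orbit t u0).
Proof using ST NL.
intros Ou [S Max]. assert (H := solution_orbit Ou S). split.
- intros t. split; [intros Jt; now apply H|].
  apply (Max _ _ (orbit_solution Ou)). intros s Js. destruct (H s Js) as [H1 H2].
  split; [exact H1|now symmetry].
- intros t Jt. now apply H.
Qed.

Lemma locally_norm_ball {K : AbsRing} {E : NormedModule K} (x : E) e (P : E -> Prop) : 0 < e ->
  (forall y, norm (minus y x) < e -> P y) -> locally x P.
Proof.
intros He H. apply (filter_imp (ball_norm x (mkposreal e He))); [exact H|].
apply locally_ball_norm.
Qed.

Lemma locally_norm_inv {K : AbsRing} {E : NormedModule K} (x : E) (P : E -> Prop) : locally x P ->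
  exists e, 0 < e /\ forall y, norm (minus y x) < e -> P y.
Proof.
intros [e He]. exists e. split; [apply cond_pos|]. intros y Hy. apply He.
now apply norm_compat1.
Qed.

(** Lipschitz dependence on the datum up to a time beyond [t], together with the
    continuity of one orbit in time, gives joint continuity and the openness of
    the domain. *)
Lemma orbit_near t u0 e : O u0 -> half_open (life u0) t -> 0 < e ->
  exists r, 0 < r /\ forall s v, 0 <= s -> O v -> Rabs (s - t) < r -> norm (minus v u0) < r ->
    Rbar_lt s (life v) /\ norm (minus (orbit s v) (orbit t u0)) <= e.
Proof using ST NL.
intros Ou [Ht H] He. assert (Oe : set_on (emb u0)) by now apply set_on_emb.
destruct (tplus_between ST NL H) as [tau [Htau H']].
destruct (stable ST NL Oe (t := tau) ltac:(lra) H') as [r1 [L [Hr1 [HL St]]]].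
destruct (flow_cont ST NL Oe Ht H (e := e / 2) ltac:(lra)) as [r2 [Hr2 Q]].
pose (r3 := e / (2 * (L + 1))). assert (Hr3 : 0 < r3) by (apply Rdiv_lt_0_compat; lra).
exists (Rmin (Rmin r1 r2) (Rmin r3 (tau - t))). split; [repeat apply Rmin_glb_lt; lra|].
assert (M1 := Rmin_l (Rmin r1 r2) (Rmin r3 (tau - t))).
assert (M2 := Rmin_r (Rmin r1 r2) (Rmin r3 (tau - t))).
assert (M3 := Rmin_l r1 r2). assert (M4 := Rmin_r r1 r2).
assert (M5 := Rmin_l r3 (tau - t)). assert (M6 := Rmin_r r3 (tau - t)).
intros s v Hs Ov Hst Hv.
assert (Hst' : Rabs (s - t) < tau - t) by lra. apply Rabs_def2 in Hst'.
assert (Bv : forall x, norm (minus v u0) < x -> bd Ea (emb v -v emb u0) x).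
{ intros x Hx. rewrite <- emb_minus. apply bd_emb. lra. }
destruct (St (emb v) (Bv r1 ltac:(lra))) as [_ [Tv Lv]].
assert (Tv' : Rbar_lt s (life v)) by (apply (Rbar_lt_real_trans (t := tau)); [lra|exact Tv]).
split; [exact Tv'|].
apply (proj1 (@bd_emb _ _ Ea _ _)).
apply (gbd_eq (y := emb (orbit s v) -v emb (orbit t u0))); [|exact (emb_minus _ _)].
rewrite !emb_orbit by assumption.
assert (B1 := Lv s r3 ltac:(lra) (Bv r3 ltac:(lra))).
destruct (Q s Hs ltac:(lra)) as [_ B2].
apply (gbd_le (gbd_tri B1 B2)).
assert (L * r3 <= e / 2); [|lra].
apply Rle_trans with ((L + 1) * r3); [apply Rmult_le_compat_r; lra|].
right. unfold r3. field. lra.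
Qed.

Lemma orbit_semiflow : is_semiflow O life orbit.
Proof using ST NL.
pose (D := fun p : R * Ea => O (snd p) /\ half_open (life (snd p)) (fst p)).
assert (Loc : forall p r (P : R * Ea -> Prop), 0 < r ->
  (forall s v, Rabs (s - fst p) < r -> norm (minus v (snd p)) < r -> P (s, v)) ->
  locally p P).
{ intros p r P Hr HP.
  assert (L1 : locally (fst p) (fun s => Rabs (s - fst p) < r)) by (exists (mkposreal r Hr); now intros).
  assert (L2 : locally (snd p) (fun v => norm (minus v (snd p)) < r)).
  { apply (locally_norm_ball Hr). now intros. }
  destruct L1 as [e1 L1]. destruct L2 as [e2 L2].
  assert (He : 0 < Rmin e1 e2) by (apply Rmin_glb_lt; apply cond_pos).
  exists (mkposreal _ He). intros [s v] [B1 B2]. simpl in B1, B2. apply HP.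
  - apply L1. apply ball_le with (Rmin e1 e2); [apply Rmin_l|exact B1].
  - apply L2. apply ball_le with (Rmin e1 e2); [apply Rmin_r|exact B2]. }
split; [|split; [|split; [|split]]].
- exists (fun p => locally p (fun p' => 0 <= fst p' -> O (snd p') -> D p')). split.
  + intros p Hp. now apply locally_locally.
  + intros t u0 Ht Ou. split.
    * intros [_ Hd]. destruct (orbit_near Ou Hd Rlt_0_1) as [r [Hr Q]].
      apply (Loc (t, u0) r); [exact Hr|]. intros s v Hs Hv Hs0 Ov. simpl in *.
      split; [exact Ov|]. split; [exact Hs0|]. now apply (Q s v).
    * intros H. apply locally_singleton in H. now apply H.
- intros t u0 [Ou [H1 H2]]. now apply orbit_range.
- intros [t u0] [Ou Hd]. simpl in Ou, Hd.
  intros P HP. destruct (locally_norm_inv HP) as [e [He Q']].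
  destruct (orbit_near Ou Hd (e := e / 2) ltac:(lra)) as [r [Hr Q]].
  apply (Loc (t, u0) r); [exact Hr|]. intros s v Hs Hv [Ov [Hs0 _]]. simpl in *.
  apply Q'. apply Rle_lt_trans with (e / 2); [now apply Q|lra].
- intros u0 Ou. unfold orbit. rewrite (flow_0 ST NL) by now apply set_on_emb. apply elt_emb.
- intros s t u0 [Ou [Hs H]] Ht. simpl in Ou, Hs, H.
  assert (Oe : set_on (emb u0)) by now apply set_on_emb.
  assert (E := emb_orbit Ou Hs H).
  destruct (flow_shift ST NL (t := t) Oe Hs Ht H) as [F1 F2].
  split.
  + unfold half_open. simpl. unfold life at 1. rewrite E. split.
    * intros [_ [_ H']]. split; [exact Ou|]. split; [lra|]. now apply F1.
    * intros [_ [_ H']]. split; [now apply orbit_range|]. split; [exact Ht|]. now apply F1.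
  + intros [_ [_ H']]. unfold orbit at 1 2. rewrite E. f_equal. now apply F2.
Qed.

Lemma orbit_global u0 : O u0 -> relatively_compact_in O
  (fun y => exists t, half_open (life u0) t /\ y = orbit t u0) -> life u0 = p_infty.
Proof using ST NL.
intros Ou Hc. assert (Oe : set_on (emb u0)) by now apply set_on_emb.
assert (Hp := life_pos0 Ou).
destruct (life u0) as [S| |] eqn:HS; [|reflexivity|destruct Hp].
exfalso.
(* The compact set is covered by balls on which orbits stay away from the final time. *)
pose (good := fun (c : Ea) (p : R * R) => 0 < fst p /\ 0 < snd p /\
  forall t, 0 <= t -> S - snd p < t < S -> ~ bd Ea (flow (emb u0) t -v emb c) (fst p)).
assert (Hgood : forall c, exists p, O c -> good c p).
{ intros c. destruct (classic (O c)) as [Oc|Nc]; [|exists (0, 0); intros; contradiction].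
  destruct (no_late_visit ST NL (S := S) Oe HS (c := emb c) (proj2 (set_on_emb c) Oc))
    as [r [e [Hr [He Q]]]].
  exists (r, e). now intros _. }
apply choice in Hgood. destruct Hgood as [p Hp'].
destruct (Hc Ea (fun c y => O c /\ norm (minus y c) < fst (p c))) as [l Hl].
- intros c y [Oc Hy]. destruct (Hp' c Oc) as [H1 [H2 _]].
  apply (locally_norm_ball (E := Ea) (x := y) (e := fst (p c) - norm (minus y c))); [lra|].
  intros z Hz. split; [exact Oc|].
  assert (Tri : norm (minus z c : Ea) <= norm (minus z y : Ea) + norm (minus y c : Ea)).
  { eapply Rle_trans; [|exact (norm_triangle (V := Ea) (minus z y) (minus y c))].
    right. apply (f_equal (norm (V := Ea))). exact (minus_trans (y : Ea) z c). }
  apply Rle_lt_trans with (1 := Tri). apply Rlt_minus_r in Hz. exact Hz.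
- intros c [Oc _]. exists c. split; [exact Oc|]. destruct (Hp' c Oc) as [H1 _].
  apply Rle_lt_trans with (norm (zero : Ea)).
  + right. apply (f_equal (norm (V := Ea))). exact (minus_eq_zero (c : Ea)).
  + apply Rle_lt_trans with (2 := H1). right. exact (norm_zero (V := Ea)).
- assert (Min : exists e, 0 < e /\ forall c, In c l -> O c -> e <= snd (p c)).
  { clear Hl. induction l as [|c l [e [He IH]]].
    - exists 1. split; [lra|]. intros c [].
    - destruct (classic (O c)) as [Oc|Nc].
      + destruct (Hp' c Oc) as [_ [H2 _]]. exists (Rmin e (snd (p c))).
        split; [now apply Rmin_glb_lt|]. intros x [<-|Hx] Ox; [apply Rmin_r|].
        apply Rle_trans with e; [apply Rmin_l|now apply IH].
      + exists e. split; [exact He|]. intros x [<-|Hx] Ox; [contradiction|now apply IH]. }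
  destruct Min as [e [He Min]].
  change (0 < S) in Hp.
  pose (t := Rmax 0 (S - e / 2)).
  assert (Ht : 0 <= t) by apply Rmax_l. assert (Ht' : S - e / 2 <= t) by apply Rmax_r.
  assert (Ht'' : t < S) by (apply Rmax_lub_lt; lra).
  assert (HtS : Rbar_lt t (life u0)) by (rewrite HS; exact Ht'').
  destruct (Hl (orbit t u0)) as [c [Hc' [Oc Hn]]].
  { split; [now apply orbit_range|]. intros P HP. exists (orbit t u0).
    split; [|now apply locally_singleton]. exists t. split; [split; assumption|reflexivity]. }
  destruct (Hp' c Oc) as [_ [_ Q]]. assert (Hm := Min c Hc' Oc).
  apply (Q t Ht ltac:(lra)). rewrite <- (emb_orbit Ou Ht HtS), <- emb_minus.
  apply bd_emb. lra.
Qed.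

Definition to_boundary (u0 : Ea) (S : R) : Prop := forall eps, 0 < eps ->
  at_left S (fun t => Rbar_lt (dist_to (orbit t u0) (boundary O)) eps).

(** The orbit converges to a point outside of [O], which is a limit of points of
    [O] and therefore lies on the boundary. *)
Lemma cauchy_to_boundary u0 (S : R) : O u0 -> life u0 = Finite S ->
  @cauchy_late k E0 E1 Ea Ex op_on alpha xi set_on fun_on (emb u0) S -> to_boundary u0 S.
Proof using ST NL.
intros Ou HS Cau eps Heps. assert (Oe : set_on (emb u0)) by now apply set_on_emb.
assert (PS := life_pos ST NL Oe HS).
destruct (cauchy_late_limit ST NL Oe HS Cau) as [c [Mc [Nc Lim]]].
set (c' := elt Ea c). assert (Ec : emb c' = c) by now apply emb_elt.
assert (Near : forall e, 0 < e -> exists r, 0 < r /\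
  forall t, 0 <= t -> S - r < t < S -> norm (minus (orbit t u0) c') <= e).
{ intros e He. destruct (Lim e He) as [r [Hr Q]]. exists r. split; [exact Hr|].
  intros t Ht HtS. apply (proj1 (@bd_emb _ _ Ea _ _)).
  apply (gbd_eq (y := emb (orbit t u0) -v emb c')); [|exact (emb_minus _ _)].
  rewrite emb_orbit, Ec by (try assumption; rewrite HS; apply HtS). now apply Q. }
assert (Bdry : boundary O c').
{ split.
  - intros P HP. destruct (locally_norm_inv HP) as [e [He Q]].
    destruct (Near (e / 2) ltac:(lra)) as [r [Hr Q']].
    pose (t := Rmax 0 (S - r / 2)).
    assert (Ht : 0 <= t) by apply Rmax_l. assert (Ht' : S - r / 2 <= t) by apply Rmax_r.
    assert (Ht'' : t < S) by (apply Rmax_lub_lt; lra).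
    exists (orbit t u0). split.
    + apply orbit_range; try assumption. rewrite HS. exact Ht''.
    + apply Q. apply Rle_lt_trans with (e / 2); [|lra]. apply Q'; [exact Ht|lra].
  - intros P HP. exists c'. split; [|now apply locally_singleton].
    intros Oc. apply Nc. rewrite <- Ec. now apply set_on_emb. }
destruct (Near (eps / 2) ltac:(lra)) as [r [Hr Q]].
apply at_left_eps. exists (Rmin r S). split; [now apply Rmin_glb_lt|]. intros t Ht.
assert (M1 := Rmin_l r S). assert (M2 := Rmin_r r S).
apply Rbar_le_lt_trans with (norm (minus (orbit t u0) c')).
- apply (proj1 (Glb_Rbar_correct _)). now exists c'.
- assert (B := Q t ltac:(lra) ltac:(lra)). simpl. lra.
Qed.

Lemma uniformly_continuous_blowup u0 (S : R) : O u0 -> life u0 = Finite S ->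
  (forall eps, 0 < eps -> exists delta, 0 < delta /\
     forall s t, 0 <= s < S -> 0 <= t < S -> Rabs (s - t) < delta ->
       norm (minus (orbit s u0) (orbit t u0)) < eps) -> to_boundary u0 S.
Proof using ST NL.
intros Ou HS UC. apply cauchy_to_boundary; [exact Ou|exact HS|]. intros e He.
destruct (UC e He) as [r [Hr Q]]. exists r. split; [exact Hr|].
intros s t Hs Ht HsS HtS.
rewrite <- !emb_orbit by (try assumption; rewrite HS; simpl; lra). rewrite <- emb_minus.
apply bd_emb. left. apply Q; [lra|lra|]. apply Rabs_def1; lra.
Qed.

Lemma bounded_blowup u0 (S : R) : O u0 -> life u0 = Finite S ->
  Rbar_lt (limsup_left (fun t => norm (emb (f (coe Ex (orbit t u0))))) S) p_infty ->
  to_boundary u0 S.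
Proof using ST NL.
intros Ou HS H. assert (Oe : set_on (emb u0)) by now apply set_on_emb.
assert (Bd : exists K, at_left S (fun t => norm (emb (f (coe Ex (orbit t u0)))) <= K)).
{ apply NNPP. intros No. apply (Rbar_lt_not_le _ _ H).
  apply (proj2 (Glb_Rbar_correct _)). intros K HK. exfalso. apply No. now exists K. }
destruct Bd as [K HK]. apply at_left_eps in HK. destruct HK as [r [Hr Q]].
apply cauchy_to_boundary; [exact Ou|exact HS|].
apply (bounded_cauchy_late ST NL Oe HS (K := K) Hr). intros t Ht HtS.
apply bd_whole. rewrite <- emb_orbit by (try assumption; rewrite HS; apply HtS).
now apply Q.
Qed.

End Bridge.

(** * The interpolation scale *)

Lemma dense_bd {K : scalar_field} {E0 : CompleteNormedModule (Kring K)} (E1 X : banach_in E0) :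
  densely_embedded E1 X -> forall x, mem X x -> forall e, 0 < e ->
  exists y, mem E1 y /\ bd X (x -v y) e.
Proof.
intros [_ H] x [z <-] e He.
destruct (H z (ball_norm z (mkposreal e He)) (locally_ball_norm _ _)) as [y [[w Ew] Hy]].
exists (emb y). split; [now exists w|]. rewrite <- emb_minus. apply bd_emb.
apply Rle_trans with (norm (minus y z)); [|left; exact Hy]. right.
transitivity (norm (opp (minus y z))).
- apply (f_equal (norm (V := X))). symmetry. exact (opp_minus y z).
- exact (norm_opp (V := X) (minus y z)).
Qed.

Lemma reiterated_cases {k : scalar_field} {E0 : CompleteNormedModule (Kring k)} (E1 : banach_in E0)
  (F : R -> couple_map (Kring k)) theta eta :
  (forall theta, 0 < theta < 1 -> functor_of_exponent (F theta) theta) ->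
  0 < theta -> theta < eta -> eta <= 1 -> (eta <> 1 -> reiterated E1 F theta eta) ->
  reiterated E1 F theta eta.
Proof.
intros HF H0 Hte H1 HR. destruct (Req_dec eta 1) as [->|Hne]; [|now apply HR].
apply reiterated_1; [exact HF|lra].
Qed.

Lemma scale_setting {k : scalar_field} {E0 : CompleteNormedModule (Kring k)} (E1 : banach_in E0)
    (F : R -> couple_map (Kring k)) (A : E1 -> E0) gamma alpha xi :
  (forall theta, 0 < theta < 1 -> functor_of_exponent (F theta) theta) ->
  (forall theta, 0 < theta < 1 -> densely_embedded E1 (interp_scale F E1 theta)) ->
  analytic_generator A -> 0 <= gamma < alpha -> alpha < xi <= 1 -> xi - gamma < 1 ->
  reiterated E1 F alpha xi -> (0 < gamma -> reiterated E1 F gamma alpha) ->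
  (0 < gamma -> reiterated E1 F gamma xi) ->
  exists T t0 M C, setting E1 (interp_scale F E1 gamma) (interp_scale F E1 alpha)
    (interp_scale F E1 xi) (op_on A) T t0 M gamma alpha xi C.
Proof.
intros HF Dense [LA [T [C0 [An Gen]]]] Hga Hax Hcrit Rax Rga Rgx.
destruct (generator_smoothing LA C0 An Gen) as [t0 [M SG]].
assert (D := dense_bd (Dense alpha ltac:(lra))).
destruct (kernel_scale SG HF (theta := gamma) (eta := xi) ltac:(lra) ltac:(lra) ltac:(lra) Rgx)
  as [c1 [P1 K1]].
destruct (kernel_scale SG HF (theta := gamma) (eta := alpha) ltac:(lra) ltac:(lra) ltac:(lra) Rga)
  as [c2 [P2 K2]].
destruct (kernel_scale SG HF (theta := alpha) (eta := xi) ltac:(lra) ltac:(lra) ltac:(lra)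
  (fun _ => Rax)) as [c3 [P3 K3]].
destruct (kernel_scale SG HF (theta := 0) (eta := alpha) ltac:(lra) ltac:(lra) ltac:(lra)
  ltac:(intros; lra)) as [c4 [P4 K4]].
destruct (kernel_scale SG HF (theta := 0) (eta := 1) ltac:(lra) ltac:(lra) ltac:(lra)
  ltac:(intros; lra)) as [c5 [P5 K5]].
rewrite scale_0, Rminus_0_r in K4, K5. rewrite scale_1 in K5.
destruct (scale_bound SG HF (theta := alpha) ltac:(lra)) as [c6 [P6 B6]].
destruct (embed_E1_scale E1 HF (theta := xi) ltac:(lra)) as [c7 [P7 B7]].
destruct (scale_embed HF (theta := alpha) (eta := xi) ltac:(lra) ltac:(lra) ltac:(lra)
  (fun _ => Rax)) as [c8 [P8 B8]].
destruct (embed_scale_E0 E1 HF (theta := alpha) ltac:(lra)) as [c9 [P9 B9]].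
destruct (embed_scale_E0 E1 HF (theta := gamma) ltac:(lra)) as [c10 [P10 B10]].
pose (C := 1 + c1 + c2 + c3 + c4 + c5 + c6 + c7 + c8 + c9 + c10).
assert (Le : forall (X : gauge E0) c x r, 0 < c <= C -> X x (c * r) -> X x (C * r)).
{ intros X c x r Hc H. apply (gbd_le H). apply Rmult_le_compat_r; [|lra].
  apply Rmult_le_reg_l with c; [lra|]. rewrite Rmult_0_r. exact (gbd_pos H). }
exists T, t0, M, C. split; try assumption; try lra.
- unfold C; lra.
- apply (kernel_le (C := c1)); [unfold C; lra|exact K1].
- apply (kernel_le (C := c2)); [unfold C; lra|exact K2].
- apply (kernel_le (C := c3)); [unfold C; lra|exact K3].
- apply (kernel_le (C := c4)); [unfold C; lra|exact K4].
- apply (kernel_le (C := c5)); [unfold C; lra|exact K5].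
- intros t Ht x r Hx. apply (Le _ c6); [unfold C; lra|now apply B6].
- intros x e. apply (cont0_scale SG HF (theta := alpha)); [lra|exact D].
- intros x e. apply (decay_scale SG HF (theta := alpha)); [lra|exact D|lra|now intros].
- intros x r Hx. apply (Le _ c7); [unfold C; lra|now apply B7].
- intros x r Hx. apply (Le _ c8); [unfold C; lra|now apply B8].
- intros x r Hx. apply (Le _ c9); [unfold C; lra|now apply B9].
- intros x r Hx. apply (Le _ c10); [unfold C; lra|now apply B10].
- intros x e Hx. now apply D.
Qed.

Lemma growth_nonlinearity {k : scalar_field} {E0 : CompleteNormedModule (Kring k)}
    (Eg Ea Ex : banach_in E0) (O : Ea -> Prop) (f : Ex -> Eg) q :
  1 < q -> open O ->
  let Oxi (w : Ex) := exists x : Ea, O x /\ emb x = emb w in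
  (forall r, 0 < r -> exists N, 0 < N /\ forall w v : Ex, Oxi w -> Oxi v ->
     norm (coe Ea w) <= r -> norm (coe Ea v) <= r ->
     norm (minus (f w) (f v)) <=
       N * (1 + rpow (norm w) (q - 1) + rpow (norm v) (q - 1)) *
       ((1 + norm w + norm v) * norm (coe Ea (minus w v)) + norm (minus w v))) ->
  nonlinearity Eg Ea Ex (set_on O) (fun_on f) q.
Proof.
intros Hq Oo Oxi Lip. split.
- intros x [y [_ <-]]. now exists y.
- intros x [y [Oy <-]]. destruct (locally_norm_inv (Oo y Oy)) as [e [He Q]].
  exists (e / 2). split; [lra|]. intros z [w [Ew Hw]].
  exists (plus y w). split.
  + apply Q. apply Rle_lt_trans with (norm w); [|lra]. right. f_equal.
    unfold minus. rewrite (plus_comm y w), <- plus_assoc.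
    transitivity (plus w zero); [f_equal; exact (plus_opp_r y)|apply plus_zero_r].
  + transitivity (emb y +v emb w); [exact (linear_plus _ (emb_linear _) y w)|].
    rewrite Ew. vec.
- intros w _ _. now exists (f (elt Ex w)).
- intros r Hr. destruct (Lip r Hr) as [N [HN Q]]. exists N. split; [exact HN|].
  intros w v m Da Dx Ow Ov Aw Av [w' [<- Xw]] [v' [<- Xv]] BDa BDx.
  unfold fun_on. rewrite !elt_emb, <- emb_minus. apply bd_emb.
  rewrite <- emb_minus in BDa, BDx. apply bd_emb in BDx.
  eapply Rle_trans; [apply Q|].
  + exact Ow.
  + exact Ov.
  + now apply norm_elt_le.
  + now apply norm_elt_le.
  + assert (N1 := norm_elt_le BDa). fold (coe Ea (minus w' v')) in N1.
    assert (R1 := @rpow_le _ _ (q - 1) ltac:(lra) Xw). assert (R2 := @rpow_le _ _ (q - 1) ltac:(lra) Xv).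
    assert (R3 := rpow_ge0 (norm w') (q - 1)). assert (R4 := rpow_ge0 (norm v') (q - 1)).
    assert (S1 := norm_ge_0 w'). assert (S2 := norm_ge_0 v').
    assert (S3 := norm_ge_0 (coe Ea (minus w' v'))). assert (S4 := norm_ge_0 (minus w' v')).
    apply Rmult_le_compat; [apply Rmult_le_pos; lra| |apply Rmult_le_compat_l; lra|].
    * apply Rplus_le_le_0_compat; [apply Rmult_le_pos; lra|exact S4].
    * apply Rplus_le_compat; [|exact BDx]. apply Rmult_le_compat; lra.
Qed.

Theorem theorem1p3
    (k : scalar_field) (E0 : CompleteNormedModule (Kring k)) (E1 : banach_in E0)
    (F : R -> couple_map (Kring k))
    (gamma alpha xi : R) (A : E1 -> E0) :
  let E := interp_scale F E1 in
  let q := (1 + gamma - alpha) / (xi - alpha) in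
  forall (O : E alpha -> Prop) (f : E xi -> E gamma),
  let Oxi (w : E xi) := exists x : E alpha, O x /\ emb x = emb w in
  let maxsol := maximal_solution A O f (xi - alpha) in
  densely_embedded E1 (whole E0) ->
  (forall theta, 0 < theta < 1 ->
     functor_of_exponent (F theta) theta /\ admissible (F theta)) ->
  analytic_generator A ->
  0 <= gamma -> gamma < alpha -> alpha < xi -> xi <= 1 -> 1 < q ->
  (xi < 1 -> exists G : couple_map (Kring k),
     functor_of_exponent G (alpha / xi) /\
     same_space (E alpha) (G E0 (whole E0) (E xi))) ->
  (0 < gamma -> forall eta, eta = alpha \/ eta = xi -> eta <> 1 ->
     exists G : couple_map (Kring k),
       functor_of_exponent G (gamma / eta) /\
       same_space (E gamma) (G E0 (whole E0) (E eta))) ->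
  open O ->
  (forall r, 0 < r -> exists N, 0 < N /\
     forall w v : E xi, Oxi w -> Oxi v ->
       norm (coe (E alpha) w) <= r -> norm (coe (E alpha) v) <= r ->
       norm (minus (f w) (f v)) <=
         N * (1 + rpow (norm w) (q - 1) + rpow (norm v) (q - 1)) *
         ((1 + norm w + norm v) * norm (coe (E alpha) (minus w v))
          + norm (minus w v))) ->
  exists (tplus : E alpha -> Rbar) (u : R -> E alpha -> E alpha),
    (* (i) *)
    (forall u0, O u0 ->
       Rbar_lt 0 (tplus u0) /\
       maxsol u0 (half_open (tplus u0)) (fun t => u t u0) /\
       forall J v, maxsol u0 J v ->
         (forall t, J t <-> half_open (tplus u0) t) /\
         (forall t, J t -> v t = u t u0)) /\
    (* (ii) *)
    is_semiflow O tplus u /\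
    (* (iii) *)
    (forall u0, O u0 ->
       relatively_compact_in O
         (fun y => exists t, half_open (tplus u0) t /\ y = u t u0) ->
       tplus u0 = p_infty) /\
    (* (iv) *)
    (forall u0 (T : R), O u0 -> tplus u0 = Finite T ->
       let to_boundary := forall eps, 0 < eps ->
         at_left T (fun t => Rbar_lt (dist_to (u t u0) (boundary O)) eps) in
       ((forall eps, 0 < eps -> exists delta, 0 < delta /\
           forall s t, 0 <= s < T -> 0 <= t < T -> Rabs (s - t) < delta ->
             norm (minus (u s u0) (u t u0)) < eps) -> to_boundary) /\
       (Rbar_lt (limsup_left
           (fun t => norm (emb (f (coe (E xi) (u t u0))))) T) p_infty ->
        to_boundary)).
Proof.
intros E q O f Oxi maxsol DE HF An H0 Hga Hax H1 Hq Rax Rg Oo Lip.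
assert (HF' : forall theta, 0 < theta < 1 -> functor_of_exponent (F theta) theta)
  by (intros; now apply HF).
(* The kernel from [E gamma] to [E xi], of order [xi - gamma], is integrable. *)
assert (Hcrit : xi - gamma < 1).
{ apply (Rmult_lt_compat_r (xi - alpha)) in Hq; [|lra].
  unfold q in Hq. unfold Rdiv in Hq. rewrite Rmult_assoc, Rinv_l in Hq; lra. }
destruct (@scale_setting k E0 E1 F A gamma alpha xi HF') as [T [t0 [M [C ST]]]];
  try assumption; try lra.
- intros theta Hth. rewrite scale_mid by exact Hth. apply HF; [exact Hth|exact DE].
- apply reiterated_cases; try assumption; try lra. intros Hne. apply Rax. lra.
- intros Hg. apply reiterated_cases; try assumption; try lra. intros Hne. apply Rg; auto.
- intros Hg. apply reiterated_cases; try assumption; try lra. intros Hne. apply Rg; auto.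
- assert (NL := growth_nonlinearity Hq Oo Lip).
  exists (life (alpha := alpha) (xi := xi) A O f), (orbit (alpha := alpha) (xi := xi) A O f). split; [|split; [|split]].
  + intros u0 Ou. split; [|split].
    * exact (life_pos0 ST NL Ou).
    * exact (orbit_maximal ST NL Ou).
    * intros J v Hv. exact (maximal_unique ST NL Ou Hv).
  + exact (orbit_semiflow ST NL).
  + intros u0 Ou Hc. exact (orbit_global ST NL Ou Hc).
  + intros u0 S Ou HS. split.
    * exact (uniformly_continuous_blowup ST NL Ou HS).
    * exact (bounded_blowup ST NL Ou HS).
Qed.
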